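(* Let $\beta>0$, $1/2<\gamma<1$ and $0<\gamma'<1/4$. Then the limit $\overline S(\cdot):=\lim_{\varepsilon\downarrow0}\overline S^\ast_\varepsilon(\cdot)$ exists almost surely in the Skorokhod space $D([0,1],\mathbb R)$, and the centered and normalized edge-count process $\overline S_n=(\overline S_n(t))_{t\in[0,1]}$ (with normalization $n^{-\gamma}$) converges weakly, as $n\to\infty$, to the process $\overline S$ in the Skorokhod space $D([0,1],\mathbb R)$.
   Context: Let $\mathbb S=\mathbb R\times[0,1]$, $\mathbb T=\mathbb R\times[0,\infty)$. Let $\mathcal P$ be a Poisson point process on $\mathbb S\times\mathbb T$, with points $p=(x,u,b,\ell)$ (position, weight, birth time, lifetime) and intensity $\mu(dx,du,db,d\ell)=dx\,du\,db\,\mathbb P_L(d\ell)$, where $\mathbb P_L$ is the exponential distribution with mean $1$. Let $\mathcal P'$ be an independent Poisson point process on $\mathbb S\times\mathbb R$ with points $p'=(z,w,r)$ and Lebesgue intensity $dz\,dw\,dr$. For $t\in\mathbb R$ and $p=(x,u,b,\ell)$ set $$N(p;t)=\{(z,w,r)\in\mathbb S\times\mathbb R:\ |x-z|\le\beta u^{-\gamma}w^{-\gamma'},\ b\le r\le t<b+\ell\},$$ $\deg(p;t)=\#(\mathcal P'\cap N(p;t))$, $S_n(t)=\sum_{P\in\mathcal P,\ (X_P,U_P)\in[0,n]\times[0,1]}\deg(P;t)$, where $(X_P,U_P)$ denotes the position and weight of $P$, and $\overline S_n(t)=n^{-\gamma}(S_n(t)-\mathbb E[S_n(t)])$ for $n\in\mathbb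 N$. Put $\widetilde c=2\beta/(1-\gamma')$. Let $\nu$ be the measure on $(0,\infty)$ with $\nu([a,\infty))=\widetilde c^{\,1/\gamma}a^{-1/\gamma}$ for $a>0$, and let $\mathcal P_\infty$ be a Poisson point process on $(0,\infty)\times\mathbb T$ with intensity $\nu\otimes\mathrm{Leb}\otimes\mathbb P_L$. For $\varepsilon>0$ and $t\in[0,1]$, $$S^\ast_\varepsilon(t)=\sum_{(J,B,L)\in\mathcal P_\infty}J\,(t-B)\,\mathbf 1\{J\ge\widetilde c\,\varepsilon^\gamma\}\,\mathbf 1\{B\le t<B+L\},\qquad \overline S^\ast_\varepsilon(t)=S^\ast_\varepsilon(t)-\mathbb E[S^\ast_\varepsilon(t)].$$ The Skorokhod space carries the metric $d(f,g)=\inf_\lambda(\|\lambda-I\|\vee\|f\circ\lambda^{-1}-g\|)$, the infimum being over homeomorphisms $\lambda$ of $[0,1]$, $I$ the identity and $\|\cdot\|$ the supremum norm on $[0,1]$. *)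

(* Defs.v *)
From HB Require Import structures.
From mathcomp Require Import all_boot all_order all_algebra.
From mathcomp Require Import all_classical all_reals all_analysis.
From mathcomp Require Import measurable_realfun ring lra.
Import Order.TTheory GRing.Theory Num.Theory.
Import numFieldTopology.Exports numFieldNormedType.Exports.

Set Implicit Arguments.
Unset Strict Implicit.
Unset Printing Implicit Defensive.

Local Open Scope classical_set_scope.
Local Open Scope ring_scope.

Definition cadlag01 (R : realType) (f : R -> R) : Prop :=
  (forall t : R, 0 <= t < 1 -> f x @[x --> t^'+] --> f t) /\
  (forall t : R, 0 < t <= 1 -> cvg (f x @[x --> t^'-])).

(* A function on [0,1] is encoded by its extension by 0 to R, so that Leibniz
   equality on [skorokhod R] is pointwise equality on [0,1]. *)
Record skorokhod (R : realType) := Skorokhod {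
  sk_fun :> R -> R ;
  sk_cadlag : cadlag01 sk_fun ;
  sk_out : forall t : R, ~~ (0 <= t <= 1) -> sk_fun t = 0 }.

HB.instance Definition _ (R : realType) := gen_eqMixin (skorokhod R).
HB.instance Definition _ (R : realType) := gen_choiceMixin (skorokhod R).

Definition sup_norm01 (R : realType) (h : R -> R) : R :=
  sup [set `|h t| | t in `[0, 1]].

(* [mu] is the inverse of [lam]. Decreasing homeomorphisms are allowed; they
   satisfy ||lam - I|| >= 1, so they do not change the balls of radius <= 1. *)
Definition homeo01 (R : realType) (lam mu : R -> R) : Prop :=
  [/\ set_fun `[0, 1] `[0, 1] lam /\ set_fun `[0, 1] `[0, 1] mu,
      {within `[0, 1], continuous lam} /\ {within `[0, 1], continuous mu},
      {in `[0, 1], cancel lam mu} & {in `[0, 1], cancel mu lam}].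

Definition skorokhod_dist (R : realType) (f g : R -> R) : R :=
  inf [set r | exists lam mu, homeo01 lam mu /\
    r = Num.max (sup_norm01 (fun t => lam t - t))
                (sup_norm01 (fun t => f (mu t) - g t))].

Section skorokhod_metric.
Variable R : realType.
Implicit Types (f g h : skorokhod R) (lam mu : R -> R).

Lemma sk_eq f g : (forall t : R, 0 <= t <= 1 -> f t = g t) -> f = g.
Proof.
case: f g => [f cf of_] [g cg og] /= fg.
have E : f = g.
  apply/funext => t; case: (boolP (0 <= t <= 1)) => [/fg//|t01].
  by rewrite of_// og.
subst g; congr Skorokhod; exact: Prop_irrelevance.
Qed.

Lemma sk_bounded f : exists M, forall t : R, 0 <= t <= 1 -> `|f t| <= M.
Proof.
have [cr cl] := sk_cadlag f.
have K : compact (`[0, 1]%classic : set R) by exact: segment_compact.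
have /compact_near_coveringP K' := K.
have [] := K' R (pinfty_nbhs R) (fun M t => 0 <= t <= 1 -> `|f t| <= M) _.
  move=> x /=; rewrite in_itv/= => x01.
  have [M1 H1] : exists M, \forall y \near x^'+, 0 <= y <= 1 -> `|f y| <= M.
    have [x1|x1] := ltP x 1.
      have /cvgrPdist_le /(_ 1 ltr01) N : f y @[y --> x^'+] --> f x.
        by apply: cr; rewrite x1 andbT; case/andP: x01.
      exists (`|f x| + 1); apply: filterS N => y le1 _.
      by rewrite -lerBlDl (le_trans (lerB_dist _ _))// distrC.
    exists 0; near=> y => /andP[_]; rewrite leNgt => /negP[].
    by rewrite (le_lt_trans x1).
  have [M2 H2] : exists M, \forall y \near x^'-, 0 <= y <= 1 -> `|f y| <= M.
    have [x0|x0] := ltP 0 x.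
      have /cvg_ex[/= l /cvgrPdist_le /(_ 1 ltr01) N] : cvg (f y @[y --> x^'-]).
        by apply: cl; rewrite x0; case/andP: x01.
      exists (`|l| + 1); apply: filterS N => y le1 _.
      by rewrite -lerBlDl (le_trans (lerB_dist _ _))// distrC.
    exists 0; near=> y => /andP[+ _]; rewrite leNgt => /negP[].
    by rewrite (lt_le_trans _ x0).
  pose M := Num.max `|f x| (Num.max M1 M2).
  have NM : \forall y \near x, 0 <= y <= 1 -> `|f y| <= M.
    move: H1 H2; rewrite /at_left /at_right !near_withinE => H1 H2.
    near=> y => y01; rewrite /M !le_max.
    have [yx|xy|->] := ltgtP y x.
    - rewrite (_ : `|f y| <= M2) ?orbT//; move: y01; move: yx; near: y.
      exact: H2.
    - rewrite (_ : `|f y| <= M1) ?orbT//; move: y01; move: xy; near: y.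
      exact: H1.
    - by rewrite lexx.
  exists ([set y | 0 <= y <= 1 -> `|f y| <= M], [set i | M <= i]) => /=.
    by split => //; by apply: nbhs_pinfty_ge; exact: num_real.
  by move=> [y i] /= [yM Mi] y01; exact: le_trans (yM y01) Mi.
move=> M [_ HM]; exists (M + 1) => t t01.
by apply: (HM (M + 1)) => //; rewrite ?ltrDl//= in_itv.
Unshelve. all: end_near. Qed.

Lemma homeo01_itv lam mu : homeo01 lam mu -> forall t : R, 0 <= t <= 1 ->
  [/\ 0 <= lam t <= 1, 0 <= mu t <= 1, mu (lam t) = t & lam (mu t) = t].
Proof.
move=> [[fl fm] _ lK mK] t t01; split.
- by have := fl t; rewrite /= ?in_itv/=; exact.
- by have := fm t; rewrite /= ?in_itv/=; exact.
- by apply: lK; rewrite ?inE /= ?in_itv.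
- by apply: mK; rewrite ?inE /= ?in_itv.
Qed.

Lemma homeo01_id : homeo01 (@id R) id.
Proof.
by split=> //; split=> //; apply: continuous_subspaceT => x; exact: cvg_id.
Qed.

Lemma homeo01_sym lam mu : homeo01 lam mu -> homeo01 mu lam.
Proof. by case=> -[? ?] [? ?] ? ?; split. Qed.

Lemma homeo01_comp lam mu lam' mu' : homeo01 lam mu -> homeo01 lam' mu' ->
  homeo01 (lam' \o lam) (mu \o mu').
Proof.
move=> H H'; have HI := homeo01_itv H; have HI' := homeo01_itv H'.
have cc (a b : R -> R) : set_fun `[0, 1]%classic `[0, 1]%classic a ->
    {within `[0, 1], continuous a} -> {within `[0, 1], continuous b} ->
    {within `[0, 1], continuous (b \o a)}.
  move=> fa /subspace_continuousP ca /subspace_continuousP cb.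
  apply/subspace_continuousP => x x01.
  apply: (@cvg_comp _ _ _ a b _ (within `[0, 1]%classic (nbhs (a x)))).
    move=> /= U; rewrite /nbhs/= => /(ca x x01).
    rewrite /nbhs/= /within/= => V.
    apply: filterS V => y /[swap] y01 /(_ y01); apply; exact: fa.
  by apply: cb; exact: fa.
case: (H) (H') => [[f1 f2] [c1 c2] K1 K2] [[f1' f2'] [c1' c2'] K1' K2'].
split.
- by split=> x /= x01; [apply/f1'/f1|apply/f2/f2'].
- by split; apply: cc.
- move=> t; rewrite in_itv/= => t01; have [? _ E _] := HI t t01.
  by have [_ _ /= -> _] := HI' (lam t) ltac:(by []).
- move=> t; rewrite in_itv/= => t01; have [_ ? _ E] := HI' t t01.
  by have [_ _ _ /= ->] := HI (mu' t) ltac:(by []).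
Qed.

Let sup_norm01P (h : R -> R) (M : R) :
  (forall t : R, 0 <= t <= 1 -> `|h t| <= M) ->
  sup_norm01 h <= M /\ forall t : R, 0 <= t <= 1 -> `|h t| <= sup_norm01 h.
Proof.
move=> hM; split.
  apply: ge_sup.
    by exists `|h 0|, 0 => //=; rewrite in_itv/= lexx ler01.
  by move=> _ [t /= t01 <-]; apply: hM; rewrite in_itv in t01.
move=> t t01; apply: ub_le_sup.
  exists M => _ [s /= s01 <-]; apply: hM; by rewrite in_itv in s01.
by exists t => //=; rewrite in_itv.
Qed.

(* All the suprema in [skorokhod_dist] are finite. *)
Lemma skorokhod_sup_norm01P f g lam mu (r : R) : homeo01 lam mu ->
  (Num.max (sup_norm01 (fun t => lam t - t))
           (sup_norm01 (fun t => f (mu t) - g t)) <= r) <->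
  (forall t : R, 0 <= t <= 1 -> `|lam t - t| <= r /\ `|f (mu t) - g t| <= r).
Proof.
move=> H; have HI := homeo01_itv H; split.
  rewrite ge_max => /andP[r1 r2] t t01; split.
    have /sup_norm01P[_ h] : forall t : R, 0 <= t <= 1 -> `|lam t - t| <= 1.
      move=> s s01; have [/andP[? ?] _ _ _] := HI s s01.
      case/andP: s01 => ? ?; rewrite ler_norml; lra.
    exact: le_trans (h t t01) r1.
  have [M fM] := sk_bounded f; have [N gN] := sk_bounded g.
  have /sup_norm01P[_ h] : forall t : R, 0 <= t <= 1 -> `|f (mu t) - g t| <= M + N.
    move=> s s01; have [_ ms _ _] := HI s s01.
    by rewrite (le_trans (ler_normB _ _))// lerD// ?fM// gN.
  exact: le_trans (h t t01) r2.
move=> h; rewrite ge_max; apply/andP; split.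
  by have /sup_norm01P[] : forall t : R, 0 <= t <= 1 -> `|lam t - t| <= r
    by move=> t /h[].
by have /sup_norm01P[] : forall t : R, 0 <= t <= 1 -> `|f (mu t) - g t| <= r
    by move=> t /h[].
Qed.

Lemma skorokhod_dist_ltP f g (e : R) : skorokhod_dist f g < e <->
  exists lam mu r, [/\ homeo01 lam mu, r < e & forall t : R, 0 <= t <= 1 ->
    `|lam t - t| <= r /\ `|f (mu t) - g t| <= r].
Proof.
split.
  move=> /inf_lt[|_ [lam [mu [H ->]]] lte].
    by eexists; exists id, id; split; [exact: homeo01_id|reflexivity].
  exists lam, mu; eexists; split; [exact: H|exact: lte|].
  exact/skorokhod_sup_norm01P.
move=> [lam [mu [r [H re h]]]]; apply: le_lt_trans re.
move/(skorokhod_sup_norm01P _ _ _ H) : h; apply: le_trans.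
apply: ge_inf; last by exists lam, mu.
exists 0 => _ [l [m [H' ->]]].
set s := Num.max _ _.
have /(skorokhod_sup_norm01P _ _ _ H')/(_ 0) := lexx s.
by rewrite lexx ler01 => /(_ isT)[+ _]; exact: le_trans.
Qed.

Lemma skorokhod_distxx f : skorokhod_dist f f = 0.
Proof.
apply/eqP; rewrite eq_le; apply/andP; split.
  apply/ler_addgt0Pl => e e0; rewrite addr0; apply/ltW/skorokhod_dist_ltP.
  exists id, id, 0; split=> //; first exact: homeo01_id.
  by move=> t _; rewrite !subrr normr0.
rewrite leNgt; apply/negP => /skorokhod_dist_ltP[lam [mu [r [_ r0 /(_ 0)]]]].
rewrite lexx ler01 => /(_ isT)[+ _]; rewrite leNgt => /negP; apply.
exact: lt_le_trans r0 _.
Qed.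

Lemma skorokhod_dist_sym f g : skorokhod_dist f g = skorokhod_dist g f.
Proof.
suff le (a b : skorokhod R) : skorokhod_dist a b <= skorokhod_dist b a.
  by apply/eqP; rewrite eq_le !le.
apply/ler_addgt0Pr => e e0.
have /skorokhod_dist_ltP[lam [mu [r [H re h]]]] :
  skorokhod_dist b a < skorokhod_dist b a + e by rewrite ltrDl.
apply/ltW/skorokhod_dist_ltP; exists mu, lam, r; split => //.
  exact: homeo01_sym.
move=> t t01; have [l01 m01 ml lm] := homeo01_itv H t01; split.
  by have [+ _] := h _ m01; rewrite lm distrC.
by have [_ +] := h _ l01; rewrite ml distrC.
Qed.

Lemma skorokhod_dist_triangle g f h :
  skorokhod_dist f h <= skorokhod_dist f g + skorokhod_dist g h.
Proof.
apply/ler_addgt0Pr => e e0; have e20 : 0 < e / 2 by rewrite divr_gt0.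
have /skorokhod_dist_ltP[lam [mu [r [H re k]]]] :
  skorokhod_dist f g < skorokhod_dist f g + e / 2 by rewrite ltrDl.
have /skorokhod_dist_ltP[lam' [mu' [r' [H' re' k']]]] :
  skorokhod_dist g h < skorokhod_dist g h + e / 2 by rewrite ltrDl.
apply/ltW/skorokhod_dist_ltP; exists (lam' \o lam), (mu \o mu'), (r + r').
split; [exact: homeo01_comp|by lra|].
move=> t t01 /=; have [l01 _ _ _] := homeo01_itv H t01.
have [_ m01 _ _] := homeo01_itv H' t01.
have [k1 _] := k _ t01; have [_ k2] := k _ m01.
have [k1' _] := k' _ l01; have [_ k2'] := k' _ t01.
split; last by rewrite (le_trans (ler_distD (g (mu' t)) _ _))// lerD.
by rewrite (le_trans (ler_distD (lam t) _ _))// addrC lerD.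
Qed.

Lemma homeo01_1 lam mu : homeo01 lam mu -> `|lam 1 - 1| < 1 -> mu 1 = 1.
Proof.
move=> H lam1; have HI := homeo01_itv H.
have [[_ _] [cl _] lK _] := H.
have i0 : 0 <= (0:R) <= 1 by rewrite lexx ler01.
have i1 : 0 <= (1:R) <= 1 by rewrite lexx ler01.
have [/andP[l0 l1] /andP[m0 m1] ml lm] := HI 1 i1.
have [_ /andP[m00 m01] _ lm0] := HI 0 i0.
have [mon|mon] := itv_continuous_inj_mono cl (can_in_inj lK).
  have : lam (mu 1) <= lam 1.
    move: (m1); rewrite le_eqVlt => /predU1P[->|m1']; first exact: lexx.
    by apply/ltW/mon; rewrite ?in_itv/= ?m0 ?m1.
  rewrite lm => l1'; have e1 : lam 1 = 1 by apply/eqP; rewrite eq_le l1 l1'.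
  by rewrite -[RHS]ml e1.
have : lam 1 <= lam (mu 0).
  move: (m01); rewrite le_eqVlt => /predU1P[->|m1']; first exact: lexx.
  by apply/ltW/mon; rewrite ?in_itv/= ?m00 ?m01.
move: lam1; rewrite lm0 distrC ltr_norml => /andP[_ ?] ?; exfalso; lra.
Qed.

Lemma skorokhod_dist_eq0 f g : skorokhod_dist f g = 0 -> f = g.
Proof.
move=> d0; apply: sk_eq => t t01.
have D (e : R) : 0 < e -> exists lam mu, homeo01 lam mu /\
    forall t : R, 0 <= t <= 1 -> `|lam t - t| < e /\ `|f (mu t) - g t| < e.
  move=> e0; have /skorokhod_dist_ltP[lam [mu [r [H re k]]]] :
    skorokhod_dist f g < e by rewrite d0.
  by exists lam, mu; split=> // s /k[k1 k2]; split; exact: le_lt_trans re.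
apply/eqP; rewrite -subr_eq0 -normr_le0; apply/ler_addgt0Pr => e e0.
rewrite add0r.
have [t1|] := ltP t 1; last first.
  move=> t1; have {t1}-> : t = 1.
    by apply/eqP; rewrite eq_le t1 andbT; case/andP: t01.
  have me : 0 < Num.min e 1 by rewrite lt_min e0 ltr01.
  have [lam [mu [H /(_ 1)]]] := D _ me.
  rewrite lexx ler01 => /(_ isT)[]; rewrite !lt_min => /andP[_ k] /andP[+ _].
  by rewrite (homeo01_1 H k) => /ltW.
have t01' : 0 <= t < 1 by rewrite t1 andbT; case/andP: t01.
have e30 : 0 < e / 3 by rewrite divr_gt0.
have /cvgrPdist_lt/(_ _ e30) cf := (sk_cadlag f).1 _ t01'.
have /cvgrPdist_lt/(_ _ e30) cg := (sk_cadlag g).1 _ t01'.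
have : \forall s \near t^'+, `|f t - f s| < e / 3 /\ `|g t - g s| < e / 3.
  by near=> s; split; near: s.
rewrite /at_right near_withinE => /nbhs_ballP[r /= r0 B].
pose k := Num.min r (1 - t).
have k0 : 0 < k by rewrite lt_min r0 subr_gt0.
have kr : k <= r by rewrite ge_min lexx.
have kt : k <= 1 - t by rewrite ge_min lexx orbT.
have me : 0 < Num.min (k / 2) (e / 3) by rewrite lt_min e30 divr_gt0.
have [lam [mu [H C]]] := D _ me.
have B' s : t < s < t + k -> `|f t - f s| < e / 3 /\ `|g t - g s| < e / 3.
  move=> /andP[ts sk]; apply: B => //.
  by rewrite /ball/= ltr_norml; apply/andP; split; lra.
case/andP: (t01) => t0 _.
have s01 : 0 <= t + k / 2 <= 1 by apply/andP; split; lra.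
have [_ m01 _ lm] := homeo01_itv H s01.
have [] := C _ m01; rewrite lm !lt_min => /andP[+ _] _.
rewrite ltr_norml => /andP[a1 a2].
have [_] := C _ s01; rewrite lt_min => /andP[_ b].
have [c _] : `|f t - f (mu (t + k / 2))| < e / 3 /\ `|g t - g (mu (t + k / 2))| < e / 3.
  by apply: B'; apply/andP; split; lra.
have [_ c'] : `|f t - f (t + k / 2)| < e / 3 /\ `|g t - g (t + k / 2)| < e / 3.
  by apply: B'; apply/andP; split; lra.
move: b c c'; rewrite !ltr_norml => /andP[? ?] /andP[? ?] /andP[? ?].
by rewrite ler_norml; apply/andP; split; lra.
Unshelve. all: end_near. Qed.

End skorokhod_metric.

HB.instance Definition _ (R : realType) :=
  @isMetric.Build R (skorokhod R) (fun f g => skorokhod_dist f g)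
    (@skorokhod_distxx R) (@skorokhod_dist_eq0 R) (@skorokhod_dist_sym R)
    (@skorokhod_dist_triangle R).

Lemma cadlag01_cst0 (R : realType) : cadlag01 (fun _ : R => 0 : R).
Proof. by split=> t _; [|apply/cvg_ex; exists 0]; exact: cvg_cst. Qed.

HB.instance Definition _ (R : realType) := isPointed.Build (skorokhod R)
  (Skorokhod (@cadlag01_cst0 R) (fun _ _ => erefl)).

Definition skorokhod_borel (R : realType) :=
  g_sigma_algebraType (@open (skorokhod R)).

Definition borel_measurable (R : realType) d (Omega : measurableType d)
    (Y : Omega -> skorokhod R) : Prop :=
  measurable_fun setT (Y : Omega -> skorokhod_borel R).

(* A process whose paths over [0,1] are only almost surely cadlag is identified
   with a random element of D([0,1], R) having almost surely the same path. *)
Definition random_element_of (R : realType) d (Omega : measurableType d)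
    (P : probability Omega R) (X : R -> Omega -> R) (Y : Omega -> skorokhod R) :
    Prop :=
  borel_measurable Y /\
  {ae P, forall w, forall t : R, 0 <= t <= 1 -> Y w t = X t w}.

Definition weak_cvg (R : realType) d (Omega : measurableType d)
    (P : probability Omega R) (Y : nat -> Omega -> skorokhod R)
    d' (Omega' : measurableType d') (P' : probability Omega' R)
    (Z : Omega' -> skorokhod R) : Prop :=
  forall h : skorokhod R -> R, continuous h ->
    (exists M : R, forall f, `|h f| <= M) ->
    'E_P[fun w => h (Y n w)]%E @[n --> \oo] --> 'E_P'[fun w => h (Z w)]%E.

(* All the intensities below are diffuse, so the processes are simple and a
   process is encoded by the random countable set [eta w] of its points. *)
Definition count_in (R : realType) (Omega : Type) (X : choiceType)
    (eta : Omega -> set X) (A : set X) (w : Omega) : \bar R :=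
  counting (eta w `&` A).
Arguments count_in {R Omega X} eta A w.

(* [poisson_pmf] is not used since its value at rate 0 is constantly 1. *)
Record poisson_process (R : realType) d (Omega : measurableType d)
    (P : probability Omega R) dX (X : measurableType dX)
    (E : set X) (mu : set X -> \bar R) (eta : Omega -> set X) : Prop := {
  pp_sub : forall w, eta w `<=` E ;
  pp_countable : forall w, countable (eta w) ;
  pp_measurable : forall A, measurable A -> A `<=` E ->
    measurable_fun setT (count_in eta A : Omega -> \bar R) ;
  pp_law : forall A, measurable A -> A `<=` E ->
    (forall r : R, mu A = r%:E -> forall k : nat,
       P [set w | count_in eta A w = (k%:R : R)%:E] =
         (r ^+ k / k`!%:R * expR (- r))%:E) /\
    (mu A = +oo%E -> P [set w | count_in eta A w = +oo%E :> \bar R] = 1%E) ;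
  pp_independent : forall (m : nat) (A : 'I_m -> set X),
    (forall i, measurable (A i) /\ A i `<=` E) ->
    trivIset setT A ->
    forall B : 'I_m -> set (\bar R), (forall i, measurable (B i)) ->
    P (\bigcap_(i in setT) (count_in eta (A i) @^-1` B i)) =
      (\prod_(i < m) P (count_in eta (A i) @^-1` B i))%E }.

Definition pp_sigma_algebra (R : realType) d (Omega : measurableType d)
    dX (X : measurableType dX) (E : set X) (eta : Omega -> set X) :
    set (set Omega) :=
  <<s [set C | exists A (B : set (\bar R)), [/\ measurable A, A `<=` E,
                 measurable B & C = count_in eta A @^-1` B]] >>.

Definition independent_pp (R : realType) d (Omega : measurableType d)
    (P : probability Omega R) dX (X : measurableType dX) (E : set X)
    (eta : Omega -> set X) dX' (X' : measurableType dX') (E' : set X')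
    (eta' : Omega -> set X') : Prop :=
  forall C C', pp_sigma_algebra R E eta C -> pp_sigma_algebra R E' eta' C' ->
    P (C `&` C') = (P C * P C')%E.

Section model.
Variable R : realType.
Local Notation leb := (@lebesgue_measure R).

Definition space_ST : set (R * R * R * R) :=
  [set p | let: (x, u, b, l) := p in 0 <= u <= 1 /\ 0 <= l].

Definition space_SR : set (R * R * R) :=
  [set q | let: (z, w, r) := q in 0 <= w <= 1].

Definition intensity_ST : set (R * R * R * R) -> \bar R :=
  (leb \x leb \x leb \x exponential_prob 1)%E.

Definition intensity_SR : set (R * R * R) -> \bar R :=
  (leb \x leb \x leb)%E.

Variables beta gamma gamma' : R.

(* [powR] sends 0 `^ (- gamma) to 0 rather than to +oo; almost surely no point
   of either process has weight 0. *)
Definition nbhd (p : R * R * R * R) (t : R) : set (R * R * R) :=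
  [set q | let: (x, u, b, l) := p in let: (z, w, r) := q in
    [/\ 0 <= w <= 1, `|x - z| <= beta * u `^ (- gamma) * w `^ (- gamma'),
        b <= r <= t & t < b + l]].

Section edge_count.
Variables (d : measure_display) (Omega : measurableType d).
Variable P : probability Omega R.
Variables (eta : Omega -> set (R * R * R * R)) (eta' : Omega -> set (R * R * R)).

Definition deg (p : R * R * R * R) (t : R) (w : Omega) : \bar R :=
  count_in eta' (nbhd p t) w.

Definition window (n : nat) : set (R * R * R * R) :=
  [set p | let: (x, u, b, l) := p in 0 <= x <= n%:R /\ 0 <= u <= 1].

Definition edge_count (n : nat) (t : R) (w : Omega) : \bar R :=
  \esum_(p in eta w `&` window n) deg p t w.

(* Almost surely, [edge_count n t] is finite for all t in [0,1], and its
   expectation is finite. *)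
Definition edge_count_bar (n : nat) (t : R) (w : Omega) : R :=
  n%:R `^ (- gamma) *
  (fine (edge_count n t w) - fine (\int[P]_v edge_count n t v)).

End edge_count.

Definition ctilde : R := 2 * beta / (1 - gamma').

Definition space_infty : set (R * R * R) :=
  [set q | let: (j, b, l) := q in 0 < j /\ 0 <= l].

Definition intensity_infty (nu : {measure set R -> \bar R}) :
    set (R * R * R) -> \bar R :=
  (nu \x leb \x exponential_prob 1)%E.

Section limit.
Variables (d : measure_display) (Omega : measurableType d).
Variable P : probability Omega R.
Variable eta : Omega -> set (R * R * R).

Definition limit_sum (eps t : R) (w : Omega) : \bar R :=
  \esum_(q in eta w)
    (let: (j, b, l) := q in
     j * (t - b) * (ctilde * eps `^ gamma <= j)%R%:R * (b <= t < b + l)%R%:R)%:E.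

Definition limit_bar (eps t : R) (w : Omega) : R :=
  fine (limit_sum eps t w) - fine (\int[P]_v limit_sum eps t v).

End limit.

End model.

(* Main.v *)
(* A point of weight [u] meets about [c u^-gamma] neighbours per unit of time, so
   the edge count is compared with the integral of [c v^-gamma (t - b)] over the
   points alive at time [t], where [v = n u].  The points [(v, b, l)] form a
   Poisson process with Lebesgue x Lebesgue x exponential intensity on
   [0 < v <= n]; the substitution [j = c v^-gamma] carries the restriction of
   [eta_infty] to [j >= c eps^gamma] to the same process with [n = 1/eps], so the
   compensated integrals over [v <= n] have the law of [limit_bar (1/n)].

   Every time-dependent integrand is a difference of two nonnegative functions
   nondecreasing in [t]: [alpha] is the time lived by [t], [delta] the total of
   the lifetimes already ended.  Monotonicity reduces suprema over [t] (and over
   the truncation [v <= y]) to maxima over dyadic grids, which are bounded by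
   second moments through chaining.  As [gamma > 1/2], this gives the almost sure
   uniform Cauchy property of the truncated limits.  For the edge count, the
   difference with its conditional mean given [eta] has increments over [[s, t]]
   of second moment at most [C n (t - s)], the [w^-gamma'] being square
   integrable; chaining over a grid of mesh below [n^-3] costs a logarithmic
   factor, so this difference is negligible against [n^gamma].  Between grid
   points births are handled by monotonicity and deaths by the fact that, with
   high probability, no cell of the grid contains two of them.

   Weak convergence is tested on bounded Lipschitz functions. *)
Require Import Defs.
From HB Require Import structures.
From mathcomp Require Import all_boot all_order all_algebra.
From mathcomp Require Import all_classical all_reals all_analysis.
From mathcomp Require Import measurable_realfun zify ring lra.
Import Order.TTheory GRing.Theory Num.Theory.
Import numFieldTopology.Exports numFieldNormedType.Exports.

Set Implicit Arguments.
Unset Strict Implicit.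
Unset Printing Implicit Defensive.

Local Open Scope classical_set_scope.
Local Open Scope ring_scope.

(** * Poisson random measures *)

(** Equality of laws takes the place of tightness and of finite-dimensional convergence. The
    compensated path of the window and the truncated limit path are compared through step functions
    sampled at finitely many times, their integrands being discretised so that only finitely many
    disjoint counts occur. What remains is a mean distance on each of the two probability spaces:
    from the edge path to its compensated path, and from the truncated limit to the limit. The mesh
    is dictated by the deaths. They occur at rate at most [n], so a cell of length [h] holds two of
    them with probability at most [(n h)^2], and the [1/h] cells together contribute [n^2 h]; at
    [h = n^-3] this is [1/n]. The logarithmic price is two factors [K + 1], against a gain
    [n^(1 - 2 gamma)]. A point process becomes a measure that is locally finite for every outcome,
    by emptying it on a null event; Fubini and kernel arguments then meet no exceptional sets.
    Conditioning on [eta] is done on the product of the sigma-algebras generated by the two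
    processes. *)

Section induction.
Local Open Scope ereal_scope.
Context d (X : measurableType d) (R : realType).

Import HBNNSimple.

(** The approximating simple functions are finite sums of scaled indicators, so the first three
    closure properties give [Q] along the sequence and the fourth passes to the limit. Each closure
    step receives measurability and nonnegativity, which the integral rules ask for. *)
Lemma ge0_measurable_ind (Q : (X -> \bar R) -> Prop) :
  (forall A, measurable A -> Q (EFin \o \1_A)) ->
  (forall (c : R) (f : X -> \bar R), (0 <= c)%R -> measurable_fun setT f ->
    (forall x, 0 <= f x) -> Q f -> Q (fun x => c%:E * f x)) ->
  (forall f g : X -> \bar R, measurable_fun setT f -> (forall x, 0 <= f x) ->
    measurable_fun setT g -> (forall x, 0 <= g x) ->
    Q f -> Q g -> Q (fun x => f x + g x)) ->
  (forall f_ : nat -> X -> \bar R, (forall n, measurable_fun setT (f_ n)) ->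
    (forall n x, 0 <= f_ n x) -> (forall x, nondecreasing_seq (f_ ^~ x)) ->
    (forall n, Q (f_ n)) -> Q (fun x => limn (f_ ^~ x))) ->
  forall f : X -> \bar R, measurable_fun setT f -> (forall x, 0 <= f x) -> Q f.
Proof.
move=> Q1 QZ QD Qlim f mf f0.
pose g := nnsfun_approx measurableT mf.
have -> : f = (fun x => limn ((fun n => EFin \o g n) ^~ x)).
  apply/funext => x; apply/esym/cvg_lim => //.
  exact: (@cvg_nnsfun_approx _ _ _ _ measurableT f mf).
apply: Qlim => //.
- by move=> n; exact/measurable_EFinP.
- by move=> n x; rewrite /= lee_fin.
- by move=> x m n mn; rewrite /= lee_fin; exact/lefP/nd_nnsfun_approx.
move=> n; pose h (y : R) := fun x => (y * \1_(g n @^-1` [set y]) x)%:E.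
have -> : EFin \o g n = fun x => \sum_(y <- finmap.enum_fset (fset_set (range (g n)))) h y x.
  by apply/funext => x /=; rewrite fimfunE fsbig_finite//= sumEFin.
have : all (fun y => 0 <= y)%R (finmap.enum_fset (fset_set (range (g n)))).
  by apply/allP => y; rewrite in_fset_set// => /set_mem[x _ <-].
have mind B : measurable B -> measurable_fun setT (EFin \o \1_B : X -> \bar R).
  by move=> mB; exact/measurable_EFinP.
elim: (finmap.enum_fset _) => [_|y s ih /= /andP[y0 s0]].
  have -> : (fun x => \sum_(y <- [::]) h y x) = fun x => 0%:E * (EFin \o \1_(set0 : set X)) x.
    by apply/funext => x; rewrite big_nil mul0e.
  by apply: QZ => //; [exact: mind|move=> x; rewrite /= lee_fin|exact: Q1].
have mh y' : measurable_fun setT (h y').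
  apply/measurable_EFinP; apply: measurable_funM => //.
have -> : (fun x => \sum_(y <- y :: s) h y x) =
    fun x => h y x + \sum_(y <- s) h y x.
  by apply/funext => x; rewrite big_cons.
apply: QD => //.
- by move=> x; rewrite lee_fin mulr_ge0.
- exact: emeasurable_sum.
- move=> x; rewrite big_seq; apply: sume_ge0 => z zs; rewrite lee_fin mulr_ge0//.
  exact: (allP s0).
- have -> : h y = fun x => y%:E * (EFin \o \1_(g n @^-1` [set y])) x.
    by apply/funext => x; rewrite /h EFinM.
  apply: QZ => //; [exact: mind|by move=> x; rewrite /= lee_fin|exact: Q1].
- exact: ih.
Qed.

End induction.

Section random_measure.
Local Open Scope ereal_scope.
Context d (W : measurableType d) d' (X : measurableType d') (R : realType).
Implicit Types M : W -> {measure set X -> \bar R}.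

(** The exhausting sets do not depend on [w] and finiteness holds for every [w], so that on each of
    them the family is a kernel of finite measures. *)
Definition locally_finite M := exists C : nat -> set X,
  [/\ forall i, measurable (C i), nondecreasing_seq C, \bigcup_i C i = setT &
      forall w i, M w (C i) < +oo].

Record random_measure M : Prop := {
  rm_measurable : forall A, measurable A -> measurable_fun setT (M ^~ A) ;
  rm_finite : locally_finite M }.

Section kernel_of.
Variables (M : W -> {measure set X -> \bar R})
  (HM : forall A, measurable A -> measurable_fun setT (M ^~ A)).
Definition kernel_of (_ : forall A, measurable A -> measurable_fun setT (M ^~ A)) := M.
HB.instance Definition _ := isKernel.Build _ _ W X R (kernel_of HM) HM.
Definition as_kernel : R.-ker W ~> X := kernel_of HM.
End kernel_of.

(** Sections are cut by the exhausting sets; there the measures are finite and the kernel result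
    applies. Continuity from below removes the cut. *)
Lemma measurable_rm_xsection M (HM : random_measure M) (A : set (W * X)) :
  measurable A -> measurable_fun setT (fun w => M w (xsection A w)).
Proof.
case: HM => mM [C [mC ndC CT finC]] mA.
have -> : (fun w => M w (xsection A w)) =
    (fun w => limn (fun i => M w (xsection A w `&` C i))).
  apply/funext => w; apply/esym/cvg_lim => //.
  have -> : xsection A w = \bigcup_i (xsection A w `&` C i).
    by rewrite -setI_bigcupr CT setIT.
  have mI i : measurable (xsection A w `&` C i).
    by apply: measurableI => //; exact: measurable_xsection.
  rewrite -setI_bigcupr CT setIT.
  rewrite [X in _ --> M w X](_ : _ = \bigcup_i (xsection A w `&` C i)); last first.
    by rewrite -setI_bigcupr CT setIT.
  apply: nondecreasing_cvg_mu => //; first exact: bigcup_measurable.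
  move=> m n mn; apply/subsetPset => x [Ax Cx]; split => //.
  by have /subsetPset := ndC _ _ mn; exact.
apply: (@emeasurable_fun_cvg _ _ _ _ (fun i w => M w (xsection A w `&` C i))) => //=.
  move=> i.
  have := @measurable_prod_subset_xsection_kernel _ _ W X R (as_kernel mM) (C i) (mC i).
  case/(_ _ A mA) => //.
  move=> w; exists (fine (M w (C i)) + 1)%R => B mB.
  rewrite EFinD fineK; last first.
    by rewrite ge0_fin_numE// ?measure_ge0//; exact: finC.
  rewrite (@le_lt_trans _ _ (M w (C i)))//.
    by rewrite /mrestr/= le_measure ?inE//; exact: measurableI.
  rewrite lteDl//.
  by rewrite ge0_fin_numE// ?measure_ge0//; exact: finC.
move=> w _; apply: ereal_nondecreasing_is_cvgn => m n mn.
apply: le_measure; rewrite ?inE.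
- by apply: measurableI => //; exact: measurable_xsection.
- by apply: measurableI => //; exact: measurable_xsection.
- move=> x [Ax Cx]; split => //.
  by have /subsetPset := ndC _ _ mn; exact.
Qed.

Import HBNNSimple.

Lemma measurable_rm_integral M (HM : random_measure M) (f : W * X -> \bar R) :
  measurable_fun setT f -> (forall z, 0 <= f z) ->
  measurable_fun setT (fun w => \int[M w]_x f (w, x)).
Proof.
move=> mf f0.
pose k_ := nnsfun_approx measurableT mf.
apply: (@measurable_fun_xsection_integral _ _ _ _ _ f M k_).
- by move=> a b ab; exact/nd_nnsfun_approx.
- by move=> z; exact/cvg_nnsfun_approx.
- move=> n r; have H := @measurable_rm_xsection M HM (HBNNSimple.NonNegSimpleFun.sort (k_ n) @^-1` [set r]).
  by apply H; exact: measurable_funPTI.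
Qed.

Lemma measurable_rm_integral1 M (HM : random_measure M) (f : X -> \bar R) :
  measurable_fun setT f -> (forall z, 0 <= f z) ->
  measurable_fun setT (fun w => \int[M w]_x f x).
Proof.
move=> mf f0; apply: (measurable_rm_integral HM (f := fun z => f z.2)) => //.
exact: measurableT_comp.
Qed.

End random_measure.

Section poisson_moments.
Local Open Scope ereal_scope.
Context d (W : measurableType d) (R : realType) (P : probability W R).

Definition pois (r : R) (k : nat) : R := (r ^+ k / k`!%:R * expR (- r))%R.

Lemma pois_ge0 r k : (0 <= r)%R -> (0 <= pois r k)%R.
Proof. by move=> r0; rewrite /pois !mulr_ge0 ?exprn_ge0 ?expR_ge0. Qed.

(** After an index shift, this recurrence reduces each Poisson moment to a lower one. *)
Lemma poisS r k : (k.+1%:R * pois r k.+1 = r * pois r k)%R.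
Proof.
rewrite /pois factS natrM exprS invfM.
have : (k.+1%:R != 0 :> R)%R by rewrite pnatr_eq0.
move: (k.+1%:R)%R (k`!%:R^-1)%R => a b a0.
by field.
Qed.

Lemma pois_series r : (0 <= r)%R -> \sum_(k <oo) (pois r k)%:E = 1.
Proof.
move=> r0.
rewrite [RHS](_ : _ = (expR (- r))%:E * (expR r)%:E); last first.
  by rewrite -EFinM expRN mulVf ?gt_eqF ?expR_gt0.
under eq_eseriesr do rewrite /pois EFinM muleC.
rewrite nneseriesZl/=; last first.
  by move=> n _; rewrite lee_fin divr_ge0// exprn_ge0// ltW.
congr *%E; rewrite expRE -EFin_lim; last first.
  rewrite /pseries/=; under eq_fun do rewrite mulrC.
  exact: is_cvg_series_exp_coeff.
apply/congr_lim/funext => n/=; rewrite /pseries/= /series/= -sumEFin//.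
by under eq_bigr do rewrite mulrC.
Qed.

Lemma nneseries_shift (f : nat -> \bar R) : (forall k, 0 <= f k) ->
  \sum_(k <oo) f k = f 0%N + \sum_(k <oo) f k.+1.
Proof.
move=> f0; rewrite nneseries_recl//; congr (_ + _).
rewrite -(nneseries_addn 1)//.
by apply: eq_eseriesr => k _; rewrite addn1.
Qed.

Lemma pois_mean r : (0 <= r)%R -> \sum_(k <oo) (k%:R * pois r k)%:E = r%:E.
Proof.
move=> r0; rewrite nneseries_shift; last first.
  by move=> k; rewrite lee_fin mulr_ge0// pois_ge0.
rewrite mul0r add0e.
under eq_eseriesr do rewrite poisS EFinM.
rewrite nneseriesZl; last by move=> k _; rewrite lee_fin pois_ge0.
by rewrite pois_series// mule1.
Qed.

Lemma pois_sqr r : (0 <= r)%R ->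
  \sum_(k <oo) (k%:R * k%:R * pois r k)%:E = (r * r + r)%:E.
Proof.
move=> r0; rewrite nneseries_shift; last first.
  by move=> k; rewrite lee_fin mulr_ge0 ?pois_ge0// mulr_ge0.
rewrite !mul0r add0e.
have E k : (k.+1%:R * k.+1%:R * pois r k.+1 = r * (k%:R * pois r k) + r * pois r k)%R.
  by rewrite -mulrA poisS -natr1; ring.
under eq_eseriesr do rewrite E EFinD !(EFinM r).
rewrite nneseriesD; last 2 first.
- by move=> k _ _; rewrite -EFinM lee_fin mulr_ge0// mulr_ge0// pois_ge0.
- by move=> k _ _; rewrite -EFinM lee_fin mulr_ge0// pois_ge0.
rewrite nneseriesZl; last by move=> k _; rewrite lee_fin mulr_ge0// pois_ge0.
rewrite nneseriesZl; last by move=> k _; rewrite lee_fin pois_ge0.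
by rewrite pois_mean// pois_series// mule1.
Qed.

Definition poisson_rv (r : R) (Y : W -> \bar R) :=
  forall k : nat, P [set w | Y w = (k%:R : R)%:E] = (pois r k)%:E.

(** The weights [pois r k] sum to one, so the integer values carry the whole mass; every other value
    of [Y], including [+oo], is negligible. *)
Lemma integral_poisson_rv (r : R) (Y : W -> \bar R) (g : \bar R -> \bar R) :
  (0 <= r)%R -> measurable_fun setT Y -> poisson_rv r Y ->
  measurable_fun setT g -> (forall x, 0 <= g x) ->
  \int[P]_w g (Y w) = \sum_(k <oo) (g (k%:R : R)%:E * (pois r k)%:E).
Proof.
move=> r0 mY pY mg g0.
pose F (k : nat) := Y @^-1` [set (k%:R : R)%:E].
have mF k : measurable (F k).
  by rewrite -[F k]setTI; apply: mY => //; exact: emeasurable_set1.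
have tF : trivIset setT F.
  by apply/trivIsetP => i j _ _ ij; rewrite -subset0 => w; rewrite /F/= => -[/= -> [/eqP]];
    rewrite eqr_nat (negbTE ij).
have mU : measurable (\bigcup_k F k) by exact: bigcup_measurable.
have PU : P (\bigcup_k F k) = 1.
  rewrite measure_bigcup//= -(pois_series r0).
  by under eq_eseriesl do rewrite in_setT; apply: eq_eseriesr => k _; exact: pY.
have mgY D : measurable D -> measurable_fun D (g \o Y).
  by move=> mD; apply: measurable_funTS; exact: measurableT_comp.
transitivity (\int[P]_(w in \bigcup_k F k) g (Y w)).
  rewrite (@ge0_negligible_integral _ _ _ _ _ (~` (\bigcup_k F k)))//.
  - by rewrite setTD setCK.
  - exact: measurableC.
  - exact: mgY.
  - by rewrite [LHS]probability_setC// PU subee.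
rewrite ge0_integral_bigcup//; last exact: mgY.
apply: eq_eseriesr => k _.
transitivity (\int[P]_(w in F k) (cst (g (k%:R : R)%:E) w)).
  by apply: eq_integral => w; rewrite inE => ->.
by rewrite integral_cst// [X in _ * X](pY k).
Qed.

Lemma poisson_rv_mean (r : R) (Y : W -> \bar R) :
  (0 <= r)%R -> measurable_fun setT Y -> (forall w, 0 <= Y w) ->
  poisson_rv r Y -> \int[P]_w Y w = r%:E.
Proof.
move=> r0 mY Y0 pY.
(* The test function must be nonnegative on all of [\bar R], hence the absolute value in place of
   the identity. *)
transitivity (\int[P]_w `|Y w|); first by apply: eq_integral => w _; rewrite gee0_abs.
rewrite (integral_poisson_rv (g := abse) r0 mY pY)//.
rewrite -[RHS](pois_mean r0); apply: eq_eseriesr => k _.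
by rewrite gee0_abs ?lee_fin// EFinM.
Qed.

Lemma poisson_rv_sqr (r : R) (Y : W -> \bar R) :
  (0 <= r)%R -> measurable_fun setT Y -> (forall w, 0 <= Y w) ->
  poisson_rv r Y -> \int[P]_w (Y w * Y w) = (r * r + r)%:E.
Proof.
move=> r0 mY Y0 pY.
transitivity (\int[P]_w (`|Y w| * `|Y w|)).
  by apply: eq_integral => w _; rewrite gee0_abs.
rewrite (integral_poisson_rv (g := fun y => `|y| * `|y|) r0 mY pY)//; last first.
  by apply: emeasurable_funM; exact: abse_measurable.
rewrite -[RHS](pois_sqr r0); apply: eq_eseriesr => k _.
by rewrite gee0_abs ?lee_fin// !EFinM.
Qed.

End poisson_moments.

(** The case [c = +oo] is included: either some [u n] is positive and both sides are infinite, or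
    [u] vanishes and [+oo * 0 = 0] on both sides. *)
Lemma limn_mulel (R : realType) (c : \bar R) (u : nat -> \bar R) :
  (0 <= c -> (forall n, 0 <= u n) -> nondecreasing_seq u ->
  limn (fun n => c * u n) = c * limn u)%E.
Proof.
move=> c0 u0 ndu; have cu : cvgn u by exact: ereal_nondecreasing_is_cvgn.
have [cfin|] := boolP (c \is a fin_num).
  by apply/cvg_lim => //; apply: cvgeZl.
rewrite ge0_fin_numE// -leNgt leye_eq => /eqP ->.
have [[n un]|nu] := pselect (exists n, (0 < u n)%E).
  rewrite gt0_mulye; last first.
    by rewrite (lt_le_trans un)//; apply: lime_ge => //; exists n => // m /= /ndu.
  apply/cvg_lim => //; apply: cvg_near_cst.
  exists n => // m /= nm; rewrite gt0_mulye//.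
  by rewrite (lt_le_trans un)//; exact: ndu.
have u00 : u = (fun=> 0%E).
  apply/funext => n; apply/eqP; rewrite eq_le u0 andbT leNgt; apply/negP => un.
  by apply: nu; exists n.
by rewrite u00; under eq_fun do rewrite mule0; rewrite lim_cst// mule0.
Qed.

Section prm.
Local Open Scope ereal_scope.
Context d (W : measurableType d) d' (X : measurableType d') (R : realType).
Variables (P : probability W R) (mu : {measure set X -> \bar R}).
Variable M : W -> {measure set X -> \bar R}.

(** Only the laws of single counts, and only on sets of finite intensity: they determine the first
    two moments. Independence over disjoint sets is kept apart in [independent_rm], for the
    comparison of whole laws. *)
Record poisson_rm : Prop := {
  prm_measurable : forall A, measurable A -> measurable_fun setT (M ^~ A) ;
  prm_cover : exists C : nat -> set X,
    [/\ forall i, measurable (C i), nondecreasing_seq C, \bigcup_i C i = setT,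
      forall i, mu (C i) < +oo & forall w i, M w (C i) < +oo] ;
  prm_law : forall A, measurable A -> forall r : R, mu A = r%:E ->
    poisson_rv P r (M ^~ A) }.

Hypothesis HM : poisson_rm.

Lemma prm_rm : random_measure M.
Proof.
case: HM => mM [C [mC ndC CT _ fC]] _.
by split => //; exists C.
Qed.

Lemma prm_mintegral (f : X -> \bar R) :
  measurable_fun setT f -> (forall z, 0 <= f z) ->
  measurable_fun setT (fun w => \int[M w]_x f x).
Proof. exact: (measurable_rm_integral1 prm_rm). Qed.

Lemma prm_mean_set A : measurable A -> \int[P]_w M w A = mu A.
Proof.
move=> mA; case: (HM) => mM [C [mC ndC CT Cfin MCfin]] law.
have mAC i : measurable (A `&` C i) by exact: measurableI.
have ACfin i : mu (A `&` C i) \is a fin_num.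
  rewrite ge0_fin_numE//; apply: le_lt_trans (Cfin i).
  by apply: le_measure; rewrite ?inE//; exact: subIsetr.
have AE : A = \bigcup_i (A `&` C i) by rewrite -setI_bigcupr CT setIT.
have ndAC : nondecreasing_seq (fun i => A `&` C i).
  move=> m n mn; apply/subsetPset => x [Ax Cx]; split => //.
  by have /subsetPset := ndC _ _ mn; exact.
have cvM (m : {measure set X -> \bar R}) : m A = limn (fun i => m (A `&` C i)).
  apply/esym/cvg_lim => //; rewrite [in X in _ --> X]AE.
  by apply: nondecreasing_cvg_mu => //; exact: bigcup_measurable.
rewrite cvM; under eq_integral do rewrite cvM.
rewrite monotone_convergence//.
- apply/congr_lim/funext => i.
  rewrite -(fineK (ACfin i)); apply: poisson_rv_mean => //.
  + exact: mM.
  + by apply: law => //; rewrite fineK.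
- by move=> i; exact/mM/mAC.
- move=> w _ m n mn; apply: le_measure; rewrite ?inE//.
  by have /subsetPset := ndAC _ _ mn; exact.
Qed.

(** Campbell's formula: on indicators it is the mean of a count, and both sides are additive and
    continuous along increasing sequences. *)
Lemma campbell (f : X -> \bar R) : measurable_fun setT f -> (forall x, 0 <= f x) ->
  \int[P]_w \int[M w]_x f x = \int[mu]_x f x.
Proof.
move: f; apply: ge0_measurable_ind.
- move=> A mA; rewrite integral_indic// setIT -prm_mean_set//.
  by apply: eq_integral => w _; rewrite integral_indic// setIT.
- move=> c f c0 mf f0 IH; rewrite ge0_integralZl// -IH.
  under eq_integral do rewrite ge0_integralZl//.
  rewrite ge0_integralZl//; last by move=> w _; exact: integral_ge0.
  exact: prm_mintegral.
- move=> f g mf f0 mg g0 If Ig; rewrite ge0_integralD// -If -Ig.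
  under eq_integral do rewrite ge0_integralD//.
  rewrite ge0_integralD//.
  - by move=> w _; exact: integral_ge0.
  - exact: prm_mintegral.
  - by move=> w _; exact: integral_ge0.
  - exact: prm_mintegral.
- move=> f mf f0 ndf IH.
  rewrite monotone_convergence//.
  rewrite (_ : (fun n => _) = (fun n => \int[P]_w \int[M w]_x f n x)); last first.
    by apply/funext => n; rewrite IH.
  rewrite -monotone_convergence//.
  - by apply: eq_integral => w _; rewrite monotone_convergence.
  - by move=> n; exact: prm_mintegral.
  - by move=> n w _; exact: integral_ge0.
  - by move=> w _ m n mn; apply: ge0_le_integral => // x _; exact: ndf.
Qed.

Let mM A : measurable A -> measurable_fun setT (M ^~ A).
Proof. exact: (prm_measurable HM). Qed.

Let mMM A B : measurable A -> measurable B ->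
  measurable_fun setT (fun w => M w A * M w B).
Proof. by move=> mA mB; apply: emeasurable_funM; exact: mM. Qed.

Let sqr_mean A a : measurable A -> mu A = a%:E ->
  \int[P]_w (M w A * M w A) = (a * a + a)%:E.
Proof.
move=> mA muA; apply: poisson_rv_sqr => //; last 2 first.
- exact: mM.
- exact: (prm_law HM).
- by rewrite -lee_fin -muA.
Qed.

(** By polarisation: the counts of [A], of [B] and of their union are Poisson, and the second moment
    of the union isolates the mixed term. *)
Let disjoint_mean A B a b : measurable A -> measurable B ->
  A `&` B = set0 -> mu A = a%:E -> mu B = b%:E ->
  \int[P]_w (M w A * M w B) = (a * b)%:E.
Proof.
move=> mA mB AB muA muB.
have mAB : measurable (A `|` B) by exact: measurableU.
have muAB : mu (A `|` B) = (a + b)%:E by rewrite EFinD -muA -muB; exact: measureU.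
have := sqr_mean mAB muAB.
have -> : (fun w => M w (A `|` B) * M w (A `|` B)) =
    (fun w => (M w A * M w A + (M w A * M w B + M w A * M w B)) + M w B * M w B).
  apply/funext => w; rewrite (measureU (M w) mA mB AB) ge0_muleDl// !ge0_muleDr//.
  by rewrite (muleC (M w B) (M w A)) !addeA.
rewrite ge0_integralD//; last 3 first.
- by move=> w _; rewrite !adde_ge0.
- by apply: emeasurable_funD; [exact: mMM|apply: emeasurable_funD; exact: mMM].
- exact: mMM.
rewrite ge0_integralD//; last 3 first.
- exact: mMM.
- by move=> w _; rewrite !adde_ge0.
- by apply: emeasurable_funD; exact: mMM.
rewrite ge0_integralD//; [|exact: mMM|exact: mMM].
rewrite (sqr_mean mA muA) (sqr_mean mB muB).
have : 0 <= \int[P]_w (M w A * M w B) by exact: integral_ge0.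
case: (\int[P]_w _) => //= x _ []; rewrite -?EFinD => h.
by congr EFin; lra.
Qed.

(** The two sets are split into their differences and their intersection; only the intersection
    contributes beyond the product of the means. *)
Let pair_mean A B a b c : measurable A -> measurable B ->
  mu A = a%:E -> mu B = b%:E -> mu (A `&` B) = c%:E ->
  \int[P]_w (M w A * M w B) = (a * b + c)%:E.
Proof.
move=> mA mB muA muB muI.
have mI : measurable (A `&` B) by exact: measurableI.
have mA' : measurable (A `\` B) by exact: measurableD.
have mB' : measurable (B `\` A) by exact: measurableD.
have MAE (m : {measure set X -> \bar R}) : m A = m (A `\` B) + m (A `&` B).
  exact: measureDI.
have MBE (m : {measure set X -> \bar R}) : m B = m (B `\` A) + m (A `&` B).
  by rewrite setIC; exact: measureDI.
have [a' muA'] : exists a', mu (A `\` B) = a'%:E.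
  have := MAE mu; rewrite muA muI; case: (mu (A `\` B)) => // x _; by exists x.
have [b' muB'] : exists b', mu (B `\` A) = b'%:E.
  have := MBE mu; rewrite muB muI; case: (mu (B `\` A)) => // x _; by exists x.
have -> : (a = a' + c)%R by apply: EFin_inj; rewrite EFinD -muA -muA' -muI MAE.
have -> : (b = b' + c)%R by apply: EFin_inj; rewrite EFinD -muB -muB' -muI MBE.
have -> : (fun w => M w A * M w B) =
    (fun w => (M w (A `\` B) * M w (B `\` A) + M w (A `\` B) * M w (A `&` B)) +
      (M w (A `&` B) * M w (B `\` A) + M w (A `&` B) * M w (A `&` B))).
  apply/funext => w; rewrite MAE (MBE (M w)) ge0_muleDl//.
  by rewrite ge0_muleDr// ge0_muleDr.
rewrite ge0_integralD//; last 4 first.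
- by move=> w _; rewrite !adde_ge0.
- by apply: emeasurable_funD; exact: mMM.
- by move=> w _; rewrite !adde_ge0.
- by apply: emeasurable_funD; exact: mMM.
rewrite ge0_integralD//; [|exact: mMM|exact: mMM].
rewrite ge0_integralD//; [|exact: mMM|exact: mMM].
rewrite (sqr_mean mI muI) (disjoint_mean mA' mB' _ muA' muB'); last first.
  by rewrite -subset0 => x [[Ax nBx] [Bx _]].
rewrite (disjoint_mean mA' mI _ muA' muI); last first.
  by rewrite -subset0 => x [[Ax nBx] [_ Bx]].
rewrite (disjoint_mean mI mB' _ muI muB'); last first.
  by rewrite -subset0 => x [[Ax Bx] [_ nAx]].
by rewrite -!EFinD; congr EFin; ring.
Qed.


(** Passes from sets to functions in one factor while the other factor [Phi] is frozen: [c] is its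
    mean and [f] the density of the diagonal term. It is applied twice, with [Phi] a count and then
    with [Phi] an integral. *)
Let pair_mean_ind (Phi : W -> \bar R) (c : R) (f : X -> \bar R) E :
  measurable_fun setT Phi -> (forall w, 0 <= Phi w) -> (0 <= c)%R ->
  measurable_fun setT f -> (forall x, 0 <= f x) -> measurable E ->
  (forall A, measurable A -> \int[P]_w (Phi w * M w (A `&` E)) =
     c%:E * mu (A `&` E) + \int[mu]_(x in E) (f x * (\1_A x)%:E)) ->
  forall g : X -> \bar R, measurable_fun setT g -> (forall x, 0 <= g x) ->
  \int[P]_w (Phi w * \int[M w]_(x in E) g x) =
  c%:E * \int[mu]_(x in E) g x + \int[mu]_(x in E) (f x * g x).
Proof.
move=> mPhi Phi0 c0 mf f0 mE H.
have mI (g : X -> \bar R) : measurable_fun setT g -> (forall x, 0 <= g x) ->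
    measurable_fun setT (fun w => \int[M w]_(x in E) g x).
  move=> mg g0; under eq_fun do rewrite integral_mkcond.
  apply: prm_mintegral; last by move=> x; exact: erestrict_ge0.
  by apply/(measurable_restrictT _ _).1 => //; exact: measurable_funTS.
have mPI (g : X -> \bar R) : measurable_fun setT g -> (forall x, 0 <= g x) ->
    measurable_fun setT (fun w => Phi w * \int[M w]_(x in E) g x).
  by move=> mg g0; apply: emeasurable_funM => //; exact: mI.
have I0 (m : {measure set X -> \bar R}) (g : X -> \bar R) :
    (forall x, 0 <= g x) -> 0 <= \int[m]_(x in E) g x.
  by move=> g0; exact: integral_ge0.
have P0 (g : X -> \bar R) w : (forall x, 0 <= g x) ->
    0 <= Phi w * \int[M w]_(x in E) g x.
  by move=> g0; rewrite mule_ge0// I0.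
have mTS (g : X -> \bar R) : measurable_fun setT g -> measurable_fun E g.
  exact: measurable_funTS.
have mfg (g : X -> \bar R) : measurable_fun setT g ->
    measurable_fun E (fun x => f x * g x).
  by move=> mg; apply: mTS; exact: emeasurable_funM.
have c0' : 0 <= c%:E by rewrite lee_fin.
apply: ge0_measurable_ind.
- move=> A mA.
  have E1 (m : {measure set X -> \bar R}) :
    \int[m]_(x in E) (EFin \o \1_A) x = m (A `&` E) by exact: integral_indic.
  transitivity (\int[P]_w (Phi w * M w (A `&` E))).
    by apply: eq_integral => w _; congr (_ * _); exact: E1.
  by rewrite H//; congr (_ * _ + _); apply/esym; exact: E1.
- move=> k g k0 mg g0 IH.
  have k0' : 0 <= k%:E by rewrite lee_fin.
  have HZ (m : {measure set X -> \bar R}) :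
      \int[m]_(x in E) (k%:E * g x) = k%:E * \int[m]_(x in E) g x.
    by rewrite ge0_integralZl//; exact: mTS.
  have -> : (fun w => Phi w * \int[M w]_(x in E) (k%:E * g x)) =
      (fun w => k%:E * (Phi w * \int[M w]_(x in E) g x)).
    by apply/funext => w; rewrite HZ muleCA.
  rewrite [LHS]ge0_integralZl//; try exact: mPI; try by move=> w _; exact: P0.
  rewrite IH HZ.
  rewrite (muleCA c%:E) ge0_muleDr//; last 2 first.
  + by rewrite mule_ge0 ?I0.
  + by rewrite I0// => x; rewrite mule_ge0.
  congr (_ + _); rewrite -ge0_integralZl//.
  + by apply: eq_integral => x _; rewrite muleCA.
  + exact: mfg.
  + by move=> x _; rewrite mule_ge0.
- move=> g h mg g0 mh h0 IHg IHh.
  have HD (m : {measure set X -> \bar R}) :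
      \int[m]_(x in E) (g x + h x) = \int[m]_(x in E) g x + \int[m]_(x in E) h x.
    by rewrite ge0_integralD//; exact: mTS.
  have -> : (fun w => Phi w * \int[M w]_(x in E) (g x + h x)) =
      (fun w => Phi w * \int[M w]_(x in E) g x + Phi w * \int[M w]_(x in E) h x).
    by apply/funext => w; rewrite HD ge0_muleDr// I0.
  rewrite [LHS]ge0_integralD//; try exact: mPI; try by move=> w _; exact: P0.
  rewrite IHg IHh HD.
  rewrite [in RHS]ge0_muleDr ?I0// addeACA; congr (_ + _).
  rewrite -ge0_integralD//; try exact: mfg; try by move=> x _; rewrite mule_ge0.
  by apply: eq_integral => x _; rewrite ge0_muleDr.
- move=> g mg g0 ndg IH.
  have cvI (m : {measure set X -> \bar R}) : \int[m]_(x in E) limn (g^~ x) =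
      limn (fun n => \int[m]_(x in E) g n x).
    by rewrite monotone_convergence// => n; exact: mTS.
  have ndI (m : {measure set X -> \bar R}) :
      nondecreasing_seq (fun n => \int[m]_(x in E) g n x).
    move=> p q pq; apply: ge0_le_integral => //; try exact: mTS; by move=> x _; exact: ndg.
  have -> : (fun w => Phi w * \int[M w]_(x in E) limn (g^~ x)) =
      (fun w => limn (fun n => Phi w * \int[M w]_(x in E) g n x)).
    by apply/funext => w; rewrite cvI limn_mulel// => n; exact: I0.
  rewrite [LHS]monotone_convergence//;
    try (by move=> n; exact: mPI); try (by move=> n w _; exact: P0);
    try (by move=> w _ p q pq; rewrite lee_pmul ?I0//; exact: ndI).
  under eq_fun do rewrite IH.
  have ndJ : nondecreasing_seq (fun n => \int[mu]_(x in E) (f x * g n x)).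
    move=> p q pq; apply: ge0_le_integral => //; try exact: mfg; try by move=> x _; rewrite mule_ge0.
    by move=> x _; rewrite lee_pmul//; exact: ndg.
  rewrite limeD; last 3 first.
  + apply: ereal_nondecreasing_is_cvgn => p q pq.
    by rewrite lee_pmul ?I0//; exact: ndI.
  + exact: ereal_nondecreasing_is_cvgn.
  + by rewrite ge0_adde_def// inE; apply: lime_ge => //;
      [apply: ereal_nondecreasing_is_cvgn => p q pq; rewrite lee_pmul ?I0//; exact: ndI
      |by apply: nearW => n; rewrite mule_ge0 ?I0
      |exact: ereal_nondecreasing_is_cvgn
      |by apply: nearW => n; rewrite I0// => x; rewrite mule_ge0].
  rewrite limn_mulel//; try (by move=> n; exact: I0).
  rewrite -cvI; congr (_ + _).
  rewrite -monotone_convergence//; try (by move=> n; exact: mfg);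
    try (by move=> n x _; rewrite mule_ge0);
    try (by move=> x _ p q pq; rewrite lee_pmul//; exact: ndg).
  by apply: eq_integral => x _; rewrite limn_mulel.
Qed.

(* Restricting to a set of finite intensity avoids the products 0 * +oo. *)
Let sqr_mean_fun E (f : X -> \bar R) : measurable E -> mu E < +oo ->
  measurable_fun setT f -> (forall x, 0 <= f x) -> \int[mu]_x f x < +oo ->
  \int[P]_w ((\int[M w]_(x in E) f x) * (\int[M w]_(x in E) f x)) =
  (\int[mu]_(x in E) f x) * (\int[mu]_(x in E) f x) +
  \int[mu]_(x in E) (f x * f x).
Proof.
move=> mE muE mf f0 foo.
have fin A : measurable A -> exists a, (0 <= a)%R /\ mu (A `&` E) = a%:E.
  move=> mA; have : mu (A `&` E) < +oo.
    apply: le_lt_trans muE; apply: le_measure; rewrite ?inE//; exact: measurableI.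
  move=> Aoo; exists (fine (mu (A `&` E))); split; first exact: fine_ge0.
  by rewrite fineK// ge0_fin_numE.
have mEI (g : X -> \bar R) : measurable_fun setT g -> (forall x, 0 <= g x) ->
    measurable_fun setT (fun w => \int[M w]_(x in E) g x).
  move=> mg g0; under eq_fun do rewrite integral_mkcond.
  apply: prm_mintegral; last by move=> x; exact: erestrict_ge0.
  by apply/(measurable_restrictT _ _).1 => //; exact: measurable_funTS.
have step1 B : measurable B -> forall g : X -> \bar R, measurable_fun setT g ->
    (forall x, 0 <= g x) ->
    \int[P]_w (M w (B `&` E) * \int[M w]_(x in E) g x) =
    mu (B `&` E) * \int[mu]_(x in E) g x + \int[mu]_(x in E) ((\1_B x)%:E * g x).
  move=> mB g mg g0; have [b [b0 muB]] := fin B mB; rewrite muB.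
  apply: pair_mean_ind => //.
  - by apply: mM; exact: measurableI.
  - exact/measurable_EFinP.
  move=> A mA; have [a [a0 muA]] := fin A mA.
  have [c [c0 muC]] := fin (B `&` A) (measurableI _ _ mB mA).
  rewrite (@pair_mean _ _ b a c)//; try exact: measurableI; last first.
    by rewrite setIACA setIid.
  rewrite muA -EFinM EFinD; congr (_ + _); rewrite -muC -integral_indic//; last exact: measurableI.
  by apply: eq_integral => x _; rewrite -EFinM indicI.
have fE : \int[mu]_(x in E) f x \is a fin_num.
  rewrite ge0_fin_numE; last exact: integral_ge0.
  by apply: le_lt_trans foo; apply: ge0_subset_integral.
rewrite -[X in _ = X * _ + _](fineK fE); apply: pair_mean_ind => //.
- exact: mEI.
- by move=> w; exact: integral_ge0.
- by rewrite fine_ge0//; exact: integral_ge0.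
move=> A mA; rewrite fineK// muleC.
have -> : (fun w => (\int[M w]_(x in E) f x) * M w (A `&` E)) =
    (fun w => M w (A `&` E) * \int[M w]_(x in E) f x).
  by apply/funext => w; rewrite muleC.
rewrite step1//; congr (_ + _).
by apply: eq_integral => x _; rewrite muleC.
Qed.

(** On each exhausting set the second moment is an identity; its right side is at most the full one,
    and the left side increases to the full second moment. *)
Lemma prm_sqr_le (f : X -> \bar R) :
  measurable_fun setT f -> (forall x, 0 <= f x) -> \int[mu]_x f x < +oo ->
  \int[P]_w ((\int[M w]_x f x) * (\int[M w]_x f x)) <=
  (\int[mu]_x f x) * (\int[mu]_x f x) + \int[mu]_x (f x * f x).
Proof.
move=> mf f0 foo; case: (HM) => _ [C [mC ndC CT Cfin _]] _.
have ndI (m : {measure set X -> \bar R}) :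
    nondecreasing_seq (fun n => \int[m]_(x in C n) f x).
  move=> p q pq; apply: ge0_subset_integral => //.
  - exact: measurable_funTS.
  - by have /subsetPset := ndC _ _ pq.
have cvI (m : {measure set X -> \bar R}) :
    \int[m]_(x in C n) f x @[n --> \oo] --> \int[m]_x f x.
  rewrite -CT; apply: ge0_nondecreasing_set_cvg_integral => //.
  by move=> i; exact: measurable_funTS.
have int_ge0' (m : {measure set X -> \bar R}) A : 0 <= \int[m]_(x in A) f x.
  exact: integral_ge0.
have mEI n : measurable_fun setT (fun w => \int[M w]_(x in C n) f x).
  under eq_fun do rewrite integral_mkcond.
  apply: prm_mintegral; last by move=> x; exact: erestrict_ge0.
  by apply/(measurable_restrictT _ _).1 => //; exact: measurable_funTS.
have -> : (fun w => (\int[M w]_x f x) * (\int[M w]_x f x)) =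
    (fun w => limn (fun n => (\int[M w]_(x in C n) f x) * (\int[M w]_(x in C n) f x))).
  apply/funext => w; apply/esym/cvg_lim => //.
  (* At an infinite limit one factor is eventually at least [A] and the other at least 1, so the
     products diverge as well. *)
  have [oo|fin] := eqVneq (\int[M w]_x f x) +oo.
    rewrite oo mulyy; apply/cvgeyPge => A.
    have := cvI (M w); rewrite oo => /cvgeyPge /(_ (Num.max A 1)%R).
    apply: filterS => n; rewrite EFin_max ge_max => /andP[h1 h2].
    rewrite (le_trans h1)// -[leLHS]mule1; apply: lee_pmul => //.
  apply: cvgeM => //.
    rewrite mule_def_fin// ge0_fin_numE//; try exact: int_ge0';
    by rewrite lt_neqAle fin leey.
rewrite monotone_convergence//.
- apply: lime_le.
    apply: ereal_nondecreasing_is_cvgn => p q pq; apply: ge0_le_integral => //.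
    + by move=> w _; rewrite mule_ge0.
    + by apply: emeasurable_funM.
    + by apply: emeasurable_funM.
    + by move=> w _; apply: lee_pmul => //; exact: ndI.
  apply: nearW => n; rewrite sqr_mean_fun//; apply: leeD.
    by apply: lee_pmul => //; apply: ge0_subset_integral.
  apply: ge0_subset_integral => //; first exact: emeasurable_funM.
  by move=> x _; rewrite mule_ge0.
- by move=> n; apply: emeasurable_funM.
- by move=> n w _; rewrite mule_ge0.
- by move=> w _ p q pq; apply: lee_pmul => //; exact: ndI.
Qed.

Lemma prm_integral_fin (f : X -> \bar R) :
  measurable_fun setT f -> (forall x, 0 <= f x) -> \int[mu]_x f x < +oo ->
  {ae P, forall w, \int[M w]_x f x \is a fin_num}.
Proof.
move=> mf f0 foo.
have /integrable_ae : P.-integrable setT (fun w => \int[M w]_x f x).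
  apply/integrableP; split; first exact: prm_mintegral.
  under eq_integral do rewrite gee0_abs ?integral_ge0//.
  by rewrite campbell.
by move=> /(_ measurableT); apply: filterS => w /(_ I).
Qed.

(** The expansion of the square is rearranged as [(I - m)^2 + 2 m I = I^2 + m^2], almost surely. All
    terms are nonnegative, so the integrals add up, and subtraction takes place only between finite
    numbers. *)
Lemma prm_variance (f : X -> \bar R) (m := fine (\int[mu]_x f x)) :
  measurable_fun setT f -> (forall x, 0 <= f x) -> \int[mu]_x f x < +oo ->
  \int[P]_w (((fine (\int[M w]_x f x) - m) ^+ 2)%R%:E) <= \int[mu]_x (f x * f x).
Proof.
move=> mf f0 foo.
have f_fin : \int[mu]_x f x \is a fin_num by rewrite ge0_fin_numE ?integral_ge0.
have m0 : (0 <= m)%R by rewrite fine_ge0// integral_ge0.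
have mI := prm_mintegral mf f0.
have mV : measurable_fun setT (fun w => ((fine (\int[M w]_x f x) - m) ^+ 2)%R%:E).
  apply/measurable_EFinP; apply: (@measurable_funX _ _ _ _ (fun w => (fine (\int[M w]_x f x) - m)%R)).
  by apply: measurable_funB => //; exact: measurableT_comp.
have [->|fin2] := eqVneq (\int[mu]_x (f x * f x)) +oo; first exact: leey.
have E : \int[P]_w (((fine (\int[M w]_x f x) - m) ^+ 2)%R%:E + (2 * m)%:E * \int[M w]_x f x) =
    \int[P]_w ((\int[M w]_x f x) * (\int[M w]_x f x) + (m * m)%:E).
  apply: ge0_ae_eq_integral => //.
  - by apply: emeasurable_funD => //; exact: measurable_funeM.
  - by apply: emeasurable_funD => //; exact: emeasurable_funM.
  - by move=> w _; rewrite adde_ge0 ?lee_fin ?sqr_ge0// mule_ge0 ?integral_ge0// lee_fin mulr_ge0.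
  - by move=> w _; rewrite adde_ge0 ?mule_ge0 ?integral_ge0// lee_fin mulr_ge0.
  have := prm_integral_fin mf f0 foo; apply: filterS => w /fineK {2 3 4}<- _.
  by rewrite -!EFinM -!EFinD; congr EFin; ring.
have := prm_sqr_le mf f0 foo.
have E2 : \int[P]_w ((\int[M w]_x f x) * (\int[M w]_x f x)) + (m * m)%:E =
    \int[P]_w (((fine (\int[M w]_x f x) - m) ^+ 2)%R%:E) + (2 * m * m)%:E.
  have PT : P setT = 1 by exact: probability_setT.
  transitivity (\int[P]_w ((\int[M w]_x f x) * (\int[M w]_x f x) + (m * m)%:E)).
    rewrite ge0_integralD//.
    - by rewrite integral_cst// [X in _ = _ + _ * X]PT mule1.
    - by move=> w _; rewrite mule_ge0 ?integral_ge0.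
    - exact: emeasurable_funM.
    - by move=> w _; rewrite lee_fin mulr_ge0.
  rewrite -E ge0_integralD//.
  - rewrite ge0_integralZl//; last 2 first.
    + by move=> w _; exact: integral_ge0.
    + by rewrite lee_fin mulr_ge0.
    by rewrite campbell// -{1}(fineK f_fin) -EFinM.
  - by move=> w _; rewrite lee_fin sqr_ge0.
  - by move=> w _; rewrite mule_ge0 ?integral_ge0// lee_fin mulr_ge0.
  - exact: measurable_funeM.
move: E2; rewrite -(fineK f_fin) -/m.
have : 0 <= \int[mu]_x (f x * f x) by apply: integral_ge0 => x _; rewrite mule_ge0.
move: fin2; case: (\int[mu]_x (f x * f x)) => // v _ v0.
have : 0 <= \int[P]_w (((fine (\int[M w]_x f x) - m) ^+ 2)%R%:E).
  by apply: integral_ge0 => w _; rewrite lee_fin sqr_ge0.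
case: (\int[P]_w ((\int[M w]_x f x) * (\int[M w]_x f x))) => //=;
  case: (\int[P]_w _) => // a a0 b []; rewrite -?EFinM -?EFinD ?lee_fin.
lra.
Qed.

End prm.

(** * The Skorokhod space *)

Section step.
Variable R : realType.
Implicit Types (f g : skorokhod R) (m : nat).

Lemma skorokhod_dist_le f g (r : R) :
  (forall t : R, 0 <= t <= 1 -> `|f t - g t| <= r) -> skorokhod_dist f g <= r.
Proof.
move=> h; apply/ler_addgt0Pr => e e0; apply/ltW/skorokhod_dist_ltP.
have r0 : 0 <= r.
  by apply: le_trans (h 0 _); rewrite ?normr_ge0// lexx ler01.
exists id, id, r; split; [exact: homeo01_id|by rewrite ltrDl|].
by move=> t t01; split; [rewrite subrr normr0|exact: h].
Qed.

(** Constant on the cells of length [1/(m+1)]. At time 1 the index is [m+1], so [m+2] values of [y]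
    are visible. *)
Definition step_fun m (y : nat -> R) (t : R) : R :=
  if 0 <= t <= 1 then y (Num.truncn (m.+1%:R * t)) else 0.

Lemma step_cadlag m y : cadlag01 (step_fun m y).
Proof.
have m0 : 0 < m.+1%:R :> R by rewrite ltr0n.
split=> t /andP[t0 t1].
  set n := Num.truncn (m.+1%:R * t).
  have mt0 : 0 <= m.+1%:R * t by rewrite mulr_ge0// ltW.
  have /andP[n1 n2] := truncn_itv mt0.
  apply: cvg_near_cst; near=> s.
  have ts : t < s by near: s; exact: nbhs_right_gt.
  have s1 : s < 1 by near: s; exact: nbhs_right_lt.
  have sn : s < n.+1%:R / m.+1%:R.
    by near: s; apply: nbhs_right_lt; rewrite ltr_pdivlMr// mulrC.
  rewrite /step_fun t0 (ltW t1) (ltW s1) (le_trans t0 (ltW ts))/=; congr (y _).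
  apply: truncn_def; rewrite (le_trans n1) ?ler_pM2l ?(ltW ts)//=.
  by rewrite mulrC -ltr_pdivlMr.
have mt0 : 0 < m.+1%:R * t by rewrite mulr_gt0.
pose n := (Num.truncn (m.+1%:R * t)); have /andP[n1 n2] := truncn_itv (ltW mt0).
have [k /andP[k1 k2]] : exists k : nat, k%:R < m.+1%:R * t <= k.+1%:R.
  move: n1; rewrite -/n le_eqVlt => /predU1P[E|n1]; last first.
    by exists n; rewrite n1 ltW.
  have n0 : (0 < n)%N by move: mt0; rewrite -E ltr0n.
  by exists n.-1; rewrite prednK// -E lexx andbT ltr_nat prednK.
apply/cvg_ex; exists (y k); apply: cvg_near_cst; near=> s.
have ts : s < t by near: s; exact: nbhs_left_lt.
have s0 : 0 < s by near: s; exact: nbhs_left_gt.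
have sn : k%:R / m.+1%:R < s.
  by near: s; apply: nbhs_left_gt; rewrite ltr_pdivrMr// mulrC.
rewrite /step_fun (ltW s0) (ltW (lt_le_trans ts t1))/=; congr (y _).
apply: truncn_def; rewrite (lt_le_trans _ k2) ?ltr_pM2l// andbT.
by rewrite mulrC -ler_pdivrMr// ltW.
Unshelve. all: end_near. Qed.

Lemma step_out m y (t : R) : ~~ (0 <= t <= 1) -> step_fun m y t = 0.
Proof. by rewrite /step_fun => /negbTE ->. Qed.

Definition step m y : skorokhod R :=
  Skorokhod (@step_cadlag m y) (@step_out m y).

Definition sample m (f : R -> R) (k : nat) : R := f (k%:R / m.+1%:R).

Let grid m (x : R) : R := (Num.ceil (m.+1%:R * x))%:~R / m.+1%:R.

Let grid_ge m x : x <= grid m x.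
Proof. by rewrite /grid ler_pdivlMr ?ltr0n// mulrC ceil_ge. Qed.

Let grid_lt m x : grid m x < x + m.+1%:R^-1.
Proof.
have m0 : 0 < m.+1%:R :> R by rewrite ltr0n.
rewrite /grid ltr_pdivrMr// mulrDl mulVf ?gt_eqF// -ltrBlDr (mulrC x).
by have /andP[+ _] := ceil_itv (m.+1%:R * x); rewrite intrB.
Qed.

Let grid_nat m n : grid m n%:R = n%:R.
Proof.
have m0 : 0 < m.+1%:R :> R by rewrite ltr0n.
rewrite /grid -natrM -[(m.+1 * n)%:R]/(((m.+1 * n)%N%:Z)%:~R) intrKceil.
by rewrite -[_%:~R]/(m.+1 * n)%:R natrM mulrC mulKf// gt_eqF.
Qed.

Let grid_trunc_lt m x s : 0 <= s -> s < grid m x ->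
  (Num.truncn (m.+1%:R * s))%:R / m.+1%:R < x.
Proof.
have m0 : 0 < m.+1%:R :> R by rewrite ltr0n.
move=> s0; rewrite /grid ltr_pdivlMr// mulrC => sx.
rewrite ltr_pdivrMr// (mulrC x) -[X in X < _]/(((Num.truncn (m.+1%:R * s))%:Z)%:~R).
rewrite -ceil_gt_int -(ltr_int R); apply: le_lt_trans sx.
by rewrite -[X in X <= _]/((Num.truncn (m.+1%:R * s))%:R) truncn_le mulr_ge0// ltW.
Qed.

Let grid_trunc_ge m x s : 0 <= s -> grid m x <= s ->
  x <= (Num.truncn (m.+1%:R * s))%:R / m.+1%:R.
Proof.
have m0 : 0 < m.+1%:R :> R by rewrite ltr0n.
move=> s0; rewrite /grid ler_pdivrMr// (mulrC s) => sx.
rewrite leNgt; apply/negP; rewrite ltr_pdivrMr// (mulrC x).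
rewrite -[X in X < _]/(((Num.truncn (m.+1%:R * s))%:Z)%:~R) -ceil_gt_int => h.
have /andP[_ +] := truncn_itv (mulr_ge0 (ltW m0) s0).
rewrite ltNge => /negP; apply; apply: le_trans sx.
by rewrite -[X in X <= _]/(((Num.truncn (m.+1%:R * s)).+1%:Z)%:~R) ler_int intS addrC lezD1.
Qed.

(** A time change for the initial piece [[0, x]]: an increasing bijection onto [[0, grid m x]],
    within one mesh of the identity, along which [f] is [e]-close to its step sample. As [grid]
    rounds up, every sampling time below [grid m x] lies below [x], so the sample never looks past
    [x]. *)
Let homeo_upto (e : R) (f : R -> R) (x : R) := exists m0, forall m, (m0 <= m)%N ->
  exists lam mu : R -> R,
  [/\ forall t, 0 <= t <= x -> [/\ 0 <= lam t <= grid m x, mu (lam t) = t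
        & `|lam t - t| <= m.+1%:R^-1],
      forall s, 0 <= s <= grid m x -> 0 <= mu s <= x /\ lam (mu s) = s,
      (forall t t', 0 <= t -> t < t' -> t' <= x -> lam t < lam t'),
      lam x = grid m x &
      forall s, 0 <= s < grid m x ->
        `|f (mu s) - f ((Num.truncn (m.+1%:R * s))%:R / m.+1%:R)| <= e].

Let homeo_upto0 e f : homeo_upto e f 0.
Proof.
exists 0%N => m _; exists id, id.
have g0 : grid m 0 = 0 by exact: (grid_nat m 0).
rewrite g0; split => //.
- by move=> t t0; split => //; rewrite subrr normr0.
- by move=> s; case: ltgtP => //; case: ltgtP.
Qed.

(** The time change is prolonged by an affine piece; on it both compared values are values of [f] on
    [[x, x'[], where the oscillation is at most [e]. *)
Let homeo_upto_ext e f x x' : 0 <= x -> x < x' ->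
  (forall t t', x <= t < x' -> x <= t' < x' -> `|f t - f t'| <= e) ->
  homeo_upto e f x -> homeo_upto e f x'.
Proof.
move=> x0 xx' osc [m0 H].
(* A mesh finer than [x' - x] keeps the rounded endpoints distinct, so the affine slope is
   positive. *)
have [m1 Hm1] : exists m1, forall m, (m1 <= m)%N -> m.+1%:R^-1 < x' - x.
  exists (Num.truncn (x' - x)^-1) => m m1m.
  rewrite invf_plt ?posrE ?subr_gt0 ?ltr0n//.
  by rewrite (lt_le_trans (truncnS_gt _))// ler_nat.
exists (maxn m0 m1) => m; rewrite geq_max => /andP[/H[lam [mu [H1 H2 H3 H4 H5]]] /Hm1 m1m].
have mp : 0 < m.+1%:R^-1 :> R by rewrite invr_gt0 ltr0n.
set d := m.+1%:R^-1 in mp m1m H1 *.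
have a1 := grid_ge m x; have a2 := grid_lt m x.
have b1 := grid_ge m x'; have b2 := grid_lt m x'.
rewrite -/d in a2 b2.
set a := grid m x in a1 a2 H1 H2 H4 H5 *; set b := grid m x' in b1 b2 *.
have ab : a < b by lra.
pose k := (b - a) / (x' - x).
have k0 : 0 < k by rewrite divr_gt0// subr_gt0.
have kE : (x' - x) * k = b - a by rewrite /k mulrC divfK// subr_eq0 gt_eqF.
exists (fun t => if t <= x then lam t else a + (t - x) * k),
  (fun s => if s <= a then mu s else x + (s - a) / k); split.
- move=> t /andP[t0 tx']; case: ifPn => [tx|].
    have [|/andP[h1 h2] h3 h4] := H1 t; first by rewrite t0 tx.
    by rewrite h2 h3 h4; split => //; rewrite h1/= ltW// (le_lt_trans h2).
  rewrite -ltNge => xt.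
  have p0 : 0 < (t - x) * k by rewrite mulr_gt0// subr_gt0.
  have p1 : (t - x) * k <= b - a by rewrite -kE ler_wpM2r ?(ltW k0)// lerD2r.
  split.
  + by apply/andP; split; lra.
  + rewrite ifF; last by apply/negbTE; rewrite -ltNge; lra.
    by rewrite addrAC subrr add0r mulfK ?gt_eqF// addrC subrK.
  (* The displacement of the affine piece is a convex combination of the rounding errors at its two
     ends, both between 0 and [d]. *)
  + have E : (x' - x) * (a + (t - x) * k - t) =
      (x' - t) * (a - x) + (t - x) * (b - x').
      rewrite -[LHS]/((x' - x) * (a + (t - x) * k - t)).
      have -> : (x' - x) * (a + (t - x) * k - t) =
        (x' - x) * (a - t) + (t - x) * ((x' - x) * k) by ring.
      by rewrite kE; ring.
    have xx0 : 0 < x' - x by rewrite subr_gt0.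
    have l0 : 0 <= (x' - x) * (a + (t - x) * k - t).
      by rewrite E addr_ge0// mulr_ge0// subr_ge0// ltW.
    have l1 : (x' - x) * (a + (t - x) * k - t) <= (x' - x) * d.
      rewrite E (_ : (x' - x) * d = (x' - t) * d + (t - x) * d); last by ring.
      by apply: lerD; apply: ler_wpM2l; rewrite ?subr_ge0 ?(ltW xt)//; lra.
    rewrite ger0_norm; last by rewrite -(pmulr_rge0 _ xx0).
    by rewrite -(ler_pM2l xx0).
- move=> s /andP[s0 sb]; case: ifPn => [sa|].
    have [|/andP[h1 h2] h3] := H2 s; first by rewrite s0 sa.
    by rewrite h1 h2 h3/= (le_trans h2 (ltW xx')).
  rewrite -ltNge => as_.
  have p0 : 0 < (s - a) / k by rewrite divr_gt0// subr_gt0.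
  have p1 : (s - a) / k <= x' - x by rewrite ler_pdivrMr// kE lerD2r.
  split; first by apply/andP; split; lra.
  rewrite ifF; last by apply/negbTE; rewrite -ltNge; lra.
  by rewrite addrAC subrr add0r divfK ?gt_eqF// addrC subrK.
- move=> t t' t0 tt' t'x'; case: ifPn => [tx|]; case: ifPn => [t'x|].
  + exact: H3.
  + rewrite -ltNge => xt'.
    have [|/andP[_ h2] _ _] := H1 t; first by rewrite t0 tx.
    by apply: le_lt_trans h2 _; rewrite ltrDl mulr_gt0// subr_gt0.
  + by rewrite -ltNge => xt; exfalso; lra.
  + by move=> _ _; rewrite ltrD2l ltr_pM2r// ltrD2r.
- by rewrite ifF; [rewrite kE addrC subrK|apply/negbTE; rewrite -ltNge].
- move=> s /andP[s0 sb].
  have [sa|as_] := ltP s a.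
    by rewrite (ltW sa); apply: H5; rewrite s0.
  apply: osc; last first.
    by rewrite (grid_trunc_ge s0)//= (grid_trunc_lt s0).
  case: ifPn => [sa|].
    have -> : s = a by apply/eqP; rewrite eq_le sa.
    have [|_ h3 _] := H1 x; first by rewrite x0 lexx.
    by rewrite -H4 h3 lexx.
  rewrite -ltNge => as'.
  have p0 : 0 < (s - a) / k by rewrite divr_gt0// subr_gt0.
  have p1 : (s - a) / k < x' - x by rewrite ltr_pdivrMr// kE ltrD2r.
  by apply/andP; split; lra.
Qed.

(** Supremum argument: at the supremum [s] of the reachable times, the left limit gives small
    oscillation just before [s], so [s] is reached, and right continuity leads beyond [s] unless
    [s = 1]. *)
Let homeo_upto1 (e : R) f : 0 < e -> homeo_upto e f 1.
Proof.
move=> e0; pose S := [set x : R | 0 <= x <= 1 /\ homeo_upto e f x].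
have e2 : 0 < e / 2 by rewrite divr_gt0.
have hS : has_sup S.
  split; first by exists 0; split; [rewrite lexx ler01|exact: homeo_upto0].
  by exists 1 => x [/andP[]].
have S0 : S 0 by split; [rewrite lexx ler01|exact: homeo_upto0].
pose s := sup S.
have s0 : 0 <= s by apply: ub_le_sup => //; case: hS.
have s1 : s <= 1 by apply: ge_sup; [exists 0|move=> x [/andP[]]].
have Hs : homeo_upto e f s.
  have [s_0|sp] := leP s 0.
    have -> : s = 0 by apply/eqP; rewrite eq_le s0 s_0.
    exact: homeo_upto0.
  have /cvg_ex[/= l /cvgrPdist_le /(_ _ e2)] : cvg (f y @[y --> s^'-]).
    by apply: (sk_cadlag f).2; rewrite sp.
  rewrite /at_left near_withinE => /nbhs_ballP[r /= r0 B].
  have [x [/andP[x0 x1] Qx] sx] := sup_adherent r0 hS.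
  have xs : x <= s by apply: ub_le_sup; [case: hS|split => //; rewrite x0].
  move: xs; rewrite le_eqVlt => /predU1P[<-//|xs].
  apply: (homeo_upto_ext x0 xs _ Qx) => t t' /andP[t1 t2] /andP[t1' t2'].
  have Bt u : x <= u -> u < s -> `|l - f u| <= e / 2.
    move=> xu us; apply: B => //.
    by rewrite /ball/= ltr_norml -/s in sx *; apply/andP; split; lra.
  rewrite (le_trans (ler_distD l _ _))// [leRHS]splitr lerD ?Bt//.
  by rewrite distrC Bt.
move: (s1); rewrite le_eqVlt => /predU1P[<-//|s1'].
have /cvgrPdist_le /(_ _ e2) : f y @[y --> s^'+] --> f s.
  by apply: (sk_cadlag f).1; rewrite s0.
rewrite /at_right near_withinE => /nbhs_ballP[r /= r0 B].
pose x' := Num.min (s + r / 2) 1.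
have sx' : s < x' by rewrite lt_min s1' ltrDl divr_gt0.
have x'r : x' <= s + r / 2 by rewrite ge_min lexx.
have x'1 : x' <= 1 by rewrite ge_min lexx orbT.
have : S x'.
  split; first by rewrite x'1 (le_trans s0 (ltW sx')).
  apply: (homeo_upto_ext s0 sx' _ Hs) => t t' /andP[t1 t2] /andP[t1' t2'].
  have Bt u : s <= u -> u < x' -> `|f s - f u| <= e / 2.
    rewrite le_eqVlt => /predU1P[<- _|su ux']; first by rewrite subrr normr0 ltW.
    apply: B => //.
    by rewrite /ball/= ltr_norml; apply/andP; split; lra.
  rewrite (le_trans (ler_distD (f s) _ _))// [leRHS]splitr lerD ?Bt//.
  by rewrite distrC Bt.
move/(ub_le_sup hS.2); rewrite -/s => ?; exfalso; lra.
Qed.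

(** Uniform convergence fails at jumps between grid points; the time change moves each large jump to
    the next sampling time. Time 1 is fixed by the change, and is sampled exactly. *)
Lemma step_sample_cvg f (e : R) : 0 < e ->
  \forall m \near \oo, skorokhod_dist (step m (sample m f)) f <= e.
Proof.
move=> e0; have [m0 H] := homeo_upto1 f e0.
near=> m.
have m0m : (m0 <= m)%N by near: m; exists m0.
have me : m.+1%:R^-1 <= e.
  rewrite invf_ple ?posrE ?ltr0n//; apply: ltW.
  rewrite (lt_le_trans (truncnS_gt _))// ler_nat ltnS.
  by near: m; exists (Num.truncn e^-1).
have [lam [mu [H1 H2 H3 H4 H5]]] := H m m0m.
have g1 : grid m 1 = 1 by exact: (grid_nat m 1).
rewrite g1 in H1 H2 H4 H5.
have hm : homeo01 lam mu.
  have i01 t : 0 <= t <= 1 -> 0 <= lam t <= 1 by case/H1.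
  have m01 t : 0 <= t <= 1 -> 0 <= mu t <= 1 by case/H2.
  have z01 : 0 <= (0 : R) <= 1 by rewrite lexx ler01.
  have o01 : 0 <= (1 : R) <= 1 by rewrite lexx ler01.
  have l0 : lam 0 = 0.
    have [h1 h2] := H2 0 z01; have [/andP[h3 _] _ _] := H1 0 z01.
    apply/eqP; rewrite eq_le h3 andbT -{2}h2; case/andP: h1 => h1 h1'.
    have [->//|n0] := eqVneq (mu 0) 0.
    by apply/ltW/H3 => //; rewrite lt_neqAle eq_sym n0.
  have m1 : mu 1 = 1 by have [_ + _] := H1 1 o01; rewrite H4.
  have m0' : mu 0 = 0 by have [_ + _] := H1 0 z01; rewrite l0.
  have monol : {in `[0, 1] &, {mono lam : x y / x <= y}}.
    apply: le_mono_in => x y; rewrite !in_itv/= => /andP[x0 x1] /andP[y0 y1] xy.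
    exact: H3.
  have monom : {in `[0, 1] &, {mono mu : x y / x <= y}}.
    move=> x y; rewrite !in_itv/= => x01 y01.
    rewrite -[RHS]/(x <= y).
    have [mx lmx] := H2 x x01; have [my lmy] := H2 y y01.
    by rewrite -{2}lmx -{2}lmy monol// in_itv.
  split.
  - by split => t /=; rewrite !in_itv/=; [exact: i01|exact: m01].
  - split.
    + apply: segment_inc_surj_continuous => //.
      by rewrite l0 H4 => s /=; rewrite in_itv/= => s01; exists (mu s); rewrite ?in_itv/= ?m01//; case: (H2 s s01).
    + apply: segment_inc_surj_continuous => //.
      by rewrite m0' m1 => s /=; rewrite in_itv/= => s01; exists (lam s); rewrite ?in_itv/= ?i01//; case: (H1 s s01).
  - by move=> t; rewrite in_itv/= => /H1[].
  - by move=> t; rewrite in_itv/= => /H2[].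
rewrite skorokhod_dist_sym; apply/ler_addgt0Pr => r r0; apply/ltW/skorokhod_dist_ltP.
exists lam, mu, e; split => //; first by rewrite ltrDl.
move=> t t01; split; first by have [_ _ h] := H1 t t01; exact: le_trans me.
rewrite /= /step_fun t01 /sample.
case/andP: (t01) => t0; rewrite le_eqVlt => /predU1P[t1|t1]; last by apply: H5; rewrite t0.
have o01 : 0 <= (1 : R) <= 1 by rewrite lexx ler01.
have m1 : mu 1 = 1 by have [_ + _] := H1 1 o01; rewrite H4.
by rewrite t1 m1 mulr1 natrK divff ?pnatr_eq0// subrr normr0 ltW.
Unshelve. all: end_near. Qed.

End step.

(** * Expectations of bounded variables *)

Section expectations.
Context d (W : measurableType d) (R : realType) (P : probability W R).
Implicit Types X Y : W -> R.

Lemma bounded_integrable X (M : R) : measurable_fun setT X ->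
  (forall w, `|X w| <= M) -> P.-integrable setT (EFin \o X).
Proof.
move=> mX XM; apply: measurable_bounded_integrable => //.
  by apply: fin_num_fun_lty; exact: fin_num_measure.
by exists M; split; [exact: num_real|move=> x Mx w _; exact: le_trans (XM w) (ltW Mx)].
Qed.

Definition mean X : R := Rintegral P setT X.

Lemma expectation_mean X (M : R) : measurable_fun setT X ->
  (forall w, `|X w| <= M) -> ('E_P[X] = (mean X)%:E)%E.
Proof.
move=> mX XM; rewrite unlock /mean /Rintegral fineK//.
exact: (integrable_fin_num _ (bounded_integrable mX XM)).
Qed.

Lemma mean_le X Y (M N : R) : measurable_fun setT X -> measurable_fun setT Y ->
  (forall w, `|X w| <= M) -> (forall w, `|Y w| <= N) ->
  (forall w, X w <= Y w) -> mean X <= mean Y.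
Proof.
move=> mX mY XM YN XY; apply: le_Rintegral => //.
- exact: bounded_integrable XM.
- exact: bounded_integrable YN.
Qed.

Lemma mean_cvg (X_ : nat -> W -> R) X (M : R) :
  (forall n, measurable_fun setT (X_ n)) -> measurable_fun setT X ->
  (forall n w, `|X_ n w| <= M) ->
  {ae P, forall w, X_ n w @[n --> \oo] --> X w} ->
  mean (X_ n) @[n --> \oo] --> mean X.
Proof.
move=> mX_ mX XM cX.
have H : P.-integrable setT (cst M%:E : W -> \bar R).
  apply/integrableP; split => //; rewrite integral_cst//= ltey_eq fin_numM//.
  exact: fin_num_measure.
have [h1 _ h] := @dominated_convergence _ _ _ P setT measurableT
  (fun n w => (X_ n w)%:E) (fun w => (X w)%:E) (cst M%:E)
  ltac:(move=> n; exact/measurable_EFinP) ltac:(exact/measurable_EFinP)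
  ltac:(apply: filterS cX => w cw _; apply/fine_cvgP; split; [exact: nearW|exact: cw])
  H ltac:(apply: aeW => w n _ /=; rewrite lee_fin; exact: XM).
rewrite /mean /Rintegral; apply: fine_cvg.
by rewrite fineK; [exact: h|exact: integrable_fin_num h1].
Qed.

Lemma meanN X (M : R) : measurable_fun setT X -> (forall w, `|X w| <= M) ->
  mean (fun w => - X w) = - mean X.
Proof.
move=> mX XM.
have E : (fun w => - X w) = (fun w => (-1) * X w) by apply/funext => w; rewrite mulN1r.
by rewrite E /mean RintegralZl ?mulN1r//; exact: bounded_integrable XM.
Qed.

Lemma mean_ae X Y : measurable_fun setT X -> measurable_fun setT Y ->
  {ae P, forall w, X w = Y w} -> mean X = mean Y.
Proof.
move=> mX mY XY; rewrite /mean /Rintegral; congr fine.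
apply: ae_eq_integral => //; try exact/measurable_EFinP.
by apply: filterS XY => w /= -> _.
Qed.

End expectations.

(** * Borel measurability from measurable coordinates *)

Section skorokhod_measurability.
Variable R : realType.
Implicit Types (f g : skorokhod R) (m : nat).

Lemma skorokhod_open_ball (U : set (skorokhod R)) f : open U -> U f ->
  exists2 r : R, 0 < r & forall g, skorokhod_dist f g < r -> U g.
Proof.
move=> oU Uf; have : nbhs f U by exact: open_nbhs_nbhs.
by move=> /(@metricType_numDomainType.nbhs_mdistP R (skorokhod R) f U)[r /= r0 h]; exists r.
Qed.

Context d (W : measurableType d).

(** [Y] is the pointwise limit of its step samples with values rounded to multiples of the mesh. A
    rounded sample takes countably many values, so every event about it, open or not, is a countable
    union of coordinate events. *)
Lemma skorokhod_measurable (Y : W -> skorokhod R) :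
  (forall t : R, 0 <= t <= 1 -> measurable_fun setT (fun w => Y w t)) ->
  borel_measurable Y.
Proof.
move=> mY.
pose rnd m w (k : nat) : R := (Num.floor (m.+1%:R * sample m (Y w) k))%:~R / m.+1%:R.
pose Z m w := step m (rnd m w).
have mZ m (U : set (skorokhod R)) : measurable [set w | U (Z m w)].
  (* [z] lists the rounded values at the [m+2] times from 0 to 1. *)
  pose S (z : m.+2.-tuple int) k : R := (nth 0 z k)%:~R / m.+1%:R.
  pose A (z : m.+2.-tuple int) : set W :=
    if `[< U (step m (S z)) >] then
      \bigcap_(k in [set: 'I_m.+2]) [set w | (nth 0 z k)%:~R <= m.+1%:R * sample m (Y w) k < (nth 0 z k + 1)%:~R]
    else set0.
  have -> : [set w | U (Z m w)] = \bigcup_z A z.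
    apply/seteqP; split => w /=.
      move=> Uw; pose z := [tuple Num.floor (m.+1%:R * sample m (Y w) k) | k < m.+2].
      have zE k : (k < m.+2)%N -> nth 0 z k = Num.floor (m.+1%:R * sample m (Y w) k).
        move=> km; have := tnth_mktuple (fun k : 'I_m.+2 => Num.floor (m.+1%:R * sample m (Y w) k)) (Ordinal km).
        by rewrite (tnth_nth 0).
      have E : step m (S z) = Z m w.
        apply: sk_eq => t t01; rewrite /= /step_fun t01 /S /rnd zE//.
        rewrite ltnS truncn_le_nat; case/andP: t01 => t0 t1.
        by rewrite (le_lt_trans (ler_piMr _ t1))// ltr_nat.
      exists z => //; rewrite /A asboolT ?E// => k _ /=; rewrite zE//.
      exact: floor_itv.
    move=> [z _]; rewrite /A; case: asboolP => // Uz h.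
    suff -> : Z m w = step m (S z) by [].
    apply: sk_eq => t t01; rewrite /= /step_fun t01 /S /rnd.
    have km : (Num.truncn (m.+1%:R * t) < m.+2)%N.
      rewrite ltnS truncn_le_nat; case/andP: t01 => t0 t1.
      by rewrite (le_lt_trans (ler_piMr _ t1))// ltr_nat.
    by congr (_%:~R / _); apply: floor_def; exact: (h (Ordinal km) I).
  apply: countable_bigcupT_measurable => // z; rewrite /A.
  case: asboolP => // _; apply: fin_bigcap_measurable => // k _.
  have k01 : 0 <= (k%:R / m.+1%:R : R) <= 1.
    by rewrite divr_ge0//= ler_pdivrMr ?ltr0n// mul1r ler_nat -ltnS.
  have mg : measurable_fun setT (fun w => m.+1%:R * sample m (Y w) k).
    by apply: measurable_funM => //; exact: mY.
  have := mg measurableT `[(nth 0 z k)%:~R, (nth 0 z k + 1)%:~R[%classic (measurable_itv _).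
  rewrite setTI; congr measurable; apply/seteqP; split => w /=; by rewrite in_itv.
have ZY w : forall e : R, 0 < e -> \forall m \near \oo, skorokhod_dist (Z m w) (Y w) < e.
  move=> e e0; have e2 : 0 < e / 2 / 2 by rewrite !divr_gt0.
  have := step_sample_cvg (Y w) e2; apply: filterS2 (near_infty_natSinv_lt (PosNum e2)) => m me h.
  apply: le_lt_trans (skorokhod_dist_triangle (step m (sample m (Y w))) (Z m w) (Y w)) _.
  suff : skorokhod_dist (Z m w) (step m (sample m (Y w))) <= e / 2 / 2 by move: h; lra.
  apply: le_trans (ltW me); apply: skorokhod_dist_le => t t01.
  rewrite /= /step_fun t01 /rnd; set y := sample _ _ _.
  have m0 : 0 < m.+1%:R :> R by rewrite ltr0n.
  have -> : (Num.floor (m.+1%:R * y))%:~R / m.+1%:R - y =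
     ((Num.floor (m.+1%:R * y))%:~R - m.+1%:R * y) / m.+1%:R.
    by rewrite mulrBl [m.+1%:R * y]mulrC mulfK ?gt_eqF.
  rewrite normrM [X in _ * X]ger0_norm ?invr_ge0 ?(ltW m0)// ler_piMl ?invr_ge0 ?(ltW m0)//.
  have /andP[] := floor_itv (m.+1%:R * y); rewrite intrD ler_norml => ? ?.
  by apply/andP; split; lra.
apply: (@measurability d _ W (g_sigma_algebraType (@open (skorokhod R))) setT Y (@open _)) => //.
move=> _ [U oU <-]; rewrite setTI.
(* The points whose ball of radius [1/(j+1)] stays in [U]. Membership of [Y] in [U] then means that,
   for some [j], eventually all samples lie in [V j]; the events about samples are measurable for
   any [V j]. *)
pose V (j : nat) : set (skorokhod R) :=
  [set f | forall g, skorokhod_dist f g < j.+1%:R^-1 -> U g].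
have -> : Y @^-1` U =
    \bigcup_j \bigcup_N \bigcap_(m in [set m | (N <= m)%N]) [set w | V j (Z m w)].
  apply/seteqP; split => w /=.
    move=> UY; have [r r0 Br] := skorokhod_open_ball oU UY.
    have r2 : 0 < r / 2 by rewrite divr_gt0.
    have [j _ Hj] := near_infty_natSinv_lt (PosNum r2).
    have [N _ HN] := ZY w _ r2.
    exists j => //; exists N => // m /= Nm g gj; apply: Br.
    apply: le_lt_trans (skorokhod_dist_triangle (Z m w) (Y w) g) _.
    rewrite [ltRHS]splitr ltrD//.
      by rewrite skorokhod_dist_sym; exact: HN.
    by apply: lt_trans gj _; exact: (Hj j (leqnn j)).
  move=> [j _ [N _ h]].
  have j0 : 0 < j.+1%:R^-1 :> R by rewrite invr_gt0.
  have [m [Nm mj]] : exists m, (N <= m)%N /\ skorokhod_dist (Z m w) (Y w) < j.+1%:R^-1.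
    near \oo => m; exists m; split; first by near: m; exact: nbhs_infty_ge.
    by near: m; exact: ZY.
  exact: (h m Nm).
apply: bigcupT_measurable => j; apply: bigcupT_measurable => N.
by apply: bigcap_measurableType => m _; exact: mZ.
Unshelve. all: end_near. Qed.

Lemma measurable_comp_continuous (Y : W -> skorokhod R) (h : skorokhod R -> R) :
  borel_measurable Y -> continuous h -> measurable_fun setT (h \o Y).
Proof.
move=> mY ch; apply: (measurability (@RGenOInfty.G R)).
  exact: RGenOInfty.measurableE.
move=> _ [_ [x ->] <-]; rewrite setTI comp_preimage -[X in measurable X]setTI.
apply: mY => //; apply: sub_sigma_algebra.
by move/continuousP : ch; apply; exact: interval_open.
Qed.

End skorokhod_measurability.

Section uniform_limit.
Variable R : realType.

Lemma uniform_limit_cadlag (W : nat -> skorokhod R) (g : R -> R) :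
  (forall e : R, 0 < e -> exists n, forall t : R, 0 <= t <= 1 -> `|W n t - g t| <= e) ->
  cadlag01 g.
Proof.
move=> H; split => t t01.
  apply/cvgrPdist_le => e e0; have e3 : 0 < e / 3 by rewrite divr_gt0.
  have [n Hn] := H _ e3.
  have /cvgrPdist_le/(_ _ e3) := (sk_cadlag (W n)).1 t t01.
  case/andP: t01 => t0 t1.
  move=> h; near=> s.
  have ts : t < s by near: s; exact: nbhs_right_gt.
  have s1 : s < 1 by near: s; exact: nbhs_right_lt.
  have h1 : `|W n t - W n s| <= e / 3 by near: s.
  have h2 : `|W n t - g t| <= e / 3 by apply: Hn; rewrite t0 ltW.
  have h3 : `|W n s - g s| <= e / 3 by apply: Hn; rewrite (le_trans t0) ?ltW.
  by move: h1 h2 h3; rewrite !ler_norml => /andP[? ?] /andP[? ?] /andP[? ?]; apply/andP; split; lra.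
apply: cauchy_cvg; apply: (@cauchy_exP R R).
move=> e e0; have e3 : 0 < e / 3 by rewrite divr_gt0.
have [n Hn] := H _ e3.
have /cvg_ex[/= l /cvgrPdist_lt/(_ _ e3) h] := (sk_cadlag (W n)).2 t t01.
case/andP: t01 => t0 t1.
exists l; near=> s.
have ts : s < t by near: s; exact: nbhs_left_lt.
have s0 : 0 < s by near: s; exact: nbhs_left_gt.
have h1 : `|l - W n s| < e / 3 by near: s.
have h3 : `|W n s - g s| <= e / 3 by apply: Hn; rewrite (ltW s0)/= ltW// (lt_le_trans ts).
by move: h1 h3; rewrite /ball/= ltr_norml ler_norml ltr_norml => /andP[? ?] /andP[? ?]; apply/andP; split; lra.
Unshelve. all: end_near. Qed.

End uniform_limit.

(** * Weak convergence tested on bounded Lipschitz functions *)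

Section weak_convergence.
Variable R : realType.
Implicit Types (f g : skorokhod R) (h : skorokhod R -> R).

Lemma lipschitz_continuous h (K : R) :
  (forall f g, `|h f - h g| <= K * skorokhod_dist f g) -> continuous h.
Proof.
move=> hK f; apply/(@cvgrPdist_le _ _ _ (nbhs f) _ h (h f)) => e e0.
have K0 : 0 < `|K| + 1 by rewrite ltr_pwDr.
apply/(@metricType_numDomainType.nbhs_mdistP R (skorokhod R)).
exists (e / (`|K| + 1)); first by rewrite /= divr_gt0.
move=> g /= fg; have fg' : skorokhod_dist f g < e / (`|K| + 1) by [].
have d0 : 0 <= skorokhod_dist f g by exact: (@mdist_ge0 R (skorokhod R)).
apply: (le_trans (hK f g)).
rewrite ltr_pdivlMr// in fg'.
apply: le_trans (ltW fg'); rewrite mulrC ler_wpM2l//.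
by rewrite (le_trans (ler_norm K))// lerDl.
Qed.

Section inf_convolution.
Variables (h : skorokhod R -> R) (M : R).
Hypothesis hM : forall f, `|h f| <= M.

(** The largest [k]-Lipschitz minorant of [h]. *)
Definition inf_conv (k : nat) f : R :=
  inf [set h g + k%:R * skorokhod_dist f g | g in setT].

Let dist_ge0 f g : 0 <= skorokhod_dist f g.
Proof. exact: (@mdist_ge0 R (skorokhod R)). Qed.

Let lower k f g : - M <= h g + k%:R * skorokhod_dist f g.
Proof.
have := hM g; rewrite ler_norml => /andP[h1 _].
by rewrite (le_trans h1)// lerDl mulr_ge0.
Qed.

Let inf_conv_le k f g : inf_conv k f <= h g + k%:R * skorokhod_dist f g.
Proof. by apply: ge_inf; [exists (- M) => _ [g' _ <-]|exists g]. Qed.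

Let inf_conv_ge k f (x : R) :
  (forall g, x <= h g + k%:R * skorokhod_dist f g) -> x <= inf_conv k f.
Proof. by move=> hx; apply: lb_le_inf; [exists (h f + k%:R * skorokhod_dist f f), f|move=> _ [g _ <-]]. Qed.

Lemma inf_conv_le_self k f : inf_conv k f <= h f.
Proof. by have := inf_conv_le k f f; rewrite skorokhod_distxx mulr0 addr0. Qed.

Lemma inf_conv_bounded k f : `|inf_conv k f| <= M.
Proof.
rewrite ler_norml inf_conv_ge//=; apply: le_trans (inf_conv_le_self k f) _.
by have := hM f; rewrite ler_norml => /andP[].
Qed.

Lemma inf_conv_lipschitz k f g :
  `|inf_conv k f - inf_conv k g| <= k%:R * skorokhod_dist f g.
Proof.
have H (a b : skorokhod R) : inf_conv k a - k%:R * skorokhod_dist a b <= inf_conv k b.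
  apply: inf_conv_ge => c; rewrite lerBlDr.
  apply: le_trans (inf_conv_le k a c) _.
  rewrite -addrA lerD2l -mulrDr ler_wpM2l// addrC.
  exact: skorokhod_dist_triangle.
have h1 := H f g; have h2 := H g f; rewrite skorokhod_dist_sym in h2.
move: (_ * _) h1 h2 => c; move: (inf_conv k f) (inf_conv k g) => x y h1 h2.
by rewrite ler_norml; apply/andP; split; lra.
Qed.

Lemma inf_conv_cvg f : continuous h -> inf_conv k f @[k --> \oo] --> h f.
Proof.
move=> /(_ f)/cvgrPdist_lt ch; apply/cvgrPdist_le => e e0.
have /(@metricType_numDomainType.nbhs_mdistP R (skorokhod R))[r /= r0 hr] := ch _ e0.
near=> k; rewrite ger0_norm ?subr_ge0 ?inf_conv_le_self// lerBlDr -lerBlDl.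
apply: inf_conv_ge => g.
have [fr|fr] := ltP (skorokhod_dist f g) r.
  have := hr g fr; rewrite ltr_norml => /andP[_ ?].
  have : 0 <= k%:R * skorokhod_dist f g by rewrite mulr_ge0.
  by lra.
have kr : 2 * M <= k%:R * r.
  rewrite -ler_pdivrMr//; apply: ltW; near: k; exact: nbhs_infty_gtr.
have : k%:R * r <= k%:R * skorokhod_dist f g by rewrite ler_wpM2l.
have := hM g; have := hM f; rewrite !ler_norml => /andP[? ?] /andP[? ?] ?; lra.
Unshelve. all: end_near. Qed.

End inf_convolution.

(* The inf-convolutions of h are Lipschitz and increase to h, which yields the
   lower half of the convergence; the upper half is the lower half for -h. *)
Lemma weak_cvg_lipschitz d (W : measurableType d) (P : probability W R)
    (Y : nat -> W -> skorokhod R) d' (W' : measurableType d')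
    (P' : probability W' R) (Z : W' -> skorokhod R) :
  (forall n, borel_measurable (Y n)) -> borel_measurable Z ->
  (forall h (M K : R), (forall f, `|h f| <= M) ->
    (forall f g, `|h f - h g| <= K * skorokhod_dist f g) ->
    mean P (h \o Y n) @[n --> \oo] --> mean P' (h \o Z)) ->
  weak_cvg P Y P' Z.
Proof.
move=> mY mZ H h ch [M hM].
have lower k (kc : continuous k) (kM : forall f, `|k f| <= M) (e : R) : 0 < e ->
    \forall n \near \oo, mean P' (k \o Z) - e <= mean P (k \o Y n).
  move=> e0; have e2 : 0 < e / 2 by rewrite divr_gt0.
  pose kj := inf_conv k.
  have kjc j : continuous (kj j) by apply: lipschitz_continuous; exact: inf_conv_lipschitz kM j.
  have kjM := inf_conv_bounded kM.
  have mk := measurable_comp_continuous mZ kc.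
  have mkj j := measurable_comp_continuous mZ (kjc j).
  have : mean P' (kj j \o Z) @[j --> \oo] --> mean P' (k \o Z).
    apply: (@mean_cvg _ _ _ _ _ _ M) => //; first by move=> n w; exact: kjM.
    by apply: aeW => w; exact: inf_conv_cvg.
  move=> /cvgrPdist_le /(_ _ e2)[j _ /(_ j (leqnn j))] /= hj.
  have /cvgrPdist_le/(_ _ e2) := H (kj j) M j%:R (kjM j) (inf_conv_lipschitz kM j).
  apply: filterS => n hn.
  have : mean P (kj j \o Y n) <= mean P (k \o Y n).
    apply: (@mean_le _ _ _ _ _ _ M M).
    - exact: measurable_comp_continuous (mY n) (kjc j).
    - exact: measurable_comp_continuous (mY n) kc.
    - by move=> w; exact: kjM.
    - by move=> w; exact: kM.
    - by move=> w; exact: inf_conv_le_self kM _ _.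
  by move: hj hn; rewrite !ler_norml => /andP[? ?] /andP[? ?] ?; lra.
have mh n := measurable_comp_continuous (mY n) ch.
have mhZ := measurable_comp_continuous mZ ch.
rewrite (expectation_mean (M := M) _ mhZ)//; last by move=> w; exact: hM.
have -> : (fun n => 'E_P[fun w => h (Y n w)]%E) = (fun n => (mean P (h \o Y n))%:E).
  apply/funext => n; apply: (@expectation_mean _ _ _ P (h \o Y n) M) => [|w]; first exact: mh.
  exact: hM.
apply/fine_cvgP; split; first exact: nearW.
apply/cvgrPdist_le => e e0.
have cN : continuous (fun f => - h f) by move=> f; apply: (@continuous_comp _ _ _ h (fun x : R => - x)); [exact: ch|exact: opp_continuous].
have hN f : `|- h f| <= M by rewrite normrN.
apply: filterS2 (lower h ch hM e e0) (lower _ cN hN e e0) => n /= l1 l2.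
have E1 : mean P' ((fun f => - h f) \o Z) = - mean P' (h \o Z).
  by apply: (@meanN _ _ _ _ _ M) => // w; exact: hM.
have E2 : mean P ((fun f => - h f) \o Y n) = - mean P (h \o Y n).
  by apply: (@meanN _ _ _ P (h \o Y n) M) => [|w]; [exact: mh|exact: hM].
by move: l2; rewrite E1 E2 ler_norml => l2; apply/andP; split; lra.
Qed.

End weak_convergence.

(** * Laws of Poisson integrals *)

Section independence.
Local Open Scope ereal_scope.
Context d (W : measurableType d) d' (X : measurableType d') (R : realType).
Variables (P : probability W R).
Variable M : W -> {measure set X -> \bar R}.

Definition independent_rm := forall (m : nat) (A : 'I_m -> set X),
  (forall i, measurable (A i)) -> trivIset setT A ->
  forall B : 'I_m -> set (\bar R), (forall i, measurable (B i)) ->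
  P (\bigcap_(i in setT) ((fun w => M w (A i)) @^-1` B i)) =
  \prod_(i < m) P ((fun w => M w (A i)) @^-1` B i).

Variable mu : {measure set X -> \bar R}.
Hypotheses (HM : poisson_rm P mu M) (HI : independent_rm).

(** Numbers the vectors of [N] counts by naturals. A natural that codes nothing is sent to the zero
    vector, and the test [pickle (code n) == n] discards the repetitions. *)
Let code N (n : nat) : {ffun 'I_N -> nat} := odflt [ffun=> 0%N] (unpickle n).

(** The right side depends on the random measure only through the rates [r]; this is the source of
    every equality of laws. *)
Lemma integral_counts N (A : 'I_N -> set X) (r : 'I_N -> R)
    (G : ('I_N -> \bar R) -> R) :
  (forall i, measurable (A i)) -> trivIset setT A ->
  (forall i, mu (A i) = (r i)%:E) -> (forall v, 0 <= G v)%R ->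
  measurable_fun setT (fun w => G (fun i => M w (A i))) ->
  \int[P]_w (G (fun i => M w (A i)))%:E =
  \sum_(n <oo) (if pickle (@code N n) == n then
     (G (fun i => ((code N n i)%:R)%:E) * \prod_(i < N) pois (r i) (code N n i))%:E
     else 0).
Proof.
move=> mA tA muA G0 mG.
have r0 i : (0 <= r i)%R by rewrite -lee_fin -muA.
have mMA i : measurable_fun setT (fun w => M w (A i)) := prm_measurable HM (mA i).
pose F n := if pickle (code N n) == n then
   \bigcap_(i in [set: 'I_N]) ((fun w => M w (A i)) @^-1` [set ((code N n i)%:R : R)%:E]) else set0.
have mF n : measurable (F n).
  rewrite /F; case: ifPn => // _; apply: fin_bigcap_measurable => // i _.
  by rewrite -[X in measurable X]setTI; apply: mMA => //; exact: emeasurable_set1.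
have PF n : P (F n) = (if pickle (code N n) == n then
     (\prod_(i < N) pois (r i) (code N n i))%:E else 0).
  rewrite /F; case: ifPn => // _; rewrite HI//.
  under eq_bigr do rewrite [P _](prm_law HM (mA _) (muA _)).
  by rewrite prodEFin.
have tF : trivIset setT F.
  apply/trivIsetP => i j _ _ ij; rewrite -subset0 => w; rewrite /F.
  case: ifPn => [/eqP ci|_ []//]; case: ifPn => [/eqP cj|_ []//] [hi hj].
  move/eqP : ij; apply; rewrite -ci -cj; congr pickle; apply/ffunP => k.
  have := hi k I; rewrite /= (hj k I) => -[/eqP].
  by rewrite eqr_nat => /eqP.
have mU : measurable (\bigcup_n F n) by exact: bigcup_measurable.
have aeU : {ae P, forall w, (\bigcup_n F n) w}.
  have : {ae P, forall w, forall i : 'I_N, exists k : nat, M w (A i) = (k%:R : R)%:E}.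
    apply: filter_forall => i.
    have := prm_law HM (mA i) (muA i) => pY.
    pose H (k : nat) := (fun w => M w (A i)) @^-1` [set (k%:R : R)%:E].
    have mH k : measurable (H k).
      by rewrite -[H k]setTI; apply: mMA => //; exact: emeasurable_set1.
    have tH : trivIset setT H.
      apply/trivIsetP => i' j' _ _ ij; rewrite -subset0 => w; rewrite /H/= => -[/= -> [/eqP]].
      by rewrite eqr_nat (negbTE ij).
    have PH : P (\bigcup_k H k) = 1.
      rewrite measure_bigcup//= -(pois_series (r0 i)).
      by under eq_eseriesl do rewrite in_setT; apply: eq_eseriesr => k _; exact: pY.
    have mUH : measurable (\bigcup_k H k) by exact: bigcup_measurable.
    exists (~` (\bigcup_k H k)); split; first exact: measurableC.
      by rewrite [LHS]probability_setC// PH subee.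
    by apply: subsetC => w [k _ Hk]; exists k.
  apply: filterS => w /choice[k kE].
  exists (pickle [ffun i => k i]) => //; rewrite /F /code pickleK/= eqxx => i _ /=.
  by rewrite ffunE.
transitivity (\int[P]_(w in \bigcup_n F n) (G (fun i => M w (A i)))%:E).
  have PU0 : P (~` (\bigcup_n F n)) = 0.
    by apply/negligibleP; [exact: measurableC|exact: aeU].
  rewrite (@ge0_negligible_integral _ _ _ _ _ (~` (\bigcup_n F n)))//.
  - by rewrite setTD setCK.
  - exact: measurableC.
  - exact/measurable_EFinP.
  - by move=> w _; rewrite lee_fin.
rewrite ge0_integral_bigcup//; last first.
  - by move=> w _; rewrite lee_fin.
  - by apply: measurable_funTS; exact/measurable_EFinP.
apply: eq_eseriesr => n _; have := PF n; rewrite {1}/F.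
case: ifPn => cn; last by move=> _; rewrite /F (negbTE cn) integral_set0.
rewrite EFinM => <-; rewrite /F cn.
transitivity (\int[P]_(w in F n) (cst (G (fun i => ((code N n i)%:R)%:E))%:E w)).
  rewrite {1}/F cn; apply: eq_integral => w; rewrite inE => h; congr (G _)%:E.
  by apply/funext => i; exact: h.
by rewrite integral_cst// /F cn.
Qed.

End independence.

Section step_extra.
Variable R : realType.

Lemma eq_step m (y y' : nat -> R) : (forall k, (k <= m.+1)%N -> y k = y' k) ->
  step m y = step m y'.
Proof.
move=> yy'; apply: sk_eq => t t01; rewrite /= /step_fun t01 yy'//.
rewrite truncn_le_nat; case/andP: t01 => t0 t1.
by rewrite (le_lt_trans (ler_piMr _ t1))// ltr_nat.
Qed.

Lemma step_dist_le m (y y' : nat -> R) e :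
  (forall k, (k <= m.+1)%N -> `|y k - y' k| <= e) ->
  skorokhod_dist (step m y) (step m y') <= e.
Proof.
move=> yy'; apply: skorokhod_dist_le => t t01; rewrite /= /step_fun t01 yy'//.
rewrite truncn_le_nat; case/andP: t01 => t0 t1.
by rewrite (le_lt_trans (ler_piMr _ t1))// ltr_nat.
Qed.

Lemma step_dist_cvg m (u : nat -> nat -> R) (y : nat -> R) :
  (forall k, (k <= m.+1)%N -> u r k @[r --> \oo] --> y k) ->
  forall e : R, 0 < e -> \forall r \near \oo, skorokhod_dist (step m (u r)) (step m y) <= e.
Proof.
move=> H e e0.
have : \forall r \near \oo, forall k : 'I_m.+2, `|u r k - y k| <= e.
  apply: filter_forall => k; have /cvgrPdist_le/(_ _ e0) := H k (leq_ord k).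
  by apply: filterS => r; rewrite distrC.
apply: filterS => r h; apply: step_dist_le => k km.
exact: (h (Ordinal (km : (k < m.+2)%N))).
Qed.

Lemma measurable_step d (W : measurableType d) m (u : W -> nat -> R) :
  (forall k, measurable_fun setT (u ^~ k)) -> borel_measurable (fun w => step m (u w)).
Proof.
move=> mu; apply: skorokhod_measurable => t t01; rewrite /= /step_fun t01.
exact: mu.
Qed.

End step_extra.

Section rounding.
Variable R : realType.

(** Rounding down to a multiple of [1/r], capped at [r]: finitely many values, never above [y], and
    convergent to [y]. *)
Definition level (r : nat) (y : R) : nat := minn (Num.truncn (r%:R * y)) (r * r).

Lemma level_le r y : 0 <= y -> (level r y)%:R / r%:R <= y.
Proof.
move=> y0; case: r => [|r]; first by rewrite invr0 mulr0.
rewrite ler_pdivrMr ?ltr0n// mulrC (@le_trans _ _ (Num.truncn (r.+1%:R * y))%:R)//.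
  by rewrite ler_nat geq_minl.
by rewrite truncn_le mulr_ge0.
Qed.

Lemma level_cvg (y : R) : 0 <= y -> (level r y)%:R / r%:R @[r --> \oo] --> y.
Proof.
move=> y0; apply/cvgrPdist_le => e e0; near=> r.
have r0 : 0 < r%:R :> R by rewrite ltr0n; near: r; exact: nbhs_infty_gt.
have yr : y < r%:R by near: r; exact: nbhs_infty_gtr.
have er : e^-1 <= r%:R by apply: ltW; near: r; exact: nbhs_infty_gtr.
have ry : 0 <= r%:R * y by rewrite mulr_ge0.
have -> : level r y = Num.truncn (r%:R * y).
  apply/minn_idPl; rewrite -(ler_nat R) natrM (le_trans (_ : _ <= r%:R * y))//.
    by rewrite truncn_le.
  by rewrite ler_wpM2l// ltW.
have /andP[h1 h2] := truncn_itv ry.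
rewrite ger0_norm; last by rewrite subr_ge0 ler_pdivrMr// (mulrC y).
rewrite lerBlDr -(ler_pM2r r0) mulrDl divfK ?gt_eqF// (mulrC y) ltW// (lt_le_trans h2)//.
rewrite -natr1 addrC lerD2r.
by rewrite -(ler_pM2l e0) mulfV ?gt_eqF// in er.
Unshelve. all: end_near. Qed.

Lemma measurable_level r : measurable_fun setT (fun y : R => (level r y)%:R : R).
Proof.
apply: nondecreasing_measurable => // x y xy; rewrite ler_nat /level.
by rewrite leq_min geq_minr andbT (leq_trans (geq_minl _ _))// le_truncn// ler_wpM2l.
Qed.

End rounding.

Section law.
Local Open Scope ereal_scope.
Context d (W : measurableType d) d1 (W1 : measurableType d1)
  d' (X : measurableType d') (R : realType).
Variables (P : probability W R) (P1 : probability W1 R).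
Variables (M : W -> {measure set X -> \bar R}) (M1 : W1 -> {measure set X -> \bar R}).
Variables (mu mu1 : {measure set X -> \bar R}).
Hypothesis mu1E : forall A, measurable A -> mu1 A = mu A.
Hypotheses (HM : poisson_rm P mu M) (HI : independent_rm P M).
Hypotheses (HM1 : poisson_rm P1 mu1 M1) (HI1 : independent_rm P1 M1).

Lemma mean_counts N (A : 'I_N -> set X) (G : ('I_N -> \bar R) -> R) (K : R) :
  (forall i, measurable (A i)) -> trivIset setT A ->
  (forall i, mu (A i) < +oo) -> (forall v, `|G v| <= K)%R ->
  measurable_fun setT (fun w => G (fun i => M w (A i))) ->
  measurable_fun setT (fun w => G (fun i => M1 w (A i))) ->
  mean P (fun w => G (fun i => M w (A i))) = mean P1 (fun w => G (fun i => M1 w (A i))).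
Proof.
move=> mA tA Afin GK mG mG1.
(* The series formula wants a nonnegative function; the bound [K] is added and removed at the
   end. *)
pose H v := (G v + K)%R.
have H0 v : (0 <= H v)%R.
  by have := GK v; rewrite /H ler_norml => /andP[+ _]; rewrite -subr_ge0 opprK.
have HK v : (`|H v| <= K + K)%R by rewrite (le_trans (ler_normD _ _))// lerD// ger0_norm// (le_trans _ (GK v)).
pose r i := fine (mu (A i)).
have muA i : mu (A i) = (r i)%:E by rewrite fineK// ge0_fin_numE.
have mH : measurable_fun setT (fun w => H (fun i => M w (A i))) by exact: measurable_funD.
have mH1 : measurable_fun setT (fun w => H (fun i => M1 w (A i))) by exact: measurable_funD.
have E : mean P (fun w => H (fun i => M w (A i))) = mean P1 (fun w => H (fun i => M1 w (A i))).
  rewrite /mean /Rintegral (integral_counts HM HI mA tA muA H0 mH).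
  have muA1 i : mu1 (A i) = (r i)%:E by rewrite mu1E.
  by rewrite (integral_counts HM1 HI1 mA tA muA1 H0 mH1).
have D d0 (V : measurableType d0) (Q : probability V R) (g : V -> R) :
    measurable_fun setT g -> (forall w, `|g w| <= K)%R ->
    mean Q (fun w => (g w + K)%R) = (mean Q g + K)%R.
  move=> mg gK; rewrite /mean RintegralD//; last 2 first.
  - exact: bounded_integrable gK.
  - by apply: (@bounded_integrable _ _ _ _ (cst K) `|K|%R).
  have QT : Q setT = 1 by exact: probability_setT.
  by rewrite Rintegral_cst//; congr (_ + _)%R; rewrite [X in fine X]QT mulr1.
move: E; rewrite /H !D//.
by move/addIr.
Qed.

Section step_law.
Variables (E0 : set X) (m : nat) (f : nat -> X -> R) (c : nat -> R).
Variables (h : skorokhod R -> R) (M0 K : R).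
Hypotheses (mE0 : measurable E0) (E0fin : mu E0 < +oo).
Hypotheses (mf : forall k, measurable_fun setT (f k)) (f0 : forall k x, (0 <= f k x)%R).
Hypothesis fE0 : forall k x, ~ E0 x -> f k x = 0%R.
Hypothesis foo : forall k, \int[mu]_x (f k x)%:E < +oo.
Hypothesis hM : forall u, (`|h u| <= M0)%R.
Hypothesis hK : forall u v, (`|h u - h v| <= K * skorokhod_dist u v)%R.

Let fr r k x : R := ((level r (f k x))%:R / r%:R)%R.

Let mfr r k : measurable_fun setT (fr r k).
Proof.
apply: measurable_funM => //.
exact: (measurableT_comp (measurable_level r) (mf k)).
Qed.

Let fr_ge0 r k x : (0 <= fr r k x)%R. Proof. exact: divr_ge0. Qed.

(** Points of [E0] are sorted by the vector of their levels at all [m+2] sampling times. All the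
    discretised integrals are then functions of one finite family of disjoint counts. *)
Let T r := {ffun 'I_m.+2 -> 'I_(r * r).+1}.
Let kappa r x : T r := [ffun k : 'I_m.+2 => inord (level r (f k x))].
Let cell r (i : 'I_#|T r|) : set X := E0 `&` [set x | kappa r x = enum_val i].
Let coef r (k : nat) (i : 'I_#|T r|) : R := ((enum_val i (inord k))%:R / r%:R)%R.
Let G r (v : 'I_#|T r| -> \bar R) : R :=
  h (step m (fun k => (fine (\sum_(i < #|T r|) ((coef k i)%:E * v i)) - c k)%R)).

Let mcell r i : measurable (@cell r i).
Proof.
apply: measurableI => //.
rewrite [X in measurable X](_ : _ = \bigcap_(k in [set: 'I_m.+2])
    ((fun x => (level r (f k x))%:R : R) @^-1` [set (enum_val i k)%:R])).
  apply: fin_bigcap_measurable => // k _.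
  rewrite -[X in measurable X]setTI.
  apply: (measurableT_comp (measurable_level r) (mf k)) => //.
apply/seteqP; split => x /=.
  move=> <- k _ /=; rewrite ffunE inordK// ltnS; exact: geq_minr.
move=> H; apply/ffunP => k; rewrite ffunE; apply: val_inj => /=.
rewrite inordK; last by rewrite ltnS; exact: geq_minr.
by have /eqP := H k I; rewrite /= eqr_nat => /eqP.
Qed.

Let tcell r : trivIset setT (@cell r).
Proof.
apply/trivIsetP => i j _ _ ij; rewrite -subset0 => x [[_ /= ei] [_ /= ej]].
by move/eqP : ij; apply; apply: enum_val_inj; rewrite -ei -ej.
Qed.

Let cell_fin r i : mu (@cell r i) < +oo.
Proof.
apply: le_lt_trans E0fin; apply: le_measure; rewrite ?inE//.
by move=> x [].
Qed.

Let fr_cell r (k : nat) x : (k <= m.+1)%N ->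
  (fr r k x)%:E = \sum_(i < #|T r|) (coef k i)%:E * (\1_(@cell r i) x)%:E.
Proof.
move=> km.
have [Ex|nEx] := pselect (E0 x); last first.
  rewrite big1; last first.
    by move=> i _; rewrite indicE memNset ?mule0// => -[].
  rewrite /fr fE0// /level mulr0 truncn0 min0n.
  by rewrite mul0r.
rewrite (bigD1 (enum_rank (kappa r x)))//= big1 ?adde0; last first.
  move=> i iN; rewrite indicE memNset ?mule0// => -[_ /= E].
  by rewrite E enum_valK eqxx in iN.
rewrite indicE mem_set ?mule1; last by split => //=; rewrite enum_rankK.
rewrite /coef enum_rankK ffunE.
have -> : nat_of_ord (inord k : 'I_m.+2) = k by exact: inordK.
by rewrite inordK// ltnS; exact: geq_minr.
Qed.

Let int_fr (N : {measure set X -> \bar R}) r k : (k <= m.+1)%N ->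
  \int[N]_x (fr r k x)%:E = \sum_(i < #|T r|) (coef k i)%:E * N (@cell r i).
Proof.
move=> km; under eq_integral do rewrite fr_cell//.
have c0 i : (0 <= @coef r k i)%R by exact: divr_ge0.
rewrite ge0_integral_sum//.
- apply: eq_bigr => i _; rewrite ge0_integralZl//.
  + by rewrite integral_indic ?setIT//; exact: mcell.
  + by apply/measurable_EFinP; apply: measurable_indic; exact: mcell.
  + by rewrite lee_fin.
- move=> i; apply: measurable_funeM.
  by apply/measurable_EFinP; apply: measurable_indic; exact: mcell.
- by move=> i x _; rewrite mule_ge0 ?lee_fin.
Qed.

Let cvg_fr (N : {measure set X -> \bar R}) k : \int[N]_x (f k x)%:E < +oo ->
  fine (\int[N]_x (fr r k x)%:E) @[r --> \oo] --> fine (\int[N]_x (f k x)%:E).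
Proof.
move=> Noo.
have If : N.-integrable setT (EFin \o f k).
  apply/integrableP; split; first exact/measurable_EFinP.
  by under eq_integral do rewrite /= ger0_norm//.
have [_ _ H] := @dominated_convergence _ _ _ N setT measurableT
  (fun r x => (fr r k x)%:E) (EFin \o f k) (EFin \o f k)
  ltac:(move=> n; exact/measurable_EFinP) ltac:(exact/measurable_EFinP)
  ltac:(apply: aeW => w _; apply/fine_cvgP; split; [exact: nearW|exact: level_cvg])
  If ltac:(apply: aeW => w n _ /=; rewrite lee_fin ger0_norm//; exact: level_le).
apply: fine_cvg; rewrite fineK; first exact: H.
exact: integrable_fin_num.
Qed.

Let step_cvg d0 (V : measurableType d0) (Q : probability V R)
    (N : V -> {measure set X -> \bar R}) (nu : {measure set X -> \bar R}) :
  poisson_rm Q nu N -> (forall k, \int[nu]_x (f k x)%:E < +oo) ->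
  (mean Q (fun w => h (step m (fun k => fine (\int[N w]_x (fr r k x)%:E) - c k))) @[r --> \oo] -->
  mean Q (fun w => h (step m (fun k => fine (\int[N w]_x (f k x)%:E) - c k))))%R.
Proof.
move=> HN nuoo.
have ms (g : nat -> X -> R) : (forall k, measurable_fun setT (g k)) ->
    (forall k x, (0 <= g k x)%R) -> measurable_fun setT
    (fun w => h (step m (fun k => (fine (\int[N w]_x (g k x)%:E) - c k)%R))).
  move=> mg g0; apply: (@measurable_comp_continuous _ _ _
    (fun w => step m (fun k => (fine (\int[N w]_x (g k x)%:E) - c k)%R))).
    apply: measurable_step => k; apply: measurable_funB => //.
    apply: measurableT_comp => //; apply: (prm_mintegral HN).
      exact/measurable_EFinP.
    by move=> x; rewrite lee_fin.
  exact: lipschitz_continuous hK.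
apply: (@mean_cvg _ _ _ _ _ _ M0).
- by move=> r; exact: ms.
- exact: ms.
- by move=> r w; exact: hM.
have : {ae Q, forall w, forall k, \int[N w]_x (f k x)%:E \is a fin_num}.
  have H k : {ae Q, forall w, \int[N w]_x (f k x)%:E \is a fin_num}.
    apply: (prm_integral_fin HN) => //; first exact/measurable_EFinP.
    by move=> x; rewrite lee_fin.
  exact/ae_foralln.
apply: filterS => w fw.
apply/cvgrPdist_le => e e0.
have K0 : (0 < `|K| + 1)%R by rewrite ltr_pwDr.
have := @step_dist_cvg R m (fun r k => (fine (\int[N w]_x (fr r k x)%:E) - c k)%R)
  (fun k => (fine (\int[N w]_x (f k x)%:E) - c k)%R) _ _ (divr_gt0 e0 K0).
have H0 k : (k <= m.+1)%N -> (fine (\int[N w]_x (fr r k x)%:E) - c k)%R @[r --> \oo] -->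
    (fine (\int[N w]_x (f k x)%:E) - c k)%R.
  move=> _; apply: cvgB; last exact: cvg_cst.
  by apply: cvg_fr; rewrite ltey_eq fw.
move=> /(_ H0); apply: filterS => r hr.
apply: (le_trans (hK _ _)); rewrite skorokhod_dist_sym.
rewrite ler_pdivlMr// in hr; apply: le_trans hr.
have d0' : (0 <= skorokhod_dist
   (step m (fun k => fine (\int[N w]_x (fr r k x)%:E) - c k)) (step m (fun k => fine (\int[N w]_x (f k x)%:E) - c k)))%R.
  exact: (@mdist_ge0 R (skorokhod R)).
rewrite mulrC ler_wpM2l//.
by rewrite (le_trans (ler_norm K))// lerDl.
Qed.

(** With discretised integrands both means are the same function of the counts of the cells, and
    [mean_counts] identifies them. Dominated convergence, inside the integrals and then under the
    means, removes the discretisation. *)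
Lemma mean_step_law :
  mean P (fun w => h (step m (fun k => (fine (\int[M w]_x (f k x)%:E) - c k)%R))) =
  mean P1 (fun w => h (step m (fun k => (fine (\int[M1 w]_x (f k x)%:E) - c k)%R))).
Proof.
have muf k : \int[mu1]_x (f k x)%:E = \int[mu]_x (f k x)%:E.
  by apply: eq_measure_integral => A mA _; rewrite mu1E.
have c1 := step_cvg HM foo.
have c2 : (mean P1 (fun w => h (step m (fun k => fine (\int[M1 w]_x (fr r k x)%:E) - c k))) @[r --> \oo] -->
  mean P1 (fun w => h (step m (fun k => fine (\int[M1 w]_x (f k x)%:E) - c k))))%R.
  by apply: (step_cvg HM1) => k; rewrite muf.
suff E : (fun r => mean P (fun w => h (step m (fun k => (fine (\int[M w]_x (fr r k x)%:E) - c k)%R)))) =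
    (fun r => mean P1 (fun w => h (step m (fun k => (fine (\int[M1 w]_x (fr r k x)%:E) - c k)%R)))).
  by rewrite E in c1; exact: (cvg_unique _ c1 c2).
apply/funext => r.
have GE (N : {measure set X -> \bar R}) :
    h (step m (fun k => (fine (\int[N]_x (fr r k x)%:E) - c k)%R)) = G (fun i => N (@cell r i)).
  by congr h; apply: eq_step => k km; rewrite int_fr.
under eq_fun do rewrite GE.
under [in RHS]eq_fun do rewrite GE.
have mG d0 (V : measurableType d0) (Q : probability V R)
    (N : V -> {measure set X -> \bar R}) (nu : {measure set X -> \bar R}) :
    poisson_rm Q nu N -> measurable_fun setT (fun w => G (fun i => N w (@cell r i))).
  move=> HN; apply: (@measurable_comp_continuous _ _ _ (fun w => step m (fun k =>
      (fine (\sum_(i < #|T r|) ((coef k i)%:E * N w (@cell r i))) - c k)%R))).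
    apply: measurable_step => k; apply: measurable_funB => //.
    apply: measurableT_comp => //; apply: emeasurable_sum => i.
    by apply: measurable_funeM; apply: (prm_measurable HN); exact: mcell.
  exact: lipschitz_continuous hK.
apply: (mean_counts (K := M0)) => //.
- by move=> v; exact: hM.
- exact: mG HM.
- exact: mG HM1.
Qed.

End step_law.

End law.

(** * Random measures of point processes *)

Section restricted_image.
Local Open Scope ereal_scope.
Context d (X : measurableType d) d' (Y : measurableType d') (R : realType).
Variables (T : X -> Y) (D : set X).

Definition rimage (mT : measurable_fun setT T) (mD : measurable D)
    (m : {measure set X -> \bar R}) (A : set Y) : \bar R := m (D `&` T @^-1` A).

Hypotheses (mT : measurable_fun setT T) (mD : measurable D).
Variable m : {measure set X -> \bar R}.

Let mTA A : measurable A -> measurable (D `&` T @^-1` A).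
Proof. by move=> mA; apply: measurableI => //; rewrite -[X in measurable X]setTI; exact: mT. Qed.

Let rimage0 : rimage mT mD m set0 = 0.
Proof. by rewrite /rimage preimage_set0 setI0 measure0. Qed.

Let rimage_ge0 A : 0 <= rimage mT mD m A. Proof. exact: measure_ge0. Qed.

Let rimage_sigma_additive : semi_sigma_additive (rimage mT mD m).
Proof.
move=> F mF tF mUF; rewrite /rimage preimage_bigcup setI_bigcupr.
apply: measure_semi_sigma_additive.
- by move=> i; exact: mTA.
- apply/trivIsetP => i j _ _ ij; rewrite -subset0 => x [[_ /= Fi] [_ /= Fj]].
  by move/trivIsetP : tF => /(_ i j I I ij); rewrite -subset0; apply; split; [exact: Fi|].
- by apply: bigcup_measurable => i _; exact: mTA.
Qed.

HB.instance Definition _ := isMeasure.Build _ _ _ (rimage mT mD m)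
  rimage0 rimage_ge0 rimage_sigma_additive.

Lemma integral_rimage (f : Y -> \bar R) : measurable_fun setT f -> (forall y, 0 <= f y) ->
  \int[rimage mT mD m]_y f y = \int[m]_(x in D) f (T x).
Proof.
have mc (g : Y -> \bar R) : measurable_fun setT g -> measurable_fun D (fun x => g (T x)).
  by move=> mg; apply: measurable_funTS; exact: measurableT_comp.
move: f; apply: ge0_measurable_ind.
- move=> A mA; rewrite integral_indic// setIT.
  rewrite [RHS](_ : _ = \int[m]_(x in D) (\1_(T @^-1` A) x)%:E)//.
  rewrite integral_indic//; first by rewrite setIC.
  by rewrite -[X in measurable X]setTI; exact: mT.
- by move=> c f c0 mf f0 IH; rewrite !ge0_integralZl ?lee_fin// ?IH//; exact: mc.
- move=> f g mf f0 mg g0 If Ig; rewrite !ge0_integralD// ?If ?Ig//; exact: mc.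
- move=> f mf f0 ndf IH.
  rewrite [LHS]monotone_convergence// [RHS]monotone_convergence//.
  + by apply/congr_lim/funext => n; exact: IH.
  + by move=> n; exact: mc.
Qed.

End restricted_image.

Section poisson_image.
Local Open Scope ereal_scope.
Context d (W : measurableType d) d1 (X : measurableType d1) d2 (Y : measurableType d2)
  (R : realType).
Variables (P : probability W R) (mu : {measure set X -> \bar R}).
Variable M : W -> {measure set X -> \bar R}.
Variables (T : X -> Y) (D : set X).
Hypotheses (mT : measurable_fun setT T) (mD : measurable D).

Definition rm_image (w : W) : {measure set Y -> \bar R} := rimage mT mD (M w).

Let mTA A : measurable A -> measurable (D `&` T @^-1` A).
Proof. by move=> mA; apply: measurableI => //; rewrite -[X in measurable X]setTI; exact: mT. Qed.

(** Mapping theorem: counts of the image measure are counts of preimages, so the laws transfer; only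
    an exhausting sequence on the target has to be supplied. *)
Lemma poisson_rm_image (C : nat -> set Y) : poisson_rm P mu M ->
  (forall i, measurable (C i)) -> nondecreasing_seq C -> \bigcup_i C i = setT ->
  (forall i, mu (D `&` T @^-1` (C i)) < +oo) ->
  (forall w i, M w (D `&` T @^-1` (C i)) < +oo) ->
  poisson_rm P (rimage mT mD mu) rm_image.
Proof.
move=> HM mC ndC CT muC MC; split.
- by move=> A mA; apply: (prm_measurable HM); exact: mTA.
- by exists C; split.
- by move=> A mA r muA; apply: (prm_law HM) => //; exact: mTA.
Qed.

Lemma independent_rm_image : independent_rm P M -> independent_rm P rm_image.
Proof.
move=> HI m A mA tA B mB; apply: (HI m (fun i => D `&` T @^-1` (A i))) => //.
- by move=> i; exact: mTA.
- apply/trivIsetP => i j _ _ ij; rewrite -subset0 => x [[_ /= Fi] [_ /= Fj]].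
  by move/trivIsetP : tA => /(_ i j I I ij); rewrite -subset0; apply; split; [exact: Fi|].
Qed.

End poisson_image.

(** * Point sets as counting measures *)

Section point_measure.
Local Open Scope ereal_scope.
Context d (X : measurableType d) (R : realType).

Lemma counting_esum (A : set X) : counting A = \esum_(x in A) (1 : \bar R).
Proof.
rewrite /counting; case: asboolP => [fA|nA].
  by rewrite (@finite_card_sum _ _ R _ fA).
rewrite -(@infinite_card_dirac _ _ R _ nA); apply: eq_esum => x Ax.
by rewrite diracE mem_set.
Qed.

Definition point_measure (S : set X) (A : set X) : \bar R := counting (S `&` A).

Section instance.
Variable S : set X.

Let pm0 : point_measure S set0 = 0.
Proof. by rewrite /point_measure setI0 counting_esum esum_set0. Qed.

Let pm_ge0 A : 0 <= point_measure S A.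
Proof. by rewrite /point_measure counting_esum; exact: esum_ge0. Qed.

Let pm_sigma_additive : semi_sigma_additive (point_measure S).
Proof.
move=> F mF tF mUF; rewrite /point_measure setI_bigcupr counting_esum.
rewrite nneseries_sum_bigcup//; last first.
  apply/trivIsetP => i j _ _ ij; rewrite -subset0 => x [[_ /= Fi] [_ /= Fj]].
  by move/trivIsetP : tF => /(_ i j I I ij); rewrite -subset0; apply; split; [exact: Fi|].
under eq_eseriesr do rewrite -counting_esum.
apply: is_cvg_nneseries => n _ _; rewrite counting_esum; exact: esum_ge0.
Qed.

HB.instance Definition _ := isMeasure.Build _ _ _ (point_measure S)
  pm0 pm_ge0 pm_sigma_additive.
End instance.

Lemma esum_limn (S : set X) (f : nat -> X -> \bar R) :
  (forall n x, 0 <= f n x) -> (forall x, nondecreasing_seq (f ^~ x)) ->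
  limn (fun n => \esum_(x in S) f n x) = \esum_(x in S) limn (f ^~ x).
Proof.
move=> f0 ndf.
have cf x : cvgn (f ^~ x) by exact: ereal_nondecreasing_is_cvgn.
have fl n x : f n x <= limn (f ^~ x).
  by apply: lime_ge => //; exists n => // m /= /(ndf x).
have ndE : nondecreasing_seq (fun n => \esum_(x in S) f n x).
  by move=> m n mn; apply: le_esum => x _; exact: ndf.
have cE := ereal_nondecreasing_is_cvgn ndE.
apply/eqP; rewrite eq_le; apply/andP; split.
  by apply: lime_le => //; apply: nearW => n; apply: le_esum => x _; exact: fl.
apply: ub_ereal_sup => _ [A [finA AS] <-].
have -> : \sum_(x \in A) limn (f ^~ x) = limn (fun n => \sum_(x \in A) f n x).
  apply/esym/cvg_lim => //; rewrite fsbig_finite//.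
  under eq_fun do rewrite fsbig_finite//=.
  apply: cvg_nnesum => // x _; apply: nearW => n; exact: f0.
apply: lee_lim => //.
  apply: ereal_nondecreasing_is_cvgn => m n mn; rewrite !fsbig_finite//=.
  by apply: lee_sum => x _; exact: ndf.
by apply: nearW => n; apply: esum_ge; exists A.
Qed.

Lemma esumZl (S : set X) (c : R) (f : X -> \bar R) : (0 <= c)%R ->
  (forall x, 0 <= f x) -> \esum_(x in S) (c%:E * f x) = c%:E * \esum_(x in S) f x.
Proof.
have le (k : R) (g : X -> \bar R) : (0 <= k)%R -> (forall x, 0 <= g x) ->
    \esum_(x in S) (k%:E * g x) <= k%:E * \esum_(x in S) g x.
  move=> k0 g0; apply: ub_ereal_sup => _ [A [finA AS] <-].
  rewrite fsbig_finite//= -ge0_sume_distrr; last by move=> x _; exact: g0.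
  apply: lee_pmul => //; first by apply: sume_ge0 => x _; exact: g0.
  by apply: esum_ge; exists A => //; rewrite fsbig_finite.
move=> c0 f0; apply/eqP; rewrite eq_le le//=.
have [<-|cn0] := eqVneq 0%R c.
  by rewrite mul0e; apply: esum_ge0 => x _; rewrite mul0e.
have {cn0}c0 : (0 < c)%R by rewrite lt_neqAle cn0.
have cf0 x : 0 <= c%:E * f x by rewrite mule_ge0// lee_fin ltW.
have := le c^-1%R _ _ cf0; rewrite invr_ge0 (ltW c0) => /(_ isT).
under eq_esum do rewrite muleA -EFinM mulVf ?gt_eqF// mul1e.
move=> h; apply: le_trans (lee_wpmul2l _ h) _; first by rewrite lee_fin ltW.
by rewrite muleA -EFinM mulfV ?gt_eqF// mul1e.
Qed.

(** Connects the sums over points, in which the edge count and the limit sum are written, with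
    integrals against measures. *)
Lemma integral_point_measure (S : set X) (f : X -> \bar R) :
  measurable_fun setT f -> (forall x, 0 <= f x) ->
  \int[point_measure S]_x f x = \esum_(x in S) f x.
Proof.
move: f; apply: ge0_measurable_ind.
- move=> A mA; rewrite integral_indic// setIT /= /point_measure counting_esum.
  rewrite esum_mkcondr; apply: eq_esum => x Sx /=.
  by rewrite indicE; case: ifPn.
- move=> c f c0 mf f0 IH; rewrite ge0_integralZl ?lee_fin// IH.
  by rewrite esumZl.
- by move=> f g mf f0 mg g0 If Ig; rewrite ge0_integralD// If Ig esumD.
- move=> f mf f0 ndf IH; rewrite monotone_convergence// -esum_limn//.
  by apply/congr_lim/funext => n; exact: IH.
Qed.

End point_measure.

Section from_poisson_process.
Local Open Scope ereal_scope.
Context d (W : measurableType d) dX (X : measurableType dX) (R : realType).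
Variables (P : probability W R) (E : set X) (mu : {measure set X -> \bar R}).
Variables (eta : W -> set X) (C : nat -> set X).
Hypothesis Heta : poisson_process P E mu eta.
Hypotheses (mE : measurable E) (mC : forall i, measurable (C i)).
Hypotheses (ndC : nondecreasing_seq C) (CT : \bigcup_i C i = setT).
Hypothesis Cfin : forall i, mu (C i `&` E) < +oo.

Definition pp_gen : set (set W) := [set S | exists A (B : set (\bar R)),
  [/\ measurable A, A `<=` E, measurable B & S = count_in eta A @^-1` B]].

Definition pp_type := g_sigma_algebraType pp_gen.

Lemma pp_gen_sub : <<s pp_gen >> `<=` measurable.
Proof.
apply: smallest_sub; first exact: sigma_algebra_measurable.
move=> _ [A [B [mA AE mB ->]]].
by rewrite -[X in measurable X]setTI; apply: (pp_measurable Heta).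
Qed.

Definition pp_good : set W := [set w | forall i, count_in eta (C i `&` E) w < +oo :> \bar R].

(** Emptied outside the almost sure event [pp_good], which makes the measure finite on every [C i]
    for all [w]. *)
Definition pp_set (w : W) : set X := if `[< pp_good w >] then eta w else set0.

Definition pp_measure (w : W) : {measure set X -> \bar R} := point_measure R (pp_set w).

Let mcount A : measurable A -> A `<=` E ->
  measurable_fun setT (count_in eta A : pp_type -> \bar R).
Proof.
move=> mA AE _ B mB; rewrite setTI; apply: sub_sigma_algebra.
by exists A, B; split.
Qed.

Let mgood : measurable (pp_good : set pp_type).
Proof.
rewrite [X in measurable X](_ : _ = \bigcap_i ((count_in eta (C i `&` E) : pp_type -> \bar R) @^-1` [set x | x < +oo])).
  apply: bigcapT_measurable => i; rewrite -[X in measurable X]setTI.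
  apply: mcount => //; first exact: measurableI.
  rewrite [X in measurable X](_ : _ = ~` [set +oo]); first exact/measurableC/emeasurable_set1.
  by apply/seteqP; split => x /=; rewrite ltey => /eqP.
by apply/seteqP; split => w /= h; [move=> i _; exact: h|move=> i; exact: (h i I)].
Qed.

Let count_setI A w : count_in eta A w = count_in eta (A `&` E) w :> \bar R.
Proof.
rewrite /count_in; congr counting; apply/seteqP; split => x [ex Ax]; split => //.
  by split => //; exact: (pp_sub Heta ex).
by case: Ax.
Qed.

Lemma pp_measureE w A : pp_measure w A =
  if `[< pp_good w >] then count_in eta (A `&` E) w else 0.
Proof.
rewrite /pp_measure /= /point_measure /pp_set; case: asboolP => _.
  by rewrite -count_setI.
by rewrite set0I counting_esum esum_set0.
Qed.

(** Measurability for the sigma-algebra generated by [eta] alone, since [pp_good] itself is an event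
    about counts; conditioning relies on this. *)
Lemma pp_measurable_sub A : measurable A ->
  measurable_fun setT ((fun w => pp_measure w A) : pp_type -> \bar R).
Proof.
move=> mA; under eq_fun do rewrite pp_measureE.
apply: measurable_fun_ifT => //.
  apply: (@measurable_fun_bool _ _ _ _ true); rewrite setTI.
  rewrite [X in measurable X](_ : _ = pp_good); first exact: mgood.
  by apply/seteqP; split => w /=; [move=> /asboolP|move=> h; exact/asboolP].
by apply: mcount => //; exact: measurableI.
Qed.

Lemma pp_good_ae : {ae P, forall w, pp_good w}.
Proof.
apply/ae_foralln => i.
have mCE : measurable (C i `&` E) by exact: measurableI.
have fin : mu (C i `&` E) \is a fin_num by rewrite ge0_fin_numE.
have law : poisson_rv P (fine (mu (C i `&` E))) (count_in eta (C i `&` E)).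
  move=> k; have [h _] := pp_law Heta mCE (@subIsetr _ _ _).
  by apply: h; rewrite fineK.
have mc : measurable_fun setT (count_in eta (C i `&` E) : W -> \bar R).
  by apply: (pp_measurable Heta) => //; exact: subIsetr.
have c0 w : 0 <= (count_in eta (C i `&` E) w : \bar R).
  by rewrite /count_in counting_esum esum_ge0.
have /integrable_ae : P.-integrable setT (count_in eta (C i `&` E) : W -> \bar R).
  apply/integrableP; split => //.
  under eq_integral do rewrite gee0_abs//.
  by rewrite (poisson_rv_mean _ mc c0 law) ?ltry// fine_ge0.
move=> /(_ measurableT); apply: filterS => w /(_ I).
by rewrite ge0_fin_numE.
Qed.

Lemma pp_measure_fin w i : pp_measure w (C i) < +oo.
Proof. by rewrite pp_measureE; case: asboolP => //; apply. Qed.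

Lemma pp_measure_ae A : measurable A ->
  {ae P, forall w, pp_measure w A = count_in eta (A `&` E) w}.
Proof.
by move=> mA; apply: filterS pp_good_ae => w gw; rewrite pp_measureE asboolT.
Qed.

Let P_ae (S S' : set W) : measurable S -> measurable S' ->
  {ae P, forall w, S w <-> S' w} -> P S = P S'.
Proof.
move=> mS mS' SS'.
transitivity (\int[P]_w (\1_S w)%:E); first by rewrite integral_indic// setIT.
transitivity (\int[P]_w (\1_S' w)%:E); last by rewrite integral_indic// setIT.
apply: ae_eq_integral => //; try exact/measurable_EFinP/measurable_indic.
apply: filterS SS' => w h _; rewrite !indicE (_ : (w \in S) = (w \in S'))//.
by apply/idP/idP => /set_mem /h ?; apply/mem_set.
Qed.

Let pmeas A : measurable A -> measurable_fun setT ((fun w => pp_measure w A) : W -> \bar R).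
Proof.
move=> mA _ B mB; rewrite setTI; apply: pp_gen_sub.
by have := pp_measurable_sub mA measurableT mB; rewrite setTI.
Qed.

Lemma pp_poisson_rm : poisson_rm P (mrestr mu mE) pp_measure.
Proof.
split.
- exact: pmeas.
- exists C; split => //; try exact: Cfin.
  by move=> w i; exact: pp_measure_fin.
- move=> A mA r muA k.
  have mAE : measurable (A `&` E) by exact: measurableI.
  have [h _] := pp_law Heta mAE (@subIsetr _ _ _).
  rewrite /pois -(h r muA k); apply: P_ae.
  + by have := pmeas mA measurableT (emeasurable_set1 (k%:R%:E : \bar R)); rewrite setTI.
  + have := pp_measurable Heta mAE (@subIsetr _ _ _) measurableT (emeasurable_set1 (k%:R%:E : \bar R)).
    by rewrite setTI.
  + by apply: filterS (pp_measure_ae mA) => w /= ->.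
Qed.

Lemma pp_independent_rm : independent_rm P pp_measure.
Proof.
move=> m A mA tA B mB.
have mAE i : measurable (A i `&` E) by exact: measurableI.
have mc i : measurable (count_in eta (A i `&` E) @^-1` B i).
  by rewrite -[X in measurable X]setTI; apply: (pp_measurable Heta).
have mp i : measurable ((fun w => pp_measure w (A i)) @^-1` B i).
  by rewrite -[X in measurable X]setTI; apply: pmeas.
have aeA : {ae P, forall w, forall i, pp_measure w (A i) = count_in eta (A i `&` E) w}.
  by apply: filter_forall => i; exact: pp_measure_ae.
rewrite (@P_ae _ (\bigcap_(i in setT) (count_in eta (A i `&` E) @^-1` B i))).
- rewrite (pp_independent Heta)//.
  + apply: eq_bigr => i _; apply: P_ae => //.
    by apply: filterS aeA => w /= ->.
  + apply/trivIsetP => i j _ _ ij; rewrite -subset0 => x [[Ai _] [Aj _]].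
    by move/trivIsetP : tA => /(_ i j I I ij); rewrite -subset0; apply; split; [exact: Ai|].
- exact: fin_bigcap_measurable.
- exact: fin_bigcap_measurable.
- apply: filterS aeA => w h; split => /= H i _; have := H i I; rewrite /= ?h//.
Qed.

(** The exceptional event is the complement of [pp_good]. It is the same for all [f], so the
    identity may be used for all times and all truncations at once. *)
Lemma pp_integral_ae : {ae P, forall w, forall f : X -> \bar R,
  measurable_fun setT f -> (forall x, 0 <= f x) ->
  \esum_(x in eta w) f x = \int[pp_measure w]_x f x}.
Proof.
apply: filterS pp_good_ae => w gw f mf f0.
by rewrite integral_point_measure// /pp_set asboolT.
Qed.

Lemma pp_count_ae : {ae P, forall w, forall A : set X,
  measurable A -> count_in eta A w = pp_measure w A}.
Proof.
by apply: filterS pp_good_ae => w gw A mA; rewrite pp_measureE asboolT// -count_setI.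
Qed.

End from_poisson_process.

(** * Independence as a product measure *)

Section sub_law.
Context d (W : measurableType d) (R : realType) (P : probability W R).
Local Open Scope ereal_scope.
Variable G : set (set W).
Hypothesis sG : <<s G>> `<=` measurable.

Local Notation WG := (g_sigma_algebraType G).

(** The inclusion of sigma-algebras is kept as an argument, so that the measure structure can be
    attached to the restricted law. *)
Definition sub_law (_ : <<s G>> `<=` measurable) (A : set WG) : \bar R := P A.

Let m0 : sub_law sG set0 = 0. Proof. exact: measure0. Qed.
Let m_ge0 A : 0 <= sub_law sG A. Proof. exact: measure_ge0. Qed.
Let m_sigma : semi_sigma_additive (sub_law sG).
Proof.
move=> F mF tF mU; apply: (@measure_semi_sigma_additive _ _ _ P) => //.
- by move=> i; apply: sG; exact: mF.
- by apply: sG; exact: mU.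
Qed.

HB.instance Definition _ := isMeasure.Build _ _ _ (sub_law sG) m0 m_ge0 m_sigma.

Let mT : sub_law sG setT = 1. Proof. exact: probability_setT. Qed.

HB.instance Definition _ := Measure_isProbability.Build _ _ _ (sub_law sG) mT.

Definition sub_probability : probability WG R := sub_law sG.

Lemma measurable_sub d' (V : measurableType d') (f : W -> V) :
  measurable_fun setT (f : WG -> V) -> measurable_fun setT f.
Proof.
move=> mf _ B mB; rewrite setTI; apply: sG.
by have := mf measurableT B mB; rewrite setTI.
Qed.

End sub_law.

Section freezing.
Context d (W : measurableType d) (R : realType) (P : probability W R).
Local Open Scope ereal_scope.
Variables G1 G2 : set (set W).
Hypotheses (s1 : <<s G1>> `<=` measurable) (s2 : <<s G2>> `<=` measurable).
Hypothesis ind : forall C C', <<s G1>> C -> <<s G2>> C' -> P (C `&` C') = P C * P C'.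

Local Notation W1 := (g_sigma_algebraType G1).
Local Notation W2 := (g_sigma_algebraType G2).

(* On the product of the two sub-sigma-algebras, independence says that the
   diagonal image of P is a product measure. *)
Lemma freezing (Phi : W1 * W2 -> \bar R) : measurable_fun setT Phi ->
  (forall z, 0 <= Phi z) ->
  \int[P]_w Phi (w, w) =
  \int[sub_probability P s1]_w \int[sub_probability P s2]_w' Phi (w, w').
Proof.
move=> mPhi Phi0.
have mi1 : measurable_fun setT (id : W -> W1) by apply: (measurable_sub s1); exact: measurable_id.
have mi2 : measurable_fun setT (id : W -> W2) by apply: (measurable_sub s2); exact: measurable_id.
have md : measurable_fun setT ((fun w => (w, w)) : W -> W1 * W2).
  by apply/measurable_fun_pairP; split.
transitivity (\int[sub_probability P s1 \x sub_probability P s2]_z Phi z);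
  last exact: fubini_tonelli1.
transitivity (\int[rimage md measurableT P]_z Phi z); first by rewrite integral_rimage.
apply: eq_measure_integral => A mA _; apply/esym.
apply: product_measure_unique => // B C mB mC.
rewrite /= /rimage setTI.
have -> : (fun w => (w, w)) @^-1` (B `*` C) = B `&` C by [].
by rewrite ind.
Qed.

End freezing.

Section cover.
Context d (X : measurableType d) (R : realType).
Local Open Scope ereal_scope.

Definition as_sigma_finite (m : {measure set X -> \bar R}) (_ : sigma_finite setT m)
  (A : set X) : \bar R := m A.

Section instance.
Variables (m : {measure set X -> \bar R}) (sf : sigma_finite setT m).

Let m0 : as_sigma_finite sf set0 = 0. Proof. exact: measure0. Qed.
Let m_ge0 A : 0 <= as_sigma_finite sf A. Proof. exact: measure_ge0. Qed.
Let m_sigma : semi_sigma_additive (as_sigma_finite sf).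
Proof. exact: (@measure_semi_sigma_additive _ _ _ m). Qed.

HB.instance Definition _ := isMeasure.Build _ _ _ (as_sigma_finite sf) m0 m_ge0 m_sigma.

Let m_sf : sigma_finite setT (as_sigma_finite sf). Proof. exact: sf. Qed.

HB.instance Definition _ := Measure_isSigmaFinite.Build _ _ _ (as_sigma_finite sf) m_sf.

Definition sigma_finite_version : {sigma_finite_measure set X -> \bar R} := as_sigma_finite sf.

End instance.

Lemma sigma_finite_cover (m : {measure set X -> \bar R}) (C : nat -> set X) :
  (forall i, measurable (C i)) -> \bigcup_i C i = setT -> (forall i, m (C i) < +oo) ->
  exists m' : {sigma_finite_measure set X -> \bar R},
    forall A, measurable A -> m' A = m A.
Proof.
move=> mC CT Cfin.
have sf : sigma_finite setT m by exists C.
by exists (sigma_finite_version sf).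
Qed.

End cover.

Section measurable_projections.
Context d1 (A : measurableType d1) d2 (B : measurableType d2) d3 (C : measurableType d3).

Lemma measurable_pair1_2 : measurable_fun setT (fun t : (A * B) * C => t.1.2).
Proof. exact: (measurableT_comp measurable_snd measurable_fst). Qed.

Lemma measurable_pair12 : measurable_fun setT (fun t : (A * B) * C => (t.1.2, t.2)).
Proof. by apply: measurable_fun_pair; [exact: measurable_pair1_2|exact: measurable_snd]. Qed.

Lemma measurable_pair21 : measurable_fun setT (fun t : (A * B) * C => (t.2, t.1.2)).
Proof. by apply: measurable_fun_pair; [exact: measurable_snd|exact: measurable_pair1_2]. Qed.

End measurable_projections.

(** * Pairs of points from two independent Poisson measures *)

Section double_variance.
Local Open Scope ereal_scope.
Context d1 (W1 : measurableType d1) d2 (W2 : measurableType d2)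
  dX (X : measurableType dX) dX' (X' : measurableType dX') (R : realType).
Variables (P1 : probability W1 R) (P2 : probability W2 R).
Variables (mu : {sigma_finite_measure set X -> \bar R})
  (la : {sigma_finite_measure set X' -> \bar R}).
Variables (M : W1 -> {measure set X -> \bar R}) (M' : W2 -> {measure set X' -> \bar R}).
Hypotheses (HM : poisson_rm P1 mu M) (HM' : poisson_rm P2 la M').
Variable D : set (X * X').
Hypothesis mD : measurable D.

Definition pairs w w' := \int[M w]_p M' w' (xsection D p).
(** The mean of [pairs w] over the second process, with the first one frozen. *)
Definition comp_pairs w := \int[M w]_p la (xsection D p).

Lemma measurable_xsection_rm : measurable_fun setT (fun z : W2 * X => M' z.1 (xsection D z.2)).
Proof.
have [mM' [C [mC ndC CT Cfin]]] := prm_rm HM'.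
have HN : random_measure (fun z : W2 * X => M' z.1).
  split; last by exists C; split => // z i; exact: Cfin.
  by move=> A mA; exact: (measurableT_comp (mM' A mA)).
pose A : set ((W2 * X) * X') := (fun t => (t.1.2, t.2)) @^-1` D.
have mA : measurable A.
  by rewrite -[A]setTI; exact: measurable_pair12.
by have := measurable_rm_xsection HN mA; congr measurable_fun; apply/funext => -[w' p].
Qed.

Lemma measurable_pairs : measurable_fun setT (fun z : W1 * W2 => pairs z.1 z.2).
Proof.
have [mM [C [mC ndC CT Cfin]]] := prm_rm HM.
have HN : random_measure (fun z : W1 * W2 => M z.1).
  split; last by exists C; split => // z i; exact: Cfin.
  by move=> A mA; exact: (measurableT_comp (mM A mA)).
apply: (measurable_rm_integral HN (f := fun t => M' t.1.2 (xsection D t.2))) => //.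
have mp : measurable_fun setT (fun t : W1 * W2 * X => (t.1.2, t.2)).
  exact: measurable_pair12.
exact: (measurable_comp measurableT (subsetT _) measurable_xsection_rm mp).
Qed.

Lemma measurable_comp_pairs : measurable_fun setT comp_pairs.
Proof.
apply: (prm_mintegral HM); last by move=> p; exact: measure_ge0.
exact: measurable_fun_xsection.
Qed.

(** Fubini for measures that are sigma-finite only through a given cover: they are replaced by
    bundled sigma-finite copies, equal on measurable sets. *)
Let fub d3 (Y : measurableType d3) d4 (Y' : measurableType d4)
    (m1 : {measure set Y -> \bar R}) (m2 : {measure set Y' -> \bar R}) (S : set (Y * Y'))
    (C : nat -> set Y) (C' : nat -> set Y') : measurable S ->
  (forall i, measurable (C i)) -> \bigcup_i C i = setT -> (forall i, m1 (C i) < +oo) ->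
  (forall i, measurable (C' i)) -> \bigcup_i C' i = setT -> (forall i, m2 (C' i) < +oo) ->
  \int[m1]_p m2 (xsection S p) = \int[m2]_q m1 (ysection S q) /\
  measurable_fun setT (fun q => m1 (ysection S q)).
Proof.
move=> mS mC CT Cfin mC' CT' Cfin'.
have [n1 E1] := sigma_finite_cover mC CT Cfin.
have [n2 E2] := sigma_finite_cover mC' CT' Cfin'.
split; last first.
  have := measurable_fun_ysection n1 mS; congr measurable_fun; apply/funext => q /=.
  by rewrite E1//; exact: measurable_ysection.
transitivity (\int[n1]_p n2 (xsection S p)).
  transitivity (\int[m1]_p n2 (xsection S p)).
    by apply: eq_integral => p _; rewrite E2//; exact: measurable_xsection.
  by apply: eq_measure_integral => A mA _; rewrite -E1.
transitivity (\int[n2]_q n1 (ysection S q)).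
  have := indic_fubini_tonelli n1 n2 mS.
  by rewrite indic_fubini_tonelli_FE// indic_fubini_tonelli_GE.
transitivity (\int[n2]_q m1 (ysection S q)).
  by apply: eq_integral => p _; rewrite E1//; exact: measurable_ysection.
by apply: eq_measure_integral => A mA _; rewrite -E2.
Qed.

Lemma mean_pairs : \int[P1]_w comp_pairs w = \int[mu]_p la (xsection D p).
Proof.
by apply: (campbell HM) => [|p]; [exact: measurable_fun_xsection|exact: measure_ge0].
Qed.

Let la_cover : exists C : nat -> set X',
  [/\ forall i, measurable (C i), \bigcup_i C i = setT & forall i, la (C i) < +oo].
Proof.
have /sigma_finiteP[F [FT ndF Foo]] := sigma_finiteT la.
by exists F; split; [move=> i; case: (Foo i)|rewrite FT|move=> i; case: (Foo i)].
Qed.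

(** For frozen [w] the number of pairs is an integral against [M'] of [q] mapped to
    [M w (ysection D q)], so its variance is at most the [la]-integral of the squared counts.
    Averaging over [w], each squared count has mean at most [mu^2 + mu] of the section. *)
Lemma double_variance : \int[mu]_p la (xsection D p) < +oo ->
  \int[P1]_w \int[P2]_w' (((fine (pairs w w') - fine (comp_pairs w)) ^+ 2)%R%:E) <=
  \int[la]_q (mu (ysection D q) * mu (ysection D q) + mu (ysection D q)).
Proof.
move=> Doo.
have [mM [C [mC ndC CT Cfin]]] := prm_rm HM.
have [mM' [C' [mC' ndC' CT' Cfin']]] := prm_rm HM'.
have [L [mL LT Lfin]] := la_cover.
have H1 w := fub mD mC CT (Cfin w) mL LT Lfin.
have mg w : measurable_fun setT (fun q => M w (ysection D q)) := (H1 w).2.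
have pairsE w w' : pairs w w' = \int[M' w']_q M w (ysection D q).
  by have [+ _] := fub mD mC CT (Cfin w) mC' CT' (Cfin' w').
have compE w : comp_pairs w = \int[la]_q M w (ysection D q) := (H1 w).1.
have mgg : measurable_fun setT (fun z : W1 * X' => M z.1 (ysection D z.2)).
  have HN : random_measure (fun z : W1 * X' => M z.1).
    split; last by exists C; split => // z i; exact: Cfin.
    by move=> A mA; exact: (measurableT_comp (mM A mA)).
  pose A : set ((W1 * X') * X) := (fun t => (t.2, t.1.2)) @^-1` D.
  have mA : measurable A.
      by rewrite -[A]setTI; exact: measurable_pair21.
  by have := measurable_rm_xsection HN mA; congr measurable_fun; apply/funext => -[w' p].
apply: (@le_trans _ _ (\int[P1]_w \int[la]_q (M w (ysection D q) * M w (ysection D q)))).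
  apply: ae_ge0_le_integral => //.
  - by move=> w _; apply: integral_ge0 => w' _; rewrite lee_fin sqr_ge0.
  - apply: (@measurable_fun_fubini_tonelli_F _ _ _ _ _ P2
      (fun z : W1 * W2 => (((fine (pairs z.1 z.2) - fine (comp_pairs z.1)) ^+ 2)%R%:E))); last first.
      by move=> z; rewrite lee_fin sqr_ge0.
    apply/measurable_EFinP; apply: (@measurable_funX _ _ _ _
      (fun z : W1 * W2 => (fine (pairs z.1 z.2) - fine (comp_pairs z.1))%R)).
    apply: measurable_funB; first exact: measurableT_comp measurable_pairs.
    apply: measurableT_comp => //.
    exact: (measurable_comp measurableT (subsetT _) measurable_comp_pairs measurable_fst).
  - by move=> w _; apply: integral_ge0 => q _; rewrite mule_ge0.
  - apply: (@measurable_fun_fubini_tonelli_F _ _ _ _ _ la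
      (fun z : W1 * X' => M z.1 (ysection D z.2) * M z.1 (ysection D z.2))); last first.
      by move=> z; rewrite mule_ge0.
    exact: emeasurable_funM.
  have := prm_integral_fin HM (measurable_fun_xsection la mD) (fun p => measure_ge0 _ _) Doo.
  apply: filterS => w wfin _.
  under eq_integral do rewrite pairsE.
  rewrite compE; apply: (prm_variance HM') => //.
  by rewrite -compE ltey_eq wfin.
rewrite (@fubini_tonelli _ _ _ _ R P1 la (fun z : W1 * X' => M z.1 (ysection D z.2) * M z.1 (ysection D z.2))); last 2 first.
- exact: emeasurable_funM.
- by move=> z; rewrite mule_ge0.
apply: ge0_le_integral => //.
- by move=> q _; apply: integral_ge0 => w _; rewrite mule_ge0.
- apply: (@measurable_fun_fubini_tonelli_G _ _ _ _ _ P1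
      (fun z : W1 * X' => M z.1 (ysection D z.2) * M z.1 (ysection D z.2))); last first.
    by move=> z; rewrite mule_ge0.
  exact: emeasurable_funM.
- have my := measurable_fun_ysection mu mD.
  by apply: emeasurable_funD => //; exact: emeasurable_funM.
move=> q _ /=.
have mDq : measurable (ysection D q) by exact: measurable_ysection.
have [muoo|mufin] := eqVneq (mu (ysection D q)) +oo.
  by rewrite muoo mulyy addye// leey.
have := @prm_sqr_le _ _ _ _ _ _ _ _ HM (EFin \o \1_(ysection D q)).
rewrite integral_indic// setIT.
have -> : (fun w => \int[M w]_x (EFin \o \1_(ysection D q)) x * \int[M w]_x (EFin \o \1_(ysection D q)) x)
   = (fun w => M w (ysection D q) * M w (ysection D q)).
  by apply/funext => w; rewrite integral_indic// setIT.
have -> : \int[mu]_x ((EFin \o \1_(ysection D q)) x * (EFin \o \1_(ysection D q)) x) = mu (ysection D q).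
  rewrite -[X in _ = mu X]setIT -integral_indic//; apply: eq_integral => x _ /=.
  by rewrite -EFinM indicE; case: (_ \in _); rewrite ?mulr1 ?mulr0.
apply => //.
- exact/measurable_EFinP.
- by move=> x; rewrite lee_fin.
- by rewrite lt_neqAle mufin leey.
Qed.

End double_variance.

(** * Intensities *)

Section powers.
Context (R : realType).
Local Notation leb := (@lebesgue_measure R).

Lemma integral_powR_itv (a e : R) : a < 1 -> 0 < e < 1 ->
  (\int[leb]_(x in `[e, 1%R]) (x `^ (- a))%:E = ((1 - e `^ (1 - a)) / (1 - a))%:E)%E.
Proof.
move=> a1 /andP[e0 e1].
have a1' : (1 - a != 0)%R by rewrite subr_eq0 gt_eqF.
pose F x : R := ((1 - a)^-1 * x `^ (1 - a))%R.
have dF (x : R) : 0 < x -> is_derive x 1%R F (x `^ (- a)).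
  move=> x0; have H := is_derive1_powR (1 - a) x0.
  have H' := @is_deriveZ R R^o R^o (fun y : R => y `^ (1 - a)) (1 - a)^-1 x 1 _ H.
  apply: (is_derive_eq H').
  by rewrite /GRing.scale/= mulrA mulVf// mul1r; congr powR; lra.
have cp (p x : R) : 0 < x -> {for x, continuous (fun y : R => y `^ p)}.
  move=> x0; apply: differentiable_continuous; apply/derivable1_diffP.
  by apply: derivable_powR; rewrite in_itv/= x0.
rewrite (@continuous_FTC2 _ _ F)//.
- rewrite -EFinB; congr EFin; rewrite /F powR1; field; exact: a1'.
- apply: continuous_in_subspaceT => x; rewrite inE/= in_itv/= => /andP[ex _].
  by apply: cp; exact: lt_le_trans ex.
- have cF (x : R) : 0 < x -> {for x, continuous F}.
    move=> x0; apply: differentiable_continuous; apply/derivable1_diffP.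
    by case: (dF x x0).
  split.
  + move=> x; rewrite in_itv/= => /andP[ex _].
    by case: (dF x (lt_le_trans e0 (ltW ex))).
  + by apply: cvg_at_right_filter; exact: cF.
  + by apply: cvg_at_left_filter; exact: cF.
- move=> x; rewrite in_itv/= => /andP[ex _].
  by rewrite derive1E; case: (dF x (lt_trans e0 ex)).
Qed.

Lemma integral_powR (a : R) : 0 <= a < 1 ->
  (\int[leb]_(x in `]0%R, 1%R]) (x `^ (- a))%:E = ((1 - a)^-1)%:E)%E.
Proof.
move=> /andP[a0 a1].
pose D (k : nat) := `[(k.+2%:R^-1 : R), 1%R]%classic.
have DU : `]0%R, 1%R]%classic = \bigcup_k D k.
  apply/seteqP; split => x /=.
    rewrite in_itv/= => /andP[x0 x1].
    have [k _ H] := near_infty_natSinv_lt (PosNum x0).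
    exists k; first by [].
    rewrite /D/= in_itv/= x1 andbT.
    have kx := H k (leqnn k); apply: le_trans (ltW kx).
    by rewrite lef_pV2 ?posrE// ler_nat.
  move=> [k _]; rewrite /D/= !in_itv/= => /andP[kx ->]; rewrite andbT.
  by apply: lt_le_trans kx; rewrite invr_gt0.
have H : (\int[leb]_(x in D k) (x `^ (- a))%:E @[k --> \oo] -->
    \int[leb]_(x in `]0%R, 1%R]) (x `^ (- a))%:E)%E.
  rewrite DU; apply: ge0_nondecreasing_set_cvg_integral.
  - move=> k l kl; apply/subsetPset => x; rewrite /D/= !in_itv/= => /andP[kx ->].
    rewrite andbT; apply: le_trans kx.
    by rewrite lef_pV2 ?posrE// ler_nat !ltnS.
  - by move=> k; exact: measurable_itv.
  - by move=> k; apply/measurable_EFinP; apply: measurable_funTS; exact: measurable_powR.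
  - by move=> k x _; rewrite lee_fin powR_ge0.
have E k : (\int[leb]_(x in D k) (x `^ (- a))%:E = ((1 - (k.+2%:R^-1) `^ (1 - a)) / (1 - a))%:E)%E.
  by rewrite integral_powR_itv// invr_gt0 ltr0n/= invf_lt1 ?ltr1n.
move: H; rewrite (funext E) => H; apply/esym/(cvg_unique _ _ H) => //.
apply/fine_cvgP; split; first by apply: nearW.
rewrite -[X in _ --> X]mul1r; apply: cvgM; last exact: cvg_cst.
rewrite -[X in _ --> X]subr0; apply: cvgB; first exact: cvg_cst.
have := powR_cvg0 (_ : 0 < 1 - a); rewrite subr_gt0 => /(_ a1)/cvg_at_rightP; apply.
split; first by move=> k; rewrite invr_gt0.
by rewrite (cvg_shiftS (@harmonic R)); exact: cvg_harmonic.
Qed.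

End powers.

Section exponential.
Context (R : realType).
Local Notation leb := (@lebesgue_measure R).

Definition expo : probability (measurableTypeR R) R.
Proof. by refine (exponential_prob 1 : probability _ R); exact: ltr01. Defined.

Lemma measurable_norm_pow (c : R) (k : nat) :
  measurable_fun setT (fun l : R => (c + `|l|) ^+ k).
Proof. by apply: measurable_funX; apply: measurable_funD => //; exact: measurableT_comp. Qed.

Local Open Scope ereal_scope.

Lemma integral_expo (f : measurableTypeR R -> \bar R) : measurable_fun setT f ->
  (forall x, 0 <= f x) ->
  \int[expo]_x f x = \int[leb]_x (f x * (exponential_pdf 1 x)%:E).
Proof.
have p0 x : 0 <= (exponential_pdf (1 : R) x)%:E by rewrite lee_fin exponential_pdf_ge0.
have mp : measurable_fun setT (fun x : measurableTypeR R => (exponential_pdf (1 : R) x)%:E).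
  by apply/measurable_EFinP; exact: measurable_exponential_pdf.
apply: (@ge0_measurable_ind _ _ R (fun f => \int[expo]_x f x =
  \int[leb]_x (f x * (exponential_pdf 1 x)%:E))).
- move=> A mA; rewrite integral_indic// setIT.
  rewrite -[LHS]/(\int[leb]_(x in A) (exponential_pdf 1 x)%:E) integral_mkcond; apply: eq_integral => x _.
  rewrite patchE /= indicE; case: (x \in A); by rewrite ?mul1e ?mul0e.
- move=> c {}f c0 mf f0 IH; rewrite ge0_integralZl_EFin// IH -ge0_integralZl_EFin//.
  + by apply: eq_integral => x _; rewrite muleA.
  + by move=> x _; rewrite mule_ge0.
  + exact: emeasurable_funM.
- move=> {}f g mf f0 mg g0 IHf IHg; rewrite ge0_integralD// IHf IHg -ge0_integralD//.
  + by apply: eq_integral => x _; rewrite ge0_muleDl.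
  + by move=> x _; rewrite mule_ge0.
  + exact: emeasurable_funM.
  + by move=> x _; rewrite mule_ge0.
  + exact: emeasurable_funM.
- move=> {}f mf f0 ndf IH; rewrite monotone_convergence//.
  under eq_fun do rewrite IH.
  rewrite -monotone_convergence//.
  + apply: eq_integral => x _; under eq_fun do rewrite muleC.
    rewrite limeMl 1?muleC//.
    by apply: ereal_nondecreasing_is_cvgn; exact: ndf.
  + by move=> n; exact: emeasurable_funM.
  + by move=> n x _; rewrite mule_ge0.
  + by move=> x _ m n mn; rewrite lee_wpmul2r//; exact: ndf.
Qed.

(** From [1 + x <= 6 exp(x/6)] one gets [(1 + x)^3 exp(-x) <= 6^3 exp(-x/2)], and [exp(-x/2)] is
    twice the exponential density of parameter 1/2. *)
Lemma expo_moment3 : \int[expo]_l ((1 + `|l|) ^+ 3)%:E <= (6 ^+ 3 * 2)%:E.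
Proof.
have p0 r x : (0 <= r)%R -> 0 <= (exponential_pdf (r : R) x)%:E.
  by move=> r0; rewrite lee_fin exponential_pdf_ge0.
have h0 : (0 <= 2^-1 :> R)%R by rewrite invr_ge0.
have mp r : measurable_fun setT (fun x : measurableTypeR R => (exponential_pdf (r : R) x)%:E).
  by apply/measurable_EFinP; exact: measurable_exponential_pdf.
have mf : measurable_fun setT (fun l : measurableTypeR R => ((1 + `|l|) ^+ 3)%:E).
  by apply/measurable_EFinP; exact: measurable_norm_pow.
have f0 (x : R) : 0 <= ((1 + `|x|) ^+ 3)%:E by rewrite lee_fin exprn_ge0// addr_ge0.
rewrite integral_expo//.
have -> : (6 ^+ 3 * 2 : R)%:E = (6 ^+ 3 * 2)%:E * \int[leb]_x (exponential_pdf 2^-1 x)%:E.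
  by rewrite integral_exponential_pdf ?mule1// invr_gt0.
rewrite -ge0_integralZl_EFin//; last by move=> x _; exact: p0.
apply: ge0_le_integral => //.
- by move=> x _; rewrite mule_ge0// p0.
- by apply: emeasurable_funM.
- by apply: emeasurable_funM.
move=> x _; rewrite -!EFinM lee_fin.
have [x0|x0] := ltP x 0%R; first by rewrite !lt0_exponential_pdf// !mulr0.
rewrite !exponential_pdfE// ger0_norm// !mulN1r mul1r mulNr.
have -> : (- x = - (2^-1 * x) - (2^-1 * x))%R by lra.
rewrite expRD mulrA mulrA ler_wpM2r ?expR_ge0// expRN ler_pdivrMr ?expR_gt0//.
have -> : (2^-1 * x = 3%:R * (x / 6))%R by lra.
rewrite expRM_natl.
rewrite mulfK//.
rewrite -exprMn lerXn2r ?nnegrE ?addr_ge0// ?mulr_ge0 ?expR_ge0//.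
have := expR_ge1Dx (x / 6); lra.
Qed.

End exponential.

Section product_measure.
Context d1 d2 (T1 : measurableType d1) (T2 : measurableType d2) (R : realType).
Variables (m1 : {sigma_finite_measure set T1 -> \bar R})
  (m2 : {sigma_finite_measure set T2 -> \bar R}).
Local Open Scope ereal_scope.

Lemma sigma_finite_prod : sigma_finite setT (m1 \x m2).
Proof.
have /sigma_finiteP[F [FT ndF Foo]] := sigma_finiteT m1.
have /sigma_finiteP[G [GT ndG Goo]] := sigma_finiteT m2.
exists (fun n => F n `*` G n).
  rewrite -setXTT FT GT; apply/seteqP; split => [[x y] [/= [n _ Fx] [k _ Gy]]|[x y] [n _ [Fx Gy]]].
    exists (maxn n k) => //; split => /=.
      by move: x Fx; apply/subsetPset/ndF/leq_maxl.
    by move: y Gy; apply/subsetPset/ndG/leq_maxr.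
  by split; exists n.
move=> k; have [mF Fk] := Foo k; have [mG Gk] := Goo k.
split; first exact: measurableX.
by rewrite product_measure1E// lte_mul_pinfty// ge0_fin_numE.
Qed.

Definition prodm : {sigma_finite_measure set (T1 * T2)%type -> \bar R} :=
  sigma_finite_version sigma_finite_prod.

End product_measure.

Section product_integral.
Context d1 d2 d3 (T1 : measurableType d1) (T2 : measurableType d2)
  (T3 : measurableType d3) (R : realType).
Variables (m1 : {sigma_finite_measure set T1 -> \bar R})
  (m2 : {sigma_finite_measure set T2 -> \bar R})
  (m3 : {sigma_finite_measure set T3 -> \bar R}).
Local Open Scope ereal_scope.

Lemma integral_prod2 (F : T1 -> \bar R) (H : T2 -> \bar R) :
  measurable_fun setT F -> (forall x, 0 <= F x) ->
  measurable_fun setT H -> (forall x, 0 <= H x) ->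
  \int[prodm m1 m2]_p (F p.1 * H p.2) = \int[m1]_x F x * \int[m2]_y H y.
Proof.
move=> mF F0 mH H0; rewrite (@fubini_tonelli1 _ _ _ _ R m1 m2 (fun p => F p.1 * H p.2)); last 2 first.
- by apply: emeasurable_funM; exact: measurableT_comp.
- by move=> x; rewrite mule_ge0.
rewrite -ge0_integralZr//; last by apply: integral_ge0.
by apply: eq_integral => x _; rewrite /fubini_F/= ge0_integralZl.
Qed.

Lemma integral_prod3 (F : T1 -> \bar R) (H : T2 * T3 -> \bar R) :
  measurable_fun setT F -> (forall x, 0 <= F x) ->
  measurable_fun setT H -> (forall x, 0 <= H x) ->
  \int[prodm (prodm m1 m2) m3]_p (F p.1.1 * H (p.1.2, p.2)) =
  \int[m1]_x F x * \int[m3]_l \int[m2]_b H (b, l).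
Proof.
move=> mF F0 mH H0.
have mH' : measurable_fun setT (fun p : (T1 * T2) * T3 => H (p.1.2, p.2)).
  by apply: (measurable_comp measurableT (subsetT _) mH); exact: measurable_pair12.
have mFH : measurable_fun setT (fun p : (T1 * T2) * T3 => F p.1.1 * H (p.1.2, p.2)).
  apply: emeasurable_funM => //.
  exact: (measurableT_comp mF (measurableT_comp measurable_fst measurable_fst)).
rewrite (@fubini_tonelli1 _ _ _ _ R (prodm m1 m2) m3 _ mFH); last by move=> x; rewrite mule_ge0.
have mK : measurable_fun setT (fun b => \int[m3]_l H (b, l)).
  exact: (@measurable_fun_fubini_tonelli_F _ _ _ _ _ m3 H mH H0).
transitivity (\int[prodm m1 m2]_z (F z.1 * (\int[m3]_l H (z.2, l)))).
  apply: eq_integral => -[x b] _; rewrite /fubini_F/= ge0_integralZl//.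
  exact: (measurableT_comp mH (measurable_pair1 _)).
rewrite (@integral_prod2 F (fun b => \int[m3]_l H (b, l)))//; last first.
  by move=> x; apply: integral_ge0.
congr (_ * _).
exact: (@fubini_tonelli _ _ _ _ R m2 m3 H mH H0).
Qed.

End product_integral.

Section canonical_measures.
Context (R : realType).
Local Notation leb := (@lebesgue_measure R).
Local Open Scope ereal_scope.

Let mid : measurable_fun setT (id : measurableTypeR R -> R).
Proof. exact: (@measurable_id _ R setT). Qed.

Let sf_image (m : {sigma_finite_measure set (measurableTypeR R) -> \bar R}) :
  sigma_finite setT (rimage mid measurableT m).
Proof.
have [F FU Foo] := sigma_finiteT m.
exists F => // i; have [? ?] := Foo i.
by split => //; rewrite /rimage/= setTI.
Qed.

(* The library measures live on [measurableTypeR R]; these are their copies on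
   the canonical measurable structure of [R]. *)
Definition lebC : {sigma_finite_measure set R -> \bar R} := sigma_finite_version (sf_image leb).
Definition expoC : {sigma_finite_measure set R -> \bar R} := sigma_finite_version (sf_image (expo R)).

Lemma lebCE A : lebC A = leb A.
Proof. by rewrite -[LHS]/(leb (setT `&` A)) setTI. Qed.

Lemma integral_lebC (f : R -> \bar R) : measurable_fun setT f -> (forall x, 0 <= f x) ->
  \int[lebC]_x f x = \int[leb]_x f x.
Proof. by move=> mf f0; exact: (@integral_rimage _ _ _ _ _ _ _ mid measurableT leb f mf f0). Qed.

Lemma integral_expoC (f : R -> \bar R) : measurable_fun setT f -> (forall x, 0 <= f x) ->
  \int[expoC]_x f x = \int[expo R]_x f x.
Proof. by move=> mf f0; exact: (@integral_rimage _ _ _ _ _ _ _ mid measurableT (expo R) f mf f0). Qed.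

End canonical_measures.

Section image_prod.
Context d1 d2 d1' d2' (X1 : measurableType d1) (X2 : measurableType d2)
  (Y1 : measurableType d1') (Y2 : measurableType d2') (R : realType).
Variables (T1 : X1 -> Y1) (T2 : X2 -> Y2) (D1 : set X1) (D2 : set X2).
Hypotheses (mT1 : measurable_fun setT T1) (mD1 : measurable D1).
Variables (m1 : {measure set X1 -> \bar R}) (m2 : {sigma_finite_measure set X2 -> \bar R}).
Variables (n1 : {measure set Y1 -> \bar R}) (n2 : {sigma_finite_measure set Y2 -> \bar R}).
Local Open Scope ereal_scope.

(** Integration over sections: the hypothesis on the second factor treats the inner measure, and a
    change of variables treats the outer integral. *)
Lemma image_prod (A : set (Y1 * Y2)) :
  (forall B, measurable B -> n1 B = m1 (D1 `&` T1 @^-1` B)) ->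
  (forall B, measurable B -> n2 B = m2 (D2 `&` T2 @^-1` B)) ->
  measurable A ->
  (n1 \x n2) A = (m1 \x m2) ((D1 `*` D2) `&` (fun p => (T1 p.1, T2 p.2)) @^-1` A).
Proof.
move=> E1 E2 mA; rewrite /product_measure1/=.
transitivity (\int[rimage mT1 mD1 m1]_y n2 (xsection A y)).
  by apply: eq_measure_integral => B mB _; rewrite E1.
rewrite integral_rimage; last 2 first.
- exact: measurable_fun_xsection.
- by move=> y; exact: measure_ge0.
rewrite integral_mkcond; apply: eq_integral => x _; rewrite patchE.
case: ifPn => [xD|xD] /=.
  rewrite E2; last exact: measurable_xsection.
  congr (m2 _); apply/seteqP; split => y; rewrite /xsection /= !inE/=.
    by move=> [? ?]; split => //; split => //; exact: set_mem.
  by move=> [[? ?] ?].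
rewrite (_ : xsection _ _ = set0) ?measure0//; apply/seteqP; split => y //.
by rewrite /xsection/= inE/= => -[[xD1 _] _]; move: xD; rewrite notin_setE.
Qed.

End image_prod.

Section identity_prod.
Context d1 d2 d1' d2' (X1 : measurableType d1) (X2 : measurableType d2)
  (Y1 : measurableType d1') (Y2 : measurableType d2') (R : realType).
Variables (T1 : X1 -> Y1) (T2 : X2 -> Y2).
Hypothesis mT1 : measurable_fun setT T1.
Variables (m1 : {measure set X1 -> \bar R}) (m2 : {sigma_finite_measure set X2 -> \bar R}).
Variables (n1 : {measure set Y1 -> \bar R}) (n2 : {sigma_finite_measure set Y2 -> \bar R}).
Local Open Scope ereal_scope.

Lemma image_prodT (A : set (Y1 * Y2)) :
  (forall B, measurable B -> n1 B = m1 (T1 @^-1` B)) ->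
  (forall B, measurable B -> n2 B = m2 (T2 @^-1` B)) ->
  measurable A ->
  (n1 \x n2) A = (m1 \x m2) ((fun p => (T1 p.1, T2 p.2)) @^-1` A).
Proof.
move=> E1 E2 mA; rewrite (image_prod (T2 := T2) (D2 := setT) mT1 measurableT (m1 := m1) (m2 := m2))//.
- by rewrite setXTT setTI.
- by move=> B mB; rewrite setTI E1.
- by move=> B mB; rewrite setTI E2.
Qed.

End identity_prod.

Section intensities.
Context (R : realType).
Local Notation leb := (@lebesgue_measure R).
Local Open Scope ereal_scope.

Let mid : measurable_fun setT (id : measurableTypeR R -> R).
Proof. exact: (@measurable_id _ R setT). Qed.

Definition intensity_STC := prodm (prodm (prodm (lebC R) (lebC R)) (lebC R)) (expoC R).
Definition intensity_SRC := prodm (prodm (lebC R) (lebC R)) (lebC R).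

Let pair_eta (S T : Type) (B : set (S * T)) : (fun p => (p.1, p.2)) @^-1` B = B.
Proof. by apply/seteqP; split => -[]. Qed.

Let mid2 : measurable_fun setT (id : measurableTypeR R * measurableTypeR R -> R * R).
Proof. exact: (@measurable_id _ (R * R)%type setT). Qed.

Let mid3 : measurable_fun setT
  (id : measurableTypeR R * measurableTypeR R * measurableTypeR R -> R * R * R).
Proof. exact: (@measurable_id _ (R * R * R)%type setT). Qed.

Lemma lebC2E B : measurable B -> (lebC R \x lebC R) B = (leb \x leb) B.
Proof.
move=> mB; apply: etrans; first apply: (@image_prodT _ _ _ _ _ _ _ _ _ (id : measurableTypeR R -> R)
  (id : measurableTypeR R -> R) mid leb leb (lebC R) (lebC R) B).
- by move=> C _; exact: lebCE.
- by move=> C _; exact: lebCE.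
- exact: mB.
by rewrite pair_eta.
Qed.

Lemma intensity_SRE B : measurable B -> intensity_SRC B = intensity_SR B.
Proof.
move=> mB; apply: etrans; first apply: (@image_prodT _ _ _ _ _ _ _ _ _
  (id : measurableTypeR R * measurableTypeR R -> R * R) (id : measurableTypeR R -> R) mid2
  (leb \x leb) leb (prodm (lebC R) (lebC R)) (lebC R) B).
- exact: lebC2E.
- by move=> C _; exact: lebCE.
- exact: mB.
by rewrite pair_eta.
Qed.

Lemma expoCE B : expoC R B = expo R B.
Proof. by rewrite -[LHS]/(expo R (setT `&` B)) setTI. Qed.

Lemma intensity_STE B : measurable B -> intensity_STC B = intensity_ST B.
Proof.
move=> mB; apply: etrans; first apply: (@image_prodT _ _ _ _ _ _ _ _ _
  (id : measurableTypeR R * measurableTypeR R * measurableTypeR R -> R * R * R)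
  (id : measurableTypeR R -> R) mid3
  ((leb \x leb) \x leb) (expo R) intensity_SRC (expoC R) B).
- exact: intensity_SRE.
- by move=> C _; exact: expoCE.
- exact: mB.
by rewrite pair_eta.
Qed.

End intensities.

(** * Changes of variable between the rates *)

Section half_line.
Context (R : realType).

(** The measures are restricted to the half-line, where []a, b]] is a difference of two intervals
    starting at 0; the half-open intervals are a generating pi-system. *)
Lemma measure_half_line_unique (m1 m2 : {measure set R -> \bar R}) :
  (forall b : R, 0 < b -> m1 `]0, b]%classic = m2 `]0, b]%classic) ->
  (forall b : R, 0 < b -> (m1 (`]0%R, b]%classic) < +oo)%E) ->
  forall A : set R, measurable A -> A `<=` `]0, +oo[%classic -> m1 A = m2 A.
Proof.
move=> E F A mA A0.
have mI : measurable (`]0, +oo[%classic : set R) by exact: measurable_itv.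
have res (m : {measure set R -> \bar R}) : m A = mrestr m mI A.
  by rewrite /mrestr; congr (m _); apply/esym/setIidl.
apply: etrans (res m1) _; apply: etrans (esym (res m2)); clear A0 res.
pose g (k : nat) : set R := `]- k%:R, k%:R]%classic.
have E' b : m1 `]0, b]%classic = m2 `]0, b]%classic.
  have [b0|b0] := ltP 0 b; first exact: E.
  by rewrite set_itv_ge ?measure0// bnd_simp -leNgt.
have F' b : (m1 (`]0%R, b]%classic) < +oo)%E.
  have [b0|b0] := ltP 0 b; first exact: F.
  by rewrite set_itv_ge ?measure0// bnd_simp -leNgt.
apply: (measure_unique (@ocitv R) g) => //.
- exact: ocitvI.
- by move=> k; exists (- k%:R, k%:R).
- apply/seteqP; split => // x _; exists (Num.truncn `|x|).+1 => //=.
  have := truncnS_gt `|x|; rewrite /g/= in_itv/= => xk.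
  by move: xk; rewrite ltr_norml => /andP[-> /ltW ->].
- move=> B [[a b]/= _ <-]; rewrite /mrestr.
  have -> : `]a, b] `&` `]0, +oo[ = `]0, b] `\` `]0, a] :> set R.
    apply/seteqP; split => x/=; rewrite !in_itv/= ?andbT.
      by move=> [/andP[ax ->] ->]; split => //; rewrite /= (ltNge a) in ax *; exact/negP.
    by move=> [/andP[x0 ->]]; rewrite x0 /= => /negP; rewrite -ltNge => ->.
  have H (m : {measure set R -> \bar R}) : (m `]0%R, b]%classic < +oo)%E ->
      (m (`]0%R, b] `\` `]0%R, a]) = m `]0%R, b]%classic - m `]0%R, Num.min b a]%classic)%E.
    move=> moo; rewrite measureD//; congr (_ - m _)%E.
    apply/seteqP; split => x/=; rewrite !in_itv/= le_min.
      by move=> [/andP[-> ->] /andP[_ ->]].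
    by move=> /andP[-> /andP[-> ->]].
  by rewrite !H ?E'// -E'.
- move=> k; rewrite /mrestr; apply: le_lt_trans (F' k%:R).
  rewrite -[X in (X <= _)%E]/(m1 (g k `&` `]0, +oo[)).
  apply: le_measure; rewrite ?inE.
  - by apply: measurableI => //; exact: measurable_itv.
  - exact: measurable_itv.
  move=> x [/=]; rewrite /g/= !in_itv/= andbT => /andP[_ xk] x0.
  by rewrite x0.
Qed.

End half_line.

Section restriction.
Context d (X : measurableType d) (R : realType).
Local Open Scope ereal_scope.
Variables (m : {sigma_finite_measure set X -> \bar R}) (D : set X) (mD : measurable D).

Lemma sigma_finite_mrestr : sigma_finite setT (mrestr m mD).
Proof.
have [F FU Foo] := sigma_finiteT m.
exists F => // i; have [mF Fi] := Foo i; split => //.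
by apply: le_lt_trans Fi; rewrite /mrestr; apply: le_measure; rewrite ?inE//; exact: measurableI.
Qed.

Definition sigma_finite_restr : {sigma_finite_measure set X -> \bar R} :=
  sigma_finite_version sigma_finite_mrestr.

Lemma integral_restr (f : X -> \bar R) :
  measurable_fun setT f -> (forall x, 0 <= f x) ->
  \int[sigma_finite_restr]_x f x = \int[m]_(x in D) f x.
Proof.
move=> mf f0; have mid : measurable_fun setT (id : X -> X) by exact: measurable_id.
rewrite -(integral_rimage mid mD m mf f0).
by apply: eq_measure_integral => A mA _; rewrite /rimage/= setIC.
Qed.

End restriction.

Section rates.
Context (R : realType).
Local Open Scope ereal_scope.

Definition half_open (n : R) : set R := `]0%R, n]%classic.
Definition positives : set R := `]0%R, +oo[%classic.

Lemma measurable_half_open n : measurable (half_open n). Proof. exact: measurable_itv. Qed.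
Lemma measurable_positives : measurable positives. Proof. exact: measurable_itv. Qed.

(* Rate of the points (v, b, l) with v in D. *)
Definition rate (D : set R) (mD : measurable D) :=
  prodm (prodm (sigma_finite_restr (lebC R) mD) (lebC R)) (expoC R).

Lemma lebC_half_open (b : R) : (0 <= b)%R -> lebC R (half_open b) = b%:E.
Proof.
move=> b0; rewrite lebCE /half_open lebesgue_measure_itv/= lte_fin.
by move: b0; rewrite le_eqVlt => /predU1P[<-|b0]; rewrite ?ltxx ?b0 -?EFinB ?subr0.
Qed.

Lemma lebC_segment (b : R) : (0 < b)%R -> lebC R `[0%R, b]%classic = b%:E.
Proof. by move=> b0; rewrite lebCE lebesgue_measure_itv/= lte_fin b0 -EFinB subr0. Qed.

Lemma half_openI (a b : R) : half_open a `&` half_open b = half_open (Num.min a b).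
Proof.
apply/seteqP; split => x; rewrite /half_open/= !in_itv/= le_min.
  by move=> [/andP[-> ->] /andP[_ ->]].
by move=> /andP[-> /andP[-> ->]].
Qed.

(** Stretching the weights by [n] divides their density by [n], and the [n] units of position
    compensate: the scaled weights have unit rate on []0, n]]. *)
Lemma scaled_window (n : nat) (B : set R) : (0 < n)%N -> measurable B ->
  lebC R (B `&` half_open n%:R) =
  (lebC R \x lebC R) ((`[0%R, n%:R]%classic `*` half_open 1) `&`
    (fun p => n%:R * p.2)%R @^-1` B).
Proof.
move=> n0 mB.
have n0' : (0 < n%:R :> R)%R by rewrite ltr0n.
have mT : measurable_fun setT (fun p : R * R => n%:R * p.2)%R.
  by apply: measurable_funM => //; exact: measurable_snd.
have mD : measurable (`[0%R, n%:R]%classic `*` half_open 1 : set (R * R)).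
  by apply: measurableX; [exact: measurable_itv|exact: measurable_half_open].
have mI := measurable_half_open n%:R.
have I0 (A : set R) : measurable A -> A `<=` positives ->
    mrestr (lebC R) mI A = rimage mT mD (prodm (lebC R) (lebC R)) A.
  have E b : (0 < b)%R -> mrestr (lebC R) mI (half_open b) =
      rimage mT mD (prodm (lebC R) (lebC R)) (half_open b).
    move=> b0; rewrite /mrestr /rimage half_openI lebC_half_open ?le_min ?ltW//.
    have -> : (`[0%R, n%:R]%classic `*` half_open 1) `&` (fun p : R * R => n%:R * p.2)%R @^-1` half_open b
       = `[0%R, n%:R]%classic `*` half_open (Num.min 1 (b / n%:R))%R.
      apply/seteqP; split => -[x u]; rewrite /half_open/= !in_itv/= le_min.
        by move=> [[-> /andP[-> ->]] /andP[_]]; rewrite ler_pdivlMr// mulrC.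
      move=> [-> /andP[u0 /andP[-> ub]]]; rewrite u0; split => //.
      by rewrite mulr_gt0//= mulrC -ler_pdivlMr.
    apply: etrans; last (apply/esym; apply: product_measure1E;
      [exact: measurable_itv|exact: measurable_half_open]).
    rewrite lebC_half_open ?le_min ?ler01 ?divr_ge0 ?ltW//.
    transitivity (n%:R%:E * (Num.min 1 (b / n%:R))%R%:E);
      last by congr (_ * _); apply/esym; exact: lebC_segment.
    rewrite -EFinM.
    by rewrite minr_pMr ?ltW// mulr1 mulrCA mulfV ?gt_eqF// mulr1 minC.
  apply: (measure_half_line_unique (m1 := mrestr (lebC R) mI)
    (m2 := rimage mT mD (prodm (lebC R) (lebC R)))) => //.
  move=> b b0; rewrite -[X in X < _]/(lebC R (half_open b `&` half_open n%:R)).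
  by rewrite half_openI lebC_half_open ?le_min ?ltW// ltry.
have := I0 (B `&` positives) (measurableI _ _ mB measurable_positives) (@subIsetr _ _ _).
rewrite /mrestr /rimage -setIA => H.
transitivity (lebC R (B `&` (positives `&` half_open n%:R))).
  congr (lebC R (B `&` _)); apply/esym/setIidr => x; rewrite /half_open /positives/= !in_itv/=.
  by move=> /andP[->].
rewrite H -[LHS]/((lebC R \x lebC R) _); congr ((lebC R \x lebC R) _).
apply/seteqP; split => -[x u] /=; first by move=> [? []].
move=> [Dp Bu]; split => //; split => //.
by move: Dp; rewrite /half_open /positives/= !in_itv/= => -[_ /andP[u0 _]]; rewrite mulr_gt0.
Qed.

(** The map is decreasing: the image of [j] is at most [b] exactly when [j >= c b^-g], a half-line
    of [nu]-mass [b]. *)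
Lemma jump_image (nu : {measure set R -> \bar R}) (c g : R) (B : set R) : (0 < c)%R -> (0 < g)%R ->
  (forall a : R, (0 < a)%R -> nu `[a, +oo[%classic = (c `^ g^-1 * a `^ (- g^-1))%R%:E) ->
  measurable B ->
  lebC R (B `&` positives) = nu (positives `&` (fun j => (j / c) `^ (- g^-1))%R @^-1` B).
Proof.
move=> c0 g0 nuE mB.
have mT : measurable_fun setT (fun j : R => (j / c) `^ (- g^-1))%R.
  by apply: (measurableT_comp (measurable_powR _)); exact: measurable_funM.
have mD := measurable_positives.
have I0 (A : set R) : measurable A -> A `<=` positives -> lebC R A = rimage mT mD nu A.
  have E b : (0 < b)%R -> lebC R (half_open b) = rimage mT mD nu (half_open b).
    move=> b0; rewrite lebC_half_open ?ltW// /rimage.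
    have -> : positives `&` (fun j => (j / c) `^ (- g^-1))%R @^-1` half_open b =
        `[(c * b `^ (- g))%R, +oo[%classic.
      apply/seteqP; split => j; rewrite /positives /half_open/= !in_itv/= !andbT.
        move=> [j0 /andP[_ jb]].
        have jc : (0 < j / c)%R by rewrite divr_gt0.
        rewrite mulrC -ler_pdivlMr//.
        have : (((j / c) `^ (- g^-1)) `^ g <= b `^ g)%R.
          by rewrite ge0_ler_powR ?nnegrE ?powR_ge0// ltW.
        rewrite -powRrM mulNr mulVf ?gt_eqF// (powR_inv1 (ltW jc)) => H.
        by rewrite powRN -(invrK (j / c)%R) lef_pV2 ?posrE ?invr_gt0 ?powR_gt0.
      move=> jb; have j0 : (0 < j)%R.
        by apply: lt_le_trans jb; rewrite mulr_gt0// powR_gt0.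
      have jc : (0 < j / c)%R by rewrite divr_gt0.
      split => //; rewrite powR_gt0//=.
      have {}jb : (b `^ (- g) <= j / c)%R by rewrite ler_pdivlMr// mulrC.
      rewrite powRN invf_ple ?posrE ?powR_gt0//.
      have -> : (b^-1 = (b `^ (- g)) `^ g^-1)%R.
        by rewrite -powRrM mulNr mulfV ?gt_eqF// powR_inv1 ?ltW.
      by rewrite ge0_ler_powR ?nnegrE ?powR_ge0 ?invr_ge0// ltW.
    rewrite nuE ?mulr_gt0 ?powR_gt0//; congr EFin.
    rewrite powRM ?ltW ?powR_gt0// mulrA -powRD; last by rewrite (gt_eqF c0) implybT.
    by rewrite subrr powRr0 mul1r -powRrM mulrNN mulfV ?gt_eqF// powRr1// ltW.
  apply: (measure_half_line_unique (m1 := lebC R) (m2 := rimage mT mD nu)) => //.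
  by move=> b b0; rewrite -[X in X < _]/(lebC R (half_open b)) lebC_half_open ?ltW// ltry.
rewrite (I0 (B `&` positives) (measurableI _ _ mB measurable_positives) (@subIsetr _ _ _)).
rewrite /rimage; congr (nu _); apply/seteqP; split => j /=; first by move=> [? []].
move=> [j0 Bj]; split => //; split => //.
by move: j0; rewrite /positives/= !in_itv/= !andbT => j0; rewrite powR_gt0// divr_gt0.
Qed.

End rates.

Section rate_integral.
Context (R : realType).
Local Open Scope ereal_scope.

(** Integral over the marks, Lebesgue in the birth time and exponential in the lifetime: the time
    factor of every intensity. *)
Definition theta (H : R * R -> \bar R) := \int[expoC R]_l \int[lebC R]_b H (b, l).

Lemma integral_rate (D : set R) (mD : measurable D) (F : R -> \bar R) (H : R * R -> \bar R) :
  measurable_fun setT F -> (forall x, 0 <= F x) ->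
  measurable_fun setT H -> (forall x, 0 <= H x) ->
  \int[rate mD]_p (F p.1.1 * H (p.1.2, p.2)) = (\int[lebC R]_(v in D) F v) * theta H.
Proof. by move=> mF F0 mH H0; rewrite integral_prod3// integral_restr. Qed.

Lemma integral_STC (F : R * R -> \bar R) (H : R * R -> \bar R) :
  measurable_fun setT F -> (forall x, 0 <= F x) ->
  measurable_fun setT H -> (forall x, 0 <= H x) ->
  \int[intensity_STC R]_p (F p.1.1 * H (p.1.2, p.2)) =
  \int[prodm (lebC R) (lebC R)]_p F p * theta H.
Proof. exact: integral_prod3. Qed.

Lemma integral_SRC (F : R * R -> \bar R) (H : R -> \bar R) :
  measurable_fun setT F -> (forall x, 0 <= F x) ->
  measurable_fun setT H -> (forall x, 0 <= H x) ->
  \int[intensity_SRC R]_p (F p.1 * H p.2) =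
  \int[prodm (lebC R) (lebC R)]_p F p * \int[lebC R]_r H r.
Proof. exact: integral_prod2. Qed.

Lemma lebC_itv (a b : R) : lebC R `[a, b]%classic = (Num.max (b - a) 0)%R%:E.
Proof.
rewrite lebCE lebesgue_measure_itv/= lte_fin; case: ltP => ab.
  by rewrite -[LHS]/((b - a)%R%:E) maxEle; congr EFin; case: leP => //; lra.
by congr EFin; rewrite maxEle; case: leP => //; lra.
Qed.

Definition nonneg : set R := `[0%R, +oo[%classic.

Lemma measurable_nonneg : measurable nonneg. Proof. exact: measurable_itv. Qed.

Lemma expoC_nonneg B : measurable B -> expoC R (nonneg `&` B) = expoC R B.
Proof.
move=> mB; rewrite !expoCE -[LHS]/(exponential_prob 1 _) -[RHS]/(exponential_prob 1 _).
rewrite /exponential_prob integral_mkcond [RHS]integral_mkcond; apply: eq_integral => x _.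
rewrite !patchE in_setI; case: (boolP (x \in nonneg)) => //= /negP x0.
case: (x \in B) => //; rewrite lt0_exponential_pdf// ltNge; apply/negP => h; apply: x0.
by rewrite inE/= /nonneg/= in_itv/= h.
Qed.

Lemma expoCT : expoC R setT = 1.
Proof. by rewrite expoCE; exact: probability_setT. Qed.

End rate_integral.

Lemma poisson_process_eq (R : realType) d (Omega : measurableType d) (P : probability Omega R)
    dX (X : measurableType dX) (E : set X) (mu mu' : set X -> \bar R) (eta : Omega -> set X) :
  (forall A, measurable A -> mu' A = mu A) ->
  poisson_process P E mu eta -> poisson_process P E mu' eta.
Proof.
move=> e [h1 h2 h3 h4 h5]; split => // A mA AE.
by have [a b] := h4 A mA AE; split => [r|]; rewrite e//; exact: a.
Qed.

Lemma poisson_rm_eq (R : realType) d (Omega : measurableType d) (P : probability Omega R)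
    dX (X : measurableType dX) (mu mu' : {measure set X -> \bar R})
    (M : Omega -> {measure set X -> \bar R}) :
  (forall A, measurable A -> mu' A = mu A) -> poisson_rm P mu M -> poisson_rm P mu' M.
Proof.
move=> e [h1 [C [mC ndC CT muC MC]] h3]; split => //.
  by exists C; split => // i; rewrite e.
by move=> A mA r; rewrite e//; exact: h3.
Qed.

Lemma mul_lty (R : realType) (x y : \bar R) :
  (0 <= x -> 0 <= y -> x < +oo -> y < +oo -> x * y < +oo)%E.
Proof. by move=> x0 y0 xoo yoo; rewrite lte_mul_pinfty// ge0_fin_numE. Qed.

(** * Exhausting sequences of finite intensity *)

Section covers.
Context (R : realType).
Local Open Scope ereal_scope.

Definition seg (i : nat) : set R := `[(- i%:R)%R, i%:R%R]%classic.

Lemma seg_nd : nondecreasing_seq seg.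
Proof.
move=> i j ij; apply/subsetPset => x; rewrite /seg/= !in_itv/= => /andP[a b].
have : (i%:R <= j%:R :> R)%R by rewrite ler_nat.
by move=> h; apply/andP; split; lra.
Qed.

Lemma seg_cover (x y : R) : exists i, seg i x /\ seg i y.
Proof.
exists (Num.truncn (`|x| + `|y|)%R).+1.
have := truncnS_gt (`|x| + `|y|)%R; rewrite /seg/= !in_itv/= -!ler_norml => h.
by split; [have := normr_ge0 y|have := normr_ge0 x]; lra.
Qed.

Lemma lebC_seg i : lebC R (seg i) < +oo. Proof. by rewrite lebC_itv ltry. Qed.

Lemma measurable_seg i : measurable (seg i). Proof. exact: measurable_itv. Qed.

Lemma measurable_space_ST : measurable (@space_ST R).
Proof.
rewrite (_ : @space_ST R = ((setT `*` `[0%R, 1%R]%classic) `*` setT) `*` @nonneg R); last first.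
  apply/seteqP; split => -[[[x u] b] l]; rewrite /nonneg/= !in_itv/= ?andbT.
    by move=> [? ?].
  by move=> [[[_ ?] _] ?].
apply: measurableX; last exact: measurable_nonneg.
apply: measurableX => //; apply: measurableX => //; exact: measurable_itv.
Qed.

Lemma measurable_space_SR : measurable (@space_SR R).
Proof.
rewrite (_ : @space_SR R = (setT `*` `[0%R, 1%R]%classic) `*` setT); last first.
  by apply/seteqP; split => -[[z w] r] /=; rewrite !in_itv/= => // -[[]].
apply: measurableX => //; apply: measurableX => //; exact: measurable_itv.
Qed.

Definition cover_ST i : set (R * R * R * R) := ((seg i `*` setT) `*` seg i) `*` setT.

Lemma measurable_cover_ST i : measurable (cover_ST i).
Proof.
apply: measurableX => //; apply: measurableX; last exact: measurable_seg.
by apply: measurableX => //; exact: measurable_seg.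
Qed.

Lemma cover_ST_nd : nondecreasing_seq cover_ST.
Proof.
move=> i j ij; apply/subsetPset => -[[[x u] b] l] [[[/= h1 _] /= h2] _].
by split => //=; split => /=; [split => //=|]; move/subsetPset : (seg_nd ij); apply.
Qed.

Lemma cover_STT : \bigcup_i cover_ST i = setT.
Proof.
by apply/seteqP; split => // -[[[x u] b] l] _; have [i [a c]] := seg_cover x b; exists i.
Qed.

Lemma cover_ST_fin i : intensity_STC R (cover_ST i `&` @space_ST R) < +oo.
Proof.
apply: (@le_lt_trans _ _ ((intensity_STC R) (((seg i `*` `[0%R, 1%R]%classic) `*` seg i) `*` setT))).
  apply: le_measure; rewrite ?inE.
  - by apply: measurableI; [exact: measurable_cover_ST|exact: measurable_space_ST].
  - apply: measurableX => //; apply: measurableX; last exact: measurable_seg.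
    by apply: measurableX; [exact: measurable_seg|exact: measurable_itv].
  - by move=> [[[x u] b] l] [[[[/= h1 _] /= h2] _]] [h3 _]; split => //=; split => //=; split => //=.
rewrite -[X in X < _]/((prodm (prodm (lebC R) (lebC R)) (lebC R) \x expoC R) _).
have ms := measurable_seg i; have mI : measurable (`[0%R, 1%R]%classic : set R) by exact: measurable_itv.
rewrite product_measure1E//; last by do 2 apply: measurableX => //.
rewrite expoCT mule1 -[X in X < _]/((prodm (lebC R) (lebC R) \x lebC R) _).
rewrite product_measure1E//; last exact: measurableX.
rewrite -[X in X * _]/((lebC R \x lebC R) _) product_measure1E//.
apply: mul_lty => //; [by rewrite mule_ge0| |exact: lebC_seg].
by apply: mul_lty => //; [exact: lebC_seg|rewrite lebC_itv ltry].
Qed.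

Definition cover_SR i : set (R * R * R) := (seg i `*` setT) `*` seg i.

Lemma measurable_cover_SR i : measurable (cover_SR i).
Proof.
apply: measurableX; last exact: measurable_seg.
by apply: measurableX => //; exact: measurable_seg.
Qed.

Lemma cover_SR_nd : nondecreasing_seq cover_SR.
Proof.
move=> i j ij; apply/subsetPset => -[[x u] b] [[/= h1 _] /= h2].
by split => /=; [split => //=|]; move/subsetPset : (seg_nd ij); apply.
Qed.

Lemma cover_SRT : \bigcup_i cover_SR i = setT.
Proof.
by apply/seteqP; split => // -[[x u] b] _; have [i [a c]] := seg_cover x b; exists i.
Qed.

Lemma cover_SR_fin i : intensity_SRC R (cover_SR i `&` @space_SR R) < +oo.
Proof.
apply: (@le_lt_trans _ _ ((intensity_SRC R) ((seg i `*` `[0%R, 1%R]%classic) `*` seg i))).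
  apply: le_measure; rewrite ?inE.
  - by apply: measurableI; [exact: measurable_cover_SR|exact: measurable_space_SR].
  - apply: measurableX; last exact: measurable_seg.
    by apply: measurableX; [exact: measurable_seg|exact: measurable_itv].
  - by move=> [[x u] b] [[[/= h1 _] /= h2]] h3; split => //=; split => //=.
have ms := measurable_seg i; have mI : measurable (`[0%R, 1%R]%classic : set R) by exact: measurable_itv.
rewrite -[X in X < _]/((prodm (lebC R) (lebC R) \x lebC R) _).
rewrite product_measure1E//; last exact: measurableX.
rewrite -[X in X * _]/((lebC R \x lebC R) _) product_measure1E//.
apply: mul_lty => //; [by rewrite mule_ge0| |exact: lebC_seg].
by apply: mul_lty => //; [exact: lebC_seg|rewrite lebC_itv ltry].
Qed.

(** The first coordinate is bounded only from above; the rates considered live on positive [v],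
    where this leaves finite mass. *)
Definition cover_V (i : nat) : set (R * R * R) := (`]-oo, i%:R]%classic `*` seg i) `*` setT.

Lemma measurable_cover_V i : measurable (cover_V i).
Proof.
apply: measurableX => //; apply: measurableX; [exact: measurable_itv|exact: measurable_seg].
Qed.

Lemma cover_V_nd : nondecreasing_seq cover_V.
Proof.
move=> i j ij; apply/subsetPset => -[[x u] b] [[/= h1 h2] _].
split => //=; split => /=; last by move/subsetPset : (seg_nd ij); apply.
by move: h1; rewrite !in_itv/= => /le_trans; apply; rewrite ler_nat.
Qed.

Lemma cover_VT : \bigcup_i cover_V i = setT.
Proof.
apply/seteqP; split => // -[[x u] b] _; have [i [a c]] := seg_cover x u.
exists i => //; split => //=; split => //=.
by move: a; rewrite /seg/= !in_itv/= => /andP[].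
Qed.

Lemma rate_cover_V (D : set R) (mD : measurable D) i : D `<=` @positives R ->
  rate mD (cover_V i) < +oo.
Proof.
move=> D0; rewrite -[X in X < _]/((prodm (sigma_finite_restr (lebC R) mD) (lebC R) \x expoC R) _).
have ms := measurable_seg i; have mI : measurable (`]-oo, i%:R]%classic : set R) by exact: measurable_itv.
rewrite product_measure1E//; last exact: measurableX.
rewrite expoCT mule1 -[X in X < _]/((sigma_finite_restr (lebC R) mD \x lebC R) _).
rewrite product_measure1E//.
rewrite lte_mul_pinfty//; last exact: lebC_seg.
  rewrite ge0_fin_numE//.
  apply: (@le_lt_trans _ _ (lebC R (half_open i%:R))).
    rewrite -[X in X <= _]/(lebC R (`]-oo, i%:R]%classic `&` D)); apply: le_measure; rewrite ?inE//.
    - exact: measurableI.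
    - exact: measurable_half_open.
    - move=> x [/= h /D0]; rewrite /half_open /positives/= !in_itv/= andbT => ->.
      by move: h; rewrite in_itv/=.
  by rewrite lebC_half_open// ltry.
Qed.

End covers.

(** * Window points and jump points as Poisson measures *)

Section window_points.
Context (R : realType) d (Omega : measurableType d) (P : probability Omega R).
Variable eta : Omega -> set (R * R * R * R).
Hypothesis Heta : poisson_process P (@space_ST R) (@intensity_ST R) eta.
Local Open Scope ereal_scope.

Let HetaC : poisson_process P (@space_ST R) (intensity_STC R) eta.
Proof. by apply: poisson_process_eq Heta => A mA; exact: intensity_STE. Qed.

Definition M_ST := pp_measure R (@space_ST R) eta (@cover_ST R).

Lemma M_ST_poisson : poisson_rm P (mrestr (intensity_STC R) (@measurable_space_ST R)) M_ST.
Proof.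
exact: (pp_poisson_rm HetaC (@measurable_space_ST R) (@measurable_cover_ST R)
  (@cover_ST_nd R) (@cover_STT R) (@cover_ST_fin R)).
Qed.

Definition window_map (n : nat) (p : R * R * R * R) : R * R * R :=
  (n%:R * p.1.1.2, p.1.2, p.2)%R.

Definition window_dom (n : nat) : set (R * R * R * R) :=
  ((`[0%R, n%:R]%classic `*` half_open 1) `*` setT) `*` @nonneg R.

Lemma measurable_window_map n : measurable_fun setT (window_map n).
Proof.
apply: measurable_fun_pair; last exact: measurable_snd.
apply: measurable_fun_pair; last exact: measurable_pair1_2.
apply: measurable_funM => //.
exact: (measurableT_comp (@measurable_pair1_2 _ _ _ _ _ _) measurable_fst).
Qed.

Lemma measurable_window_dom n : measurable (window_dom n).
Proof.
apply: measurableX; last exact: measurable_nonneg.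
by apply: measurableX => //; apply: measurableX; [exact: measurable_itv|exact: measurable_half_open].
Qed.

Definition window_rm (n : nat) :=
  rm_image M_ST (measurable_window_map n) (measurable_window_dom n).

(** The map acts factor by factor: [scaled_window] for position and weight, the identity for the
    birth, and for the lifetime a restriction to a set of full mass. *)
Lemma window_rate n : (0 < n)%N -> forall A, measurable A ->
  rate (measurable_half_open (n%:R : R)) A =
  rimage (measurable_window_map n) (measurable_window_dom n)
    (mrestr (intensity_STC R) (@measurable_space_ST R)) A.
Proof.
move=> n0 A mA; rewrite /rimage.
rewrite -[RHS]/(intensity_STC R (window_dom n `&` window_map n @^-1` A `&` @space_ST R)).
have -> : window_dom n `&` window_map n @^-1` A `&` @space_ST R =
    window_dom n `&` window_map n @^-1` A.
  apply/setIidl => -[[[x u] b] l] [[[[/= _ hu] _] hl] _]; split.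
    by move: hu; rewrite /half_open/= in_itv/= => /andP[/ltW -> ->].
  by move: hl; rewrite /nonneg/= in_itv/= andbT.
have mT : measurable_fun setT (fun p : R * R => n%:R * p.2)%R.
  by apply: measurable_funM => //; exact: measurable_snd.
have mT2 : measurable_fun setT (fun p : R * R * R => (n%:R * p.1.2, p.2))%R.
  apply: measurable_fun_pair; last exact: measurable_snd.
  by apply: measurable_funM => //; exact: measurable_pair1_2.
have mD : measurable (`[0%R, n%:R]%classic `*` half_open 1 : set (R * R)).
  by apply: measurableX; [exact: measurable_itv|exact: measurable_half_open].
have mD2 : measurable ((`[0%R, n%:R]%classic `*` half_open 1) `*` setT : set (R * R * R)).
  exact: measurableX.
pose lv := sigma_finite_restr (lebC R) (measurable_half_open (n%:R : R)).
rewrite -[LHS]/((prodm lv (lebC R) \x expoC R) A).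
apply: etrans; first apply: (@image_prod _ _ _ _ _ _ _ _ _ (fun p : R * R * R => (n%:R * p.1.2, p.2))%R id
  _ (@nonneg R) mT2 mD2 (intensity_SRC R) (expoC R) (prodm lv (lebC R)) (expoC R)) => //.
- move=> B mB; apply: etrans; first apply: (@image_prod _ _ _ _ _ _ _ _ _
    (fun p : R * R => n%:R * p.2)%R id _ setT mT mD (prodm (lebC R) (lebC R)) (lebC R) lv (lebC R)) => //.
  + by move=> C mC; exact: scaled_window.
  + by move=> C mC; rewrite setTI.
  by [].
- by move=> B mB; rewrite expoC_nonneg.
by [].
Qed.

Lemma window_rm_poisson n : (0 < n)%N ->
  poisson_rm P (rate (measurable_half_open (n%:R : R))) (window_rm n).
Proof.
move=> n0; have [mM [C0 [_ _ _ _ _]] _] := M_ST_poisson.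
apply: (poisson_rm_eq (window_rate n0)).
apply: (poisson_rm_image (measurable_window_map n) (measurable_window_dom n) (C := @cover_V R)) => //.
- exact: M_ST_poisson.
- exact: measurable_cover_V.
- exact: cover_V_nd.
- exact: cover_VT.
- move=> i; rewrite -[X in X < _]/(rimage (measurable_window_map n) (measurable_window_dom n)
    (mrestr (intensity_STC R) (@measurable_space_ST R)) (cover_V i)).
  rewrite -(window_rate n0 (@measurable_cover_V R i)); apply: rate_cover_V.
  by move=> x; rewrite /half_open /positives/= !in_itv/= andbT => /andP[].
- move=> w i; apply: (@le_lt_trans _ _ (M_ST w (@cover_ST R (maxn n i)))).
    apply: le_measure; rewrite ?inE.
    + apply: measurableI; first exact: measurable_window_dom.
      by rewrite -[X in measurable X]setTI; apply: measurable_window_map => //; exact: measurable_cover_V.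
    + exact: measurable_cover_ST.
    move=> [[[x u] b] l] [[[[/= hx _] _] _]] [[/= _ hb] _]; split => //; split => /=.
      split => //=; move: hx; rewrite /seg/= !in_itv/= => /andP[x0 xn].
      have h : (n%:R <= (maxn n i)%:R :> R)%R by rewrite ler_nat leq_maxl.
      by apply/andP; split; [apply: le_trans x0; rewrite oppr_le0|exact: le_trans h].
    by move: b hb; apply/subsetPset/seg_nd/leq_maxr.
  exact: (pp_measure_fin _ HetaC).
Qed.

Lemma window_rm_independent n : independent_rm P (window_rm n).
Proof.
apply: (independent_rm_image (measurable_window_map n) (measurable_window_dom n)).
exact: (pp_independent_rm HetaC (@measurable_space_ST R) (@measurable_cover_ST R) (@cover_ST_fin R)).
Qed.

End window_points.

Section jump_points.
Context (R : realType) d (Omega : measurableType d) (P : probability Omega R).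
Variables (nu : {measure set R -> \bar R}) (c g : R) (eta : Omega -> set (R * R * R)).
Hypotheses (c0 : 0 < c) (g0 : 0 < g).
Hypothesis nuE : forall a : R, 0 < a ->
  nu `[a, +oo[%classic = (c `^ g^-1 * a `^ (- g^-1))%:E.
Hypothesis Heta : poisson_process P (@space_infty R) (intensity_infty nu) eta.
Local Open Scope ereal_scope.

Definition jump_intensity : {measure set (R * R * R) -> \bar R} := ((nu \x lebC R) \x expoC R).

Let mid : measurable_fun setT (id : measurableTypeR R -> R).
Proof. exact: (@measurable_id _ R setT). Qed.

Let mid2 : measurable_fun setT (id : R * measurableTypeR R -> R * R).
Proof. exact: (@measurable_id _ (R * R)%type setT). Qed.

Lemma jump_intensityE A : measurable A -> jump_intensity A = intensity_infty nu A.
Proof.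
have eta2 (S T : Type) (B : set (S * T)) : (fun p => (p.1, p.2)) @^-1` B = B.
  by apply/seteqP; split => -[].
move=> mA; apply: etrans; first apply: (@image_prodT _ _ _ _ _ _ _ _ _
  (id : R * measurableTypeR R -> R * R) (id : measurableTypeR R -> R) mid2
  (nu \x lebesgue_measure) (expo R) (nu \x lebC R) (expoC R) A).
- move=> B mB; apply: etrans; first apply: (@image_prodT _ _ _ _ _ _ _ _ _
    (id : R -> R) (id : measurableTypeR R -> R) (@measurable_id _ R setT)
    nu lebesgue_measure nu (lebC R) B).
  + by [].
  + by move=> C _; exact: lebCE.
  + exact: mB.
  by rewrite eta2.
- by move=> C _; exact: expoCE.
- exact: mA.
by rewrite eta2.
Qed.

Definition jump_map (p : R * R * R) : R * R * R := ((p.1.1 / c) `^ (- g^-1), p.1.2, p.2)%R.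

Definition jump_dom : set (R * R * R) := (@positives R `*` setT) `*` @nonneg R.

Lemma measurable_jump_map : measurable_fun setT jump_map.
Proof.
apply: measurable_fun_pair; last exact: measurable_snd.
apply: measurable_fun_pair; last exact: measurable_pair1_2.
apply: (measurableT_comp (measurable_powR _)); apply: measurable_funM => //.
exact: (measurableT_comp measurable_fst measurable_fst).
Qed.

Lemma jump_domE : jump_dom = @space_infty R.
Proof.
apply/seteqP; split => -[[j b] l]; rewrite /jump_dom /positives /nonneg /= !in_itv/= !andbT.
  by move=> [[? ?] ?].
by move=> [? ?].
Qed.

Lemma measurable_jump_dom : measurable jump_dom.
Proof.
apply: measurableX; last exact: measurable_nonneg.
by apply: measurableX => //; exact: measurable_positives.
Qed.

Let mE : measurable (@space_infty R).
Proof. rewrite -jump_domE; exact: measurable_jump_dom. Qed.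

Lemma jump_rate A : measurable A ->
  rate (@measurable_positives R) A =
  rimage measurable_jump_map measurable_jump_dom jump_intensity A.
Proof.
move=> mA; rewrite /rimage.
pose lv := sigma_finite_restr (lebC R) (@measurable_positives R).
have mT : measurable_fun setT (fun j : R => (j / c) `^ (- g^-1))%R.
  by apply: (measurableT_comp (measurable_powR _)); exact: measurable_funM.
have mT2 : measurable_fun setT (fun p : R * R => ((p.1 / c) `^ (- g^-1), p.2))%R.
  apply: measurable_fun_pair; last exact: measurable_snd.
  exact: (measurableT_comp mT).
have mD2 : measurable (@positives R `*` setT : set (R * R)).
  by apply: measurableX => //; exact: measurable_positives.
rewrite -[LHS]/((prodm lv (lebC R) \x expoC R) A).
apply: etrans; first apply: (@image_prod _ _ _ _ _ _ _ _ _
  (fun p : R * R => ((p.1 / c) `^ (- g^-1), p.2))%R id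
  _ (@nonneg R) mT2 mD2 (nu \x lebC R) (expoC R) (prodm lv (lebC R)) (expoC R)) => //.
- move=> B mB; apply: etrans; first apply: (@image_prod _ _ _ _ _ _ _ _ _
    (fun j : R => (j / c) `^ (- g^-1))%R id _ setT mT (@measurable_positives R) nu (lebC R) lv (lebC R)) => //.
  + by move=> C mC; exact: jump_image.
  + by move=> C mC; rewrite setTI.
  by [].
- by move=> B mB; rewrite expoC_nonneg.
by [].
Qed.

(** The pulled-back cover of the [v]-space. The complement of the domain is added so that the union
    is the whole space. *)
Definition cover_jump (i : nat) : set (R * R * R) :=
  ~` jump_dom `|` jump_map @^-1` (cover_V i).

Lemma measurable_cover_jump i : measurable (cover_jump i).
Proof.
apply: measurableU; first by apply: measurableC; exact: measurable_jump_dom.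
rewrite -[X in measurable X]setTI; apply: measurable_jump_map => //; exact: measurable_cover_V.
Qed.

Lemma cover_jump_nd : nondecreasing_seq cover_jump.
Proof.
move=> i j ij; apply/subsetPset => p [h|h]; [by left|right].
by have /subsetPset := @cover_V_nd R _ _ ij; apply.
Qed.

Lemma cover_jumpT : \bigcup_i cover_jump i = setT.
Proof.
apply/seteqP; split => // p _.
by have : setT (jump_map p) by []; rewrite -(@cover_VT R) => -[i _ h]; exists i => //; right.
Qed.

Lemma cover_jumpI i : cover_jump i `&` @space_infty R = jump_dom `&` jump_map @^-1` (cover_V i).
Proof.
rewrite -jump_domE /cover_jump; apply/seteqP; split => p /=; first by move=> [[]].
by move=> [? ?]; split => //; right.
Qed.

Lemma cover_jump_fin i : jump_intensity (cover_jump i `&` @space_infty R) < +oo.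
Proof.
rewrite cover_jumpI -[X in X < _]/(rimage measurable_jump_map measurable_jump_dom jump_intensity _).
rewrite -jump_rate; last exact: measurable_cover_V.
by apply: rate_cover_V.
Qed.

Let HetaC : poisson_process P (@space_infty R) jump_intensity eta.
Proof. by apply: poisson_process_eq Heta => A mA; exact: jump_intensityE. Qed.

Definition M_jump := pp_measure R (@space_infty R) eta cover_jump.

Definition jump_rm := rm_image M_jump measurable_jump_map measurable_jump_dom.

Lemma jump_rm_poisson : poisson_rm P (rate (@measurable_positives R)) jump_rm.
Proof.
have H := pp_poisson_rm HetaC mE measurable_cover_jump cover_jump_nd cover_jumpT cover_jump_fin.
have E A : measurable A -> rate (@measurable_positives R) A =
  rimage measurable_jump_map measurable_jump_dom (mrestr jump_intensity mE) A.
  move=> mA; apply: etrans (jump_rate mA) _.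
  rewrite -[LHS]/(jump_intensity (jump_dom `&` jump_map @^-1` A)).
  rewrite -[RHS]/(jump_intensity (jump_dom `&` jump_map @^-1` A `&` @space_infty R)).
  by rewrite -jump_domE setIAC setIid.
apply: (poisson_rm_eq E).
apply: (poisson_rm_image measurable_jump_map measurable_jump_dom (C := @cover_V R)) => //.
- exact: measurable_cover_V.
- exact: cover_V_nd.
- exact: cover_VT.
- move=> i; rewrite -[X in X < _]/(rimage measurable_jump_map measurable_jump_dom
    (mrestr jump_intensity mE) (cover_V i)).
  by rewrite -(E _ (@measurable_cover_V R i)); apply: rate_cover_V.
- move=> w i; apply: (@le_lt_trans _ _ (M_jump w (cover_jump i))).
    apply: le_measure; rewrite ?inE.
    + apply: measurableI; first exact: measurable_jump_dom.
      by rewrite -[X in measurable X]setTI; apply: measurable_jump_map => //; exact: measurable_cover_V.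
    + exact: measurable_cover_jump.
    by move=> p [_ h]; right.
  exact: (pp_measure_fin _ HetaC).
Qed.

Lemma jump_rm_independent : independent_rm P jump_rm.
Proof.
apply: (independent_rm_image measurable_jump_map measurable_jump_dom).
exact: (pp_independent_rm HetaC mE measurable_cover_jump cover_jump_fin).
Qed.

End jump_points.

(** * Time kernels and monotone paths *)

Section kernels.
Context (R : realType).
Implicit Types (s t : R) (p : R * R).

Definition expo_bound : R := 6 ^+ 3 * 2.

Lemma expo_bound_ge0 : 0 <= expo_bound.
Proof. by rewrite /expo_bound mulr_ge0// exprn_ge0. Qed.

(** For a given lifetime the integrand is at most [c l] on an interval of births and zero outside,
    so [c l] times the length bounds the inner integral; the third moment of the lifetime does the
    rest. *)
Lemma theta_le (H : R * R -> R) (c q1 q2 : R -> R) (K : R) : 0 <= K ->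
  measurable_fun setT H -> (forall p, 0 <= H p) ->
  (forall b l, H (b, l) <= if q1 l <= b <= q2 l then c l else 0) ->
  (forall l, 0 <= c l) -> (forall l, q1 l <= q2 l) ->
  (forall l, c l * (q2 l - q1 l) <= K * (1 + `|l|) ^+ 3) ->
  (theta (EFin \o H) <= (K * expo_bound)%:E)%E.
Proof.
move=> K0 mH H0 Hc c0 q12 cK.
have mH' : measurable_fun setT (EFin \o H) by exact/measurable_EFinP.
have mB : measurable_fun setT (fun l : R => (K * (1 + `|l|) ^+ 3)%:E).
  by apply/measurable_EFinP; apply: measurable_funM => //; exact: measurable_norm_pow.
have pw (l : R) : (0 <= ((1 + `|l|) ^+ 3)%:E)%E by rewrite lee_fin exprn_ge0// addr_ge0.
apply: (@le_trans _ _ (\int[expoC R]_l (K * (1 + `|l|) ^+ 3)%:E)%E).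
  apply: ge0_le_integral => //.
  - by move=> l _; apply: integral_ge0 => b _; rewrite lee_fin.
  - exact: (@measurable_fun_fubini_tonelli_G _ _ _ _ _ (lebC R) (EFin \o H) mH' (fun p => H0 p)).
  - move=> l _; apply: (@le_trans _ _ (c l * (q2 l - q1 l))%:E); last by rewrite lee_fin.
    apply: (@le_trans _ _ (\int[lebC R]_b ((c l)%:E * (\1_(`[q1 l, q2 l]%classic) b)%:E))%E).
      apply: ge0_le_integral => //.
      - by move=> b _; rewrite lee_fin.
      - exact: (measurableT_comp mH' (measurable_pair2 _)).
      - by apply: emeasurable_funM => //; apply/measurable_EFinP; exact: measurable_indic.
      - move=> b _; rewrite -EFinM lee_fin; apply: le_trans (Hc b l) _.
        rewrite indicE mem_setE in_itv/=; case: ifP => _; by rewrite ?mulr1 ?mulr0.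
    rewrite ge0_integralZl//; last by rewrite lee_fin.
      rewrite integral_indic// setIT.
      rewrite [X in (_ * X <= _)%E](_ : _ = (Num.max (q2 l - q1 l) 0)%:E); last exact: lebC_itv.
      by rewrite -EFinM lee_fin maxEle; case: ifP => // /(le_trans _); rewrite ler_wpM2l// subr_ge0.
    by apply/measurable_EFinP; exact: measurable_indic.
under eq_integral do rewrite EFinM.
rewrite ge0_integralZl//; last by apply/measurable_EFinP; exact: measurable_norm_pow.
rewrite EFinM lee_wpmul2l//.
rewrite integral_expoC//; first exact: expo_moment3.
by apply/measurable_EFinP; exact: measurable_norm_pow.
Qed.

(** What chaining needs of a time-dependent integrand: monotone and right continuous in time, with
    first and second moments of the increments at most linear in the elapsed time. The first moments
    control compensators, the second ones variances. *)
Record path_kernel (g : R -> R * R -> R) (C : R) : Prop := {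
  kg_meas : forall t, measurable_fun setT (g t) ;
  kg_ge0 : forall t p, 0 <= g t p ;
  kg_mono : forall s t p, s <= t -> g s p <= g t p ;
  kg_rc : forall t p e, 0 < e -> exists s0, t < s0 /\ forall s, t <= s <= s0 -> g s p <= g t p + e ;
  kg_1 : (theta (fun p => (g 0 p)%:E) <= C%:E)%E ;
  kg_2 : (theta (fun p => (g 0 p ^+ 2)%:E) <= C%:E)%E ;
  kg_inc1 : forall s t, 0 <= s -> s <= t -> t <= 1 ->
    (theta (fun p => (g t p - g s p)%:E) <= (C * (t - s))%:E)%E ;
  kg_inc2 : forall s t, 0 <= s -> s <= t -> t <= 1 ->
    (theta (fun p => ((g t p - g s p) ^+ 2)%:E) <= (C * (t - s))%:E)%E }.

(** The test on [p.1 + p.2] discards the points dead by time 0: they are never alive on [[0, 1]],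
    and as births extend infinitely far into the past they would make the integrals diverge. *)
Definition alpha t p : R := if 0 < p.1 + p.2 then Num.max 0 (Num.min (t - p.1) p.2) else 0.

Definition delta t p : R := if 0 < p.1 + p.2 <= t then Num.max 0 p.2 else 0.

Let norm1 (l : R) : - `|l| <= l <= `|l|. Proof. by rewrite -ler_norml. Qed.

Variant alpha_spec t (b l : R) : R -> Prop :=
| Alpha0 of b + l <= 0 \/ t <= b \/ l <= 0 : alpha_spec t b l 0
| AlphaAge of 0 < b + l & b <= t & t - b <= l : alpha_spec t b l (t - b)
| AlphaLife of 0 < b + l & 0 <= l & l <= t - b : alpha_spec t b l l.

Lemma alphaP t b l : alpha_spec t b l (alpha t (b, l)).
Proof.
rewrite /alpha/=; case: ifPn => [bl|]; last by rewrite -leNgt => h; apply: Alpha0; left.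
rewrite minEle; case: ifPn => [h|]; last rewrite -ltNge => h.
  rewrite maxEle; case: ifPn => [h'|]; first by apply: AlphaAge => //; lra.
  by rewrite -ltNge => h'; apply: Alpha0; right; left; lra.
rewrite maxEle; case: ifPn => [h'|]; first by apply: AlphaLife => //; lra.
by rewrite -ltNge => h'; apply: Alpha0; right; right; lra.
Qed.

(** A living point has age [t - b] and no completed lifetime; for a point that died after time 0 the
    two terms are both its lifetime and cancel. *)
Lemma alpha_sub_delta t (b l : R) : 0 <= t ->
  alpha t (b, l) - delta t (b, l) = (t - b) * (b <= t < b + l)%R%:R.
Proof.
move=> t0; have [tl|tl] := boolP (b <= t < b + l); rewrite ?mulr1 ?mulr0.
  case/andP: tl => bt tl; rewrite /delta/= [b + l <= t]leNgt tl andbF subr0.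
  by case: alphaP => *; lra.
have {}tl : t < b \/ b + l <= t.
  by move: tl; rewrite negb_and -ltNge -leNgt => /orP[|]; [left|right].
rewrite /delta/=; case: ifPn => [/andP[bl bt]|].
  rewrite maxEle; case: ifPn => [l0|]; last rewrite -ltNge => l0; case: alphaP => *; lra.
rewrite negb_and -leNgt -ltNge subr0 => /orP[?|?]; case: alphaP => *; lra.
Qed.

Let mpos : measurable_fun setT (fun p => 0 < p.1 + p.2).
Proof. by apply: measurable_fun_ltr => //; exact: measurable_funD. Qed.

Lemma alpha_kernel : path_kernel alpha expo_bound.
Proof.
have inc s t p : s <= t -> 0 <= alpha t p - alpha s p <= t - s.
  by case: p => b l st; case: (alphaP t b l); case: (alphaP s b l) => *; apply/andP; split; lra.
have a0 t p : 0 <= alpha t p by rewrite /alpha; case: ifP => // _; rewrite le_max lexx.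
have ma t : measurable_fun setT (alpha t).
  apply: measurable_fun_ifT => //; apply: measurable_maxr => //; apply: measurable_minr => //.
  exact: measurable_funB.
(* Only births between [-|l|] and 0 can give a positive age at time 0. *)
have b0 b l : alpha 0 (b, l) <= if - `|l| <= b <= 0 then `|l| else 0.
  have /andP[l1 l2] := norm1 l.
  case: ifPn => [_|h]; first by case: alphaP => *; lra.
  by move: h; rewrite negb_and -!ltNge => /orP[?|?]; case: alphaP => *; lra.
have bi s t b l : 0 <= s -> s <= t -> t <= 1 ->
    alpha t (b, l) - alpha s (b, l) <= if - `|l| <= b <= 1 then t - s else 0.
  move=> s0 st t1; have /andP[l1 l2] := norm1 l; have /andP[i1 i2] := inc s t (b, l) st.
  case: ifPn => // h; move: i1 i2; move: h; rewrite negb_and -!ltNge => /orP[?|?];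
    by case: (alphaP t b l); case: (alphaP s b l) => *; lra.
have pow3 (l : R) : 1 + `|l| <= (1 + `|l|) ^+ 3.
  have := normr_ge0 l; set x := `|l| => x0.
  have h1 : 0 <= x * x by rewrite mulr_ge0.
  have h2 : 0 <= x * (x * x) by rewrite mulr_ge0.
  rewrite !exprS expr0; lra.
split => //.
- by move=> s t p st; have /andP[] := inc s t p st; rewrite subr_ge0.
- move=> t p e e0; exists (t + e); split; first lra.
  move=> s /andP[ts se]; have /andP[_] := inc t s p ts; lra.
- rewrite -[X in X%:E]mul1r.
  apply: (@theta_le (alpha 0) (fun l => `|l|) (fun l => - `|l|) (fun=> 0)) => //.
  + move=> l; rewrite mul1r; have := normr_ge0 l; set x := `|l| => x0.
    have h1 : 0 <= x * x by rewrite mulr_ge0.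
    have h2 : 0 <= x * (x * x) by rewrite mulr_ge0.
    rewrite !exprS expr0; lra.
(* The squared age is at most [l^2] over a birth interval of length [|l|]: here the third moment of
   the lifetime enters. *)
- rewrite -[X in X%:E]mul1r.
  apply: (@theta_le (fun p => alpha 0 p ^+ 2) (fun l => `|l| ^+ 2) (fun l => - `|l|) (fun=> 0)) => //.
  + exact: measurable_funX.
  + by move=> p; exact: sqr_ge0.
  + move=> b l; have := b0 b l; case: ifP => _ h; first by rewrite lerXn2r ?nnegrE.
    by rewrite (_ : alpha 0 (b, l) = 0) ?expr0n//; apply/eqP; rewrite eq_le h a0.
  + move=> l; rewrite mul1r; have := normr_ge0 l; set x := `|l| => x0.
    have h1 : 0 <= x * x by rewrite mulr_ge0.
    have h2 : 0 <= x * (x * x) by rewrite mulr_ge0.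
    rewrite !exprS expr0; lra.
- move=> s t s0 st t1; rewrite mulrC.
  apply: (@theta_le (fun p => alpha t p - alpha s p) (fun=> t - s) (fun l => - `|l|) (fun=> 1)) => //.
  + by rewrite subr_ge0.
  + exact: measurable_funB.
  + by move=> p; have /andP[] := inc s t p st.
  + by move=> b l; exact: bi.
  + by move=> l; rewrite subr_ge0.
  + by move=> l; rewrite ler_wpM2l ?subr_ge0// opprK.
- move=> s t s0 st t1; rewrite mulrC.
  apply: (@theta_le (fun p => (alpha t p - alpha s p) ^+ 2) (fun=> t - s) (fun l => - `|l|) (fun=> 1)) => //.
  + by rewrite subr_ge0.
  + by apply: measurable_funX; exact: measurable_funB.
  + by move=> p; exact: sqr_ge0.
  + move=> b l; have := bi s t b l s0 st t1; have /andP[] := inc s t (b, l) st.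
    set x := alpha t _ - _ => x0 x1; case: ifP => _ h.
      by rewrite (le_trans _ h)// expr2 ler_piMl//; lra.
    by rewrite (_ : x = 0) ?expr0n//; apply/eqP; rewrite eq_le h x0.
  + by move=> l; rewrite subr_ge0.
  + by move=> l; rewrite ler_wpM2l ?subr_ge0// opprK.
Qed.

(** [delta] jumps by the lifetime at the death. For a given lifetime, a death between [s] and [t]
    confines the birth to an interval of length [t - s], which makes both moments of the increment
    linear in [t - s]. *)
Lemma delta_kernel : path_kernel delta expo_bound.
Proof.
have d0 t p : 0 <= delta t p by rewrite /delta; case: ifP => // _; rewrite le_max lexx.
have md t : measurable_fun setT (delta t).
  apply: measurable_fun_ifT => //; last by apply: measurable_maxr.
  apply: measurable_and => //; apply: measurable_fun_ler => //; exact: measurable_funD.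
have mono s t p : s <= t -> delta s p <= delta t p.
  move=> st; rewrite /delta; case: ifP => [/andP[-> h]|_]; first by rewrite (le_trans h st).
  by case: ifP => // _; rewrite le_max lexx.
have z0 p : delta 0 p = 0.
  by rewrite /delta; case: ifP => // /andP[h1 h2]; move: (lt_le_trans h1 h2); rewrite ltxx.
have bi s t b l : 0 <= s -> s <= t ->
    delta t (b, l) - delta s (b, l) <= if s - l <= b <= t - l then `|l| else 0.
  move=> s0 st; have /andP[l1 l2] := norm1 l; have n0 := normr_ge0 l.
  rewrite /delta/=; have M : 0 <= Num.max 0 l <= `|l| by rewrite le_max lexx ge_max n0.
  case/andP: M => M0 M1; set m := Num.max 0 l in M0 M1 *.
  case: (ifPn (s - l <= b <= t - l)) => h.
    by do 2 case: ifP => _; lra.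
  have {}h : b + l < s \/ t < b + l.
    by move: h; rewrite negb_and -!ltNge => /orP[?|?]; [left|right]; lra.
  have [h1|h1] := ltP 0 (b + l); have [h2|h2] := leP (b + l) t;
    have [h3|h3] := leP (b + l) s => /=; lra.
have th0 : (theta (fun=> 0%:E) = 0 :> \bar R)%E.
  rewrite /theta -[RHS](@integral0 _ _ _ (expoC R) setT); apply: eq_integral => l _.
  exact: integral0.
split => //.
- move=> t p e e0; have [h1|h1] := leP (p.1 + p.2) t.
    exists (t + 1); split; first by rewrite ltrDl.
    move=> s /andP[ts _]; rewrite /delta h1 (le_trans h1 ts).
    by rewrite lerDl ltW.
  exists ((t + (p.1 + p.2)) / 2); split; first lra.
  move=> s /andP[ts h2]; have sp : s < p.1 + p.2 by lra.
  have -> : delta s p = 0 by rewrite /delta [_ <= s]leNgt sp andbF.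
  by have := d0 t p; lra.
- under eq_fun do rewrite z0.
  by rewrite th0 lee_fin expo_bound_ge0.
- under eq_fun do rewrite z0 expr0n/=.
  by rewrite th0 lee_fin expo_bound_ge0.
- move=> s t s0 st t1; rewrite mulrC.
  apply: (@theta_le (fun p => delta t p - delta s p) (fun l => `|l|) (fun l => s - l) (fun l => t - l)) => //.
  + by rewrite subr_ge0.
  + exact: measurable_funB.
  + by move=> p; rewrite subr_ge0 mono.
  + by move=> b l; exact: bi.
  + by move=> l; lra.
  + move=> l; have -> : t - l - (s - l) = t - s by lra.
    rewrite mulrC ler_wpM2l ?subr_ge0//; have := normr_ge0 l; set x := `|l| => x0.
    have h1 : 0 <= x * x by rewrite mulr_ge0.
    have h2 : 0 <= x * (x * x) by rewrite mulr_ge0.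
    rewrite !exprS expr0; lra.
- move=> s t s0 st t1; rewrite mulrC.
  apply: (@theta_le (fun p => (delta t p - delta s p) ^+ 2) (fun l => `|l| ^+ 2) (fun l => s - l) (fun l => t - l)) => //.
  + by rewrite subr_ge0.
  + by apply: measurable_funX; exact: measurable_funB.
  + by move=> p; exact: sqr_ge0.
  + move=> b l; have := bi s t b l s0 st; have : 0 <= delta t (b, l) - delta s (b, l) by rewrite subr_ge0 mono.
    set x := delta t _ - _ => x0; case: ifP => _ h; first by rewrite lerXn2r ?nnegrE.
    by rewrite (_ : x = 0) ?expr0n//; apply/eqP; rewrite eq_le h x0.
  + by move=> l; lra.
  + move=> l; have -> : t - l - (s - l) = t - s by lra.
    rewrite mulrC ler_wpM2l ?subr_ge0//; have := normr_ge0 l; set x := `|l| => x0.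
    have h1 : 0 <= x * x by rewrite mulr_ge0.
    have h2 : 0 <= x * (x * x) by rewrite mulr_ge0.
    rewrite !exprS expr0; lra.
Qed.

Lemma mono_cadlag (F : R -> R) :
  (forall s t, 0 <= s -> s <= t -> t <= 1 -> F s <= F t) ->
  (forall t e, 0 <= t < 1 -> 0 < e -> exists s, t < s <= 1 /\ F s <= F t + e) ->
  cadlag01 F.
Proof.
move=> mono rc; split => t t01.
  case/andP: (t01) => t0 t1; apply/cvgrPdist_le => e e0.
  have [s [/andP[ts s1] Fs]] := rc t e t01 e0; near=> u.
  have tu : t < u by near: u; exact: nbhs_right_gt.
  have us : u < s by near: u; exact: nbhs_right_lt.
  have m1 : F t <= F u by apply: mono; lra.
  have m2 : F u <= F s by apply: mono; lra.
  by rewrite distrC ler_norml; apply/andP; split; lra.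
case/andP: t01 => t0 t1.
pose l := sup [set F s | s in [set s | 0 <= s < t]].
have hs : has_sup [set F s | s in [set s | 0 <= s < t]].
  split; first by exists (F 0), 0; rewrite //= lexx.
  by exists (F t) => _ [s /= /andP[s0 st] <-]; apply: mono; lra.
apply/cvg_ex; exists l; apply/cvgrPdist_le => e e0.
have [_ [s /= /andP[s0 st] <-] ls] := sup_adherent e0 hs; rewrite -/l in ls.
near=> u.
have su : s < u by near: u; exact: nbhs_left_gt.
have ut : u < t by near: u; exact: nbhs_left_lt.
have m1 : F s <= F u by apply: mono; lra.
have m2 : F u <= l.
  by apply: ub_le_sup; [case: hs|exists u => //=; apply/andP; split; lra].
by rewrite ler_norml; apply/andP; split; lra.
Unshelve. all: end_near. Qed.

Lemma cadlag01B (F G : R -> R) : cadlag01 F -> cadlag01 G -> cadlag01 (F \- G).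
Proof.
move=> [F1 F2] [G1 G2]; split => t t01; first by apply: cvgB; [exact: F1|exact: G1].
by apply: is_cvgB; [exact: F2|exact: G2].
Qed.

Lemma cadlag01Z (c : R) (F : R -> R) : cadlag01 F -> cadlag01 (fun t => c * F t).
Proof.
move=> [F1 F2]; split => t t01; first by apply: cvgMr; exact: F1.
by apply: is_cvgMr; exact: F2.
Qed.

Lemma eq_cadlag01 (F G : R -> R) : (forall t, 0 <= t <= 1 -> F t = G t) -> cadlag01 F -> cadlag01 G.
Proof.
move=> E [F1 F2]; split => t t01; case/andP: (t01) => t0 t1.
  rewrite -E ?t0 ?ltW//; apply: cvg_trans (F1 t t01); apply: near_eq_cvg; near=> s.
  have ts : t < s by near: s; exact: nbhs_right_gt.
  have s1 : s < 1 by near: s; exact: nbhs_right_lt.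
  by apply: E; apply/andP; split; lra.
have /cvg_ex[l Fl] := F2 t t01; apply/cvg_ex; exists l.
apply: cvg_trans Fl; apply: near_eq_cvg; near=> s.
have s0 : 0 < s by near: s; exact: nbhs_left_gt.
have st : s < t by near: s; exact: nbhs_left_lt.
by apply: E; apply/andP; split; lra.
Unshelve. all: end_near. Qed.

Lemma cadlag01_out (F : R -> R) : cadlag01 F -> cadlag01 (fun t => if 0 <= t <= 1 then F t else 0).
Proof. by apply: eq_cadlag01 => t ->. Qed.

(** Total by default: a function that is not cadlag is sent to the zero path. *)
Definition to_skorokhod (F : R -> R) : skorokhod R :=
  match pselect (cadlag01 F) with
  | left h => Skorokhod (cadlag01_out h) (fun t h => ifN _ _ h)
  | right _ => point
  end.

Lemma to_skorokhodE (F : R -> R) t : cadlag01 F -> 0 <= t <= 1 -> to_skorokhod F t = F t.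
Proof. by move=> cF t01; rewrite /to_skorokhod; case: pselect => //= _; rewrite t01. Qed.

End kernels.

Section integral_cadlag.
Context (R : realType) d (X : measurableType d) (m : {measure set X -> \bar R}).
Variable f : R -> X -> \bar R.
Hypotheses (mf : forall t, measurable_fun setT (f t)) (f0 : forall t x, (0 <= f t x)%E).
Hypothesis f_mono : forall s t x, s <= t -> (f s x <= f t x)%E.
Hypothesis f1_fin : (\int[m]_x f 1 x < +oo)%E.
Hypothesis f_rc : forall t, 0 <= t < 1 -> {ae m, forall x,
  f (t + (1 - t) * k.+1%:R^-1) x @[k --> \oo] --> f t x}.

Let fin t : t <= 1 -> (\int[m]_x f t x)%E \is a fin_num.
Proof.
move=> t1; rewrite ge0_fin_numE; last exact: integral_ge0.
by apply: le_lt_trans f1_fin; apply: ge0_le_integral => // x _; exact: f_mono.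
Qed.

(** Monotonicity gives the left limits and lets right continuity be tested along a single sequence
    decreasing to [t]; [f 1] dominates along it. *)
Lemma integral_cadlag : cadlag01 (fun t => fine (\int[m]_x f t x)%E).
Proof.
have mono s t : s <= t -> t <= 1 -> fine (\int[m]_x f s x)%E <= fine (\int[m]_x f t x)%E.
  move=> st t1; apply: fine_le; [by apply: fin; exact: le_trans st t1|exact: fin|].
  by apply: ge0_le_integral => // x _; exact: f_mono.
apply: mono_cadlag => [s t _|t e t01 e0]; first exact: mono.
case/andP: (t01) => t0 t1.
pose u k := t + (1 - t) * k.+1%:R^-1.
have u1 k : t < u k <= 1.
  rewrite /u ltrDl mulr_gt0 ?subr_gt0 ?invr_gt0//=.
  have : (1 - t) * k.+1%:R^-1 <= 1 - t.
    by rewrite -[leRHS]mulr1 ler_wpM2l ?subr_ge0 ?(ltW t1)// invf_le1 ?ler1n ?ltr0n.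
  by rewrite lerBrDl.
have if1 : m.-integrable setT (f 1).
  by apply/integrableP; split => //; under eq_integral do rewrite gee0_abs//.
have cv : (\int[m]_x f (u k) x @[k --> \oo] --> \int[m]_x f t x)%E.
  have := @dominated_convergence _ _ _ m setT measurableT (fun k => f (u k)) (f t) (f 1).
  case => //.
  - by apply: filterS (f_rc t01) => x h _; exact: h.
  - by apply: aeW => x k _; rewrite gee0_abs//; apply: f_mono; case/andP: (u1 k).
have {}cv : fine (\int[m]_x f (u k) x)%E @[k --> \oo] --> fine (\int[m]_x f t x)%E.
  by apply: fine_cvg; rewrite fineK//; apply: fin; exact: ltW.
have /cvgrPdist_le/(_ _ e0)[k _ /(_ k (leqnn k)) /=] := cv.
rewrite distrC ler_norml => /andP[_ h].
by exists (u k); split; [exact: u1|lra].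
Qed.

End integral_cadlag.

(** * Chaining *)

Section chaining.
Context (R : realType).
Implicit Types (K : nat) (x : nat -> R) (q : nat -> nat -> R).

(** Level [k] consists of the [2^k] consecutive dyadic intervals of [2^(K-k)] grid steps. *)
Definition chain_sum K q : R :=
  \sum_(k < K.+1) \sum_(j < (2 ^ k)%N) q (j * 2 ^ (K - k))%N (j.+1 * 2 ^ (K - k))%N.

Lemma chain_sum_ge0 K q : (forall a b, 0 <= q a b) -> 0 <= chain_sum K q.
Proof. by move=> q0; apply: sumr_ge0 => k _; apply: sumr_ge0. Qed.

Lemma chain_sumS K q : chain_sum K.+1 q =
  chain_sum K (fun a b => q (a * 2)%N (b * 2)%N) + \sum_(j < (2 ^ K.+1)%N) q j j.+1.
Proof.
rewrite /chain_sum big_ord_recr/= subnn expn0; congr (_ + _); last first.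
  by apply: eq_bigr => j _; rewrite !muln1.
apply: eq_bigr => k _; apply: eq_bigr => j _.
have kK : (k <= K)%N by rewrite -ltnS.
by rewrite (subSn kK) expnSr !mulnA.
Qed.

(* (a + b)^2 <= (K + 2) (a^2 / (K + 1) + b^2), with a the increment along the
   coarser grid and b a single increment of the finest one. *)
Lemma dyadic_chaining K x q i : (forall a b, (x b - x a) ^+ 2 <= q a b) ->
  (i <= 2 ^ K)%N -> (x i - x 0%N) ^+ 2 <= K.+1%:R * chain_sum K q.
Proof.
elim: K x q i => [|K IH] x q i xq iK.
  have q0 a b : 0 <= q a b by apply: le_trans (xq a b); exact: sqr_ge0.
  rewrite mul1r /chain_sum big_ord_recr big_ord0/= add0r big_ord_recr big_ord0/= add0r.
  case: i iK => [|[|//]] _; last by rewrite mul0n mul1n; exact: xq.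
  by rewrite subrr expr0n; exact: q0.
have q0 a b : 0 <= q a b by apply: le_trans (xq a b); exact: sqr_ge0.
have c0 : 0 <= chain_sum K (fun a b => q (a * 2)%N (b * 2)%N) by exact: chain_sum_ge0.
have s0 : 0 <= \sum_(j < (2 ^ K.+1)%N) q j j.+1 by exact: sumr_ge0.
have := IH (fun i => x (i * 2)%N) (fun a b => q (a * 2)%N (b * 2)%N) i./2 (fun a b => xq _ _).
rewrite mul0n chain_sumS => /(_ _) H.
have {}H : (x (i./2 * 2)%N - x 0%N) ^+ 2 <= K.+1%:R * chain_sum K (fun a b => q (a * 2)%N (b * 2)%N).
  apply: H; rewrite -leq_double -!muln2 -expnSr (leq_trans _ iK)// muln2.
  by rewrite -[leqRHS]odd_double_half leq_addl.
have B : (x i - x (i./2 * 2)%N) ^+ 2 <= \sum_(j < (2 ^ K.+1)%N) q j j.+1.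
  rewrite muln2; case: (boolP (odd i)) => oi; last first.
    by rewrite -[X in x X - _]odd_double_half (negbTE oi) add0n subrr expr0n.
  have iE : i = (i./2).*2.+1 by rewrite -[LHS]odd_double_half oi.
  have ilt : ((i./2).*2 < 2 ^ K.+1)%N by rewrite -iE.
  rewrite (bigD1 (Ordinal ilt))//= -[leLHS]addr0 lerD//; last exact: sumr_ge0.
  by rewrite {1}iE; exact: xq.
set c := chain_sum _ _ in H c0 *; set s := \sum_(j < _) _ in B s0 *.
set a := x (i./2 * 2)%N - x 0%N in H; set b := x i - x (i./2 * 2)%N in B.
have -> : x i - x 0%N = a + b by rewrite /a /b; ring.
have k0 : 0 < K.+1%:R :> R by rewrite ltr0n.
rewrite -[K.+2]addn1 natrD; set k := K.+1%:R in k0 H *.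
have E : (k + 1) * (a ^+ 2 + k * b ^+ 2) - k * (a + b) ^+ 2 = (a - k * b) ^+ 2 by ring.
have E2 : k * (a + b) ^+ 2 <= (k + 1) * (a ^+ 2 + k * b ^+ 2).
  by rewrite -subr_ge0 E sqr_ge0.
have E3 : (k + 1) * (a ^+ 2 + k * b ^+ 2) <= (k + 1) * (k * c + k * s).
  apply: ler_wpM2l; first by rewrite addr_ge0// ltW.
  by apply: lerD => //; apply: ler_wpM2l => //; exact: ltW.
rewrite -(ler_pM2l k0); apply: le_trans E2 (le_trans E3 _).
by rewrite -mulrDr mulrCA.
Qed.

(** When [q] is bounded by [c] times the relative length, every level sums to at most [c], and there
    are [K+1] levels. *)
Lemma chain_sum_le K q (c : R) : 0 <= c ->
  (forall a b, (a <= b)%N -> (b <= 2 ^ K)%N -> q a b <= c * (b - a)%:R / 2 ^+ K) ->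
  chain_sum K q <= K.+1%:R * c.
Proof.
move=> c0 qc; apply: (@le_trans _ _ (\sum_(k < K.+1) c)); last first.
  by rewrite sumr_const card_ord mulr_natl.
apply: ler_sum => k _.
apply: (@le_trans _ _ (\sum_(j < (2 ^ k)%N) (c * (2 ^ (K - k))%:R / 2 ^+ K))).
  apply: ler_sum => j _.
  have := qc (j * 2 ^ (K - k))%N (j.+1 * 2 ^ (K - k))%N.
  rewrite -mulnBl subSnn mul1n; apply; first by rewrite leq_mul2r leqnSn orbT.
  apply: (@leq_trans (2 ^ k * 2 ^ (K - k))); first by rewrite leq_mul2r ltn_ord orbT.
  by rewrite -expnD subnKC// -ltnS.
rewrite sumr_const card_ord -[leLHS]mulr_natl.
have kK : (k <= K)%N by rewrite -ltnS.
have -> : (2 ^ k)%:R * (c * (2 ^ (K - k))%:R / 2 ^+ K) = c * ((2 ^ k * 2 ^ (K - k))%:R / 2 ^+ K) :> R.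
  by rewrite natrM; ring.
by rewrite -expnD subnKC// natrX mulfV ?mulr1// expf_neq0.
Qed.

End chaining.

Section chaining_mean.
Context (R : realType) d (W : measurableType d) (P : probability W R).
Local Open Scope ereal_scope.

Lemma integral_sum_le (I : Type) (r : seq I) (f : I -> W -> R) (c : I -> R) :
  (forall i, measurable_fun setT (f i)) -> (forall i w, (0 <= f i w)%R) ->
  (forall i, \int[P]_w (f i w)%:E <= (c i)%:E) ->
  \int[P]_w (\sum_(i <- r) f i w)%R%:E <= (\sum_(i <- r) c i)%R%:E.
Proof.
move=> mf f0 fc; under eq_integral do rewrite -sumEFin.
rewrite ge0_integral_sum//; last by move=> i w _; rewrite lee_fin.
  by rewrite -sumEFin; apply: lee_sum => i _; exact: fc.
by move=> i; apply/measurable_EFinP.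
Qed.

Lemma measurable_chain_sum K (q : nat -> nat -> W -> R) :
  (forall a b, measurable_fun setT (q a b)) ->
  measurable_fun setT (fun w => chain_sum K (fun a b => q a b w)).
Proof.
by move=> mq; apply: measurable_sum => k; apply: measurable_sum => j; exact: mq.
Qed.

(** One factor [K+1] comes from the chaining inequality, the other from the number of levels. *)
Lemma mean_chain_sum K (q : nat -> nat -> W -> R) (c : R) : (0 <= c)%R ->
  (forall a b, measurable_fun setT (q a b)) -> (forall a b w, (0 <= q a b w)%R) ->
  (forall a b, (a <= b)%N -> (b <= 2 ^ K)%N ->
    \int[P]_w (q a b w)%:E <= (c * (b - a)%:R / 2 ^+ K)%R%:E) ->
  \int[P]_w (K.+1%:R * chain_sum K (fun a b => q a b w))%R%:E <= (K.+1%:R ^+ 2 * c)%R%:E.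
Proof.
move=> c0 mq q0 qc.
pose e a b : R := fine (\int[P]_w (q a b w)%:E).
have qe a b : (a <= b)%N -> (b <= 2 ^ K)%N -> \int[P]_w (q a b w)%:E = (e a b)%:E.
  move=> ab bK; rewrite fineK// ge0_fin_numE ?(le_lt_trans (qc a b ab bK)) ?ltry//.
  by apply: integral_ge0 => w _; rewrite lee_fin.
under eq_integral do rewrite EFinM.
have mC := measurable_chain_sum K mq.
rewrite ge0_integralZl//; try exact/measurable_EFinP;
  try by move=> w _; rewrite lee_fin chain_sum_ge0.
rewrite expr2 -mulrA EFinM lee_wpmul2l ?lee_fin//.
have Ee : \int[P]_w (chain_sum K (fun a b => q a b w))%:E <= (chain_sum K e)%:E.
  apply: integral_sum_le => [k|k w|k].
  - by apply: measurable_sum => j; exact: mq.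
  - by apply: sumr_ge0.
  apply: integral_sum_le => // j; rewrite qe//; first by rewrite leq_mul2r leqnSn orbT.
  apply: (@leq_trans (2 ^ k * 2 ^ (K - k))); first by rewrite leq_mul2r ltn_ord orbT.
  by rewrite -expnD subnKC// -ltnS.
apply: le_trans Ee _; rewrite lee_fin; apply: chain_sum_le => // a b ab bK.
by rewrite -lee_fin -qe//; exact: qc.
Qed.

(* With exponentially decaying means, almost surely all the variables are at
   most a geometric sequence. *)
Definition geometric_sum (s : R) (Q : nat -> W -> R) (w : W) : \bar R :=
  \sum_(m <oo) ((s ^- m) * Q m w)%R%:E.

Lemma geometric_sum_bound (s : R) (Q : nat -> W -> R) w : (0 < s)%R ->
  (forall m w, (0 <= Q m w)%R) ->
  geometric_sum s Q w < +oo -> exists C : R, forall m, (Q m w <= C * s ^+ m)%R.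
Proof.
move=> s0 Q0 foo.
have t0 m : 0 <= ((s ^- m) * Q m w)%R%:E by rewrite lee_fin mulr_ge0// invr_ge0 exprn_ge0// ltW.
have g0 : 0 <= geometric_sum s Q w by exact: nneseries_ge0.
exists (fine (geometric_sum s Q w)) => m.
rewrite -ler_pdivrMr ?exprn_gt0// mulrC -lee_fin fineK ?ge0_fin_numE//.
apply: (@le_trans _ _ (\sum_(0 <= i < m.+1) ((s ^- i) * Q i w)%R%:E)).
  by rewrite big_nat_recr//= leeDr// sume_ge0.
exact: nneseries_lim_ge.
Qed.

(** Half of the decay is spent: means of order [s^(2m)] divided by [s^m] still form a convergent
    geometric series, so the weighted sum is integrable. *)
Lemma geometric_sum_ae (Q : nat -> W -> R) (C s : R) : (0 <= C)%R -> (0 < s < 1)%R ->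
  (forall m, measurable_fun setT (Q m)) -> (forall m w, (0 <= Q m w)%R) ->
  (forall m, \int[P]_w (Q m w)%:E <= (C * (s ^+ 2) ^+ m)%R%:E) ->
  measurable_fun setT (geometric_sum s Q) /\ {ae P, forall w, geometric_sum s Q w < +oo}.
Proof.
move=> C0 /andP[s0 s1] mQ Q0 QC.
have t0 m w : 0 <= ((s ^- m) * Q m w)%R%:E by rewrite lee_fin mulr_ge0// invr_ge0 exprn_ge0// ltW.
have mt m : measurable_fun setT (fun w => ((s ^- m) * Q m w)%R%:E).
  by apply/measurable_EFinP; exact: measurable_funM.
have mG : measurable_fun setT (geometric_sum s Q).
  by apply: ge0_emeasurable_sum => // m w _; exact: t0.
split => //.
have foo : \int[P]_w geometric_sum s Q w < +oo.
  rewrite integral_nneseries//.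
  apply: (@le_lt_trans _ _ (\sum_(m <oo) (C * s ^+ m)%R%:E)).
    apply: lee_nneseries => [m _|m _].
      by move=> _; apply: integral_ge0.
    under eq_integral do rewrite EFinM.
    rewrite ge0_integralZl//; try exact/measurable_EFinP; try by [move=> w _; rewrite lee_fin
      |rewrite lee_fin invr_ge0 exprn_ge0// ltW].
    apply: (@le_trans _ _ ((s ^- m)%:E * (C * (s ^+ 2) ^+ m)%R%:E)).
      by rewrite lee_wpmul2l// lee_fin invr_ge0 exprn_ge0// ltW.
    rewrite -EFinM lee_fin -exprM mulnC exprM expr2 mulrCA mulKf//.
    by rewrite expf_neq0// gt_eqF.
  apply: (@le_lt_trans _ _ (C * (1 - s)^-1)%:E); last exact: ltry.
  apply: lime_le.
    by apply: is_cvg_nneseries => m _ _; rewrite lee_fin mulr_ge0// exprn_ge0// ltW.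
  apply: nearW => n; rewrite sumEFin lee_fin.
  by apply: (geometric_le_lim n C0 s0); rewrite gtr0_norm.
have g0 w : 0 <= geometric_sum s Q w by exact: nneseries_ge0.
have gi : P.-integrable setT (geometric_sum s Q).
  by apply/integrableP; split => //; under eq_integral do rewrite gee0_abs//.
apply: filterS (integrable_ae measurableT gi) => w /(_ I).
by rewrite ge0_fin_numE.
Qed.

End chaining_mean.

Section theta.
Context (R : realType).
Local Open Scope ereal_scope.
Implicit Types H : R * R -> \bar R.

Lemma theta_prod H : measurable_fun setT H -> (forall p, 0 <= H p) ->
  theta H = \int[prodm (lebC R) (expoC R)]_p H p.
Proof. by move=> mH H0; apply/esym; exact: (@fubini_tonelli2 _ _ _ _ R (lebC R) (expoC R) H mH H0). Qed.

Lemma theta_ge0 H : (forall p, 0 <= H p) -> 0 <= theta H.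
Proof. by move=> H0; apply: integral_ge0 => l _; apply: integral_ge0. Qed.

Lemma thetaD H1 H2 : measurable_fun setT H1 -> (forall p, 0 <= H1 p) ->
  measurable_fun setT H2 -> (forall p, 0 <= H2 p) ->
  theta (fun p => H1 p + H2 p) = theta H1 + theta H2.
Proof.
move=> m1 h1 m2 h2; rewrite !theta_prod ?ge0_integralD//.
- exact: emeasurable_funD.
- by move=> p; rewrite adde_ge0.
Qed.

Variables (g : R -> R * R -> R) (C : R).
Hypothesis Hg : path_kernel g C.

Lemma kernel_ge0 : (0 <= C)%R.
Proof.
rewrite -lee_fin; apply: le_trans (kg_1 Hg); apply: theta_ge0 => p.
by rewrite lee_fin (kg_ge0 Hg).
Qed.

Lemma theta_kernel_inc s t : (0 <= s)%R -> (s <= t)%R -> (t <= 1)%R ->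
  theta (fun p => (g t p)%:E) <= theta (fun p => (g s p)%:E) + (C * (t - s))%R%:E.
Proof.
move=> s0 st t1.
have -> : (fun p => (g t p)%:E) = (fun p => (g s p)%:E + (g t p - g s p)%R%:E).
  by apply/funext => p; rewrite -EFinD; congr EFin; ring.
rewrite thetaD.
- by rewrite leeD2l//; exact: (kg_inc1 Hg).
- by apply/measurable_EFinP; exact: (kg_meas Hg).
- by move=> p; rewrite lee_fin (kg_ge0 Hg).
- by apply/measurable_EFinP; apply: measurable_funB; exact: (kg_meas Hg).
- by move=> p; rewrite lee_fin subr_ge0 (kg_mono Hg).
Qed.

Lemma theta_kernel t : (0 <= t <= 1)%R -> theta (fun p => (g t p)%:E) <= (2 * C)%R%:E.
Proof.
move=> /andP[t0 t1]; apply: le_trans (theta_kernel_inc (lexx 0%R) t0 t1) _.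
rewrite subr0 mulrDl mul1r EFinD; apply: leeD; first exact: (kg_1 Hg).
by rewrite lee_fin -[leRHS]mulr1 ler_wpM2l// kernel_ge0.
Qed.

End theta.

Section power_block.
Context (R : realType) (gm : R).
Hypothesis gm01 : 0 < gm < 1.
Implicit Types a b v : R.

Definition pow_block a b v : R := if a < v <= b then v `^ (- gm) else 0.

Lemma pow_block_ge0 a b v : 0 <= pow_block a b v.
Proof. by rewrite /pow_block; case: ifP => // _; exact: powR_ge0. Qed.

Lemma measurable_pow_block a b : measurable_fun setT (pow_block a b).
Proof.
apply: measurable_fun_ifT => //; apply: measurable_and => //.
  exact: measurable_fun_ltr.
exact: measurable_fun_ler.
Qed.

Lemma pow_block_le a b v : 0 < a -> pow_block a b v <= if a <= v <= b then a `^ (- gm) else 0.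
Proof.
move=> a0; rewrite /pow_block; case: ifPn => [/andP[av vb]|_]; last by case: ifP => // _; exact: powR_ge0.
rewrite (ltW av) vb !powRN lef_pV2 ?posrE ?powR_gt0//; last exact: lt_trans a0 av.
by rewrite ge0_ler_powR ?nnegrE// ?ltW//; [case/andP: gm01|exact: lt_trans a0 av].
Qed.

Lemma integral_bounded_itv (f : R -> R) (a b c : R) : a <= b -> 0 <= c -> measurable_fun setT f ->
  (forall v, 0 <= f v) -> (forall v, f v <= if a <= v <= b then c else 0) ->
  (\int[lebC R]_(v in @positives R) (f v)%:E <= (c * (b - a))%:E)%E.
Proof.
move=> ab c0 mf f0 fc.
apply: (@le_trans _ _ (\int[lebC R]_v (f v)%:E)%E).
  apply: ge0_subset_integral => //.
  - exact: measurable_positives.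
  - exact/measurable_EFinP.
  - by move=> v _; rewrite lee_fin.
apply: (@le_trans _ _ (\int[lebC R]_v (c%:E * (\1_(`[a, b]%classic) v)%:E))%E).
  apply: ge0_le_integral => //.
  - by move=> v _; rewrite lee_fin.
  - exact/measurable_EFinP.
  - by apply: emeasurable_funM => //; apply/measurable_EFinP; exact: measurable_indic.
  - move=> v _; rewrite -EFinM lee_fin; apply: le_trans (fc v) _.
    by rewrite indicE mem_setE in_itv/=; case: ifP => _; rewrite ?mulr1 ?mulr0.
rewrite ge0_integralZl//; last by apply/measurable_EFinP; exact: measurable_indic.
rewrite integral_indic// setIT.
rewrite [X in (_ * X <= _)%E](_ : _ = (Num.max (b - a) 0)%:E); last exact: lebC_itv.
by rewrite -EFinM lee_fin maxEle; case: ifP => // /(le_trans _); rewrite ler_wpM2l// subr_ge0.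
Qed.

Lemma integral_pow_block a b : 0 < a -> a <= b ->
  (\int[lebC R]_(v in @positives R) (pow_block a b v)%:E <= (a `^ (- gm) * (b - a))%:E)%E.
Proof.
move=> a0 ab; apply: integral_bounded_itv => //.
- exact: powR_ge0.
- exact: measurable_pow_block.
- by move=> v; exact: pow_block_ge0.
- by move=> v; exact: pow_block_le.
Qed.

Lemma integral_pow_block_sqr a b : 0 < a -> a <= b ->
  (\int[lebC R]_(v in @positives R) (pow_block a b v ^+ 2)%:E <=
   ((a `^ (- gm)) ^+ 2 * (b - a))%:E)%E.
Proof.
move=> a0 ab; apply: integral_bounded_itv => //.
- exact: sqr_ge0.
- by apply: measurable_funX; exact: measurable_pow_block.
- by move=> v; exact: sqr_ge0.
- move=> v; have := pow_block_le b v a0; have := pow_block_ge0 a b v.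
  case: ifP => _ h h'; first by rewrite lerXn2r ?nnegrE ?powR_ge0.
  by rewrite (_ : pow_block a b v = 0) ?expr0n//; apply/eqP; rewrite eq_le h h'.
Qed.

Lemma integral_pow_unit :
  (\int[lebC R]_v (pow_block 0 1 v)%:E = ((1 - gm)^-1)%:E)%E.
Proof.
have /andP[g0 g1] := gm01.
rewrite integral_lebC; first last.
- by move=> v; rewrite lee_fin pow_block_ge0.
- by apply/measurable_EFinP; exact: measurable_pow_block.
rewrite -integral_powR ?(ltW g0) ?g1// [RHS]integral_mkcond; apply: eq_integral => v _.
by rewrite patchE mem_setE in_itv/= /pow_block; case: ifP.
Qed.

(** The integrand is split at [v = 1]: below it the power is integrable, above it the power is at
    most 1. *)
Lemma integral_pow_block0 b : 0 <= b ->
  (\int[lebC R]_(v in @positives R) (pow_block 0 b v)%:E <= ((1 - gm)^-1 + b)%:E)%E.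
Proof.
have /andP[g0 g1] := gm01; move=> b0.
pose f v : R := if 0 <= v <= b then 1 else 0.
have mf : measurable_fun setT f.
  by apply: measurable_fun_ifT => //; apply: measurable_and; exact: measurable_fun_ler.
have f0 v : 0 <= f v by rewrite /f; case: ifP.
have mp (m : R) : measurable_fun (@positives R) (EFin \o pow_block 0 m).
  by apply/measurable_EFinP; apply: measurable_funTS; exact: measurable_pow_block.
have mf' : measurable_fun (@positives R) (EFin \o f).
  by apply/measurable_EFinP; exact: measurable_funTS.
apply: (@le_trans _ _ (\int[lebC R]_(v in @positives R) ((pow_block 0 1 v)%:E + (f v)%:E))%E).
  apply: ge0_le_integral => //.
  - exact: measurable_positives.
  - by move=> v _; rewrite lee_fin pow_block_ge0.
  - exact: mp.
  - by apply: emeasurable_funD => //; exact: mp.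
  - move=> v _; rewrite -EFinD lee_fin /pow_block /f.
    case: ifPn => [/andP[v0 vb]|_]; last by case: ifP => _; case: ifP => _; rewrite ?addr_ge0 ?powR_ge0.
    rewrite v0 (ltW v0) vb/=; case: ifPn => [_|]; first by rewrite lerDl.
    rewrite -ltNge => v1; rewrite add0r powRN invf_le1 ?powR_gt0//.
    by rewrite -(powRr0 v) ler_powR// ltW.
rewrite ge0_integralD//; try exact: measurable_positives; try exact: mp; try exact: mf';
  try (by move=> v _; rewrite lee_fin pow_block_ge0); try by move=> v _; rewrite lee_fin.
rewrite EFinD; apply: leeD.
  rewrite -integral_pow_unit; apply: ge0_subset_integral => //.
  - exact: measurable_positives.
  - by apply/measurable_EFinP; exact: measurable_pow_block.
  - by move=> v _; rewrite lee_fin pow_block_ge0.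
have := @integral_bounded_itv f 0 b 1 b0 ler01 mf f0 (fun v => lexx _).
by rewrite mul1r subr0.
Qed.

End power_block.

(** With [r = exp(-a)], the bound [z <= exp z] at [z = a (m+1) / 4], raised to the fourth power,
    gives [(m+1)^4 <= (4/a)^4 exp(a (m+1))]. *)
Lemma poly_geometric (R : realType) (r : R) : 0 < r < 1 ->
  exists C : R, 0 <= C /\ forall m : nat, m.+1%:R ^+ 4 * r ^+ m <= C.
Proof.
move=> /andP[r0 r1]; pose a := - ln r.
have a0 : 0 < a by rewrite oppr_gt0 ln_lt0// r0.
have rE : r = expR (- a) by rewrite opprK lnK.
exists ((4 / a) ^+ 4 * expR a); split; first by rewrite mulr_ge0 ?expR_ge0// exprn_ge0// divr_ge0// ltW.
move=> m; have h : m.+1%:R <= 4 / a * expR (a * m.+1%:R / 4).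
  have := expR_ge1Dx (a * m.+1%:R / 4); set z := a * _ / 4 => hz.
  have -> : m.+1%:R = 4 / a * z by rewrite /z; field; rewrite gt_eqF.
  by rewrite ler_wpM2l ?divr_ge0 ?ltW//; apply: lt_le_trans hz; rewrite ltrDr.
apply: (@le_trans _ _ ((4 / a * expR (a * m.+1%:R / 4)) ^+ 4 * r ^+ m)).
  apply: ler_wpM2r; first by rewrite exprn_ge0 ?ltW.
  by rewrite lerXn2r ?nnegrE// mulr_ge0 ?expR_ge0// divr_ge0// ltW.
have q0 : 0 <= 4 / a by rewrite divr_ge0// ltW.
have -> : (4 / a * expR (a * m.+1%:R / 4)) ^+ 4 * r ^+ m =
    (4 / a) ^+ 4 * (expR (a * m.+1%:R / 4) ^+ 4 * r ^+ m) by move: (4 / a) (expR _) (r ^+ m) => q e z; ring.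
apply: (ler_wpM2l (exprn_ge0 4 q0)).
rewrite rE -!expRM_natl -expRD ler_expR.
have -> : 4%:R * (a * m.+1%:R / 4) = a * m.+1%:R by field.
by rewrite -natr1; lra.
Qed.

(** The upper index is capped at [M] so as to stay on the grid; at [z = M] the two indices
    coincide. *)
Lemma grid_bounds (R : realType) (z : R) (M : nat) : 0 <= z <= M%:R ->
  exists i j : nat, [/\ (i <= j)%N, (j <= i.+1)%N, (j <= M)%N, i%:R <= z & z <= j%:R].
Proof.
move=> /andP[z0 zM]; exists (Num.truncn z), (minn (Num.truncn z).+1 M).
have iz : (Num.truncn z)%:R <= z by rewrite truncn_le.
have iM : (Num.truncn z <= M)%N by rewrite -(ler_nat R) (le_trans iz).
split => //.
- by rewrite leq_min leqnSn.
- exact: geq_minl.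
- exact: geq_minr.
- by rewrite /minn; case: ifP => // _; exact/ltW/truncnS_gt.
Qed.

(** * Compensated integrals and their dyadic blocks *)

Section centred_integrals.
Context (R : realType) d (W : measurableType d) (P : probability W R).
Context dX (X : measurableType dX) (mu : {measure set X -> \bar R}).
Variable M : W -> {measure set X -> \bar R}.
Hypothesis HM : poisson_rm P mu M.
Local Open Scope ereal_scope.
Implicit Types f : X -> \bar R.

Lemma fine_integralD (m : {measure set X -> \bar R}) f1 f2 :
  measurable_fun setT f1 -> (forall x, 0 <= f1 x) ->
  measurable_fun setT f2 -> (forall x, 0 <= f2 x) ->
  \int[m]_x (f1 x + f2 x) < +oo ->
  fine (\int[m]_x (f1 x + f2 x)) = (fine (\int[m]_x f1 x) + fine (\int[m]_x f2 x))%R.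
Proof.
move=> m1 h1 m2 h2; rewrite ge0_integralD// => foo.
have i1 : 0 <= \int[m]_x f1 x by exact: integral_ge0.
have i2 : 0 <= \int[m]_x f2 x by exact: integral_ge0.
rewrite fineD// ge0_fin_numE//; apply: le_lt_trans foo.
  by rewrite leeDl.
by rewrite leeDr.
Qed.

Definition centred f (w : W) : R := (fine (\int[M w]_x f x) - fine (\int[mu]_x f x))%R.

Lemma measurable_centred f : measurable_fun setT f -> (forall x, 0 <= f x) ->
  measurable_fun setT (centred f).
Proof.
move=> mf f0; apply: measurable_funB => //; apply: measurableT_comp => //.
exact: (measurable_rm_integral1 (prm_rm HM)).
Qed.

Lemma centredD f1 f2 w :
  measurable_fun setT f1 -> (forall x, 0 <= f1 x) ->
  measurable_fun setT f2 -> (forall x, 0 <= f2 x) ->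
  \int[mu]_x (f1 x + f2 x) < +oo -> \int[M w]_x (f1 x + f2 x) < +oo ->
  centred (fun x => f1 x + f2 x) w = (centred f1 w + centred f2 w)%R.
Proof. by move=> m1 h1 m2 h2 fm fM; rewrite /centred !fine_integralD//; ring. Qed.

(** Both the random and the deterministic integral are monotone in the integrand, so a compensated
    integral lies between its neighbours up to the gap of the compensators. *)
Lemma centred_le f1 f2 f3 w :
  measurable_fun setT f1 -> (forall x, 0 <= f1 x) -> measurable_fun setT f2 ->
  measurable_fun setT f3 ->
  (forall x, f1 x <= f2 x) -> (forall x, f2 x <= f3 x) ->
  \int[mu]_x f3 x < +oo -> \int[M w]_x f3 x < +oo ->
  (`|centred f2 w| <= Num.max `|centred f1 w| `|centred f3 w| +
    (fine (\int[mu]_x f3 x) - fine (\int[mu]_x f1 x)))%R.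
Proof.
move=> m1 h1 m2 m3 f12 f23 fm fM.
have h2 x : 0 <= f2 x by exact: le_trans (h1 x) (f12 x).
have h3 x : 0 <= f3 x by exact: le_trans (h2 x) (f23 x).
have key (m : {measure set X -> \bar R}) : \int[m]_x f3 x < +oo ->
    (fine (\int[m]_x f1 x) <= fine (\int[m]_x f2 x) <= fine (\int[m]_x f3 x))%R.
  move=> f3oo.
  have i12 : \int[m]_x f1 x <= \int[m]_x f2 x by exact: ge0_le_integral.
  have i23 : \int[m]_x f2 x <= \int[m]_x f3 x by exact: ge0_le_integral.
  have n3 : \int[m]_x f3 x \is a fin_num by rewrite ge0_fin_numE//; exact: integral_ge0.
  have n2 : \int[m]_x f2 x \is a fin_num.
    by rewrite ge0_fin_numE; [exact: le_lt_trans i23 f3oo|exact: integral_ge0].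
  have n1 : \int[m]_x f1 x \is a fin_num.
    by rewrite ge0_fin_numE; [exact: le_lt_trans (le_trans i12 i23) f3oo|exact: integral_ge0].
  by apply/andP; split; exact: fine_le.
have /andP[a1 a2] := key _ fm; have /andP[b1 b2] := key _ fM.
rewrite /centred; set c1 := (fine _ - fine _)%R; set c3 := (_ - _)%R in |- *.
move: a1 a2 b1 b2; rewrite /c1 /c3.
move: (fine (\int[mu]_x f1 x)) (fine (\int[mu]_x f2 x)) (fine (\int[mu]_x f3 x)) => x1 x2 x3.
move: (fine (\int[M w]_x f1 x)) (fine (\int[M w]_x f2 x)) (fine (\int[M w]_x f3 x)) => y1 y2 y3.
move=> x12 x23 y12 y23; have e1 := ler_norm (y3 - x3); have e2 := ler_norm (- (y1 - x1))%R.
rewrite normrN in e2.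
have m1' : (`|y1 - x1| <= Num.max `|y1 - x1| `|y3 - x3|)%R by rewrite le_max lexx.
have m3' : (`|y3 - x3| <= Num.max `|y1 - x1| `|y3 - x3|)%R by rewrite le_max lexx orbT.
by rewrite ler_norml; apply/andP; split; lra.
Qed.

Lemma centred_sqr f : measurable_fun setT f -> (forall x, 0 <= f x) -> \int[mu]_x f x < +oo ->
  \int[P]_w ((centred f w) ^+ 2)%R%:E <= \int[mu]_x (f x * f x).
Proof. by move=> mf f0 foo; exact: (prm_variance HM mf f0 foo). Qed.

End centred_integrals.

Section block_process.
Context (R : realType) d (W : measurableType d) (P : probability W R).
Variable N : W -> {measure set (R * R * R) -> \bar R}.
Hypothesis HN : poisson_rm P (rate (@measurable_positives R)) N.
Variable gm : R.
Hypothesis gm_bounds : 2^-1 < gm < 1.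
Variables (g : R -> R * R -> R) (C : R).
Hypothesis Hg : path_kernel g C.
Local Open Scope ereal_scope.
Implicit Types (a b s t : R) (G : R * R -> R) (w : W).

Local Notation mu := (rate (@measurable_positives R)).

Let gm01 : (0 < gm < 1)%R.
Proof. by case/andP: gm_bounds => h ->; rewrite andbT (lt_trans _ h)// invr_gt0. Qed.

Definition phi (a b : R) (G : R * R -> R) (p : R * R * R) : \bar R :=
  (pow_block gm a b p.1.1 * G (p.1.2, p.2))%R%:E.

Lemma powRN_le a b : (0 < a)%R -> (a <= b)%R -> (b `^ (- gm) <= a `^ (- gm))%R.
Proof.
have /andP[g0 _] := gm01; move=> a0 ab; have b0 := lt_le_trans a0 ab.
by rewrite !powRN lef_pV2 ?posrE ?powR_gt0// ge0_ler_powR ?nnegrE ?(ltW g0) ?(ltW a0) ?(ltW b0).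
Qed.

Lemma measurable_phi a b G : measurable_fun setT G -> measurable_fun setT (phi a b G).
Proof.
move=> mG; apply/measurable_EFinP; apply: measurable_funM.
  apply: (measurable_comp measurableT (subsetT _) (@measurable_pow_block R gm a b)).
  exact: (measurableT_comp measurable_fst measurable_fst).
by apply: (measurable_comp measurableT (subsetT _) mG); exact: measurable_pair12.
Qed.

Lemma phi_ge0 a b G p : (forall q, (0 <= G q)%R) -> 0 <= phi a b G p.
Proof. by move=> G0; rewrite lee_fin mulr_ge0 ?pow_block_ge0. Qed.

Let mF a b : measurable_fun setT (EFin \o pow_block gm a b).
Proof. by apply/measurable_EFinP; exact: measurable_pow_block. Qed.

Lemma integral_phi a b G : measurable_fun setT G -> (forall q, (0 <= G q)%R) ->
  \int[mu]_p phi a b G p =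
  (\int[lebC R]_(v in @positives R) (pow_block gm a b v)%:E) * theta (fun q => (G q)%:E).
Proof.
move=> mG G0.
rewrite -(@integral_rate R _ (@measurable_positives R) (fun v => (pow_block gm a b v)%:E) (fun q => (G q)%:E))//;
  try (by move=> x; rewrite lee_fin pow_block_ge0).
- exact: (mF a b).
- by apply/measurable_EFinP.
Qed.

Lemma integral_phi_sqr a b G : (0 < a)%R -> (a <= b)%R ->
  measurable_fun setT G -> (forall q, (0 <= G q)%R) ->
  \int[mu]_p (phi a b G p * phi a b G p) <=
  ((a `^ (- gm)) ^+ 2 * (b - a))%R%:E * theta (fun q => ((G q) ^+ 2)%R%:E).
Proof.
move=> a0 ab mG G0.
have -> : \int[mu]_p (phi a b G p * phi a b G p) =
    (\int[lebC R]_(v in @positives R) ((pow_block gm a b v) ^+ 2)%R%:E) *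
    theta (fun q => ((G q) ^+ 2)%R%:E).
  rewrite -(@integral_rate R _ (@measurable_positives R)
    (fun v => ((pow_block gm a b v) ^+ 2)%R%:E) (fun q => ((G q) ^+ 2)%R%:E)).
  - apply: eq_integral => p _; rewrite /phi -!EFinM; congr EFin; ring.
  - by apply/measurable_EFinP; apply: measurable_funX; exact: measurable_pow_block.
  - by move=> x; rewrite lee_fin sqr_ge0.
  - by apply/measurable_EFinP; exact: measurable_funX.
  - by move=> x; rewrite lee_fin sqr_ge0.
apply: lee_wpmul2r; last exact: integral_pow_block_sqr.
by apply: theta_ge0 => q; rewrite lee_fin sqr_ge0.
Qed.

Lemma le_phi a b a' b' G G' p : (a' <= a)%R -> (b <= b')%R ->
  (forall q, (0 <= G q)%R) -> (forall q, (G q <= G' q)%R) -> phi a b G p <= phi a' b' G' p.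
Proof.
move=> aa bb G0 GG; rewrite lee_fin ler_pM ?pow_block_ge0// /pow_block.
case: ifPn => [/andP[av vb]|_]; last by case: ifP => // _; exact: powR_ge0.
by rewrite (le_lt_trans aa av) (le_trans vb bb).
Qed.

Lemma integral_phi_fin a b t : (0 <= a)%R -> (t <= 1)%R -> \int[mu]_p phi a b (g t) p < +oo.
Proof.
move=> a0 t1; pose b' := Num.max b 0%R.
apply: (@le_lt_trans _ _ (\int[mu]_p phi 0 b' (g 1%R) p)).
  apply: ge0_le_integral => //.
  - by move=> p _; apply: phi_ge0; exact: kg_ge0 Hg _.
  - by apply: measurable_phi; exact: kg_meas Hg _.
  - by apply: measurable_phi; exact: kg_meas Hg _.
  - move=> p _; apply: le_phi => //; first by rewrite le_max lexx.
      exact: kg_ge0 Hg _.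
    by move=> q; exact: (kg_mono Hg).
rewrite integral_phi; [|exact: kg_meas Hg _|exact: kg_ge0 Hg _].
have b0 : (0 <= b')%R by rewrite le_max lexx orbT.
apply: mul_lty.
- by apply: integral_ge0 => v _; rewrite lee_fin pow_block_ge0.
- by apply: theta_ge0 => q; rewrite lee_fin (kg_ge0 Hg).
- by apply: le_lt_trans (integral_pow_block0 gm01 b0) _; exact: ltry.
- by apply: le_lt_trans (theta_kernel Hg _) (ltry _); rewrite ler01 lexx.
Qed.

(** Integer truncations at time 1 suffice: all other truncations and earlier times are dominated by
    these. *)
Definition good : set W := [set w | forall n : nat, \int[N w]_p phi 0 n%:R (g 1%R) p < +oo].

Lemma measurable_good : measurable good.
Proof.
rewrite [X in measurable X](_ : _ = \bigcap_n [set w | \int[N w]_p phi 0 n%:R (g 1%R) p < +oo]); last first.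
  by apply/seteqP; split => [w h n _|w h n]; [exact: h|exact: (h n I)].
apply: bigcapT_measurable => n.
have mI : measurable_fun setT (fun w => \int[N w]_p phi 0 n%:R (g 1%R) p).
  apply: (measurable_rm_integral1 (prm_rm HN)); last by move=> p; apply: phi_ge0; exact: kg_ge0 Hg _.
  by apply: measurable_phi; exact: kg_meas Hg _.
rewrite (_ : [set w | _] = (fun w => \int[N w]_p phi 0 n%:R (g 1%R) p) @^-1` (~` [set +oo])).
  by rewrite -[X in measurable X]setTI; apply: mI => //; exact/measurableC/emeasurable_set1.
by apply/seteqP; split => w /=; rewrite ltey => /eqP.
Qed.

Lemma good_ae : {ae P, forall w, good w}.
Proof.
apply/ae_foralln => n.
have h := prm_integral_fin HN (measurable_phi 0 n%:R (kg_meas Hg 1%R))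
  (fun p => phi_ge0 0 n%:R p (kg_ge0 Hg 1%R)) (integral_phi_fin n%:R (lexx 0%R) (lexx 1%R)).
apply: filterS h => w; rewrite ge0_fin_numE//.
by apply: integral_ge0 => p _; apply: phi_ge0; exact: kg_ge0 Hg _.
Qed.

Lemma good_fin w a b t : good w -> (0 <= a)%R -> (t <= 1)%R -> \int[N w]_p phi a b (g t) p < +oo.
Proof.
move=> gw a0 t1; apply: le_lt_trans (gw (Num.truncn b).+1).
apply: ge0_le_integral => //.
- by move=> p _; apply: phi_ge0; exact: kg_ge0 Hg _.
- by apply: measurable_phi; exact: kg_meas Hg _.
- by apply: measurable_phi; exact: kg_meas Hg _.
- move=> p _; apply: le_phi => //; first exact/ltW/truncnS_gt.
    exact: kg_ge0 Hg _.
  by move=> q; exact: (kg_mono Hg).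
Qed.

Definition cphi a b G w : R := centred mu N (phi a b G) w.

Lemma measurable_cphi a b G : measurable_fun setT G -> (forall q, (0 <= G q)%R) ->
  measurable_fun setT (cphi a b G).
Proof.
move=> mG G0; apply: (measurable_centred HN); first exact: measurable_phi.
by move=> p; exact: phi_ge0.
Qed.

Lemma phi_split a b c t : (a <= b)%R -> (b <= c)%R ->
  phi a c (g t) = (fun p => phi a b (g t) p + phi b c (g t) p).
Proof.
move=> ab bc; apply/funext => p; rewrite /phi -EFinD -mulrDl; congr (_ * _)%R%:E.
rewrite /pow_block; case: (ltP b p.1.1) => bv.
  by rewrite (le_lt_trans ab bv)/= add0r.
by rewrite (le_trans bv bc) !andbT/= addr0.
Qed.

Lemma phi_inc a b s t : phi a b (g t) =
  (fun p => phi a b (g s) p + phi a b (fun q => (g t q - g s q)%R) p).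
Proof.
by apply/funext => p; rewrite /phi -EFinD -mulrDr; congr (_ * _)%R%:E; ring.
Qed.

Lemma cphi_split a b c t w : good w -> (0 <= a)%R -> (a <= b)%R -> (b <= c)%R -> (t <= 1)%R ->
  cphi a c (g t) w = (cphi a b (g t) w + cphi b c (g t) w)%R.
Proof.
move=> gw a0 ab bc t1.
rewrite /cphi (phi_split _ ab bc) centredD//.
- by apply: measurable_phi; exact: kg_meas Hg _.
- by move=> p; apply: phi_ge0; exact: kg_ge0 Hg _.
- by apply: measurable_phi; exact: kg_meas Hg _.
- by move=> p; apply: phi_ge0; exact: kg_ge0 Hg _.
- by rewrite -(phi_split _ ab bc); exact: integral_phi_fin.
- by rewrite -(phi_split _ ab bc); exact: good_fin.
Qed.

Lemma cphi_inc a b s t w : good w -> (0 <= a)%R -> (s <= t)%R -> (t <= 1)%R ->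
  cphi a b (g t) w = (cphi a b (g s) w + cphi a b (fun q => (g t q - g s q)%R) w)%R.
Proof.
move=> gw a0 st t1.
rewrite /cphi (phi_inc a b s t) centredD//.
- by apply: measurable_phi; exact: kg_meas Hg _.
- by move=> p; apply: phi_ge0; exact: kg_ge0 Hg _.
- by apply: measurable_phi; apply: measurable_funB; exact: kg_meas Hg _.
- by move=> p; apply: phi_ge0 => q; rewrite subr_ge0 (kg_mono Hg).
- by rewrite -(phi_inc a b s t); exact: integral_phi_fin.
- by rewrite -(phi_inc a b s t); exact: good_fin.
Qed.

(** Stated for any measurable [X] that agrees with the block integral on [good], so that it applies
    to differences of the variables [bx], which become single block integrals only there. *)
Lemma cphi_sqr (a b K : R) G (X : W -> R) : (0 < a)%R -> (a <= b)%R ->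
  measurable_fun setT G -> (forall q, (0 <= G q)%R) ->
  theta (fun q => (G q)%:E) < +oo -> theta (fun q => ((G q) ^+ 2)%R%:E) <= K%:E ->
  measurable_fun setT X -> (forall w, good w -> X w = cphi a b G w) ->
  \int[P]_w ((X w) ^+ 2)%R%:E <= ((a `^ (- gm)) ^+ 2 * (b - a) * K)%R%:E.
Proof.
move=> a0 ab mG G0 Gfin GK mX XE.
have -> : \int[P]_w ((X w) ^+ 2)%R%:E = \int[P]_w ((cphi a b G w) ^+ 2)%R%:E.
  apply: ae_eq_integral => //.
  - by apply/measurable_EFinP; exact: measurable_funX.
  - by apply/measurable_EFinP; apply: measurable_funX; exact: measurable_cphi.
  by apply: filterS good_ae => w gw _; rewrite XE.
apply: le_trans (centred_sqr HN (measurable_phi a b mG) (fun p => phi_ge0 a b p G0) _) _.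
  rewrite integral_phi//; apply: mul_lty => //.
  - by apply: integral_ge0 => v _; rewrite lee_fin pow_block_ge0.
  - by apply: theta_ge0 => q; rewrite lee_fin.
  - by apply: le_lt_trans (integral_pow_block gm01 a0 ab) _; exact: ltry.
apply: le_trans (integral_phi_sqr a0 ab mG G0) _.
rewrite [X in _ <= X]EFinM; apply: lee_wpmul2l => //.
by rewrite lee_fin mulr_ge0 ?sqr_ge0// subr_ge0.
Qed.

Section block.
Variable m : nat.
Local Notation A := (2 ^+ m : R)%R.

Let A0 : (0 < A)%R. Proof. by rewrite exprn_gt0. Qed.

(** Block [m] covers [2^m < v <= 2^(m+1)]. Both indices run up to [2^m]: unit steps in the
    truncation level, steps [2^-m] in time. *)
Definition bx (i j : nat) (w : W) : R := cphi A (A + i%:R) (g (j%:R / A)%R) w.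

Let q1 i i' w : R := ((bx i' 0 w - bx i 0 w) ^+ 2)%R.
Let q2 i i' j j' w : R := (((bx i' j' w - bx i j' w) - (bx i' j w - bx i j w)) ^+ 2)%R.
(** Bounds the square of a truncation increment simultaneously at all times of the grid: its value
    at time 0 plus a chaining of its increments in time, the latter being increments over
    rectangles. *)
Let Q1 i i' w : R := (2 * q1 i i' w + 2 * (m.+1%:R * chain_sum m (fun j j' => q2 i i' j j' w)))%R.

Definition blockQ (w : W) : R := (m.+1%:R * chain_sum m (fun i i' => Q1 i i' w))%R.

Let mbx i j : measurable_fun setT (bx i j).
Proof. by apply: measurable_cphi; [exact: kg_meas Hg _|exact: kg_ge0 Hg _]. Qed.

Let mq1 i i' : measurable_fun setT (q1 i i').
Proof. by apply: measurable_funX; exact: measurable_funB. Qed.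

Let mq2 i i' j j' : measurable_fun setT (q2 i i' j j').
Proof. by apply: measurable_funX; apply: measurable_funB; exact: measurable_funB. Qed.

Let mQ1 i i' : measurable_fun setT (Q1 i i').
Proof.
apply: measurable_funD; first exact: measurable_funM.
by apply: measurable_funM => //; apply: measurable_funM => //; exact: measurable_chain_sum.
Qed.

Lemma measurable_blockQ : measurable_fun setT blockQ.
Proof. by apply: measurable_funM => //; exact: measurable_chain_sum. Qed.

Let q2_ge0 i i' j j' w : (0 <= q2 i i' j j' w)%R. Proof. exact: sqr_ge0. Qed.

Let Q1_ge0 i i' w : (0 <= Q1 i i' w)%R.
Proof.
apply: addr_ge0; first by rewrite mulr_ge0// sqr_ge0.
by rewrite mulr_ge0// mulr_ge0// chain_sum_ge0.
Qed.

Lemma blockQ_ge0 w : (0 <= blockQ w)%R.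
Proof. by rewrite mulr_ge0// chain_sum_ge0. Qed.

(** Two-parameter chaining: over truncation levels starting from the empty block, where [bx] is
    zero, and, for each increment in the level, over times. *)
Lemma bx_le_blockQ i j w : (i <= 2 ^ m)%N -> (j <= 2 ^ m)%N -> ((bx i j w) ^+ 2 <= blockQ w)%R.
Proof.
move=> im jm.
have bx0 k : bx 0 k w = 0%R.
  have E : phi A (A + 0%:R) (g (k%:R / A)%R) = cst 0.
    apply/funext => p; rewrite /phi /pow_block addr0; case: ifP; rewrite ?mul0r//.
    by move=> /andP[h1 h2]; move: (lt_le_trans h1 h2); rewrite ltxx.
  by rewrite /bx /cphi E /centred !integral0 subrr.
have := @dyadic_chaining R m (fun i => bx i j w) (fun i i' => Q1 i i' w) i _ im.
rewrite bx0 subr0; apply => a b.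
have := @dyadic_chaining R m (fun j => bx b j w - bx a j w)%R (fun j j' => q2 a b j j' w) j
  (fun _ _ => lexx _) jm.
rewrite /Q1 /q1; set y := (bx b j w - bx a j w)%R; set y0 := (bx b 0 w - bx a 0 w)%R.
set S := (m.+1%:R * _)%R => h.
(* This square identity is [y^2 <= 2 y0^2 + 2 (y - y0)^2] in disguise. *)
have E : (2 * y0 ^+ 2 + 2 * (y - y0) ^+ 2 - y ^+ 2 = (y - 2 * y0) ^+ 2)%R by ring.
have := sqr_ge0 (y - 2 * y0)%R; lra.
Qed.

Let B : R := ((A `^ (- gm)) ^+ 2 * C)%R.

Let B0 : (0 <= B)%R. Proof. by rewrite mulr_ge0 ?sqr_ge0 ?(kernel_ge0 Hg). Qed.

Let t01 j : (j <= 2 ^ m)%N -> (0 <= j%:R / A <= 1)%R.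
Proof.
move=> jm; rewrite divr_ge0 ?(ltW A0)//= ler_pdivrMr// mul1r.
by rewrite -natrX ler_nat.
Qed.

Let bx_inc w i i' j : good w -> (i <= i')%N -> (j <= 2 ^ m)%N ->
  (bx i' j w - bx i j w)%R = cphi (A + i%:R) (A + i'%:R) (g (j%:R / A)%R) w.
Proof.
move=> gw ii jm; have /andP[t0 t1] := t01 jm.
rewrite /bx (@cphi_split A (A + i%:R)%R (A + i'%:R)%R)//; first ring.
- by rewrite lerDl.
- by rewrite lerD2l ler_nat.
Qed.

Let mean_q1 i i' : (i <= i')%N -> (i' <= 2 ^ m)%N ->
  \int[P]_w (q1 i i' w)%:E <= (B * (i' - i)%:R)%R%:E.
Proof.
move=> ii im.
have := @cphi_sqr (A + i%:R)%R (A + i'%:R)%R C (g 0%R) (fun w => bx i' 0 w - bx i 0 w)%R.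
move=> /(_ _ _ _ _ _ _ _ _) H; apply: le_trans (H _ _ _ _ _ _ _ _) _.
- by rewrite ltr_wpDr.
- by rewrite lerD2l ler_nat.
- exact: kg_meas Hg _.
- exact: kg_ge0 Hg _.
- by apply: le_lt_trans (kg_1 Hg) _; exact: ltry.
- exact: kg_2 Hg.
- exact: measurable_funB.
- by move=> w gw; rewrite bx_inc// mul0r.
rewrite lee_fin /B -[leRHS]mulrAC natrB// (_ : A + i'%:R - (A + i%:R) = i'%:R - i%:R)%R; last ring.
rewrite ler_wpM2r ?(kernel_ge0 Hg)// ler_wpM2r ?subr_ge0 ?ler_nat//.
by rewrite lerXn2r ?nnegrE ?powR_ge0// powRN_le// lerDl.
Qed.

Let mean_q2 i i' j j' : (i <= i')%N -> (i' <= 2 ^ m)%N -> (j <= j')%N -> (j' <= 2 ^ m)%N ->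
  \int[P]_w (q2 i i' j j' w)%:E <= (B * (i' - i)%:R * (j' - j)%:R / 2 ^+ m)%R%:E.
Proof.
move=> ii im jj jm.
have jm' := leq_trans jj jm.
have /andP[t0 t1] := t01 jm'; have /andP[t0' t1'] := t01 jm.
have tt : (j%:R / A <= j'%:R / A)%R by rewrite ler_wpM2r ?invr_ge0 ?(ltW A0)// ler_nat.
have := @cphi_sqr (A + i%:R)%R (A + i'%:R)%R (C * (j'%:R / A - j%:R / A))%R
  (fun q => g (j'%:R / A) q - g (j%:R / A) q)%R
  (fun w => (bx i' j' w - bx i j' w) - (bx i' j w - bx i j w))%R.
move=> /(_ _ _ _ _ _ _ _ _) H; apply: le_trans (H _ _ _ _ _ _ _ _) _.
- by rewrite ltr_wpDr.
- by rewrite lerD2l ler_nat.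
- by apply: measurable_funB; exact: kg_meas Hg _.
- by move=> q; rewrite subr_ge0 (kg_mono Hg).
- by apply: le_lt_trans (kg_inc1 Hg t0 tt t1') _; exact: ltry.
- exact: (kg_inc2 Hg).
- by apply: measurable_funB; exact: measurable_funB.
- move=> w gw; rewrite !bx_inc// (@cphi_inc _ _ _ _ w gw _ tt t1'); first ring.
  by rewrite addr_ge0// ltW.
rewrite lee_fin (_ : A + i'%:R - (A + i%:R) = (i' - i)%:R)%R; last by rewrite natrB//; ring.
have -> : (B * (i' - i)%:R * (j' - j)%:R / A =
   (A `^ (- gm)) ^+ 2 * ((i' - i)%:R * (C * (j'%:R / A - j%:R / A))))%R.
  by rewrite /B natrB// natrB//; field; rewrite gt_eqF.
rewrite -mulrA ler_wpM2r//.
  by rewrite mulr_ge0// mulr_ge0 ?(kernel_ge0 Hg)// subr_ge0.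
by rewrite lerXn2r ?nnegrE ?powR_ge0// powRN_le// lerDl.
Qed.

(** Each of the two chainings costs [(m+1)^2]. The remaining factor is of order [2^(m (1 - 2 gm))],
    which decays because [gm > 1/2]. *)
Lemma mean_blockQ : \int[P]_w (blockQ w)%:E <= (m.+1%:R ^+ 4 * (4 * B * A))%R%:E.
Proof.
apply: le_trans (@mean_chain_sum _ _ _ P m Q1 (4 * m.+1%:R ^+ 2 * B * A)%R _ mQ1 Q1_ge0 _) _.
- by rewrite mulr_ge0 ?(ltW A0)// mulr_ge0// mulr_ge0// sqr_ge0.
- move=> a b ab bm.
  have h1 := mean_q1 ab bm.
  have h2 := @mean_chain_sum _ _ _ P m (q2 a b) (B * (b - a)%:R)%R _ (mq2 a b) (q2_ge0 a b)
    (fun j j' jj jm => mean_q2 ab bm jj jm).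
  rewrite /Q1; under eq_integral do rewrite EFinD !(EFinM 2).
  rewrite ge0_integralD//; last 4 first.
  + by move=> w _; rewrite mule_ge0// lee_fin sqr_ge0.
  + by apply: emeasurable_funM => //; exact/measurable_EFinP.
  + by move=> w _; rewrite mule_ge0// lee_fin mulr_ge0// chain_sum_ge0.
  + apply: emeasurable_funM => //; apply/measurable_EFinP; apply: measurable_funM => //.
    exact: measurable_chain_sum.
  rewrite !ge0_integralZl//; try exact/measurable_EFinP;
    try (by move=> w _; rewrite lee_fin sqr_ge0);
    try (by move=> w _; rewrite lee_fin mulr_ge0// chain_sum_ge0);
    try (by apply/measurable_EFinP; apply: measurable_funM => //; exact: measurable_chain_sum).
  apply: (@le_trans _ _ (2%:E * (B * (b - a)%:R)%R%:E + 2%:E * (m.+1%:R ^+ 2 * (B * (b - a)%:R))%R%:E)).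
    apply: leeD; apply: lee_wpmul2l => //.
    by apply: h2; rewrite mulr_ge0.
  rewrite -!EFinM -EFinD lee_fin.
  have -> : (4 * m.+1%:R ^+ 2 * B * A * (b - a)%:R / A = 4 * m.+1%:R ^+ 2 * (B * (b - a)%:R))%R.
    by field; rewrite gt_eqF.
  set z := (B * _)%R; have z0 : (0 <= z)%R by rewrite mulr_ge0.
  have m1 : (1 <= m.+1%:R ^+ 2 :> R)%R by rewrite exprn_ege1// ler1n.
  have : (z <= m.+1%:R ^+ 2 * z)%R by rewrite ler_peMl.
  lra.
rewrite lee_fin le_eqVlt; apply/orP; left; apply/eqP; ring.
Qed.

End block.

Let tau : R := (2 `^ (- gm))%R.
Let rho : R := (tau ^+ 2 * 2)%R.

Let tau0 : (0 < tau)%R. Proof. exact: powR_gt0. Qed.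

Let rho01 : (0 < rho < 1)%R.
Proof.
have /andP[g2 _] := gm_bounds; rewrite /rho mulr_gt0 ?exprn_gt0//=.
have l2 : (0 < ln 2 :> R)%R by rewrite ln_gt0// ltr1n.
have -> : (tau = expR (- gm * ln 2))%R by rewrite /tau /powR pnatr_eq0.
rewrite -expRM_natl -[X in (_ * X)%R](@lnK _ 2%R) ?posrE// -expRD expR_lt1.
have h : (1 - 2 * gm < 0)%R by lra.
have := h; rewrite -(pmulr_llt0 _ l2); lra.
Qed.

(** Eighth root of the ratio [rho = 2^(1 - 2 gm)]. Of [rho^m = sigma^(8m)], one factor [sigma^(4m)]
    absorbs [(m+1)^4]; the other leaves, after the almost sure bound, [blockQ] of order
    [sigma^(2m)], hence values of order [sigma^m]. *)
Definition sigma : R := (rho `^ 8^-1)%R.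

Let sigmaE : (sigma ^+ 8 = rho)%R.
Proof.
have /andP[r0 _] := rho01.
by rewrite -powR_mulrn ?powR_ge0// -powRrM mulVf// powRr1// ltW.
Qed.

Lemma sigma01 : (0 < sigma < 1)%R.
Proof.
have /andP[r0 r1] := rho01; have s0 : (0 < sigma)%R by exact: powR_gt0.
rewrite s0/= ltNge; apply/negP => s1; have := exprn_ege1 8 s1.
by rewrite sigmaE leNgt r1.
Qed.

(** As [gm < 1], [tau] exceeds 1/2 and so is at most [rho = 2 tau^2]. This makes the compensator
    gaps between grid points no larger than the chaining bound. *)
Let tau_sigma : (tau <= sigma)%R.
Proof.
have /andP[g2 g1] := gm_bounds; have /andP[s0 s1] := sigma01.
apply: (@le_trans _ _ rho).
  have h : (2^-1 <= tau)%R by rewrite -[leLHS]powR_inv1// ler_powR ?ler1n// lerN2 ltW.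
  have h2 : (1 <= tau * 2)%R by lra.
  by rewrite /rho expr2 -mulrA -[leLHS]mulr1 ler_wpM2l// ltW.
rewrite -sigmaE exprS -[leRHS]mulr1 ler_wpM2l ?(ltW s0)//.
by rewrite exprn_ile1 ?ltW.
Qed.

Let pow2 m : ((2 ^+ m : R) `^ (- gm) = tau ^+ m)%R.
Proof. by rewrite -[(2 ^+ m)%R]powR_mulrn// -powRrM mulrC powRrM powR_mulrn// powR_ge0. Qed.

Definition geo : set W := [set w | good w /\ geometric_sum (sigma ^+ 2)%R blockQ w < +oo].

Lemma geo_ae_measurable : measurable geo /\ {ae P, forall w, geo w}.
Proof.
have /andP[s0 s1] := sigma01; have /andP[r0 r1] := rho01.
have s4 : (0 < sigma ^+ 4 < 1)%R by rewrite exprn_gt0//= expr_lt1// ltW.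
have s2 : (0 < sigma ^+ 2 < 1)%R by rewrite exprn_gt0//= expr_lt1// ltW.
have [K [K0 HK]] := poly_geometric s4.
have C0 := kernel_ge0 Hg.
have KC : (0 <= K * (4 * C))%R by rewrite mulr_ge0// mulr_ge0.
have mB m : \int[P]_w (blockQ m w)%:E <= (K * (4 * C) * ((sigma ^+ 2) ^+ 2) ^+ m)%R%:E.
  apply: le_trans (mean_blockQ m) _; rewrite lee_fin pow2.
  have -> : ((sigma ^+ 2) ^+ 2 = sigma ^+ 4)%R by rewrite -exprM.
  have -> : (4 * ((tau ^+ m) ^+ 2 * C) * 2 ^+ m = (rho ^+ m) * (4 * C))%R.
    by rewrite /rho exprMn exprAC; ring.
  have -> : (rho ^+ m = (sigma ^+ 4) ^+ m * (sigma ^+ 4) ^+ m)%R.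
    by rewrite -sigmaE -exprMn -exprD.
  have -> : (m.+1%:R ^+ 4 * ((sigma ^+ 4) ^+ m * (sigma ^+ 4) ^+ m * (4 * C)) =
    m.+1%:R ^+ 4 * (sigma ^+ 4) ^+ m * (4 * C * (sigma ^+ 4) ^+ m))%R by ring.
  rewrite -[leRHS]mulrA ler_wpM2r//.
  by rewrite mulr_ge0 ?mulr_ge0// exprn_ge0// exprn_ge0// ltW.
have [mG aeG] := geometric_sum_ae KC s2 measurable_blockQ blockQ_ge0 mB.
split; last by apply: filterS2 good_ae aeG => w; split.
rewrite /geo (_ : [set w | _] = good `&` (geometric_sum (sigma ^+ 2)%R blockQ) @^-1` (~` [set +oo])).
  apply: measurableI; first exact: measurable_good.
  by rewrite -[X in measurable X]setTI; apply: mG => //; exact/measurableC/emeasurable_set1.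
apply/seteqP; split => w [gw /= h]; split => //.
  by move: h; rewrite /= ltey => /eqP.
by rewrite ltey; exact/eqP.
Qed.

(** On the grid the square root of [blockQ] bounds the block. Off the grid [centred_le] adds the
    compensator of one unit of [v], at most [2 C tau^m], and that of one time step, at most
    [C tau^m]: whence [3 * C]. *)
Lemma block_bound w : geo w -> exists K : R, (0 <= K)%R /\ forall m y t,
  (2 ^+ m <= y <= 2 ^+ m.+1)%R -> (0 <= t <= 1)%R ->
  (`|cphi (2 ^+ m) y (g t) w| <= K * sigma ^+ m)%R.
Proof.
have /andP[s0 s1] := sigma01; have C0 := kernel_ge0 Hg.
move=> [gw Qoo].
have [K HK] := geometric_sum_bound (exprn_gt0 2 s0) blockQ_ge0 Qoo.
have K0 : (0 <= K)%R by have := HK 0%N; rewrite expr0 mulr1; apply: le_trans; exact: blockQ_ge0.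
exists (Num.sqrt K + 3 * C)%R; split; first by rewrite addr_ge0 ?sqrtr_ge0 ?mulr_ge0.
move=> m y t /andP[y1 y2] /andP[t0 t1].
pose A : R := (2 ^+ m)%R; have A0 : (0 < A)%R by rewrite exprn_gt0.
have [i [i' [ii' ii1 im iz zi]]] : exists i j : nat,
    [/\ (i <= j)%N, (j <= i.+1)%N, (j <= 2 ^ m)%N, (i%:R <= y - A)%R & (y - A <= j%:R)%R].
  by apply: grid_bounds; rewrite natrX subr_ge0 y1/= -/A lerBlDr -mulr2n -[(A *+ 2)%R]mulr_natl -exprS.
have [j [j' [jj' jj1 jm jz zj]]] : exists i j : nat,
    [/\ (i <= j)%N, (j <= i.+1)%N, (j <= 2 ^ m)%N, (i%:R <= t * A)%R & (t * A <= j%:R)%R].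
  apply: grid_bounds; rewrite natrX mulr_ge0 ?(ltW A0)//=.
  by rewrite -[leRHS]mul1r ler_wpM2r ?(ltW A0).
have im' := leq_trans ii' im; have jm' := leq_trans jj' jm.
have tj : (j%:R / A <= t)%R by rewrite ler_pdivrMr.
have jt : (t <= j'%:R / A)%R by rewrite ler_pdivlMr.
have j'1 : (j'%:R / A <= 1)%R by rewrite ler_pdivrMr// mul1r /A -natrX ler_nat.
have j0 : (0 <= j%:R / A)%R by rewrite divr_ge0 ?(ltW A0).
have Aii : (A + i%:R <= A + i'%:R)%R by rewrite lerD2l ler_nat.
pose f1 := phi A (A + i%:R)%R (g (j%:R / A)%R).
pose f3 := phi A (A + i'%:R)%R (g (j'%:R / A)%R).
have := @centred_le R _ W _ _ mu N f1 (phi A y (g t)) f3 w.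
have f3mu : \int[mu]_x f3 x < +oo by apply: integral_phi_fin => //; exact: ltW.
have f3N : \int[N w]_x f3 x < +oo by apply: good_fin => //; exact: ltW.
move=> /(_ _ _ _ _ _ _ f3mu f3N) H; apply: le_trans (H _ _ _ _ _ _) _.
- by apply: measurable_phi; exact: kg_meas Hg _.
- by move=> x; apply: phi_ge0; exact: kg_ge0 Hg _.
- by apply: measurable_phi; exact: kg_meas Hg _.
- by apply: measurable_phi; exact: kg_meas Hg _.
- by move=> x; apply: le_phi => //; [lra|exact: kg_ge0 Hg _|move=> q; exact: (kg_mono Hg)].
- by move=> x; apply: le_phi => //; [lra|exact: kg_ge0 Hg _|move=> q; exact: (kg_mono Hg)].
rewrite mulrDl; apply: lerD.
  have bb (a b : nat) : (a <= 2 ^ m)%N -> (b <= 2 ^ m)%N ->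
      (`|bx m a b w| <= Num.sqrt K * sigma ^+ m)%R.
    move=> am bm; rewrite -ler_sqr ?nnegrE ?mulr_ge0 ?sqrtr_ge0 ?exprn_ge0 ?(ltW s0)//.
    rewrite (real_normK (num_real _)) exprMn (sqr_sqrtr K0) -exprM mulnC exprM.
    exact: le_trans (bx_le_blockQ w am bm) (HK m).
  by rewrite ge_max; apply/andP; split; exact: bb.
have fle x (r : R) : 0 <= x -> x <= r%:E -> (fine x <= r)%R.
  by case: x => [z||]//=; rewrite ?lee_fin.
have A00 := ltW A0; have iA : (i%:R <= A)%R by rewrite /A -natrX ler_nat.
have jj0 : (j%:R / A <= j'%:R / A)%R by rewrite ler_wpM2r ?invr_ge0// ler_nat.
have e1 : fine (\int[mu]_x f3 x) = (fine (\int[mu]_x phi A (A + i%:R) (g (j'%:R / A)) x) +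
    fine (\int[mu]_x phi (A + i%:R) (A + i'%:R) (g (j'%:R / A)) x))%R.
  rewrite /f3 (@phi_split A (A + i%:R)%R) ?lerDl// fine_integralD//.
  - by apply: measurable_phi; exact: kg_meas Hg _.
  - by move=> x; apply: phi_ge0; exact: kg_ge0 Hg _.
  - by apply: measurable_phi; exact: kg_meas Hg _.
  - by move=> x; apply: phi_ge0; exact: kg_ge0 Hg _.
  - by rewrite -phi_split ?lerDl.
have e2 : fine (\int[mu]_x phi A (A + i%:R) (g (j'%:R / A)) x) = (fine (\int[mu]_x f1 x) +
    fine (\int[mu]_x phi A (A + i%:R) (fun q => (g (j'%:R / A) q - g (j%:R / A) q)%R) x))%R.
  rewrite (@phi_inc A (A + i%:R)%R (j%:R / A)%R) fine_integralD//.
  - by apply: measurable_phi; exact: kg_meas Hg _.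
  - by move=> x; apply: phi_ge0; exact: kg_ge0 Hg _.
  - by apply: measurable_phi; apply: measurable_funB; exact: kg_meas Hg _.
  - by move=> x; apply: phi_ge0 => q; rewrite subr_ge0 (kg_mono Hg).
  - by rewrite -phi_inc; exact: integral_phi_fin.
have b1 : (fine (\int[mu]_x phi (A + i%:R) (A + i'%:R) (g (j'%:R / A)) x) <= sigma ^+ m * (2 * C))%R.
  apply: fle; first by apply: integral_ge0 => x _; apply: phi_ge0; exact: kg_ge0 Hg _.
  rewrite integral_phi; [|exact: kg_meas Hg _|exact: kg_ge0 Hg _].
  rewrite EFinM; apply: lee_pmul.
  - by apply: integral_ge0 => v _; rewrite lee_fin pow_block_ge0.
  - by apply: theta_ge0 => q; rewrite lee_fin (kg_ge0 Hg).
  - apply: le_trans (integral_pow_block gm01 _ Aii) _; first by rewrite ltr_wpDr.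
    rewrite lee_fin (_ : A + i'%:R - (A + i%:R) = i'%:R - i%:R)%R; last ring.
    apply: (@le_trans _ _ (tau ^+ m * 1)%R).
      apply: ler_pM; rewrite ?powR_ge0 ?subr_ge0 ?ler_nat//.
        by rewrite -pow2; apply: powRN_le; rewrite ?lerDl.
      have h : (i'%:R <= i%:R + 1 :> R)%R by rewrite natr1 ler_nat.
      by rewrite lerBlDr addrC.
    by rewrite mulr1 lerXn2r ?nnegrE ?(ltW tau0) ?(ltW s0).
  - by apply: theta_kernel; rewrite ?(le_trans j0 jj0).
have b2 : (fine (\int[mu]_x phi A (A + i%:R) (fun q => (g (j'%:R / A) q - g (j%:R / A) q)%R) x)
    <= sigma ^+ m * C)%R.
  apply: fle.
    by apply: integral_ge0 => x _; apply: phi_ge0 => q; rewrite subr_ge0 (kg_mono Hg).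
  rewrite integral_phi; first last.
  - by move=> q; rewrite subr_ge0 (kg_mono Hg).
  - by apply: measurable_funB; exact: kg_meas Hg _.
  apply: (@le_trans _ _ ((tau ^+ m * A)%R%:E * (C * (A^-1))%R%:E)).
    apply: lee_pmul.
    - by apply: integral_ge0 => v _; rewrite lee_fin pow_block_ge0.
    - by apply: theta_ge0 => q; rewrite lee_fin subr_ge0 (kg_mono Hg).
    - apply: le_trans (integral_pow_block gm01 A0 _) _; first by rewrite lerDl.
      by rewrite pow2 addrAC subrr add0r lee_fin ler_wpM2l// exprn_ge0// ltW.
    - apply: le_trans (kg_inc1 Hg j0 jj0 j'1) _; rewrite lee_fin ler_wpM2l//.
      rewrite -mulrBl -[leRHS]mul1r ler_wpM2r ?invr_ge0//.
      have h : (j'%:R <= j%:R + 1 :> R)%R by rewrite natr1 ler_nat.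
      by rewrite lerBlDr addrC.
  rewrite -EFinM lee_fin (_ : tau ^+ m * A * (C / A) = tau ^+ m * C)%R; last by field; rewrite gt_eqF.
  by rewrite ler_wpM2r// lerXn2r ?nnegrE ?(ltW tau0) ?(ltW s0).
rewrite e1 e2; move: b1 b2; set x1 := fine _; set x2 := fine _; set x3 := fine _; lra.
Qed.

Lemma cadlag_phi (m : {measure set (R * R * R) -> \bar R}) y :
  \int[m]_p phi 0 y (g 1%R) p < +oo -> cadlag01 (fun t => fine (\int[m]_p phi 0 y (g t) p)).
Proof.
move=> foo; apply: integral_cadlag => //.
- by move=> t; apply: measurable_phi; exact: kg_meas Hg _.
- by move=> t p; apply: phi_ge0; exact: kg_ge0 Hg _.
- by move=> s t p st; apply: le_phi => //; [exact: kg_ge0 Hg _|move=> q; exact: (kg_mono Hg)].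
move=> t /andP[t0 t1]; apply: aeW => p; apply/fine_cvgP; split; first exact: nearW.
rewrite /=; apply: cvgMr; apply/cvgrPdist_le => e e0.
have [s0 [ts0 H]] := kg_rc Hg t (p.1.2, p.2) e0.
have d0 : (0 < s0 - t)%R by rewrite subr_gt0.
near=> k.
have kd : (k.+1%:R^-1 < s0 - t)%R by near: k; exact: (near_infty_natSinv_lt (PosNum d0)).
have k0 : (0 < k.+1%:R^-1 :> R)%R by rewrite invr_gt0.
have z0 : (0 <= (1 - t) * k.+1%:R^-1)%R by rewrite mulr_ge0 ?subr_ge0 ?(ltW t1) ?(ltW k0).
have z1 : ((1 - t) * k.+1%:R^-1 <= k.+1%:R^-1)%R by rewrite ler_piMl ?(ltW k0)//; lra.
have h1 : (g t (p.1.2, p.2) <= g (t + (1 - t) * k.+1%:R^-1)%R (p.1.2, p.2))%R.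
  by apply: (kg_mono Hg); rewrite lerDl.
have h2 := H (t + (1 - t) * k.+1%:R^-1)%R.
have zs : ((1 - t) * k.+1%:R^-1 <= s0 - t)%R := le_trans z1 (ltW kd).
move: z0 zs h1 h2 => /=; set z := ((1 - t) * _)%R => z0 zs h1 h2.
rewrite distrC ger0_norm ?subr_ge0// lerBlDl; apply: h2.
by apply/andP; split; [rewrite lerDl|rewrite -lerBrDl].
Unshelve. all: end_near. Qed.

(** Splitting at the powers of 2 between [2^m] and [y], the block bounds sum to a geometric tail,
    uniformly in time. *)
Lemma cphi_cauchy w : geo w -> exists K : R, (0 <= K)%R /\ forall m y t,
  (2 ^+ m <= y)%R -> (0 <= t <= 1)%R ->
  (`|cphi 0 y (g t) w - cphi 0 (2 ^+ m) (g t) w| <= K * sigma ^+ m)%R.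
Proof.
have /andP[s0 s1] := sigma01.
move=> gw; have [K [K0 HK]] := block_bound gw.
have d0 : (0 < 1 - sigma)%R by rewrite subr_gt0.
exists (K / (1 - sigma))%R; split; first by rewrite divr_ge0 ?(ltW d0).
move=> m y t my t01; have /andP[t0 t1] := t01.
have pos k : (0 < (2 : R) ^+ k)%R by rewrite exprn_gt0.
have step k z : (2 ^+ k <= z <= 2 ^+ k.+1)%R ->
    (`|cphi 0 z (g t) w - cphi 0 (2 ^+ k) (g t) w| <= K * sigma ^+ k)%R.
  move=> kz; have := HK k z t kz t01; case/andP: kz => kz _.
  rewrite (@cphi_split 0%R (2 ^+ k)%R z t w)//; try exact: ltW; try by case: gw.
  by rewrite addrAC subrr add0r.
(* The bound is the exact partial sum of the geometric series, which lets the induction on the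
   number of blocks close. *)
have key n : forall z, (2 ^+ m <= z <= 2 ^+ (m + n))%R ->
    (`|cphi 0 z (g t) w - cphi 0 (2 ^+ m) (g t) w| <= K / (1 - sigma) * (sigma ^+ m - sigma ^+ (m + n)))%R.
  elim: n => [|n IH] z.
    by rewrite addn0 => /le_anti <-; rewrite !subrr normr0 mulr0.
  move=> /andP[mz zn].
  have E : (K / (1 - sigma) * (sigma ^+ m - sigma ^+ (m + n.+1)) =
      K / (1 - sigma) * (sigma ^+ m - sigma ^+ (m + n)) + K * sigma ^+ (m + n))%R.
    by rewrite addnS exprS; field; rewrite gt_eqF.
  have q0 : (0 <= K * sigma ^+ (m + n))%R by rewrite mulr_ge0// exprn_ge0// ltW.
  rewrite E; have [zn'|zn'] := leP z (2 ^+ (m + n))%R.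
    by apply: le_trans (IH z _) _; rewrite ?mz ?zn'// lerDl.
  have h1 := IH (2 ^+ (m + n))%R.
  have h2 := step (m + n)%N z.
  apply: le_trans (ler_distD (cphi 0 (2 ^+ (m + n)) (g t) w) _ _) _.
  rewrite addrC; apply: lerD.
    by apply: h1; rewrite lexx andbT ler_weXn2l ?ler1n// leq_addr.
  by apply: h2; rewrite (ltW zn')/= -addnS.
pose n := (Num.truncn y).+1.
have yn : (y <= 2 ^+ (m + n))%R.
  apply: ltW; apply: lt_le_trans (truncnS_gt y) _; rewrite -/n.
  rewrite -natrX ler_nat; apply: leq_trans (ltnW (ltn_expl n (ltnSn 1))) _.
  by rewrite leq_exp2l// leq_addl.
have yn2 : (2 ^+ m <= y <= 2 ^+ (m + n))%R by rewrite my yn.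
apply: le_trans (key n y yn2) _.
by rewrite ler_wpM2l ?divr_ge0 ?(ltW d0)// gerBl exprn_ge0// ltW.
Qed.

End block_process.

(** * Edges *)

Lemma measurable_bool_set d (X : measurableType d) (f : X -> bool) :
  measurable_fun setT f -> measurable [set x | f x].
Proof. by move=> mf; rewrite -[X in measurable X]setTI; exact: (mf measurableT [set true]). Qed.

Lemma measurable_natb d (X : measurableType d) (R : realType) (f : X -> bool) :
  measurable_fun setT f -> measurable_fun setT (fun x => (f x)%:R : R).
Proof.
move=> mf; rewrite (_ : (fun x => _) = fun x => if f x then 1 else 0).
  exact: measurable_fun_ifT.
by apply/funext => x; case: (f x).
Qed.

Section geometry.
Context (R : realType) (beta gamma gamma' : R).
Hypotheses (beta0 : 0 < beta) (gamma01 : 0 < gamma < 1) (gamma'01 : 0 < gamma' < 4^-1).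
Variable n : nat.
Implicit Types (x u z w r : R).

(** The part of the edge relation that ignores time. The weight [u] is required to be positive,
    which agrees with the window almost surely. *)
Definition closeb (a : (R * R) * (R * R)) : bool :=
  [&& 0 <= a.1.1 <= n%:R, 0 < a.1.2 <= 1, 0 <= a.2.2 <= 1 &
      `|a.1.1 - a.2.1| <= beta * a.1.2 `^ (- gamma) * a.2.2 `^ (- gamma')].

Lemma measurable_closeb : measurable_fun setT closeb.
Proof.
have m11 : measurable_fun setT (fun a : (R * R) * (R * R) => a.1.1).
  exact: (measurableT_comp measurable_fst measurable_fst).
have m12 : measurable_fun setT (fun a : (R * R) * (R * R) => a.1.2).
  exact: (measurableT_comp measurable_snd measurable_fst).
have m21 : measurable_fun setT (fun a : (R * R) * (R * R) => a.2.1).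
  exact: (measurableT_comp measurable_fst measurable_snd).
have m22 : measurable_fun setT (fun a : (R * R) * (R * R) => a.2.2).
  exact: (measurableT_comp measurable_snd measurable_snd).
apply: measurable_and; last apply: measurable_and; last apply: measurable_and.
- by apply: measurable_and; apply: measurable_fun_ler.
- by apply: measurable_and; [apply: measurable_fun_ltr|apply: measurable_fun_ler].
- by apply: measurable_and; apply: measurable_fun_ler.
apply: measurable_fun_ler.
  by apply: measurableT_comp => //; exact: measurable_funB.
apply: measurable_funM; last exact: (measurableT_comp (measurable_powR _)).
by apply: measurable_funM => //; exact: (measurableT_comp (measurable_powR _)).
Qed.

Let gamma'1 : 0 < gamma' < 1.
Proof. by case/andP: gamma'01 => -> h /=; lra. Qed.

Let radius_ge0 u w : 0 <= beta * u `^ (- gamma) * w `^ (- gamma').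
Proof. by rewrite mulr_ge0 ?powR_ge0// mulr_ge0 ?powR_ge0// ltW. Qed.

Local Open Scope ereal_scope.

Let leb_ball (c r : R) (b : bool) : (0 <= r)%R ->
  \int[lebC R]_z (b && (`|c - z| <= r))%R%:R%:E = (b%:R * (2 * r))%R%:E.
Proof.
move=> r0; case: b => /=; last by rewrite mul0r integral0.
rewrite mul1r -(_ : lebC R `[(c - r)%R, (c + r)%R]%classic = (2 * r)%:E); last first.
  by rewrite lebC_itv maxEle; case: ifPn => h; congr EFin; lra.
rewrite -[X in _ = lebC R X]setIT -integral_indic//.
apply: eq_integral => z _; rewrite indicE mem_setE in_itv/=; congr (_%:R%:E).
rewrite ler_norml; congr (nat_of_bool (_ : bool)).
by apply/andP/andP => -[? ?]; split; lra.
Qed.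

(** Integrating over [z] first gives the length of an interval of radius
    [beta u^-gamma w^-gamma']. *)
Lemma integral_close_right x u (h : R -> R) : measurable_fun setT h -> (forall w, (0 <= h w)%R) ->
  \int[prodm (lebC R) (lebC R)]_a (h a.2 * (closeb ((x, u), a))%:R)%R%:E =
  (((0 <= x <= n%:R) && (0 < u <= 1))%R%:R * (2 * beta * u `^ (- gamma)))%R%:E *
  \int[lebC R]_w (h w * pow_block gamma' 0 1 w)%R%:E.
Proof.
move=> mh h0.
have mpair : measurable_fun setT (fun a : R * R => ((x, u), a)).
  exact: measurable_pair1.
have mc : measurable_fun setT (fun a : R * R => closeb ((x, u), a)).
  exact: (measurable_comp measurableT (subsetT _) measurable_closeb mpair).
have mf : measurable_fun setT (fun a : R * R => (h a.2 * (closeb ((x, u), a))%:R)%R%:E).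
  apply/measurable_EFinP; apply: measurable_funM; last exact: measurable_natb.
  exact: (measurableT_comp mh).
rewrite (@fubini_tonelli2 _ _ _ _ R (lebC R) (lebC R) _ mf); last first.
  by move=> a; rewrite lee_fin mulr_ge0.
rewrite -ge0_integralZl//; last 3 first.
- apply/measurable_EFinP; apply: measurable_funM => //; exact: measurable_pow_block.
- by move=> w _; rewrite lee_fin mulr_ge0// pow_block_ge0.
- by rewrite lee_fin mulr_ge0// mulr_ge0 ?powR_ge0// mulr_ge0// ltW.
apply: eq_integral => w _; rewrite /fubini_G/=.
under eq_integral do rewrite EFinM.
rewrite ge0_integralZl//; try (by rewrite lee_fin); last first.
  apply/measurable_EFinP; apply: measurable_natb.
  apply: (measurable_comp measurableT (subsetT _) mc); exact: measurable_pair2.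
pose b := ((0 <= x <= n%:R) && (0 < u <= 1))%R.
transitivity ((h w)%:E * ((b && (0 <= w <= 1)%R)%:R * (2 * (beta * u `^ (- gamma) * w `^ (- gamma'))))%R%:E).
  congr (_ * _); rewrite -(@leb_ball x _ (b && (0 <= w <= 1)%R))//.
  by apply: eq_integral => z _; rewrite /closeb/= /b !andbA.
rewrite -!EFinM; congr EFin; rewrite /pow_block -/b.
(* At [w = 0] the power is 0 by convention, so the interval is degenerate and both sides vanish. *)
have [w0|w0] := eqVneq w 0%R.
  rewrite w0 ltxx/= powR0 ?mulr0//; last by rewrite oppr_eq0 gt_eqF//; case/andP: gamma'01.
rewrite lt_neqAle eq_sym w0/=; case: (0 <= w <= 1)%R; case: b => /=; ring.
Qed.

(** Only an upper bound: the restriction of the position to the window is dropped, which makes the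
    bound uniform in [z] and [n]. *)
Lemma integral_close_left z w :
  \int[prodm (lebC R) (lebC R)]_a (closeb (a, (z, w)))%:R%:E <=
  (2 * beta / (1 - gamma) * pow_block gamma' 0 1 w)%R%:E.
Proof.
have mc : measurable_fun setT (fun a : R * R => closeb (a, (z, w))).
  apply: (measurable_comp measurableT (subsetT _) measurable_closeb); exact: measurable_pair2.
have mf : measurable_fun setT (fun a : R * R => (closeb (a, (z, w)))%:R%:E : \bar R).
  by apply/measurable_EFinP; exact: measurable_natb.
rewrite (@fubini_tonelli2 _ _ _ _ R (lebC R) (lebC R) _ mf); last first.
  by move=> a; rewrite lee_fin.
pose c := (2 * beta * pow_block gamma' 0 1 w)%R.
have c0 : (0 <= c)%R by rewrite mulr_ge0 ?pow_block_ge0// mulr_ge0// ltW.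
apply: (@le_trans _ _ (\int[lebC R]_u (c%:E * (pow_block gamma 0 1 u)%:E))); last first.
  rewrite ge0_integralZl//; try (by apply/measurable_EFinP; exact: measurable_pow_block);
    try (by move=> u _; rewrite lee_fin pow_block_ge0).
  rewrite integral_pow_unit// -EFinM lee_fin le_eqVlt; apply/orP; left; apply/eqP.
  by rewrite /c; field; rewrite subr_eq0 gt_eqF//; case/andP: gamma01.
apply: ge0_le_integral => //.
- by move=> u _; apply: integral_ge0 => x _; rewrite lee_fin.
- exact: (@measurable_fun_fubini_tonelli_G _ _ _ _ _ (lebC R) _ mf (fun a => ltac:(by rewrite lee_fin))).
- by apply: emeasurable_funM => //; apply/measurable_EFinP; exact: measurable_pow_block.
move=> u _; rewrite /fubini_G/=.
pose b := ((0 < u <= 1) && (0 <= w <= 1))%R.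
apply: (@le_trans _ _ (b%:R * (2 * (beta * u `^ (- gamma) * w `^ (- gamma'))))%R%:E).
  rewrite -(@leb_ball z _ b)//; apply: ge0_le_integral => //.
  - apply/measurable_EFinP; apply: measurable_natb.
    by apply: (measurable_comp measurableT (subsetT _) mc); exact: measurable_pair2.
  - apply/measurable_EFinP; apply: measurable_natb; apply: measurable_and => //.
    by apply: measurable_fun_ler => //; apply: measurableT_comp => //; exact: measurable_funB.
  move=> x _; rewrite lee_fin ler_nat /closeb/= -/b [`|z - x|%R]distrC.
  by rewrite /b; case: (0 <= x <= n%:R)%R => //=; rewrite !andbA.
rewrite -EFinM lee_fin /c /pow_block.
have [w0|w0] := eqVneq w 0%R.
  rewrite w0 ltxx/= powR0 ?mulr0 ?mul0r//; last by rewrite oppr_eq0 gt_eqF//; case/andP: gamma'01.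
rewrite [(0 < w)%R]lt_neqAle eq_sym w0/= /b.
by case: (0 <= w <= 1)%R; case: (0 < u <= 1)%R => /=; rewrite le_eqVlt; apply/orP; left; apply/eqP; ring.
Qed.

(** Divided by [1 - gamma'], this is the mean number of neighbours per unit of time of a point of
    the window. *)
Definition window_share (a : R * R) : R :=
  ((0 <= a.1 <= n%:R) && (0 < a.2 <= 1))%R%:R * (2 * beta * a.2 `^ (- gamma)).

Lemma measurable_window_share : measurable_fun setT window_share.
Proof.
apply: measurable_funM.
  apply: measurable_natb; apply: measurable_and; apply: measurable_and;
    solve [exact: measurable_fun_ler|exact: measurable_fun_ltr].
by apply: measurable_funM => //; exact: (measurableT_comp (measurable_powR _)).
Qed.

Lemma window_share_ge0 a : (0 <= window_share a)%R.
Proof. by rewrite /window_share mulr_ge0// mulr_ge0 ?powR_ge0// mulr_ge0// ltW. Qed.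

Lemma integral_window_share : \int[prodm (lebC R) (lebC R)]_a (window_share a)%:E =
  (2 * beta / (1 - gamma) * n%:R)%:E.
Proof.
pose i (x : R) : \bar R := (0 <= x <= n%:R)%R%:R%:E.
have mi : measurable_fun setT i.
  by apply/measurable_EFinP; apply: measurable_natb; apply: measurable_and; exact: measurable_fun_ler.
transitivity (\int[prodm (lebC R) (lebC R)]_a (i a.1 * ((2 * beta)%:E * (pow_block gamma 0 1 a.2)%:E))).
  apply: eq_integral => -[x u] _; rewrite -!EFinM; congr EFin; rewrite /window_share /pow_block/=.
  by case: (0 <= x <= n%:R)%R; case: (0 < u <= 1)%R => /=; ring.
rewrite (@integral_prod2 _ _ _ _ R (lebC R) (lebC R) i
  (fun u => (2 * beta)%:E * (pow_block gamma 0 1 u)%:E))//.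
- rewrite ge0_integralZl//; first last.
  + by rewrite lee_fin mulr_ge0// ltW.
  + by move=> w _; rewrite lee_fin pow_block_ge0.
  + by apply/measurable_EFinP; exact: measurable_pow_block.
  rewrite integral_pow_unit// (_ : \int[lebC R]_x i x = (n%:R)%:E).
    by rewrite -!EFinM; congr EFin; ring.
  transitivity (\int[lebC R]_x (\1_`[0%R, n%:R]%classic x)%:E).
    by apply: eq_integral => x _; rewrite indicE mem_setE in_itv.
  rewrite integral_indic; [|by []|exact: measurable_itv].
  by apply: (etrans (congr1 (lebC R) (setIT _))); rewrite lebC_itv subr0; congr EFin; apply/max_idPl.
- by move=> x; rewrite lee_fin.
- by apply: emeasurable_funM => //; apply/measurable_EFinP; exact: measurable_pow_block.
- by move=> u; rewrite mule_ge0// lee_fin ?mulr_ge0 ?pow_block_ge0// ltW.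
Qed.

Section cell.
Variable T : (R * R) * R -> bool.
Hypothesis mT : measurable_fun setT T.

Definition joined : set ((R * R * R * R) * (R * R * R)) :=
  [set a | closeb (a.1.1.1, a.2.1) && T (a.1.1.2, a.1.2, a.2.2)].

Definition section_length (p : R * R) : \bar R := \int[lebC R]_r (T (p, r))%:R%:E.

Let mTq p : measurable_fun setT (fun r => T (p, r)).
Proof. apply: (measurable_comp measurableT (subsetT _) mT); exact: measurable_pair1. Qed.

Let mTp r : measurable_fun setT (fun p => T (p, r)).
Proof. apply: (measurable_comp measurableT (subsetT _) mT); exact: measurable_pair2. Qed.

Let mTR : measurable_fun setT (fun a : (R * R) * R => (T a)%:R%:E : \bar R).
Proof. by apply/measurable_EFinP; exact: measurable_natb. Qed.

Lemma measurable_joined : measurable joined.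
Proof.
apply: measurable_bool_set; apply: measurable_and.
  apply: (measurable_comp measurableT (subsetT _) measurable_closeb).
  apply: measurable_fun_pair.
    exact: (measurableT_comp measurable_fst (measurableT_comp measurable_fst measurable_fst)).
  exact: (measurableT_comp measurable_fst measurable_snd).
apply: (measurable_comp measurableT (subsetT _) mT); apply: measurable_fun_pair.
  apply: measurable_fun_pair.
    exact: (measurableT_comp measurable_snd (measurableT_comp measurable_fst measurable_fst)).
  exact: (measurableT_comp measurable_snd measurable_fst).
exact: (measurableT_comp measurable_snd measurable_snd).
Qed.

Lemma measurable_section_length : measurable_fun setT section_length.
Proof. exact: (@measurable_fun_fubini_tonelli_F _ _ _ _ _ (lebC R) _ mTR (fun a => ltac:(by rewrite lee_fin))). Qed.

Lemma section_length_ge0 p : 0 <= section_length p.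
Proof. by apply: integral_ge0 => r _; rewrite lee_fin. Qed.

Lemma xsection_joined p : intensity_SRC R (xsection joined p) =
  (window_share p.1.1 / (1 - gamma'))%R%:E * section_length (p.1.2, p.2).
Proof.
have mx : measurable (xsection joined p) by apply: measurable_xsection; exact: measurable_joined.
rewrite -[X in intensity_SRC R X]setIT -integral_indic//.
have mc : measurable_fun setT (fun a : R * R => closeb (p.1.1, a)).
  apply: (measurable_comp measurableT (subsetT _) measurable_closeb); exact: measurable_pair1.
transitivity (\int[intensity_SRC R]_q ((closeb (p.1.1, q.1))%:R%:E * (T (p.1.2, p.2, q.2))%:R%:E)).
  apply: eq_integral => q _; rewrite indicE mem_xsection mem_setE/= -EFinM; congr EFin.
  by rewrite -natrM mulnb.
rewrite (@integral_SRC R (fun a => (closeb (p.1.1, a))%:R%:E) (fun r => (T (p.1.2, p.2, r))%:R%:E)).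
- congr (_ * _).
  transitivity (\int[prodm (lebC R) (lebC R)]_a (1 * (closeb ((p.1.1.1, p.1.1.2), a))%:R)%R%:E).
    by apply: eq_integral => a _; rewrite mul1r -surjective_pairing.
  rewrite (@integral_close_right p.1.1.1 p.1.1.2 (cst 1%R))//.
  under eq_integral do rewrite mul1r.
  by rewrite integral_pow_unit.
- by apply/measurable_EFinP; exact: measurable_natb.
- by move=> a; rewrite lee_fin.
- by apply/measurable_EFinP; exact: measurable_natb.
- by move=> a; rewrite lee_fin.
Qed.

Definition left_share (a : R * R) := \int[prodm (lebC R) (lebC R)]_c (closeb (c, a))%:R%:E.

Lemma ysection_joined q : intensity_STC R (ysection joined q) =
  left_share q.1 * theta (fun p => (T (p, q.2))%:R%:E).
Proof.
have mx : measurable (ysection joined q) by apply: measurable_ysection; exact: measurable_joined.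
rewrite -[X in intensity_STC R X]setIT -integral_indic//.
have mc : measurable_fun setT (fun a : R * R => closeb (a, q.1)).
  apply: (measurable_comp measurableT (subsetT _) measurable_closeb); exact: measurable_pair2.
transitivity (\int[intensity_STC R]_p ((closeb (p.1.1, q.1))%:R%:E * (T (p.1.2, p.2, q.2))%:R%:E)).
  apply: eq_integral => p _; rewrite indicE mem_ysection mem_setE/= -EFinM; congr EFin.
  by rewrite -natrM mulnb.
rewrite (@integral_STC R (fun a => (closeb (a, q.1))%:R%:E) (fun c => (T (c, q.2))%:R%:E))//.
- by apply/measurable_EFinP; exact: measurable_natb.
- by apply/measurable_EFinP; exact: measurable_natb.
Qed.

Hypothesis T_bound : forall r, theta (fun p => (T (p, r))%:R%:E) <= (expo_bound R)%:E.

Let e := expo_bound R.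
Let e0 : (0 <= e)%R. Proof. exact: expo_bound_ge0. Qed.
Let kl := (2 * beta / (1 - gamma))%R.
Let kl0 : (0 <= kl)%R.
Proof.
by rewrite /kl divr_ge0// ?mulr_ge0// ?subr_ge0; [exact: ltW|case/andP: gamma01 => _ /ltW].
Qed.
Let h (w : R) := (1 + e * (kl * pow_block gamma' 0 1 w))%R.
Let h0 w : (0 <= h w)%R.
Proof. by rewrite addr_ge0// mulr_ge0// mulr_ge0// pow_block_ge0. Qed.
Let mh : measurable_fun setT h.
Proof.
apply: measurable_funD => //; apply: measurable_funM => //; apply: measurable_funM => //.
exact: measurable_pow_block.
Qed.

(** The first summand in the bracket is the integral of [w^-gamma'], the second comes from the
    integral of [w^(-2 gamma')]: the square integrability of the weight factor. *)
Definition edge_const : R :=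
  2 * beta / (1 - gamma) * ((1 - gamma')^-1 + e * kl / (1 - 2 * gamma')).

Lemma edge_const_ge0 : (0 <= edge_const)%R.
Proof.
have /andP[g0 g4] := gamma'01; rewrite /edge_const -/kl mulr_ge0// addr_ge0//.
  by rewrite invr_ge0; lra.
by apply: divr_ge0; [exact: mulr_ge0|lra].
Qed.

Let integral_h : \int[lebC R]_w (h w * pow_block gamma' 0 1 w)%:E =
  ((1 - gamma')^-1 + e * kl / (1 - 2 * gamma'))%:E.
Proof.
have g2 : (0 < 2 * gamma' < 1)%R by case/andP: gamma'01 => ? ?; apply/andP; split; lra.
have mp g : measurable_fun setT (fun w : R => (pow_block g 0 1 w)%:E).
  by apply/measurable_EFinP; exact: measurable_pow_block.
transitivity (\int[lebC R]_w ((pow_block gamma' 0 1 w)%:E + (e * kl)%:E * (pow_block (2 * gamma') 0 1 w)%:E)).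
  apply: eq_integral => w _; rewrite -EFinM -EFinD; congr EFin; rewrite /h /pow_block.
  case: ifP => [/andP[w0 _]|]; last by rewrite !mulr0 addr0.
  rewrite (_ : - (2 * gamma') = (- gamma') * 2)%R; last by ring.
  rewrite powRrM powR_mulrn ?powR_ge0//; ring.
rewrite ge0_integralD//; first last.
- by apply: emeasurable_funM.
- by move=> w _; apply: mule_ge0; rewrite lee_fin ?pow_block_ge0// mulr_ge0.
- by move=> w _; rewrite lee_fin pow_block_ge0.
rewrite ge0_integralZl//; last 2 first.
- by move=> w _; rewrite lee_fin pow_block_ge0.
- by rewrite lee_fin mulr_ge0.
by rewrite !integral_pow_unit.
Qed.

Let mclose2 : measurable_fun setT (fun c : (R * R) * (R * R) => (closeb c)%:R%:E : \bar R).
Proof. by apply/measurable_EFinP; apply: measurable_natb; exact: measurable_closeb. Qed.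

Let measurable_left_share : measurable_fun setT left_share.
Proof.
exact: (@measurable_fun_fubini_tonelli_G _ _ _ _ _ (prodm (lebC R) (lebC R)) _ mclose2
  (fun a => ltac:(by rewrite lee_fin))).
Qed.

Let left_share_ge0 a : 0 <= left_share a.
Proof. by apply: integral_ge0 => c _; rewrite lee_fin. Qed.

Let integral_left_share : \int[prodm (lebC R) (lebC R)]_a (left_share a * (h a.2)%:E) =
  (edge_const * n%:R)%:E.
Proof.
pose F (c : (R * R) * (R * R)) := (closeb c)%:R%:E * (h c.2.2)%:E.
have mF : measurable_fun setT F.
  apply: emeasurable_funM => //; apply/measurable_EFinP; apply: (measurableT_comp mh).
  exact: (measurableT_comp measurable_snd measurable_snd).
have F0 c : 0 <= F c by rewrite mule_ge0// lee_fin.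
transitivity (\int[prodm (lebC R) (lebC R)]_a \int[prodm (lebC R) (lebC R)]_c F (c, a)).
  apply: eq_integral => a _; rewrite /left_share -ge0_integralZr//.
  - apply/measurable_EFinP; apply: measurable_natb.
    by apply: (measurable_comp measurableT (subsetT _) measurable_closeb); exact: measurable_pair2.
  - by rewrite lee_fin.
rewrite -(@fubini_tonelli _ _ _ _ R (prodm (lebC R) (lebC R)) (prodm (lebC R) (lebC R)) F mF F0).
transitivity (\int[prodm (lebC R) (lebC R)]_c ((window_share c)%:E *
    \int[lebC R]_w (h w * pow_block gamma' 0 1 w)%:E)).
  apply: eq_integral => c _.
  rewrite -(@integral_close_right c.1 c.2 h mh h0); apply: eq_integral => a _.
  by rewrite -surjective_pairing /F/= -EFinM mulrC.
rewrite ge0_integralZr//.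
- by rewrite integral_window_share integral_h -EFinM; congr EFin; rewrite /edge_const; ring.
- by apply/measurable_EFinP; exact: measurable_window_share.
- by move=> c _; rewrite lee_fin window_share_ge0.
- by apply: integral_ge0 => w _; rewrite lee_fin mulr_ge0 ?pow_block_ge0.
Qed.

(** The intensity of a section factors as [left_share] times a time factor [J]. In its square, one
    copy of [left_share] is bounded by [kl w^-gamma'] and one copy of [J] by [e]; the remaining
    product integrates by Fubini to a window factor and a time factor. *)
Lemma joined_bound :
  \int[intensity_SRC R]_q (intensity_STC R (ysection joined q) * intensity_STC R (ysection joined q)
    + intensity_STC R (ysection joined q)) <= (edge_const * n%:R)%:E * theta section_length.
Proof.
pose J r := theta (fun p => (T (p, r))%:R%:E).
have J0 r : 0 <= J r by apply: theta_ge0 => p; rewrite lee_fin.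
have JE : J = fun r => \int[prodm (lebC R) (expoC R)]_p (T (p, r))%:R%:E.
  apply/funext => r; rewrite /J theta_prod//.
  by apply/measurable_EFinP; exact: measurable_natb.
have mJ : measurable_fun setT J.
  rewrite JE.
  exact: (@measurable_fun_fubini_tonelli_G _ _ _ _ _ (prodm (lebC R) (expoC R)) _ mTR
    (fun a => ltac:(by rewrite lee_fin))).
have iJ : \int[lebC R]_r J r = theta section_length.
  rewrite theta_prod; first last.
  - exact: section_length_ge0.
  - exact: measurable_section_length.
  rewrite JE; apply/esym.
  exact: (@fubini_tonelli _ _ _ _ R (prodm (lebC R) (expoC R)) (lebC R) _ mTR
    (fun a => ltac:(by rewrite lee_fin))).
rewrite -iJ -integral_left_share -(@integral_SRC R (fun a => left_share a * (h a.2)%:E) J)//; first last.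
- by move=> a; rewrite mule_ge0// lee_fin.
- by apply: emeasurable_funM => //; apply/measurable_EFinP; exact: (measurableT_comp mh).
have my : measurable_fun setT (fun q => intensity_STC R (ysection joined q)).
  by apply: measurable_fun_ysection; exact: measurable_joined.
apply: ge0_le_integral => //.
- by move=> q _; rewrite adde_ge0// mule_ge0.
- by apply: emeasurable_funD => //; exact: emeasurable_funM.
- apply: emeasurable_funM; last exact: (measurableT_comp mJ).
  apply: emeasurable_funM; first exact: (measurableT_comp measurable_left_share).
  apply/measurable_EFinP; apply: (measurableT_comp mh).
  exact: (measurableT_comp measurable_snd measurable_fst).
move=> -[[z w] r] _; rewrite ysection_joined -/(J _)/=.
have Ie : left_share (z, w) <= (kl * pow_block gamma' 0 1 w)%:E by exact: integral_close_left.
have := left_share_ge0 (z, w); move: (J0 r) (T_bound r); rewrite -/(J r) -/e.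
case: (left_share (z, w)) Ie => [i||]; rewrite ?leye_eq//.
case: (J r) => [j||]; rewrite ?leye_eq// => Ie j0 je i0.
rewrite -!EFinM -EFinD lee_fin /h.
move: Ie j0 je i0; rewrite !lee_fin; set k := (kl * _)%R => ik j0 je i0.
rewrite mulrDr mulr1 mulrDl addrC lerD2l -mulrA [X in (_ <= X)%R]mulrAC -mulrA.
apply: ler_wpM2l => //; apply: ler_wpM2l => //; rewrite mulrC.
by apply: ler_pM.
Qed.

End cell.

End geometry.

(** * Edge numbers and their conditional means *)

Section generic_pairs.
Context (R : realType) d (W : measurableType d) (P : probability W R)
  dX (X : measurableType dX) dX' (X' : measurableType dX').
Local Open Scope ereal_scope.
Variables (mu : {sigma_finite_measure set X -> \bar R}) (E : set X) (eta : W -> set X).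
Variables (la : {sigma_finite_measure set X' -> \bar R}) (E' : set X') (eta' : W -> set X').
Hypotheses (Heta : poisson_process P E mu eta) (Heta' : poisson_process P E' la eta').
Hypothesis Hind : independent_pp P E eta E' eta'.
Hypotheses (mE : measurable E) (mE' : measurable E').
Variables (C : nat -> set X) (C' : nat -> set X').
Hypotheses (mC : forall i, measurable (C i)) (ndC : nondecreasing_seq C)
  (CT : \bigcup_i C i = setT) (Cfin : forall i, mu (C i `&` E) < +oo).
Hypotheses (mC' : forall i, measurable (C' i)) (ndC' : nondecreasing_seq C')
  (CT' : \bigcup_i C' i = setT) (Cfin' : forall i, la (C' i `&` E') < +oo).

Let muE := sigma_finite_restr mu mE.
Let laE := sigma_finite_restr la mE'.
Let M := pp_measure R E eta C.
Let M' := pp_measure R E' eta' C'.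

Let s1 := pp_gen_sub Heta.
Let s2 := pp_gen_sub Heta'.

(** Stated over the sigma-algebra generated by [eta] alone, because [freezing] works on the product
    of the two generated sigma-algebras. *)
Let HM : poisson_rm (sub_probability P s1) muE (M : pp_type R E eta -> _).
Proof.
have [_ [C0 [mC0 ndC0 CT0 C0fin C0fin']] law] := pp_poisson_rm Heta mE mC ndC CT Cfin.
split; last exact: law; last by exists C0.
by move=> A mA; exact: (pp_measurable_sub Heta mE mC).
Qed.

Let HM' : poisson_rm (sub_probability P s2) laE (M' : pp_type R E' eta' -> _).
Proof.
have [_ [C0 [mC0 ndC0 CT0 C0fin C0fin']] law] := pp_poisson_rm Heta' mE' mC' ndC' CT' Cfin'.
split; last exact: law; last by exists C0.
by move=> A mA; exact: (pp_measurable_sub Heta' mE' mC').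
Qed.

Variable D : set (X * X').
Hypothesis mD : measurable D.

Let HP : poisson_rm P muE M.
Proof. exact: (poisson_rm_eq _ (pp_poisson_rm Heta mE mC ndC CT Cfin)). Qed.

Let HP' : poisson_rm P laE M'.
Proof. exact: (poisson_rm_eq _ (pp_poisson_rm Heta' mE' mC' ndC' CT' Cfin')). Qed.

Lemma measurable_pairs_diag : measurable_fun setT (fun w => pairs M M' D w w).
Proof.
apply: (measurable_comp measurableT (subsetT _) (measurable_pairs HP HP' mD)
  (measurable_fun_pair (@measurable_id _ W setT) (@measurable_id _ W setT))).
Qed.

(** [freezing] decouples the two copies of [w]; the inner mean is the mean of a count and the outer
    one is Campbell's formula. *)
Lemma mean_pairs_diag :
  \int[P]_w pairs M M' D w w = \int[muE]_p laE (xsection D p).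
Proof.
have mpr := measurable_pairs HM HM' mD.
have pr0 z : 0 <= pairs M M' D z.1 z.2 by apply: integral_ge0 => p _; exact: measure_ge0.
rewrite (@freezing _ _ _ P _ _ s1 s2 Hind (fun z => pairs M M' D z.1 z.2) mpr pr0).
rewrite -(campbell HM); first last.
- by move=> p; exact: measure_ge0.
- exact: measurable_fun_xsection.
apply: eq_integral => w _.
have [_ [C0 [mC0 ndC0 CT0 C0fin]]] := prm_rm HM.
have [N NE] := sigma_finite_cover mC0 CT0 (C0fin w).
have NI f : \int[M w]_p f p = \int[N]_p f p.
  by apply: eq_measure_integral => A mA _; rewrite -NE.
transitivity (\int[sub_probability P s2]_w' \int[N]_p M' w' (xsection D p)).
  by apply: eq_integral => w' _; exact: NI.
rewrite (@fubini_tonelli _ _ _ _ R (sub_probability P s2) N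
  (fun z => M' z.1 (xsection D z.2)) (measurable_xsection_rm HM' mD)); last first.
  by move=> z; exact: measure_ge0.
rewrite [RHS]NI; apply: eq_integral => p _.
transitivity (\int[sub_probability P s2]_w' M' w' (xsection D p)); first by [].
exact: (prm_mean_set HM' (measurable_xsection p mD)).
Qed.

Lemma measurable_comp_pairs_diag : measurable_fun setT (comp_pairs laE M D).
Proof. exact: (measurable_comp_pairs laE HP mD). Qed.

Lemma mean_comp_pairs : \int[P]_w comp_pairs laE M D w = \int[muE]_p laE (xsection D p).
Proof. exact: (mean_pairs laE HP mD). Qed.

Hypothesis Doo : \int[muE]_p laE (xsection D p) < +oo.

Lemma pairs_comp_fin : {ae P, forall w, pairs M M' D w w \is a fin_num /\
  comp_pairs laE M D w \is a fin_num}.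
Proof.
have F (f : W -> \bar R) : measurable_fun setT f -> (forall w, 0 <= f w) ->
    \int[P]_w f w < +oo -> {ae P, forall w, f w \is a fin_num}.
  move=> mf f0 foo; have /integrable_ae : P.-integrable setT f.
    by apply/integrableP; split => //; under eq_integral do rewrite gee0_abs//.
  by move=> /(_ measurableT); apply: filterS => w /(_ I).
apply: filterS2 (F _ measurable_pairs_diag _ _) (F _ measurable_comp_pairs_diag _ _) => //.
- by move=> w; apply: integral_ge0 => p _; exact: measure_ge0.
- by rewrite mean_pairs_diag.
- by move=> w; apply: integral_ge0 => p _; exact: measure_ge0.
- by rewrite mean_comp_pairs.
Qed.

(** The squared deviation is a function of the two processes, so [freezing] turns its mean into the
    iterated integral of [double_variance]. *)
Lemma pairs_variance :
  \int[P]_w (((fine (pairs M M' D w w) - fine (comp_pairs laE M D w)) ^+ 2)%R%:E) <=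
  \int[la]_q (mu (ysection D q) * mu (ysection D q) + mu (ysection D q)).
Proof.
pose Phi (z : pp_type R E eta * pp_type R E' eta') : \bar R :=
  (((fine (pairs M M' D z.1 z.2) - fine (comp_pairs laE M D z.1)) ^+ 2)%R%:E).
have mPhi : measurable_fun setT Phi.
  apply/measurable_EFinP; apply: (@measurable_funX _ _ _ _
    (fun z : pp_type R E eta * pp_type R E' eta' =>
      (fine (pairs M M' D z.1 z.2) - fine (comp_pairs laE M D z.1))%R)).
  apply: measurable_funB.
    exact: (measurableT_comp (fine_measurable measurableT) (measurable_pairs HM HM' mD)).
  apply: (measurableT_comp (fine_measurable measurableT)).
  exact: (measurable_comp measurableT (subsetT _) (measurable_comp_pairs laE HM mD) measurable_fst).
rewrite (@freezing _ _ _ P _ _ s1 s2 Hind Phi mPhi); last by move=> z; rewrite lee_fin sqr_ge0.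
apply: le_trans (double_variance HM HM' mD Doo) _.
have my := measurable_fun_ysection mu mD; have my' := measurable_fun_ysection muE mD.
have mle q : muE (ysection D q) <= mu (ysection D q).
  have mDq : measurable (ysection D q) by exact: measurable_ysection.
  apply: le_measure; rewrite ?inE//; exact: measurableI.
rewrite integral_restr; last 2 first.
- by apply: emeasurable_funD => //; exact: emeasurable_funM.
- by move=> q; rewrite adde_ge0// mule_ge0.
rewrite integral_mkcond; apply: ge0_le_integral => //.
- by move=> q _; rewrite patchE; case: ifP => // _; rewrite adde_ge0// mule_ge0.
- apply/(measurable_restrictT _ mE'); apply: measurable_funTS.
  by apply: emeasurable_funD => //; exact: emeasurable_funM.
- by apply: emeasurable_funD => //; exact: emeasurable_funM.
move=> q _; rewrite patchE; case: ifP => _; last by rewrite adde_ge0// mule_ge0.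
by rewrite leeD// lee_pmul.
Qed.

End generic_pairs.

Definition M_SR (R : realType) d (W : measurableType d) (eta' : W -> set (R * R * R)) :=
  pp_measure R (@space_SR R) eta' (@cover_SR R).

Lemma fine_subD (R : realType) (x1 x2 y1 y2 : \bar R) :
  (0 <= x1 -> 0 <= x2 -> 0 <= y1 -> 0 <= y2 -> x1 + x2 \is a fin_num -> y1 + y2 \is a fin_num ->
  (fine (x1 + x2) - fine (y1 + y2))%R = (fine x1 - fine y1 + (fine x2 - fine y2))%R)%E.
Proof.
move: x1 x2 y1 y2 => [x1||] [x2||] [y1||] [y2||] //= _ _ _ _ _ _.
by rewrite opprD addrACA.
Qed.

Lemma fin_num_addl (R : realType) (x y : \bar R) :
  (0 <= x -> 0 <= y -> x + y \is a fin_num -> x \is a fin_num)%E.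
Proof. by move: x y => [x||] [y||]. Qed.

Section edges.
Context (R : realType) (beta gamma gamma' : R).
Hypotheses (beta0 : 0 < beta) (gamma01 : 0 < gamma < 1) (gamma'01 : 0 < gamma' < 4^-1).
Context d (W : measurableType d) (P : probability W R).
Variables (eta : W -> set (R * R * R * R)) (eta' : W -> set (R * R * R)).
Hypotheses (Heta : poisson_process P (@space_ST R) (@intensity_ST R) eta)
  (Heta' : poisson_process P (@space_SR R) (@intensity_SR R) eta')
  (Hind : independent_pp P (@space_ST R) eta (@space_SR R) eta').
Variable n : nat.
Local Open Scope ereal_scope.

Local Notation muE := (sigma_finite_restr (intensity_STC R) (@measurable_space_ST R)).
Local Notation laE := (sigma_finite_restr (intensity_SRC R) (@measurable_space_SR R)).
Local Notation M := (M_ST eta).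
Local Notation M' := (M_SR eta').
Local Notation lifetimes := ((R * R) * R -> bool).
Implicit Types T : lifetimes.

Let HetaC : poisson_process P (@space_ST R) (intensity_STC R) eta.
Proof. by apply: poisson_process_eq Heta => A mA; exact: intensity_STE. Qed.

Let HetaC' : poisson_process P (@space_SR R) (intensity_SRC R) eta'.
Proof. by apply: poisson_process_eq Heta' => A mA; exact: intensity_SRE. Qed.

(** Locked, as are the next two, so that conversion does not unfold the nested measures. *)
Definition edges : lifetimes -> W -> \bar R :=
  locked (fun T w => pairs M M' (joined beta gamma gamma' n T) w w).
Definition edge_means : lifetimes -> W -> \bar R :=
  locked (fun T w => comp_pairs laE M (joined beta gamma gamma' n T) w).
Definition edge_error : lifetimes -> W -> R :=
  locked (fun T w => fine (edges T w) - fine (edge_means T w))%R.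

Lemma edgesE T : edges T = fun w => pairs M M' (joined beta gamma gamma' n T) w w.
Proof. by rewrite /edges -lock. Qed.

Lemma edge_means_pairs T : edge_means T = comp_pairs laE M (joined beta gamma gamma' n T).
Proof. by rewrite /edge_means -lock. Qed.

Lemma edge_errorE T : edge_error T = fun w => (fine (edges T w) - fine (edge_means T w))%R.
Proof. by rewrite /edge_error -lock. Qed.

Definition share (a : R * R) : R := (window_share beta gamma n a / (1 - gamma'))%R.

Lemma share_ge0 a : (0 <= share a)%R.
Proof.
rewrite divr_ge0 ?window_share_ge0// subr_ge0; case/andP: gamma'01 => ? ?; lra.
Qed.

Lemma measurable_share : measurable_fun setT share.
Proof. by apply: measurable_funM => //; exact: measurable_window_share. Qed.

Lemma edges_ge0 T w : 0 <= edges T w.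
Proof. by rewrite edgesE; apply: integral_ge0 => p _; exact: measure_ge0. Qed.

Lemma edge_means_ge0 T w : 0 <= edge_means T w.
Proof. by rewrite edge_means_pairs; apply: integral_ge0 => p _; exact: measure_ge0. Qed.

Let mX := measurable_joined beta gamma gamma' n.

Let laE_xsection T p : measurable_fun setT T ->
  laE (xsection (joined beta gamma gamma' n T) p) =
  (share p.1.1)%:E * section_length T (p.1.2, p.2).
Proof.
move=> mT; rewrite /share -(@xsection_joined R beta gamma gamma' beta0 gamma'01 n T mT).
rewrite -[LHS]/(intensity_SRC R (xsection (joined beta gamma gamma' n T) p `&` @space_SR R)).
congr (intensity_SRC R _); apply/seteqP; split => q; first by case.
move=> h; split => //; move: h; rewrite /xsection/= inE/= => /andP[+ _].
by case: q => -[z w] r /=; rewrite /closeb => /and4P[].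
Qed.

Let measurable_share1 : measurable_fun setT (fun p : R * R * R * R => (share p.1.1)%:E : \bar R).
Proof.
apply/measurable_EFinP; apply: (measurableT_comp measurable_share).
exact: (measurableT_comp measurable_fst measurable_fst).
Qed.

Let measurable_time (f : R * R -> \bar R) : measurable_fun setT f ->
  measurable_fun setT (fun p : R * R * R * R => f (p.1.2, p.2)).
Proof. by move=> mf; apply: (measurableT_comp mf); exact: measurable_pair12. Qed.

Lemma edge_meansE T w : measurable_fun setT T ->
  edge_means T w = \int[M w]_p ((share p.1.1)%:E * section_length T (p.1.2, p.2)).
Proof. by move=> mT; rewrite edge_means_pairs; apply: eq_integral => p _; exact: laE_xsection. Qed.

Lemma mean_share : \int[prodm (lebC R) (lebC R)]_a (share a)%:E =
  (2 * beta / (1 - gamma) / (1 - gamma') * n%:R)%R%:E.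
Proof.
have h : (0 <= (1 - gamma')^-1)%R by rewrite invr_ge0 subr_ge0; case/andP: gamma'01 => ? ?; lra.
under eq_integral do rewrite /share EFinM.
rewrite ge0_integralZr//.
- by rewrite integral_window_share// -EFinM; congr EFin; ring.
- by apply/measurable_EFinP; exact: measurable_window_share.
- by move=> a _; rewrite lee_fin window_share_ge0.
Qed.

Let integral_restr_le (f : R * R * R * R -> \bar R) : measurable_fun setT f -> (forall p, 0 <= f p) ->
  \int[muE]_p f p <= \int[intensity_STC R]_p f p.
Proof.
move=> mf f0; have le_of_eq (x y : \bar R) : x = y -> x <= y by move->.
apply: le_trans (le_of_eq _ _ (integral_restr _ (@measurable_space_ST R) mf f0)) _.
apply: ge0_subset_integral; [exact: measurable_space_ST|exact: measurableT|exact: mf| |exact: subsetT].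
by move=> p _; exact: f0.
Qed.

Lemma mean_share_time (H : R * R -> \bar R) : measurable_fun setT H -> (forall p, 0 <= H p) ->
  \int[muE]_p ((share p.1.1)%:E * H (p.1.2, p.2)) <=
  (2 * beta / (1 - gamma) / (1 - gamma') * n%:R)%R%:E * theta H.
Proof.
move=> mH H0; apply: le_trans (integral_restr_le _ _) _.
- by apply: emeasurable_funM => //; exact: measurable_time.
- by move=> p; rewrite mule_ge0// lee_fin share_ge0.
rewrite (@integral_STC R (fun a => (share a)%:E) H)//.
- by rewrite mean_share.
- by apply/measurable_EFinP; exact: measurable_share.
- by move=> a; rewrite lee_fin share_ge0.
Qed.

Lemma mean_edges T : measurable_fun setT T ->
  \int[P]_w edges T w = \int[muE]_p ((share p.1.1)%:E * section_length T (p.1.2, p.2)).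
Proof.
move=> mT; rewrite edgesE (mean_pairs_diag HetaC HetaC' Hind (@measurable_space_ST R)
  (@measurable_space_SR R) (@measurable_cover_ST R) (@cover_ST_nd R) (@cover_STT R) (@cover_ST_fin R)
  (@measurable_cover_SR R) (@cover_SR_nd R) (@cover_SRT R) (@cover_SR_fin R) (mX mT)).
by apply: eq_integral => p _; exact: laE_xsection.
Qed.

Lemma measurable_edges T : measurable_fun setT T -> measurable_fun setT (edges T).
Proof.
move=> mT; rewrite edgesE; exact: (measurable_pairs_diag HetaC HetaC' (@measurable_space_ST R)
  (@measurable_space_SR R) (@measurable_cover_ST R) (@cover_ST_nd R) (@cover_STT R) (@cover_ST_fin R)
  (@measurable_cover_SR R) (@cover_SR_nd R) (@cover_SRT R) (@cover_SR_fin R) (mX mT)).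
Qed.

Lemma measurable_edge_means T : measurable_fun setT T -> measurable_fun setT (edge_means T).
Proof.
move=> mT; rewrite edge_means_pairs; exact: (measurable_comp_pairs_diag (intensity_SRC R) HetaC (@measurable_space_ST R)
  (@measurable_space_SR R) (@measurable_cover_ST R) (@cover_ST_nd R) (@cover_STT R) (@cover_ST_fin R)
  (mX mT)).
Qed.

Lemma measurable_edge_error T : measurable_fun setT T -> measurable_fun setT (edge_error T).
Proof.
move=> mT; rewrite edge_errorE; apply: measurable_funB; apply: (measurableT_comp (fine_measurable measurableT)).
  exact: measurable_edges.
exact: measurable_edge_means.
Qed.

Let time_fin T : measurable_fun setT T -> theta (section_length T) < +oo ->
  \int[muE]_p laE (xsection (joined beta gamma gamma' n T) p) < +oo.
Proof.
move=> mT Toe; under eq_integral do rewrite laE_xsection//.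
have msl := measurable_section_length mT.
apply: le_lt_trans (mean_share_time msl (section_length_ge0 T)) _.
apply: mul_lty => //; last exact: ltry; last by apply: theta_ge0; exact: section_length_ge0.
have : 0 <= (2 * beta / (1 - gamma) / (1 - gamma') * n%:R)%R%:E by rewrite -mean_share; apply: integral_ge0 => a _; rewrite lee_fin share_ge0.
by [].
Qed.

Lemma edges_fin T : measurable_fun setT T -> theta (section_length T) < +oo ->
  {ae P, forall w, edges T w \is a fin_num /\ edge_means T w \is a fin_num}.
Proof.
move=> mT Toe; rewrite edgesE edge_means_pairs; exact: (pairs_comp_fin HetaC HetaC' Hind (@measurable_cover_ST R)
  (@cover_ST_nd R) (@cover_STT R) (@cover_ST_fin R)
  (@measurable_cover_SR R) (@cover_SR_nd R) (@cover_SRT R) (@cover_SR_fin R) (mX mT) (time_fin mT Toe)).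
Qed.

Lemma edge_error_sqr T : measurable_fun setT T ->
  (forall r, theta (fun p => (T (p, r))%:R%:E) <= (expo_bound R)%:E) ->
  theta (section_length T) < +oo ->
  \int[P]_w (edge_error T w ^+ 2)%:E <= (edge_const beta gamma gamma' * n%:R)%:E * theta (section_length T).
Proof.
move=> mT Tb Toe; rewrite edge_errorE edgesE edge_means_pairs; apply: le_trans (pairs_variance HetaC HetaC' Hind (@measurable_cover_ST R)
  (@cover_ST_nd R) (@cover_STT R) (@cover_ST_fin R)
  (@measurable_cover_SR R) (@cover_SR_nd R) (@cover_SRT R) (@cover_SR_fin R) (mX mT) (time_fin mT Toe)) _.
exact: joined_bound.
Qed.

Section additivity.
Variables T T1 T2 : lifetimes.
Hypotheses (mT1 : measurable_fun setT T1) (mT2 : measurable_fun setT T2).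
(** Equality of booleans read as numbers: [T] is the disjoint union of [T1] and [T2]. *)
Hypothesis TE : forall a, (T a : nat) = (T1 a + T2 a)%N.

Let joinedU : joined beta gamma gamma' n T =
  joined beta gamma gamma' n T1 `|` joined beta gamma gamma' n T2.
Proof.
apply/seteqP; split => a; rewrite /joined/=; have := TE (a.1.1.2, a.1.2, a.2.2);
  case: (closeb _ _ _ _) => //=; case: (T _); case: (T1 _); case: (T2 _) => //= _;
  first [by left|by right|by move=> _; left|by move=> _; right|by case].
Qed.

Let joinedI : joined beta gamma gamma' n T1 `&` joined beta gamma gamma' n T2 = set0.
Proof.
apply/seteqP; split => // a [] /= /andP[_ a1] /andP[_ a2].
by have := TE (a.1.1.2, a.1.2, a.2.2); rewrite a1 a2; case: (T _).
Qed.

Let measure_xsectionU (m : {measure set (R * R * R) -> \bar R}) p :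
  m (xsection (joined beta gamma gamma' n T) p) =
  m (xsection (joined beta gamma gamma' n T1) p) + m (xsection (joined beta gamma gamma' n T2) p).
Proof.
rewrite joinedU (_ : xsection (_ `|` _) p = xsection (joined beta gamma gamma' n T1) p `|`
  xsection (joined beta gamma gamma' n T2) p); last by rewrite !xsectionE.
rewrite measureU//; try (by apply: measurable_xsection; exact: mX).
by rewrite !xsectionE -preimage_setI joinedI preimage_set0.
Qed.

Lemma edgesD w : edges T w = edges T1 w + edges T2 w.
Proof.
have [mM' [C0 [mC0 ndC0 CT0 C0fin]]] := prm_rm (pp_poisson_rm HetaC' (@measurable_space_SR R)
  (@measurable_cover_SR R) (@cover_SR_nd R) (@cover_SRT R) (@cover_SR_fin R)).
have [N NE] := sigma_finite_cover mC0 CT0 (C0fin w).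
have mx T' : measurable_fun setT T' ->
    measurable_fun setT (fun p => M' w (xsection (joined beta gamma gamma' n T') p)).
  move=> mT'; have := measurable_fun_xsection N (mX mT'); congr measurable_fun.
  by apply/funext => p /=; rewrite NE//; apply: measurable_xsection; exact: mX.
rewrite !edgesE /pairs; transitivity (\int[M w]_p (M' w (xsection (joined beta gamma gamma' n T1) p) +
  M' w (xsection (joined beta gamma gamma' n T2) p))).
  by apply: eq_integral => p _; exact: measure_xsectionU.
by rewrite ge0_integralD//; exact: mx.
Qed.

Lemma edge_meansD w : edge_means T w = edge_means T1 w + edge_means T2 w.
Proof.
rewrite !edge_means_pairs /comp_pairs; transitivity (\int[M w]_p (laE (xsection (joined beta gamma gamma' n T1) p) +
  laE (xsection (joined beta gamma gamma' n T2) p))).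
  by apply: eq_integral => p _; exact: measure_xsectionU.
by rewrite ge0_integralD//; apply: measurable_fun_xsection; exact: mX.
Qed.

Lemma section_lengthD p : section_length T p = section_length T1 p + section_length T2 p.
Proof.
have ms T' : measurable_fun setT T' -> measurable_fun setT (fun r => (T' (p, r))%:R%:E : \bar R).
  move=> mT'; apply/measurable_EFinP; apply: measurable_natb.
  by apply: (measurable_comp measurableT (subsetT _) mT'); exact: measurable_pair1.
rewrite -ge0_integralD//; [|exact: ms|exact: ms].
by apply: eq_integral => r _; rewrite -EFinD -natrD -TE.
Qed.

Lemma edge_errorD w : edges T w \is a fin_num -> edge_means T w \is a fin_num ->
  edge_error T w = (edge_error T1 w + edge_error T2 w)%R.
Proof.
rewrite !edge_errorE edgesD edge_meansD => e1 e2.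
by apply: fine_subD => //; rewrite ?edges_ge0 ?edge_means_ge0.
Qed.

End additivity.

End edges.

(** * Edge families growing in time *)

Section edge_family.
Context (R : realType) (beta gamma gamma' : R).
Hypotheses (beta0 : 0 < beta) (gamma01 : 0 < gamma < 1) (gamma'01 : 0 < gamma' < 4^-1).
Context d (W : measurableType d) (P : probability W R).
Variables (eta : W -> set (R * R * R * R)) (eta' : W -> set (R * R * R)).
Hypotheses (Heta : poisson_process P (@space_ST R) (@intensity_ST R) eta)
  (Heta' : poisson_process P (@space_SR R) (@intensity_SR R) eta')
  (Hind : independent_pp P (@space_ST R) eta (@space_SR R) eta').
Variable n : nat.
Variables (F : R -> (R * R) * R -> bool) (g : R -> R * R -> R) (C : R).
Hypotheses (mF : forall t, measurable_fun setT (F t))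
  (F_mono : forall s t a, s <= t -> F s a -> F t a)
  (F_life : forall t a, F t a -> a.1.1 <= a.2 < a.1.1 + a.1.2)
  (F_len : forall t p, section_length (F t) p = (g t p)%:E)
  (Hg : path_kernel g C).
Local Open Scope ereal_scope.

Local Notation edges := (edges beta gamma gamma' eta eta' n).
Local Notation edge_means := (edge_means beta gamma gamma' eta n).
Local Notation edge_error := (edge_error beta gamma gamma' eta eta' n).

Definition births (s t : R) (a : (R * R) * R) := F t a && ~~ F s a.

Lemma measurable_births s t : measurable_fun setT (births s t).
Proof.
apply: measurable_and => //; apply: (measurable_comp measurableT (subsetT _) _ (mF s)).
exact: measurable_neg.
Qed.

Lemma birthsE s t a : (s <= t)%R -> (F t a : nat) = (F s a + births s t a)%N.
Proof.
move=> st; rewrite /births; case: (boolP (F s a)) => [/(F_mono st) ->//|_] /=.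
by rewrite andbT.
Qed.

Lemma births_len s t p : (s <= t)%R -> section_length (births s t) p = (g t p - g s p)%:E.
Proof.
move=> st; have := @section_lengthD R (F t) (F s) (births s t) (mF s)
  (measurable_births s t) (fun a => birthsE a st) p.
rewrite !F_len; have := section_length_ge0 (births s t) p.
by case: (section_length _ p) => [x||]//= x0 [] ->; congr EFin; ring.
Qed.

(** The arrival time falls within the life of the point, so the birth lies in an interval of length
    at most |l| below it; a moment of the lifetime bounds the integral. *)
Lemma life_bound (T : (R * R) * R -> bool) : measurable_fun setT T ->
  (forall a, T a -> (a.1.1 <= a.2 < a.1.1 + a.1.2)%R) ->
  forall r, theta (fun p => (T (p, r))%:R%:E) <= (expo_bound R)%:E.
Proof.
move=> mT Tl r; rewrite -[expo_bound R]mul1r.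
apply: (@theta_le R (fun p => (T (p, r))%:R) (fun=> 1%R) (fun l => r - `|l|)%R (fun=> r)) => //.
- apply: measurable_natb; apply: (measurable_comp measurableT (subsetT _) mT).
  exact: measurable_pair2.
- move=> b l; have := Tl (b, l, r); case: (T _) => /= [/(_ isT)/andP[h1 h2]|_].
    have := ler_norm l => h; rewrite ifT//; apply/andP; split; lra.
  by case: ifP.
- by move=> l; rewrite lerBlDr lerDl.
move=> l; rewrite !mul1r opprB addrC subrK.
have : (0 <= `|l|)%R by []. 
move=> h; rewrite !exprS expr0 mulr1; set x := `|l|%R in h *.
have h1 : (0 <= x * x)%R by rewrite mulr_ge0.
have h2 : (0 <= x * (x * x))%R by rewrite mulr_ge0.
lra.
Qed.

Let error_sqr (T : (R * R) * R -> bool) (c : R) : measurable_fun setT T ->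
  (forall a, T a -> (a.1.1 <= a.2 < a.1.1 + a.1.2)%R) ->
  theta (section_length T) <= c%:E ->
  \int[P]_w (edge_error T w ^+ 2)%:E <= (edge_const beta gamma gamma' * n%:R * c)%:E.
Proof.
move=> mT Tl Tc.
apply: le_trans (edge_error_sqr beta0 gamma01 gamma'01 Heta Heta' Hind _ mT (life_bound mT Tl) _) _.
  exact: le_lt_trans Tc (ltry _).
rewrite [leRHS]EFinM; apply: lee_wpmul2l => //; rewrite lee_fin mulr_ge0//; exact: edge_const_ge0.
Qed.

Let C0 : (0 <= C)%R := kernel_ge0 Hg.

Lemma edge_error0_sqr : \int[P]_w (edge_error (F 0%R) w ^+ 2)%:E <= (edge_const beta gamma gamma' * n%:R * C)%:E.
Proof.
apply: error_sqr => //; first by move=> a; exact: F_life.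
by rewrite (_ : section_length _ = fun p => (g 0 p)%:E); [exact: (kg_1 Hg)|apply/funext].
Qed.

Lemma births_error_sqr s t : (0 <= s)%R -> (s <= t)%R -> (t <= 1)%R ->
  \int[P]_w (edge_error (births s t) w ^+ 2)%:E <=
  (edge_const beta gamma gamma' * n%:R * (C * (t - s)))%:E.
Proof.
move=> s0 st t1; apply: error_sqr; first exact: measurable_births.
  by move=> a /andP[+ _]; exact: F_life.
rewrite (_ : section_length _ = fun p => (g t p - g s p)%:E); first exact: (kg_inc1 Hg).
by apply/funext => p; exact: births_len.
Qed.

Definition edges_good w := edges (F 1%R) w \is a fin_num /\ edge_means (F 1%R) w \is a fin_num.

Lemma theta_len t : (0 <= t <= 1)%R -> theta (section_length (F t)) <= (2 * C)%:E.
Proof.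
move=> t01; rewrite (_ : section_length _ = fun p => (g t p)%:E); last exact/funext.
exact: theta_kernel.
Qed.

Lemma edges_good_ae : {ae P, forall w, edges_good w}.
Proof.
apply: edges_fin => //; apply: le_lt_trans (theta_len _) (ltry _).
by rewrite ler01 lexx.
Qed.

Lemma births_edges w s t : (s <= t)%R ->
  edges (F t) w = edges (F s) w + edges (births s t) w.
Proof. by move=> st; exact: (edgesD beta gamma gamma' eta Heta' n (mF s) (measurable_births s t) (fun a => birthsE a st)). Qed.

Lemma births_edge_means w s t : (s <= t)%R ->
  edge_means (F t) w = edge_means (F s) w + edge_means (births s t) w.
Proof. by move=> st; exact: (edge_meansD beta gamma gamma' eta n (mF s) (measurable_births s t) (fun a => birthsE a st)). Qed.

Lemma edges_good_le w t : edges_good w -> (t <= 1)%R ->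
  edges (F t) w \is a fin_num /\ edge_means (F t) w \is a fin_num.
Proof.
move=> [e1 e2] t1; move: e1 e2; rewrite (births_edges w t1) (births_edge_means w t1).
by move=> /(fin_num_addl (edges_ge0 _ _ _ _ _ _ _ _) (edges_ge0 _ _ _ _ _ _ _ _)) ?
  /(fin_num_addl (edge_means_ge0 _ _ _ _ _ _ _) (edge_means_ge0 _ _ _ _ _ _ _)) ?.
Qed.

Lemma edges_le w s t : edges_good w -> (s <= t)%R -> (t <= 1)%R ->
  (fine (edges (F s) w) <= fine (edges (F t) w))%R.
Proof.
move=> gw st t1; have [? _] := edges_good_le gw t1.
have [? _] := edges_good_le gw (le_trans st t1).
by apply: fine_le => //; rewrite (births_edges w st) leeDl//; exact: edges_ge0.
Qed.

Lemma edge_means_le w s t : edges_good w -> (s <= t)%R -> (t <= 1)%R ->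
  (fine (edge_means (F s) w) <= fine (edge_means (F t) w))%R.
Proof.
move=> gw st t1; have [_ ?] := edges_good_le gw t1.
have [_ ?] := edges_good_le gw (le_trans st t1).
by apply: fine_le => //; rewrite (births_edge_means w st) leeDl//; exact: edge_means_ge0.
Qed.

(** The edge numbers and their conditional means are both nondecreasing in time, so the error
    between two times exceeds those at the ends by at most the growth of the conditional mean. *)
Lemma edge_error_sandwich w s t u m : edges_good w -> (s <= t)%R -> (t <= u)%R -> (u <= 1)%R ->
  (`|edge_error (F s) w| <= m)%R -> (`|edge_error (F u) w| <= m)%R ->
  (`|edge_error (F t) w| <= m + (fine (edge_means (F u) w) - fine (edge_means (F s) w)))%R.
Proof.
move=> gw st tu u1; have h1 := edges_le gw st (le_trans tu u1).
have h2 := edges_le gw tu u1; have h3 := edge_means_le gw st (le_trans tu u1).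
have h4 := edge_means_le gw tu u1.
rewrite !edge_errorE.
move: (fine (edges (F s) w)) (fine (edges (F t) w)) (fine (edges (F u) w)) h1 h2 => e1 e2 e3 h1 h2.
move: (fine (edge_means (F s) w)) (fine (edge_means (F t) w)) (fine (edge_means (F u) w)) h3 h4.
by move=> c1 c2 c3 h3 h4; rewrite !ler_norml => /andP[? ?] /andP[? ?]; apply/andP; split; lra.
Qed.

Section grid.
Variable K : nat.

Definition grid_point (i : nat) : R := i%:R / 2 ^+ K.

Definition grid_error (i : nat) w : R := edge_error (F (grid_point i)) w.

Definition grid_inc a b w : R := (grid_error b w - grid_error a w) ^+ 2.

(** One variable that dominates the squared error at every grid point: the chained increments from
    time 0 and the error at time 0. *)
Definition grid_sqr w : R :=
  2 * (K.+1%:R * chain_sum K (fun a b => grid_inc a b w)) + 2 * grid_error 0 w ^+ 2.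

Lemma measurable_grid_error i : measurable_fun setT (grid_error i).
Proof. exact: (measurable_edge_error beta gamma gamma' Heta Heta' n (mF _)). Qed.

Let measurable_grid_inc a b : measurable_fun setT (grid_inc a b).
Proof. by apply: measurable_funX; apply: measurable_funB; exact: measurable_grid_error. Qed.

Lemma measurable_grid_sqr : measurable_fun setT grid_sqr.
Proof.
apply: measurable_funD; apply: measurable_funM => //.
  by apply: measurable_funM => //; exact: measurable_chain_sum.
by apply: measurable_funX; exact: measurable_grid_error.
Qed.

Lemma grid_sqr_ge0 w : (0 <= grid_sqr w)%R.
Proof.
rewrite addr_ge0// mulr_ge0 ?sqr_ge0// mulr_ge0//; apply: chain_sum_ge0 => a b; exact: sqr_ge0.
Qed.

Lemma grid_error_sqr w i : (i <= 2 ^ K)%N -> (grid_error i w ^+ 2 <= grid_sqr w)%R.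
Proof.
move=> iK.
have := @dyadic_chaining R K (grid_error ^~ w) (fun a b => grid_inc a b w) i (fun a b => lexx _) iK.
rewrite /grid_sqr; set c := (_ * chain_sum _ _)%R; move: c (grid_error i w) (grid_error 0 w) => c x y.
have := sqr_ge0 (x - 2 * y); rewrite !expr2 => h1 h2; nra.
Qed.

(** The mean square of an increment is linear in its length, so chaining costs only [(K+1)^2]. The
    time-0 term is absorbed by doubling the constant from 2 to 4. *)
Lemma mean_grid_sqr :
  \int[P]_w (grid_sqr w)%:E <= (4 * K.+1%:R ^+ 2 * (edge_const beta gamma gamma' * C) * n%:R)%:E.
Proof.
set e := edge_const beta gamma gamma'; have e0 : (0 <= e)%R by exact: edge_const_ge0.
have K0 : (0 < 2 ^+ K :> R)%R by rewrite exprn_gt0.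
have e0sq := edge_error0_sqr.
have mchain := @mean_chain_sum R _ _ P K grid_inc (e * n%:R * C)%R.
have {}mchain : \int[P]_w (K.+1%:R * chain_sum K (fun a b => grid_inc a b w))%R%:E <=
    (K.+1%:R ^+ 2 * (e * n%:R * C))%R%:E.
  apply: mchain => //; first by apply: mulr_ge0 => //; exact: mulr_ge0.
    by move=> a b w; exact: sqr_ge0.
  move=> a b ab bK; have ab' : (grid_point a <= grid_point b)%R.
    by rewrite ler_pM2r ?invr_gt0// ler_nat.
  have a0 : (0 <= grid_point a)%R by rewrite divr_ge0// ltW.
  have b1 : (grid_point b <= 1)%R by rewrite ler_pdivrMr// mul1r -natrX ler_nat.
  rewrite (_ : (e * n%:R * C * (b - a)%:R / 2 ^+ K = e * n%:R * (C * (grid_point b - grid_point a)))%R); last first.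
    by rewrite /grid_point natrB//; ring.
  apply: le_trans (births_error_sqr a0 ab' b1).
  apply: ae_ge0_le_integral => //.
  - by move=> w _; rewrite lee_fin sqr_ge0.
  - exact/measurable_EFinP.
  - by move=> w _; rewrite lee_fin sqr_ge0.
  - apply/measurable_EFinP; apply: measurable_funX.
    exact: (measurable_edge_error beta gamma gamma' Heta Heta' n (measurable_births _ _)).
  apply: filterS edges_good_ae => w gw _; rewrite lee_fin /grid_inc /grid_error.
  have [h1 h2] := edges_good_le gw b1.
  rewrite (@edge_errorD _ beta gamma gamma' _ _ _ eta _ Heta' n _ _ _ (mF (grid_point a)) (measurable_births (grid_point a) (grid_point b))
    (fun a => birthsE a ab') w h1 h2).
  by rewrite addrC addKr.
rewrite /grid_sqr; under eq_integral do rewrite EFinD (EFinM 2 (_ * chain_sum _ _)%R) (EFinM 2 (_ ^+ 2)%R).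
rewrite ge0_integralD//; first last.
- apply: emeasurable_funM => //; apply/measurable_EFinP; apply: measurable_funX.
  exact: measurable_grid_error.
- by move=> w _; rewrite -EFinM lee_fin mulr_ge0// sqr_ge0.
- apply: emeasurable_funM => //; apply/measurable_EFinP; apply: measurable_funM => //.
  exact: measurable_chain_sum.
- move=> w _; rewrite -EFinM lee_fin mulr_ge0// mulr_ge0//; apply: chain_sum_ge0 => a b.
  exact: sqr_ge0.
rewrite !ge0_integralZl//; first last.
- move=> w _; rewrite lee_fin mulr_ge0//; apply: chain_sum_ge0 => a b; exact: sqr_ge0.
- apply/measurable_EFinP; apply: measurable_funM => //; exact: measurable_chain_sum.
- by move=> w _; rewrite lee_fin sqr_ge0.
- by apply/measurable_EFinP; apply: measurable_funX; exact: measurable_grid_error.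
have g0 : grid_point 0 = 0%R by rewrite /grid_point mul0r.
rewrite /grid_error g0.
apply: le_trans (leeD (lee_wpmul2l _ mchain) (lee_wpmul2l _ e0sq)) _ => //.
rewrite -!EFinM -EFinD lee_fin; set k := (K.+1%:R ^+ 2)%R.
have k1 : (1 <= k)%R by rewrite /k exprn_ege1// ler1n.
rewrite -/e; have x0 : (0 <= e * n%:R * C)%R by apply: mulr_ge0 => //; exact: mulr_ge0.
have := ler_wpM2r x0 k1; rewrite mul1r; set x := (e * n%:R * C)%R in x0 *; set y := (k * x)%R.
by rewrite (_ : 4 * k * (e * C) * n%:R = 4 * y)%R; [lra|rewrite /y /x; ring].
Qed.

End grid.

End edge_family.

Section lifetimes.
Context (R : realType).

Definition born t (a : (R * R) * R) : bool :=
  [&& 0 < a.1.1 + a.1.2, a.1.1 <= a.2, a.2 <= t & a.2 < a.1.1 + a.1.2].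

(** All edges of a point enter this family at once, when the point dies. *)
Definition dead t (a : (R * R) * R) : bool :=
  [&& 0 < a.1.1 + a.1.2, a.1.1 + a.1.2 <= t, a.1.1 <= a.2 & a.2 < a.1.1 + a.1.2].

Let mb : measurable_fun setT (fun a : (R * R) * R => a.1.1).
Proof. exact: (measurableT_comp measurable_fst measurable_fst). Qed.

Let ml : measurable_fun setT (fun a : (R * R) * R => a.1.2).
Proof. exact: (measurableT_comp measurable_snd measurable_fst). Qed.

Let mbl : measurable_fun setT (fun a : (R * R) * R => a.1.1 + a.1.2).
Proof. exact: measurable_funD. Qed.

Lemma measurable_born t : measurable_fun setT (born t).
Proof.
apply: measurable_and; first exact: measurable_fun_ltr.
apply: measurable_and; first exact: measurable_fun_ler.
by apply: measurable_and; [exact: measurable_fun_ler|exact: measurable_fun_ltr].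
Qed.

Lemma measurable_dead t : measurable_fun setT (dead t).
Proof.
apply: measurable_and; first exact: measurable_fun_ltr.
apply: measurable_and; first exact: measurable_fun_ler.
by apply: measurable_and; [exact: measurable_fun_ler|exact: measurable_fun_ltr].
Qed.

Lemma born_mono s t a : s <= t -> born s a -> born t a.
Proof. by move=> st /and4P[h1 h2 h3 h4]; apply/and4P; split => //; exact: le_trans st. Qed.

Lemma dead_mono s t a : s <= t -> dead s a -> dead t a.
Proof. by move=> st /and4P[h1 h2 h3 h4]; apply/and4P; split => //; exact: le_trans st. Qed.

Lemma born_life t a : born t a -> a.1.1 <= a.2 < a.1.1 + a.1.2.
Proof. by move=> /and4P[_ -> _ ->]. Qed.

Lemma dead_life t a : dead t a -> a.1.1 <= a.2 < a.1.1 + a.1.2.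
Proof. by move=> /and4P[_ _ -> ->]. Qed.

Lemma dead_born t a : dead t a -> born t a.
Proof. by move=> /and4P[h1 h2 h3 h4]; apply/and4P; split => //; exact: (ltW (lt_le_trans h4 h2)). Qed.

(** The edges present at [t] are not monotone in time, but they are the difference of two growing
    families. *)
Lemma alive_born_dead t a : 0 <= t ->
  (born t a && ~~ dead t a) = (a.1.1 <= a.2 <= t) && (t < a.1.1 + a.1.2).
Proof.
move=> t0; apply/idP/idP.
  move=> /andP[/and4P[h1 h2 h3 h4]]; rewrite /dead h1 h2 h4 !andbT /= -ltNge => ->.
  by rewrite h3.
move=> /andP[/andP[h1 h2] h3]; have h4 := le_lt_trans t0 h3.
by rewrite /born /dead h4 h1 h2 (le_lt_trans h2 h3) /= andbT -ltNge.
Qed.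

Local Open Scope ereal_scope.

Let section_itv (T : (R * R) * R -> bool) p (i : interval R) :
  (forall r, T (p, r) = (r \in i)) ->
  section_length T p = (if i.1 < i.2 then (i.2 : \bar R) - i.1 else 0).
Proof.
move=> Ti; rewrite -lebesgue_measure_itv; have mi : measurable ([set` i] : set R) by exact: measurable_itv.
transitivity (lebC R [set` i]); last by rewrite lebCE.
transitivity (lebC R ([set` i] `&` setT)); last by congr (lebC R _); exact: setIT.
rewrite -integral_indic//; apply: eq_integral => r _.
by rewrite Ti indicE mem_setE.
Qed.

Let section0 (T : (R * R) * R -> bool) p : (forall r, T (p, r) = false) -> section_length T p = 0.
Proof. by move=> T0; apply: integral0_eq => r _; rewrite T0. Qed.

Lemma born_length t p : section_length (born t) p = (alpha t p)%:E.
Proof.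
case: p => b l; rewrite /alpha/=; case: ifPn => [bl|/negbTE bl]; last first.
  by apply: section0 => r; rewrite /born/= bl.
have [tb|tb] := leP t (b + l)%R; last first.
  rewrite (@section_itv _ _ `[b, b + l[%R); last first.
    move=> r; rewrite /born/= bl in_itv/=; case: (b <= r)%R => //=.
    by case: (ltP r (b + l)%R) => h; rewrite ?andbF// andbT (ltW (lt_trans h tb)).
  rewrite /= lte_fin minEle maxEle; case: ltP => h; case: (leP (t - b)%R l) => h2; case: ifPn => h';
    rewrite -?ltNge in h'; congr EFin; lra.
have [tb'|tb'] := eqVneq t (b + l)%R.
  rewrite (@section_itv _ _ `[b, b + l[%R); last first.
    move=> r; rewrite /born/= bl in_itv/= tb'; case: (b <= r)%R => //=.
    by case: (ltP r (b + l)%R) => h; rewrite ?andbF// andbT ltW.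
  rewrite /= lte_fin minEle maxEle; case: ltP => h; case: (leP (t - b)%R l) => h2; case: ifPn => h';
    rewrite -?ltNge in h'; congr EFin; lra.
have {tb tb'}tb : (t < b + l)%R by rewrite lt_neqAle tb'.
rewrite (@section_itv _ _ `[b, t]%R); last first.
  move=> r; rewrite /born/= bl in_itv/=; case: (b <= r)%R => //=.
  by case: (leP r t) => h //=; rewrite (le_lt_trans h tb).
rewrite /= lte_fin minEle maxEle; case: ltP => h; case: (leP (t - b)%R l) => h2; case: ifPn => h';
    rewrite -?ltNge in h'; congr EFin; lra.
Qed.

Lemma dead_length t p : section_length (dead t) p = (delta t p)%:E.
Proof.
case: p => b l; rewrite /delta/=; case: ifPn => [/andP[bl tl]|h]; last first.
  by apply: section0 => r; rewrite /dead/= andbA (negbTE h).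
rewrite (@section_itv _ _ `[b, b + l[%R); last by move=> r; rewrite /dead/= bl tl in_itv.
rewrite /= lte_fin maxEle; case: ltP => h; case: ifPn => h'; rewrite -?ltNge in h'; congr EFin; lra.
Qed.

(** The points that can be alive at some time of [[0, 1]]. *)
Definition live (p : R * R) : bool := [&& (0 < p.1 + p.2)%R, (p.1 <= 1)%R & (0 <= p.2)%R].

Lemma measurable_live : measurable_fun setT live.
Proof.
apply: measurable_and; first by apply: measurable_fun_ltr => //; exact: measurable_funD.
by apply: measurable_and; exact: measurable_fun_ler.
Qed.

Lemma alpha_inc_le s u p : (s <= u)%R -> (u <= 1)%R ->
  (alpha u p - alpha s p <= (u - s) * (live p)%:R)%R.
Proof.
case: p => b l su u1; rewrite /live/=.
case: (ltP 0%R (b + l)%R) => h1; last by rewrite mulr0; case: (alphaP u b l); case: (alphaP s b l) => *; lra.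
case: (leP b 1%R) => h2; last by rewrite mulr0; case: (alphaP u b l); case: (alphaP s b l) => *; lra.
by case: (leP 0%R l) => h3 /=; rewrite ?mulr1 ?mulr0; case: (alphaP u b l); case: (alphaP s b l) => *; lra.
Qed.

Lemma theta_live : theta (fun p => (live p)%:R%:E) <= (expo_bound R)%:E.
Proof.
rewrite -[expo_bound R]mul1r.
apply: (@theta_le R (fun p => (live p)%:R) (fun=> 1%R) (fun l => - `|l|)%R (fun=> 1%R)) => //.
- exact: measurable_natb measurable_live.
- move=> b l; rewrite /live/=; have h := ler_norm l.
  case: ifPn => h'; first by case: [&& _, _ & _].
  case: and3P => // -[h1 h2 h3]; move: h'; rewrite h2 andbT -ltNge; lra.
move=> l; rewrite !mul1r.
have : (0 <= `|l|)%R by []. 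
move: (`|l|)%R => x h; rewrite !exprS expr0 mulr1.
have h1 : (0 <= x * x)%R by rewrite mulr_ge0.
have h2 : (0 <= x * (x * x))%R by rewrite mulr_ge0.
lra.
Qed.

End lifetimes.

(** * Births and deaths between grid points *)

Section deaths.
Context (R : realType) (beta gamma gamma' : R).
Hypotheses (beta0 : 0 < beta) (gamma01 : 0 < gamma < 1) (gamma'01 : 0 < gamma' < 4^-1).
Context d (W : measurableType d) (P : probability W R).
Variables (eta : W -> set (R * R * R * R)) (eta' : W -> set (R * R * R)).
Hypotheses (Heta : poisson_process P (@space_ST R) (@intensity_ST R) eta)
  (Heta' : poisson_process P (@space_SR R) (@intensity_SR R) eta').
Variable n : nat.
Local Open Scope ereal_scope.

Local Notation M := (M_ST eta).
Local Notation edges := (edges beta gamma gamma' eta eta' n).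
Local Notation edge_means := (edge_means beta gamma gamma' eta n).
Local Notation edge_error := (edge_error beta gamma gamma' eta eta' n).

(** Total rate at which the live points of the window acquire edges. *)
Definition load (w : W) : \bar R :=
  \int[M w]_p ((share beta gamma gamma' n p.1.1)%:E * (live (p.1.2, p.2))%:R%:E).

Let measurable_share2 : measurable_fun setT
  (fun p : R * R * R * R => (share beta gamma gamma' n p.1.1)%:E : \bar R).
Proof.
apply/measurable_EFinP; apply: (measurableT_comp (measurable_share _ _ _ _)).
exact: (measurableT_comp measurable_fst measurable_fst).
Qed.

Let measurable_live2 : measurable_fun setT
  (fun p : R * R * R * R => (live (p.1.2, p.2))%:R%:E : \bar R).
Proof.
apply/measurable_EFinP; apply: measurable_natb; apply: (measurableT_comp (@measurable_live R)).
exact: measurable_pair12.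
Qed.

Let measurable_weight : measurable_fun setT
  (fun p : R * R * R * R => (share beta gamma gamma' n p.1.1)%:E * (live (p.1.2, p.2))%:R%:E).
Proof. exact: emeasurable_funM. Qed.

Let weight_ge0 (p : R * R * R * R) :
  0 <= (share beta gamma gamma' n p.1.1)%:E * (live (p.1.2, p.2))%:R%:E.
Proof. by rewrite mule_ge0// lee_fin share_ge0. Qed.

Lemma measurable_load : measurable_fun setT load.
Proof. exact: (prm_mintegral (M_ST_poisson Heta) measurable_weight weight_ge0). Qed.

Lemma load_ge0 w : 0 <= load w.
Proof. by apply: integral_ge0 => p _; exact: weight_ge0. Qed.

Lemma mean_load : \int[P]_w load w <=
  (2 * beta / (1 - gamma) / (1 - gamma') * n%:R * expo_bound R)%:E.
Proof.
rewrite (campbell (M_ST_poisson Heta) measurable_weight weight_ge0) EFinM.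
have H0 (p : R * R) : 0 <= (live p)%:R%:E :> \bar R by rewrite lee_fin.
have mH : measurable_fun setT (fun p : R * R => (live p)%:R%:E : \bar R).
  by apply/measurable_EFinP; apply: measurable_natb; exact: measurable_live.
apply: le_trans (mean_share_time beta0 gamma01 gamma'01 n mH H0) _.
apply: lee_wpmul2l; last exact: theta_live.
by rewrite -(mean_share beta0 gamma01 gamma'01 n); apply: integral_ge0 => a _; rewrite lee_fin share_ge0.
Qed.

(** The conditional mean number of born edges is Lipschitz in time with constant [load], because
    each age grows at most at unit speed and only for live points. *)
Lemma edge_means_born_inc w s u : (s <= u)%R -> (u <= 1)%R ->
  edges_good beta gamma gamma' eta eta' n (@born R) w -> load w \is a fin_num ->
  (fine (edge_means (born u) w) - fine (edge_means (born s) w) <= (u - s) * fine (load w))%R.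
Proof.
move=> su u1 gw lfin; have us0 : (0 <= u - s)%R by rewrite subr_ge0.
have [_ f1] := edges_good_le Heta' (@measurable_born R) (@born_mono R) gw (le_trans su u1).
have [_ f2] := edges_good_le Heta' (@measurable_born R) (@born_mono R) gw u1.
rewrite -fineB// -lee_fin EFinM fineK; last by rewrite fin_numB f1 f2.
rewrite fineK// (births_edge_means beta gamma gamma' eta n (@measurable_born R) (@born_mono R) w su).
rewrite addeAC subee// add0e (edge_meansE gamma beta0 gamma'01 eta n w (measurable_births (@measurable_born R) s u)).
rewrite /load -ge0_integralZl; [|exact: measurableT|exact: measurable_weight|
  by move=> p _; exact: weight_ge0|by rewrite lee_fin].
have mlen : measurable_fun setT (section_length (births (@born R) s u)).
  exact: (measurable_section_length (measurable_births (@measurable_born R) s u)).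
apply: ge0_le_integral => //.
- by move=> p _; rewrite mule_ge0 ?section_length_ge0// lee_fin share_ge0.
- apply: emeasurable_funM => //; apply: (measurableT_comp mlen); exact: measurable_pair12.
- by apply: emeasurable_funM.
move=> p _; rewrite (births_len (@measurable_born R) (@born_mono R) (@born_length R) _ su).
rewrite -!EFinM lee_fin mulrCA; apply: ler_wpM2l; first exact: share_ge0.
exact: alpha_inc_le.
Qed.

Definition death_cell (s t : R) : set (R * R * R * R) :=
  [set p | [&& 0 <= p.1.1.1 <= n%:R, 0 < p.1.1.2 <= 1 & s < p.1.2 + p.2 <= t]%R].

Lemma measurable_death_cell s t : measurable (death_cell s t).
Proof.
apply: measurable_bool_set.
have m1 : measurable_fun setT (fun p : R * R * R * R => p.1.1.1).
  exact: (measurableT_comp measurable_fst (measurableT_comp measurable_fst measurable_fst)).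
have m2 : measurable_fun setT (fun p : R * R * R * R => p.1.1.2).
  exact: (measurableT_comp measurable_snd (measurableT_comp measurable_fst measurable_fst)).
have m3 : measurable_fun setT (fun p : R * R * R * R => p.1.2 + p.2)%R.
  by apply: measurable_funD => //; exact: measurable_pair1_2.
apply: measurable_and; last apply: measurable_and; apply: measurable_and;
  solve [exact: measurable_fun_ler|exact: measurable_fun_ltr].
Qed.

Let integral_outside (m : {measure set (R * R * R * R) -> \bar R}) (A : set (R * R * R * R)) f :
  measurable A -> measurable_fun setT f -> (forall p, ~ A p -> f p = 0) -> m A = 0 ->
  \int[m]_p f p = 0.
Proof.
move=> mA mf f0 mA0; transitivity (\int[m]_(p in A) f p); last first.
  by apply: null_set_integral => //; exact: measurable_funTS.
rewrite [RHS]integral_mkcond; apply: eq_integral => p _; rewrite patchE.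
by case: ifPn => // /negP pA; apply: f0 => Ap; apply: pA; exact/mem_set.
Qed.

Let outside_cell s t p : (0 <= s)%R -> ~ death_cell s t p ->
  xsection (joined beta gamma gamma' n (births (@dead R) s t)) p = set0.
Proof.
move=> s0 pA; apply/seteqP; split => // q; rewrite /xsection/= inE/= => /andP[cl bd]; case: pA.
move: bd; rewrite /births /dead/= => /andP[/and4P[h1 h2 h3 h4]]; rewrite h1 h3 h4/= !andbT -ltNge => h5.
case: p cl h1 h2 h3 h4 h5 => [[[x u] b] l]; case: q => [[z w] r] /= cl h1 h2 h3 h4 h5.
move: cl; rewrite /closeb/= => /and4P[xn un _ _].
rewrite -[death_cell _ _ _]/(is_true [&& (0 <= x <= n%:R)%R, (0 < u <= 1)%R & (s < b + l <= t)%R]).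
by apply/and3P; split; [exact: xn|exact: un|apply/andP; split].
Qed.

Let HetaC : poisson_process P (@space_ST R) (intensity_STC R) eta.
Proof. by apply: poisson_process_eq Heta => A mA; exact: intensity_STE. Qed.

Let HetaC' : poisson_process P (@space_SR R) (intensity_SRC R) eta'.
Proof. by apply: poisson_process_eq Heta' => A mA; exact: intensity_SRE. Qed.

(** A dead edge appears only with a death in the window. Without a death between [s] and [t],
    neither the edges nor their conditional mean change. *)
Lemma edge_error_death w s t : (0 <= s)%R -> (s <= t)%R -> M w (death_cell s t) = 0 ->
  edge_error (dead t) w = edge_error (dead s) w.
Proof.
move=> s0 st Mw0; rewrite !edge_errorE.
rewrite (births_edges beta gamma gamma' eta Heta' n (@measurable_dead R) (@dead_mono R) w st).
rewrite (births_edge_means beta gamma gamma' eta n (@measurable_dead R) (@dead_mono R) w st).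
have mX := measurable_joined beta gamma gamma' n (measurable_births (@measurable_dead R) s t).
have mC := measurable_death_cell s t.
have e0 : edges (births (@dead R) s t) w = 0.
  rewrite edgesE /pairs; apply: (integral_outside mC _ _ Mw0).
    have [_ [C0 [mC0 ndC0 CT0 C0fin]]] := prm_rm (pp_poisson_rm HetaC' (@measurable_space_SR R)
      (@measurable_cover_SR R) (@cover_SR_nd R) (@cover_SRT R) (@cover_SR_fin R)).
    have [N NE] := sigma_finite_cover mC0 CT0 (C0fin w).
    have := measurable_fun_xsection N mX; congr measurable_fun.
    by apply/funext => p /=; rewrite NE//; exact: measurable_xsection.
  by move=> p pA; rewrite (outside_cell s0 pA) measure0.
have m0 : edge_means (births (@dead R) s t) w = 0.
  rewrite edge_means_pairs /comp_pairs; apply: (integral_outside mC _ _ Mw0).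
    exact: measurable_fun_xsection.
  by move=> p pA; rewrite (outside_cell s0 pA) measure0.
by rewrite e0 m0 !adde0.
Qed.

(** Counts are integers or infinite, so two of them with sum at most 1 cannot both be nonzero. *)
Lemma M_ST_le1 w A B : measurable A -> measurable B -> A `&` B = set0 ->
  M w (A `|` B) <= 1 -> M w A = 0 \/ M w B = 0.
Proof.
move=> mA mB AB; rewrite measureU//.
have int C : M w C = 0 \/ 1 <= M w C.
  rewrite (pp_measureE (@cover_ST R) HetaC w C); case: asboolP => _; last by left.
  rewrite /count_in /counting; case: asboolP => _; last by right; rewrite leey.
  by case: (size _) => [|k]; [left|right; rewrite lee_fin ler1n].
case: (int A) (int B) => [->|hA] [->|hB]; try by [left|right].
move=> h; have := le_trans (leeD hA hB) h.
by rewrite -EFinD lee_fin gerDl ler10.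
Qed.

Section grid.
Variable K : nat.

(** At least two deaths in cell [j], written as a count that is not at most 1 so that an infinite
    count is included. *)
Definition crowded (j : nat) : set W :=
  [set w | ~ (M w (death_cell (grid_point R K j) (grid_point R K j.+1)) <= 1)].

(** [t] cuts its cell in two. At most one death occurs in the cell, so one of the parts has none,
    and the error at [t] equals the error at the endpoint of that part. *)
Lemma edge_error_grid w t : (0 <= t <= 1)%R ->
  (forall j, (j < 2 ^ K)%N -> ~ crowded j w) ->
  exists2 i, (i <= 2 ^ K)%N & edge_error (dead t) w = edge_error (dead (grid_point R K i)) w.
Proof.
move=> /andP[t0 t1] nc; have K0 : (0 < 2 ^+ K :> R)%R by rewrite exprn_gt0.
have [->|tn1] := eqVneq t 1%R.
  exists (2 ^ K)%N => //; rewrite /grid_point natrX divff//; exact: lt0r_neq0.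
have {t1 tn1}t1 : (t < 1)%R by rewrite lt_neqAle tn1.
have z0 : (0 <= t * 2 ^+ K)%R by rewrite mulr_ge0// ltW.
pose j := Num.truncn (t * 2 ^+ K)%R.
have jt : (grid_point R K j <= t)%R by rewrite /grid_point ler_pdivrMr// truncn_le.
have tj : (t <= grid_point R K j.+1)%R by rewrite /grid_point ler_pdivlMr// ltW// truncnS_gt.
have jK : (j < 2 ^ K)%N.
  by rewrite -(ltr_nat R) natrX (le_lt_trans (y := t * 2 ^+ K)%R) ?truncn_le// gtr_pMl.
have gj : (0 <= grid_point R K j)%R by rewrite divr_ge0// ltW.
have := nc j jK; rewrite /crowded/= notK.
have -> : death_cell (grid_point R K j) (grid_point R K j.+1) =
    death_cell (grid_point R K j) t `|` death_cell t (grid_point R K j.+1).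
  apply/seteqP; split => p; rewrite /death_cell/=.
    move=> /and4P[-> -> h1 h2] /=; rewrite h1 h2 /= andbT.
    by case: (leP (p.1.2 + p.2)%R t) => _; [left|right].
  move=> [/and4P[-> -> h1 h2]|/and4P[-> -> h1 h2]] /=.
    by rewrite h1 (le_trans h2).
  by rewrite h2 (le_lt_trans jt).
move=> /(M_ST_le1 (measurable_death_cell _ _) (measurable_death_cell _ _)) [].
- apply/seteqP; split => // p; rewrite /death_cell/= => -[/and4P[_ _ _ h1] /and4P[_ _ h2 _]].
  by move: h1; rewrite leNgt h2.
- by move=> h; exists j; [exact: ltnW|exact: edge_error_death].
- by move=> h; exists j.+1 => //; rewrite (edge_error_death _ _ h).
Qed.

(** For a given lifetime, a death in []s, t]] means a birth in an interval of length [t - s]; the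
    window contributes at most [n]. *)
Let rate_cell s t : (s <= t)%R ->
  mrestr (intensity_STC R) (@measurable_space_ST R) (death_cell s t) <= (n%:R * (t - s))%R%:E.
Proof.
move=> st; have mC := measurable_death_cell s t.
apply: (@le_trans _ _ (intensity_STC R (death_cell s t))).
  rewrite -[X in X <= _]/(intensity_STC R (death_cell s t `&` @space_ST R)).
  apply: le_measure; [apply/mem_set; apply: measurableI; [exact: mC|exact: measurable_space_ST]|
    exact/mem_set|exact: subIsetl].
pose F (a : R * R) : \bar R := (((0 <= a.1 <= n%:R) && (0 < a.2 <= 1))%R)%:R%:E.
pose H (p : R * R) : \bar R := (s < p.1 + p.2 <= t)%R%:R%:E.
have mF : measurable_fun setT F.
  by apply/measurable_EFinP; apply: measurable_natb; apply: measurable_and; apply: measurable_and;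
    solve [exact: measurable_fun_ler|exact: measurable_fun_ltr].
have mH : measurable_fun setT H.
  have mD : measurable_fun setT (fun p : R * R => p.1 + p.2)%R by exact: measurable_funD.
  by apply/measurable_EFinP; apply: measurable_natb; apply: measurable_and;
    solve [exact: measurable_fun_ler|exact: measurable_fun_ltr].
have F0 a : 0 <= F a by rewrite lee_fin.
have H0 a : 0 <= H a by rewrite lee_fin.
have -> : intensity_STC R (death_cell s t) = \int[intensity_STC R]_p (F p.1.1 * H (p.1.2, p.2)).
  transitivity (intensity_STC R (death_cell s t `&` setT)); first by congr (intensity_STC R _); rewrite setIT.
  rewrite -integral_indic//; apply: eq_integral => p _.
  rewrite indicE mem_setE /F /H -EFinM; congr EFin; rewrite -natrM mulnb.
  by rewrite -andbA.
rewrite integral_STC// EFinM; apply: lee_pmul.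
- by apply: integral_ge0.
- by apply: theta_ge0.
- rewrite (_ : \int[_]_p F p = prodm (lebC R) (lebC R) (`[0%R, n%:R]%classic `*` half_open 1)); last first.
    transitivity (prodm (lebC R) (lebC R) ((`[0%R, n%:R]%classic `*` half_open 1) `&` setT)); last first.
      by congr (prodm _ _ _); rewrite setIT.
    rewrite -integral_indic//; last first.
      by apply: measurableX; [exact: measurable_itv|exact: measurable_half_open].
    apply: eq_integral => a _; rewrite indicE /F; congr (_%:R%:E).
    by rewrite in_setX !mem_setE !in_itv.
  rewrite -[X in X <= _]/((lebC R \x lebC R) _) product_measure1E; [|exact: measurable_itv|exact: measurable_half_open].
  have E1 := lebC_itv 0%R (n%:R : R); have E2 := lebC_half_open (@ler01 R).
  apply: (@le_trans _ _ ((Num.max (n%:R - 0) 0)%R%:E * 1%R%:E)).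
    by apply: lee_pmul; [exact: measure_ge0|exact: measure_ge0|rewrite -E1; exact: lexx|rewrite -E2; exact: lexx].
  by rewrite mule1 lee_fin subr0 ge_max lexx ler0n.
- rewrite theta_prod// (@le_trans _ _ (\int[expoC R]_l (t - s)%:E))//; last first.
    apply: (@le_trans _ _ ((t - s)%:E * expoC R setT)); first by rewrite -integral_cst.
    by rewrite expoCT mule1.
  rewrite -theta_prod//; apply: ge0_le_integral => //.
  + by move=> l _; apply: integral_ge0.
  + exact: (@measurable_fun_fubini_tonelli_G _ _ _ _ _ (lebC R) _ mH H0).
  move=> l _; apply: (@le_trans _ _ (\int[lebC R]_b (\1_`[(s - l)%R, (t - l)%R]%classic b)%:E)).
    apply: ge0_le_integral => //.
    + by apply: (measurable_comp measurableT (subsetT _) mH); exact: measurable_pair2.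
    + by apply/measurable_EFinP; exact: measurable_indic.
    move=> b _; rewrite /H lee_fin indicE ler_nat mem_setE in_itv/=.
    case: (ltP s (b + l)%R) => // h1; case: (leP (b + l)%R t) => // h2.
    rewrite (_ : (s - l <= b <= t - l)%R)//; apply/andP; split; lra.
  rewrite integral_indic; [|by []|exact: measurable_itv].
  rewrite (_ : _ `&` _ = `[(s - l)%R, (t - l)%R]%classic); last by rewrite setIT.
  have E3 := lebC_itv (s - l)%R (t - l)%R.
  apply: (@le_trans _ _ (Num.max (t - l - (s - l)) 0)%R%:E); first by rewrite -E3; exact: lexx.
  by rewrite lee_fin ge_max; apply/andP; split; lra.
Qed.

Lemma measurable_crowded j : measurable (crowded j).
Proof.
have mM := prm_measurable (M_ST_poisson Heta) (measurable_death_cell (grid_point R K j) (grid_point R K j.+1)).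
rewrite [X in measurable X](_ : _ = ~` [set w | M w (death_cell (grid_point R K j) (grid_point R K j.+1)) <= 1])//.
apply: measurableC; rewrite -[X in measurable X]setTI; exact: emeasurable_fun_infty_c.
Qed.

(** For a Poisson count of mean [r], two or more points have probability [1 - (1 + r) exp(-r)], at
    most [r^2] because [exp(-r) >= 1 - r]. *)
Lemma crowded_small j : P (crowded j) <= ((n%:R / 2 ^+ K) ^+ 2)%:E.
Proof.
have K0 : (0 < 2 ^+ K :> R)%R by rewrite exprn_gt0.
set s := grid_point R K j; set t := grid_point R K j.+1.
have st : (t - s = (2 ^+ K)^-1)%R by rewrite /t /s /grid_point -mulrBl -natrB// subSnn mul1r.
have st' : (s <= t)%R by rewrite -subr_ge0 st invr_ge0 ltW.
have mC := measurable_death_cell s t.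
have rle := rate_cell st'; rewrite st in rle.
have r0 : 0 <= mrestr (intensity_STC R) (@measurable_space_ST R) (death_cell s t) by exact: measure_ge0.
have [r rE] : exists r : R, mrestr (intensity_STC R) (@measurable_space_ST R) (death_cell s t) = r%:E.
  by move: r0 rle; case: (mrestr _ _ _) => [r||]//= _ _; exists r.
rewrite rE lee_fin in rle; rewrite rE lee_fin in r0.
have law := prm_law (M_ST_poisson Heta) mC rE.
have mM := prm_measurable (M_ST_poisson Heta) mC.
pose Z k := [set w | M w (death_cell s t) = (k%:R : R)%:E].
have mZ k : measurable (Z k).
  by rewrite -[X in measurable X]setTI; exact: (mM measurableT [set (k%:R : R)%:E]).
have Z01 : Z 0%N `&` Z 1%N = set0.
  apply/seteqP; split => // w; rewrite /Z/= => -[-> /eqP].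
  by rewrite eqe eq_sym oner_eq0.
have sub : crowded j `<=` ~` (Z 0%N `|` Z 1%N).
  by move=> w cw [h|h]; apply: cw; rewrite h// lee_fin ler01.
apply: (@le_trans _ _ (P (~` (Z 0%N `|` Z 1%N)))).
  apply: le_measure; rewrite ?inE//; first exact: measurable_crowded.
  by apply: measurableC; exact: measurableU.
rewrite probability_setC; last exact: measurableU.
have l0 : P (Z 0%N) = (pois r 0)%:E := law 0%N.
have l1 : P (Z 1%N) = (pois r 1)%:E := law 1%N.
have PU : P (Z 0%N `|` Z 1%N) = P (Z 0%N) + P (Z 1%N) by apply: measureU.
rewrite PU l0 l1 -[X in X <= _]/((1 - (pois r 0 + pois r 1))%R%:E) lee_fin.
apply: (@le_trans _ _ (r ^+ 2)%R); last by rewrite ler_sqr ?nnegrE ?divr_ge0// ltW.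
have -> : pois r 0 = expR (- r) by rewrite /pois expr0 fact0 divr1 mul1r.
have -> : pois r 1 = (r * expR (- r))%R by rewrite /pois expr1 factS fact0 muln1 divr1.
have e1 : (1 - r <= expR (- r))%R by exact: expR_ge1Dx.
have := ler_wpM2l (addr_ge0 ler01 r0) e1; rewrite expr2.
move: (expR (- r)) => e; lra.
Qed.

End grid.

End deaths.

(** * Compensated paths *)

Section slab.
Context (R : realType).
Local Open Scope ereal_scope.

Definition slab (b : R) : set (R * R * R) := (half_open b `*` setT) `*` setT.

Lemma measurable_slab b : measurable (slab b).
Proof.
by apply: measurableX => //; apply: measurableX => //; exact: measurable_half_open.
Qed.

Let mid3 : measurable_fun setT (id : R * R * R -> R * R * R).
Proof. exact: measurable_id. Qed.

Lemma rate_slab (b : R) A : measurable A ->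
  rate (measurable_half_open b) A = rimage mid3 (measurable_slab b) (rate (@measurable_positives R)) A.
Proof.
move=> mA.
have eta2 (S T : Type) (B : set (S * T)) : (fun p => (p.1, p.2)) @^-1` B = B.
  by apply/seteqP; split => -[].
have mid1 : measurable_fun setT (id : R -> R) by exact: measurable_id.
have mid2 : measurable_fun setT (id : R * R -> R * R) by exact: measurable_id.
pose lb := sigma_finite_restr (lebC R) (measurable_half_open b).
pose lp := sigma_finite_restr (lebC R) (@measurable_positives R).
have mhb := measurable_half_open b.
have mhb2 : measurable (half_open b `*` setT : set (R * R)) by exact: measurableX.
rewrite -[LHS]/((prodm lb (lebC R) \x expoC R) A).
apply: etrans; first apply: (@image_prod _ _ _ _ _ _ _ _ _ id id _ setT mid2 mhb2
  (prodm lp (lebC R)) (expoC R) (prodm lb (lebC R)) (expoC R)) => //.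
- move=> B mB; apply: etrans; first apply: (@image_prod _ _ _ _ _ _ _ _ _ id id _ setT mid1 mhb
    lp (lebC R) lb (lebC R)) => //.
  + move=> C mC; rewrite -[LHS]/(lebC R (C `&` half_open b)).
    rewrite -[RHS]/(lebC R ((half_open b `&` C) `&` @positives R)); congr (lebC R _).
    rewrite setIC [in RHS]setIAC; congr (_ `&` _); apply/esym/setIidl => x.
    by rewrite /half_open /positives/= !in_itv/= andbT => /andP[].
  + by move=> C mC; rewrite setTI.
  by rewrite eta2.
- by move=> B mB; rewrite setTI.
by rewrite eta2.
Qed.

End slab.

Section paths.
Context (R : realType) (c gm : R).
Hypotheses (c0 : 0 < c) (gm_bounds : 2^-1 < gm < 1).
Local Open Scope ereal_scope.

Local Notation aK := (@alpha_kernel R).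
Local Notation dK := (@delta_kernel R).

(** The integrand of the truncated limit in the coordinate [v]: a jump of size [c v^-gm], multiplied
    by the age of the point while it is alive. *)
Definition weight (y t : R) (p : R * R * R) : R :=
  (c * pow_block gm 0 y p.1.1 * ((t - p.1.2) * (p.1.2 <= t < p.1.2 + p.2)%R%:R))%R.

Lemma weight_ge0 y t p : (0 <= weight y t p)%R.
Proof.
apply: mulr_ge0; first by rewrite mulr_ge0 ?pow_block_ge0 ?(ltW c0).
by case: (boolP (_ <= t < _)%R) => [/andP[h _]|_]; rewrite ?mulr1 ?mulr0// subr_ge0.
Qed.

Lemma measurable_weight y t : measurable_fun setT (weight y t).
Proof.
have m1 : measurable_fun setT (fun p : R * R * R => p.1.1).
  exact: (measurableT_comp measurable_fst measurable_fst).
have m2 : measurable_fun setT (fun p : R * R * R => p.1.2) by exact: measurable_pair1_2.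
apply: measurable_funM.
  by apply: measurable_funM => //; apply: (measurableT_comp (measurable_pow_block _ _ _) m1).
apply: measurable_funM; first exact: measurable_funB.
rewrite (_ : (fun p => _) = fun p => if (p.1.2 <= t < p.1.2 + p.2)%R then 1%R else 0%R); last first.
  by apply/funext => p; case: (_ <= t < _)%R.
apply: measurable_fun_ifT => //; apply: measurable_and; first exact: measurable_fun_ler.
by apply: measurable_fun_ltr => //; exact: measurable_funD.
Qed.

(** Written as a sum, since nonnegative integrals add while differences of extended reals need
    finiteness. *)
Lemma weightE y t p : (0 <= t)%R ->
  (weight y t p)%:E + (c%:E * phi gm 0 y (delta t) p) = c%:E * phi gm 0 y (alpha t) p.
Proof.
move=> t0; rewrite /phi /weight -!EFinM -EFinD; congr EFin.
case: p => -[v b] l /=; rewrite -alpha_sub_delta//; ring.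
Qed.

Section one.
Context d (W : measurableType d) (P : probability W R).
Variables (mu : {measure set (R * R * R) -> \bar R}) (M : W -> {measure set (R * R * R) -> \bar R}).
Hypothesis HM : poisson_rm P mu M.
Variable y : R.
Hypotheses (Foo : \int[mu]_p phi gm 0 y (alpha 1%R) p < +oo) (Doo : \int[mu]_p phi gm 0 y (delta 1%R) p < +oo).

(** The same path as the compensated integral of [weight], kept as a difference of two monotone
    parts; this form makes the regularity in time accessible. *)
Definition centred_path (w : W) (t : R) : R :=
  (c * ((fine (\int[M w]_p phi gm 0 y (alpha t) p) - fine (\int[mu]_p phi gm 0 y (alpha t) p)) -
        (fine (\int[M w]_p phi gm 0 y (delta t) p) - fine (\int[mu]_p phi gm 0 y (delta t) p))))%R.

Definition path_good : set W := [set w |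
  \int[M w]_p phi gm 0 y (alpha 1%R) p < +oo /\ \int[M w]_p phi gm 0 y (delta 1%R) p < +oo].

Lemma path_good_ae : {ae P, forall w, path_good w}.
Proof.
have hA := prm_integral_fin HM (measurable_phi gm 0 y (kg_meas aK 1%R))
  (fun p => phi_ge0 gm 0 y p (kg_ge0 aK 1%R)) Foo.
have hD := prm_integral_fin HM (measurable_phi gm 0 y (kg_meas dK 1%R))
  (fun p => phi_ge0 gm 0 y p (kg_ge0 dK 1%R)) Doo.
apply: filterS2 hA hD => w; rewrite !ge0_fin_numE//.
- by apply: integral_ge0 => p _; apply: phi_ge0; exact: kg_ge0 dK _.
- by apply: integral_ge0 => p _; apply: phi_ge0; exact: kg_ge0 aK _.
Qed.

Let mint t g C (Hg : @path_kernel R g C) : measurable_fun setT (fun w => \int[M w]_p phi gm 0 y (g t) p).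
Proof.
apply: (prm_mintegral HM); first by apply: measurable_phi; exact: kg_meas Hg _.
by move=> p; apply: phi_ge0; exact: kg_ge0 Hg _.
Qed.

Lemma measurable_path_good : measurable path_good.
Proof.
rewrite [X in measurable X](_ : _ = [set w | \int[M w]_p phi gm 0 y (alpha 1%R) p < +oo] `&`
  [set w | \int[M w]_p phi gm 0 y (delta 1%R) p < +oo])//.
apply: measurableI; rewrite -[X in measurable X]setTI; apply: emeasurable_fun_infty_o => //.
  exact: mint aK.
exact: mint dK.
Qed.

Lemma centred_path_cadlag w : path_good w -> cadlag01 (centred_path w).
Proof.
move=> [gA gD]; apply: cadlag01Z; apply: cadlag01B; apply: cadlag01B.
- exact: (cadlag_phi aK gA).
- exact: (cadlag_phi aK Foo).
- exact: (cadlag_phi dK gD).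
- exact: (cadlag_phi dK Doo).
Qed.

Lemma measurable_centred_path t : measurable_fun setT (centred_path ^~ t).
Proof.
apply: measurable_funM => //; apply: measurable_funB; apply: measurable_funB => //;
  apply: measurableT_comp => //; [exact: mint aK|exact: mint dK].
Qed.

Lemma integral_kernel_fin (m : {measure set (R * R * R) -> \bar R}) t g C (Hg : @path_kernel R g C) : (t <= 1)%R ->
  \int[m]_p phi gm 0 y (g 1%R) p < +oo -> \int[m]_p phi gm 0 y (g t) p \is a fin_num.
Proof.
move=> t1 foo; rewrite ge0_fin_numE; last first.
  by apply: integral_ge0 => p _; apply: phi_ge0; exact: kg_ge0 Hg _.
apply: le_lt_trans foo; apply: ge0_le_integral => //.
- by move=> p _; apply: phi_ge0; exact: kg_ge0 Hg _.
- by apply: measurable_phi; exact: kg_meas Hg _.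
- by apply: measurable_phi; exact: kg_meas Hg _.
by move=> p _; rewrite lee_fin ler_wpM2l ?pow_block_ge0// (kg_mono Hg).
Qed.

Lemma weight_fine (m : {measure set (R * R * R) -> \bar R}) t : (0 <= t <= 1)%R ->
  \int[m]_p phi gm 0 y (alpha 1%R) p < +oo -> \int[m]_p phi gm 0 y (delta 1%R) p < +oo ->
  \int[m]_p (weight y t p)%:E \is a fin_num /\
  fine (\int[m]_p (weight y t p)%:E) =
  (c * (fine (\int[m]_p phi gm 0 y (alpha t) p) - fine (\int[m]_p phi gm 0 y (delta t) p)))%R.
Proof.
move=> /andP[t0 t1] ao do_.
have fa := integral_kernel_fin aK t1 ao; have fd := integral_kernel_fin dK t1 do_.
have pa0 p : 0 <= phi gm 0 y (alpha t) p by apply: phi_ge0; exact: kg_ge0 aK _.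
have pd0 p : 0 <= phi gm 0 y (delta t) p by apply: phi_ge0; exact: kg_ge0 dK _.
have ma : measurable_fun setT (phi gm 0 y (alpha t)) by apply: measurable_phi; exact: kg_meas aK _.
have md : measurable_fun setT (phi gm 0 y (delta t)) by apply: measurable_phi; exact: kg_meas dK _.
have mw : measurable_fun setT (fun p => (weight y t p)%:E : \bar R).
  by apply/measurable_EFinP; exact: measurable_weight.
have E : \int[m]_p (weight y t p)%:E + c%:E * \int[m]_p phi gm 0 y (delta t) p =
    c%:E * \int[m]_p phi gm 0 y (alpha t) p.
  rewrite -ge0_integralZl// ?lee_fin ?(ltW c0)// -ge0_integralZl// ?lee_fin ?(ltW c0)//.
  rewrite -ge0_integralD//.
  - by apply: eq_integral => p _; exact: weightE.
  - by move=> p _; rewrite lee_fin weight_ge0.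
  - by move=> p _; rewrite mule_ge0// lee_fin ltW.
  - exact: measurable_funeM.
have w0 : 0 <= \int[m]_p (weight y t p)%:E by apply: integral_ge0 => p _; rewrite lee_fin weight_ge0.
move: E w0; rewrite -(fineK fa) -(fineK fd) -!EFinM.
case: (\int[m]_p (weight y t p)%:E) => [x||]//= [E] _; split => //.
by rewrite mulrBr -E addrK.
Qed.

Lemma centred_path_weight w t : path_good w -> (0 <= t <= 1)%R ->
  [/\ \int[M w]_p (weight y t p)%:E \is a fin_num, \int[mu]_p (weight y t p)%:E \is a fin_num &
  centred_path w t = (fine (\int[M w]_p (weight y t p)%:E) - fine (\int[mu]_p (weight y t p)%:E))%R].
Proof.
move=> [gA gD] t01; have [f1 e1] := weight_fine t01 gA gD; have [f2 e2] := weight_fine t01 Foo Doo.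
by split => //; rewrite e1 e2 /centred_path; ring.
Qed.

Definition path_sk (w : W) : skorokhod R :=
  if `[< path_good w >] then to_skorokhod (centred_path w) else point.

Lemma path_skE w t : path_good w -> (0 <= t <= 1)%R -> path_sk w t = centred_path w t.
Proof.
by move=> gw t01; rewrite /path_sk asboolT// to_skorokhodE//; exact: centred_path_cadlag.
Qed.

Lemma measurable_path_sk_at t : (0 <= t <= 1)%R -> measurable_fun setT (fun w => path_sk w t).
Proof.
move=> t01; rewrite (_ : (fun w => _) = fun w => if w \in path_good then centred_path w t else 0%R); last first.
  apply/funext => w; case: ifPn => [/set_mem gw|/negP gw]; first exact: path_skE.
  by rewrite /path_sk asboolF// => h; apply: gw; exact/mem_set.
apply: measurable_fun_ifT => //; last exact: measurable_centred_path.
apply: (@measurable_fun_bool _ _ _ _ true); rewrite setTI.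
rewrite [X in measurable X](_ : _ = path_good); first exact: measurable_path_good.
by apply/seteqP; split => w /= h; [exact: set_mem|exact/mem_set].
Qed.

Lemma measurable_path_sk : borel_measurable path_sk.
Proof. by apply: skorokhod_measurable => t t01; exact: measurable_path_sk_at. Qed.

End one.

(** A set of finite intensity outside which [weight y t] vanishes for every [t] in [[0, 1]], as the
    comparison of laws requires. *)
Definition slab_live (y : R) : set (R * R * R) := [set p | ((0 < p.1.1 <= y) && live (p.1.2, p.2))%R].

Lemma measurable_slab_live y : measurable (slab_live y).
Proof.
have m1 : measurable_fun setT (fun p : R * R * R => p.1.1).
  exact: (measurableT_comp measurable_fst measurable_fst).
apply: measurable_bool_set; apply: measurable_and.
  by apply: measurable_and; [exact: measurable_fun_ltr|exact: measurable_fun_ler].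
apply: (measurableT_comp (@measurable_live R)); exact: measurable_pair12.
Qed.

Lemma rate_slab_live (D : set R) (mD : measurable D) y : (0 <= y)%R -> rate mD (slab_live y) < +oo.
Proof.
move=> y0; pose F (v : R) : \bar R := (\1_(half_open y) v)%:E.
pose H (p : R * R) : \bar R := (live p)%:R%:E.
have mF : measurable_fun setT F.
  by apply/measurable_EFinP; apply: measurable_indic; exact: measurable_half_open.
have mH : measurable_fun setT H.
  by apply/measurable_EFinP; apply: measurable_natb; exact: measurable_live.
have F0 v : 0 <= F v by rewrite lee_fin.
have H0 p : 0 <= H p by rewrite lee_fin.
have -> : rate mD (slab_live y) = \int[rate mD]_p (F p.1.1 * H (p.1.2, p.2)).
  transitivity (rate mD (slab_live y `&` setT)); first by congr (rate mD _); rewrite setIT.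
  rewrite -integral_indic//; last exact: measurable_slab_live.
  apply: eq_integral => p _; rewrite /F /H !indicE /half_open !mem_setE -EFinM in_itv/=.
  by rewrite -natrM mulnb.
rewrite integral_rate//; apply: mul_lty.
- by apply: integral_ge0.
- by apply: theta_ge0.
- apply: (@le_lt_trans _ _ (\int[lebC R]_v F v)).
    by apply: ge0_subset_integral => //; exact: measurable_funTS.
  have E := lebC_half_open y0; rewrite integral_indic//; last exact: measurable_half_open.
  by apply: (@le_lt_trans _ _ (lebC R (half_open y))); [rewrite setIT|rewrite E ltry].
- exact: le_lt_trans (@theta_live R) (ltry _).
Qed.

Lemma weight_out y t p : (0 <= t <= 1)%R -> ~ slab_live y p -> weight y t p = 0%R.
Proof.
move=> /andP[t0 t1] pS; rewrite /weight /pow_block.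
case: (boolP (0 < p.1.1 <= y)%R) => hv; last by rewrite mulr0 mul0r.
case: (boolP (p.1.2 <= t < p.1.2 + p.2)%R) => hb; last by rewrite !mulr0.
exfalso; apply: pS; rewrite /slab_live/= hv /live/=; case/andP: hb => h1 h2.
by apply/and3P; split; lra.
Qed.

Lemma centred_path_eq d (W : measurableType d) (mu mu' : {measure set (R * R * R) -> \bar R})
    (M M' : W -> {measure set (R * R * R) -> \bar R}) y w t :
  \int[M w]_p phi gm 0 y (alpha t) p = \int[M' w]_p phi gm 0 y (alpha t) p ->
  \int[mu]_p phi gm 0 y (alpha t) p = \int[mu']_p phi gm 0 y (alpha t) p ->
  \int[M w]_p phi gm 0 y (delta t) p = \int[M' w]_p phi gm 0 y (delta t) p ->
  \int[mu]_p phi gm 0 y (delta t) p = \int[mu']_p phi gm 0 y (delta t) p ->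
  centred_path mu M y w t = centred_path mu' M' y w t.
Proof. by rewrite /centred_path => -> -> -> ->. Qed.

Section law.
Context d (W : measurableType d) (P : probability W R) d1 (W1 : measurableType d1) (P1 : probability W1 R).
Variables (mu mu1 : {measure set (R * R * R) -> \bar R}).
Variables (M : W -> {measure set (R * R * R) -> \bar R}) (M1 : W1 -> {measure set (R * R * R) -> \bar R}).
Hypotheses (HM : poisson_rm P mu M) (HM1 : poisson_rm P1 mu1 M1).
Hypotheses (HI : independent_rm P M) (HI1 : independent_rm P1 M1).
Hypothesis mu1E : forall A, measurable A -> mu1 A = mu A.
Variable y : R.
Hypothesis Ey : mu (slab_live y) < +oo.
Hypotheses (Foo : \int[mu]_p phi gm 0 y (alpha 1%R) p < +oo) (Doo : \int[mu]_p phi gm 0 y (delta 1%R) p < +oo).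
Variables (h : skorokhod R -> R) (M0 K : R).
Hypotheses (hM : forall f, (`|h f| <= M0)%R) (hK : forall f g, (`|h f - h g| <= K * skorokhod_dist f g)%R).

Let ch : continuous h. Proof. exact: lipschitz_continuous hK. Qed.

Let sample_cvg d2 (W2 : measurableType d2) (P2 : probability W2 R) (Y : W2 -> skorokhod R) :
  (forall t, (0 <= t <= 1)%R -> measurable_fun setT (fun w => Y w t)) ->
  (mean P2 (fun w => h (step m (sample m (Y w)))) @[m --> \oo] --> mean P2 (fun w => h (Y w)))%R.
Proof.
move=> mY; apply: (@mean_cvg _ _ _ _ _ _ M0).
- move=> m; apply: (@measurable_comp_continuous _ _ _ (fun w => step m (sample m (Y w)))) => //.
  apply: measurable_step => k; rewrite /sample.
  have [t01|t01] := boolP (0 <= (k%:R / m.+1%:R : R) <= 1)%R.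
    exact: mY.
  by rewrite (_ : (fun w => _) = cst 0%R)//; apply/funext => w; rewrite sk_out.
- by apply: measurable_comp_continuous ch; exact: skorokhod_measurable.
- by move=> m w; exact: hM.
apply: aeW => w; apply/cvgrPdist_le => e e0.
have K0 : (0 < `|K| + 1)%R by rewrite ltr_pwDr.
apply: filterS (step_sample_cvg (Y w) (divr_gt0 e0 K0)) => m.
rewrite ler_pdivlMr// => hm; apply: le_trans (hK _ _) _; rewrite skorokhod_dist_sym.
apply: le_trans hm; rewrite mulrC ler_wpM2l//; first exact: (@mdist_ge0 R (skorokhod R)).
by rewrite (le_trans (ler_norm K))// lerDl.
Qed.

(** Sampling indices beyond [m+1] correspond to times after 1, where elements of the Skorokhod space
    are 0; the integrand is set to 0 to match. *)
Let fstep m k p : R := if (k <= m.+1)%N then weight y (k%:R / m.+1%:R) p else 0%R.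

Let grid01 m k : (k <= m.+1)%N -> (0 <= (k%:R / m.+1%:R : R) <= 1)%R.
Proof. by move=> km; rewrite divr_ge0//= ler_pdivrMr// mul1r ler_nat. Qed.

Let grid_out m k : ~~ (k <= m.+1)%N -> ~~ (0 <= (k%:R / m.+1%:R : R) <= 1)%R.
Proof.
by rewrite -ltnNge => km; rewrite negb_and -!ltNge ltr_pdivlMr// mul1r ltr_nat km orbT.
Qed.

Let step_eq d2 (W2 : measurableType d2) (P2 : probability W2 R) (mu2 : {measure set (R * R * R) -> \bar R})
    (M2 : W2 -> {measure set (R * R * R) -> \bar R}) m : poisson_rm P2 mu2 M2 ->
  \int[mu2]_p phi gm 0 y (alpha 1%R) p < +oo -> \int[mu2]_p phi gm 0 y (delta 1%R) p < +oo ->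
  mean P2 (fun w => h (step m (sample m (path_sk mu2 M2 y w)))) =
  mean P2 (fun w => h (step m (fun k => (fine (\int[M2 w]_p (fstep m k p)%:E) -
     fine (\int[mu2]_p (fstep m k p)%:E))%R))).
Proof.
move=> HM2 F2 D2.
have mf k : measurable_fun setT (fun p => (fstep m k p)%:E : \bar R).
  by apply/measurable_EFinP; rewrite /fstep; case: (k <= m.+1)%N => //; exact: measurable_weight.
have f0 k p : 0 <= (fstep m k p)%:E.
  by rewrite lee_fin /fstep; case: ifP => _ //; exact: weight_ge0.
apply: mean_ae.
- apply: (@measurable_comp_continuous _ _ _ (fun w => step m (sample m (path_sk mu2 M2 y w)))) => //.
  apply: measurable_step => k; rewrite /sample.
  have [t01|t01] := boolP (0 <= (k%:R / m.+1%:R : R) <= 1)%R.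
    exact: (measurable_path_sk_at HM2 F2 D2).
  by rewrite (_ : (fun w => _) = cst 0%R)//; apply/funext => w; rewrite sk_out.
- apply: (@measurable_comp_continuous _ _ _ (fun w => step m (fun k => (fine (\int[M2 w]_p (fstep m k p)%:E) -
     fine (\int[mu2]_p (fstep m k p)%:E))%R))) => //.
  apply: measurable_step => k; apply: measurable_funB => //.
  by apply: measurableT_comp => //; apply: (prm_mintegral HM2).
apply: filterS (path_good_ae HM2 F2 D2) => w gw; congr (h (step m _)); apply/funext => k.
rewrite /sample /fstep; case: (boolP (k <= m.+1)%N) => km.
  by rewrite (path_skE F2 D2 gw (grid01 km)); have [_ _ ->] := centred_path_weight F2 D2 gw (grid01 km).
by rewrite sk_out ?grid_out// !integral0 subrr.
Qed.

(** Sampled on a grid, the two paths are step functions of finitely many compensated integrals and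
    have equal laws; refining the grid recovers the paths in the Skorokhod metric, for which [h] is
    Lipschitz. *)
Lemma path_law : mean P (fun w => h (path_sk mu M y w)) = mean P1 (fun w => h (path_sk mu1 M1 y w)).
Proof.
have mu1I f : \int[mu1]_p f p = \int[mu]_p f p by apply: eq_measure_integral => A mA _; exact: mu1E.
have F1 : \int[mu1]_p phi gm 0 y (alpha 1%R) p < +oo by rewrite mu1I.
have D1 : \int[mu1]_p phi gm 0 y (delta 1%R) p < +oo by rewrite mu1I.
have c1 := @sample_cvg _ _ P _ (measurable_path_sk_at HM Foo Doo).
have c2 := @sample_cvg _ _ P1 _ (measurable_path_sk_at HM1 F1 D1).
have E : (fun m => mean P (fun w => h (step m (sample m (path_sk mu M y w))))) =
    (fun m => mean P1 (fun w => h (step m (sample m (path_sk mu1 M1 y w))))).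
  apply/funext => m; rewrite (step_eq m HM Foo Doo) (step_eq m HM1 F1 D1).
  have -> : (fun w => h (step m (fun k => (fine (\int[M1 w]_p (fstep m k p)%:E) -
      fine (\int[mu1]_p (fstep m k p)%:E))%R))) =
    (fun w => h (step m (fun k => (fine (\int[M1 w]_p (fstep m k p)%:E) -
      fine (\int[mu]_p (fstep m k p)%:E))%R))).
    by apply/funext => w; congr (h (step m _)); apply/funext => k; rewrite mu1I.
  apply: (mean_step_law mu1E HM HI HM1 HI1 m _ (measurable_slab_live y) Ey (M0 := M0) (K := K)) => //.
  - by move=> k; rewrite /fstep; case: (k <= m.+1)%N => //; exact: measurable_weight.
  - by move=> k p; rewrite /fstep; case: ifP => _ //; exact: weight_ge0.
  - by move=> k p pS; rewrite /fstep; case: ifP => // km; apply: weight_out pS; exact: grid01.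
  move=> k; rewrite /fstep; case: (boolP (k <= m.+1)%N) => km; last by rewrite integral0 ltry.
  have [gA gD] := conj Foo Doo.
  have [] := weight_fine (grid01 km) Foo Doo.
  by rewrite ge0_fin_numE//; apply: integral_ge0 => p _; rewrite lee_fin weight_ge0.
by rewrite -(cvg_lim (@Rhausdorff R) c2) -E (cvg_lim (@Rhausdorff R) c1).
Qed.

End law.

Section limit.
Context d (W : measurableType d) (P : probability W R).
Variable N : W -> {measure set (R * R * R) -> \bar R}.
Local Notation mu := (rate (@measurable_positives R)).
Hypothesis HN : poisson_rm P mu N.

Lemma rate_alpha y : \int[mu]_p phi gm 0 y (alpha 1%R) p < +oo.
Proof. exact: (integral_phi_fin gm_bounds aK). Qed.

Lemma rate_delta y : \int[mu]_p phi gm 0 y (delta 1%R) p < +oo.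
Proof. exact: (integral_phi_fin gm_bounds dK). Qed.

Definition limit_good : set W := geo N gm (@alpha R) `&` geo N gm (@delta R).

Lemma measurable_limit_good : measurable limit_good.
Proof.
have [mA _] := geo_ae_measurable HN gm_bounds aK.
have [mD _] := geo_ae_measurable HN gm_bounds dK.
exact: measurableI.
Qed.

Lemma limit_good_ae : {ae P, forall w, limit_good w}.
Proof.
have [_ hA] := geo_ae_measurable HN gm_bounds aK.
have [_ hD] := geo_ae_measurable HN gm_bounds dK.
by apply: filterS2 hA hD => w ? ?; split.
Qed.

Lemma limit_good_path w y : limit_good w -> path_good N y w.
Proof. by move=> [[gA _] [gD _]]; split; [exact: (good_fin aK y gA (lexx _) (lexx _))|exact: (good_fin dK y gD (lexx _) (lexx _))]. Qed.

Lemma path_cauchy w : limit_good w -> exists2 K, (0 <= K)%R & forall m y t,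
  (2 ^+ m <= y)%R -> (0 <= t <= 1)%R ->
  (`|centred_path mu N y w t - centred_path mu N (2 ^+ m) w t| <= K * sigma gm ^+ m)%R.
Proof.
move=> [gA gD]; have [KA [KA0 hA]] := cphi_cauchy gm_bounds aK gA.
have [KD [KD0 hD]] := cphi_cauchy gm_bounds dK gD.
exists (c * (KA + KD))%R; first by rewrite mulr_ge0 ?addr_ge0 ?(ltW c0).
move=> m y t my t01; have := hA m y t my t01; have := hD m y t my t01.
rewrite -[centred_path mu N y w t]/(c * (cphi N gm 0 y (alpha t) w - cphi N gm 0 y (delta t) w))%R.
rewrite -[centred_path mu N (2 ^+ m) w t]/(c * (cphi N gm 0 (2 ^+ m) (alpha t) w - cphi N gm 0 (2 ^+ m) (delta t) w))%R.
move: (cphi _ _ _ y _ _) (cphi _ _ _ y _ _) (cphi _ _ _ (2 ^+ m) _ _) (cphi _ _ _ (2 ^+ m) _ _) => x1 x2 x3 x4.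
move=> h1 h2; rewrite -mulrBr normrM (gtr0_norm c0) -mulrA ler_wpM2l ?(ltW c0)// mulrDl.
rewrite (_ : x1 - x2 - (x3 - x4) = (x1 - x3) - (x2 - x4))%R; last by ring.
by apply: le_trans (ler_normB _ _) _; rewrite lerD.
Qed.

(** Taken along the truncations [2^m]; convergence along all truncations is recovered from the
    uniform Cauchy bound. *)
Definition limit_path w t : R := lim (centred_path mu N (2 ^+ m)%R w t @[m --> \oo]).

Hypothesis HI : independent_rm P N.
Variable n : nat.
Let mid3 : measurable_fun setT (id : R * R * R -> R * R * R) := @measurable_id _ _ setT.

Local Notation mun := (rate (measurable_half_open (n%:R : R))).

Definition slab_rm := rm_image N mid3 (measurable_slab (n%:R : R)).

Let slab_rm_poisson : poisson_rm P mun slab_rm.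
Proof.
have [_ [C [mC ndC CT muC NC]] _] := HN.
pose ms := measurable_slab (n%:R : R).
have mS i : measurable (slab n%:R `&` id @^-1` C i) by apply: measurableI => //; exact: mC.
have E A (mA : measurable A) : mun A = rimage mid3 ms mu A := rate_slab n%:R mA.
apply: (poisson_rm_eq E); apply: (poisson_rm_image mid3 ms (C := C));
  [exact: HN|exact: mC|exact: ndC|exact: CT| |].
- move=> i; apply: le_lt_trans (muC i); apply: le_measure; [exact/mem_set|exact/mem_set|].
  by move=> x [].
- move=> w i; apply: le_lt_trans (NC w i); apply: le_measure; [exact/mem_set|exact/mem_set|].
  by move=> x [].
Qed.

Let slab_integral (m : {measure set (R * R * R) -> \bar R}) g C t (Hg : @path_kernel R g C) :
  \int[rimage mid3 (measurable_slab (n%:R : R)) m]_p phi gm 0 n%:R (g t) p = \int[m]_p phi gm 0 n%:R (g t) p.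
Proof.
rewrite integral_rimage; first last.
- by move=> p; apply: phi_ge0; exact: kg_ge0 Hg _.
- by apply: measurable_phi; exact: kg_meas Hg _.
rewrite integral_mkcond; apply: eq_integral => p _; rewrite patchE; case: ifPn => // /negP pS.
rewrite /phi /pow_block; case: ifPn => [h|_]; last by rewrite mul0r.
exfalso; apply: pS; apply/mem_set; split => //; split => //=.
Qed.

Let mun_integral g C t (Hg : @path_kernel R g C) :
  \int[mun]_p phi gm 0 n%:R (g t) p = \int[mu]_p phi gm 0 n%:R (g t) p.
Proof.
apply: etrans (slab_integral mu t Hg); apply: eq_measure_integral => A mA _; exact: rate_slab.
Qed.

Let slab_path w : path_sk mun slab_rm n%:R w = path_sk mu N n%:R w.
Proof.
have E1 t : \int[slab_rm w]_p phi gm 0 n%:R (alpha t) p = \int[N w]_p phi gm 0 n%:R (alpha t) p.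
  exact: slab_integral aK.
have E2 t : \int[slab_rm w]_p phi gm 0 n%:R (delta t) p = \int[N w]_p phi gm 0 n%:R (delta t) p.
  exact: slab_integral dK.
rewrite /path_sk (_ : path_good slab_rm n%:R w = path_good N n%:R w); last first.
  by rewrite /path_good/= E1 E2.
have E : centred_path mun slab_rm n%:R w = centred_path mu N n%:R w.
  apply/funext => t; have E3 := mun_integral t aK; have E4 := mun_integral t dK.
  exact: centred_path_eq (E1 t) E3 (E2 t) E4.
by rewrite E.
Qed.

Lemma window_alpha : \int[mun]_p phi gm 0 n%:R (alpha 1%R) p < +oo.
Proof. by rewrite (mun_integral 1 aK); exact: rate_alpha. Qed.

Lemma window_delta : \int[mun]_p phi gm 0 n%:R (delta 1%R) p < +oo.
Proof. by rewrite (mun_integral 1 dK); exact: rate_delta. Qed.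

(** The path truncated at [n] only sees [v <= n]. The restriction of [N] to that slab and [M1] are
    independently scattered Poisson measures of the same intensity. *)
Lemma window_path_law d1 (W1 : measurableType d1) (P1 : probability W1 R)
    (M1 : W1 -> {measure set (R * R * R) -> \bar R}) (h : skorokhod R -> R) (M0 K : R) :
  poisson_rm P1 mun M1 -> independent_rm P1 M1 ->
  (forall f, (`|h f| <= M0)%R) -> (forall f g, (`|h f - h g| <= K * skorokhod_dist f g)%R) ->
  mean P1 (fun w => h (path_sk mun M1 n%:R w)) = mean P (fun w => h (path_sk mu N n%:R w)).
Proof.
move=> HM1 HI1 hM hK.
have -> : (fun w => h (path_sk mu N n%:R w)) = (fun w => h (path_sk mun slab_rm n%:R w)).
  by apply/funext => w; rewrite slab_path.
apply: (path_law HM1 slab_rm_poisson HI1 _ _ _ window_alpha window_delta hM hK) => //.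
- exact: (independent_rm_image mid3 (measurable_slab (n%:R : R)) HI).
- exact: rate_slab_live.
Qed.

End limit.

End paths.

(** * The limiting random element *)

Section limit_process.
Context (R : realType) (c gm : R).
Hypotheses (c0 : 0 < c) (gm_bounds : 2^-1 < gm < 1).
Local Open Scope ereal_scope.
Context d (W : measurableType d) (P : probability W R).
Variable N : W -> {measure set (R * R * R) -> \bar R}.
Local Notation mu := (rate (@measurable_positives R)).
Hypothesis HN : poisson_rm P mu N.

Local Notation limit_path := (limit_path c gm N).
Local Notation limit_good := (limit_good gm N).
Local Notation centred_path := (centred_path c gm).
Local Notation path_sk := (path_sk c gm).
Local Notation ra := (rate_alpha gm_bounds).
Local Notation rd := (rate_delta gm_bounds).

(** Two applications of the Cauchy bound, from [y] and from a far truncation to the same [2^m], give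
    the factor 2. *)
Lemma path_limit w : limit_good w -> exists2 K, (0 <= K)%R & forall m y t,
  (2 ^+ m <= y)%R -> (0 <= t <= 1)%R ->
  (`|centred_path mu N y w t - limit_path w t| <= K * sigma gm ^+ m)%R.
Proof.
move=> gw; have [K K0 HK] := path_cauchy c0 gm_bounds gw.
have /andP[s0 s1] := sigma01 gm_bounds.
have cs : (K * sigma gm ^+ m @[m --> \oo] --> (0 : R))%R.
  rewrite -[X in _ --> X](mulr0 K); apply: cvgMr; apply: cvg_expr.
  by rewrite ger0_norm// ltW.
have cv t : (0 <= t <= 1)%R -> cvg (centred_path mu N (2 ^+ m)%R w t @[m --> \oo]).
  move=> t01; apply: cauchy_cvg; apply: cauchy_exP => e e0.
  have /cvgrPdist_lt /(_ e e0) [m0 _ h] := cs.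
  exists (centred_path mu N (2 ^+ m0)%R w t); exists m0 => // m /= m0m.
  have := h m0 (leqnn _); rewrite sub0r normrN => hm0.
  rewrite /ball/= distrC; apply: le_lt_trans (HK m0 _ t _ t01) _.
    by rewrite ler_eXn2l// ltr1n.
  exact: le_lt_trans (ler_norm _) hm0.
exists (2 * K)%R; first by rewrite mulr_ge0.
move=> m y t my t01; apply/ler_addgt0Pr => e e0.
have /cvgrPdist_lt /(_ e e0) [m1 _ h] := cv t t01.
pose k := maxn m m1; have := h k (leq_maxr _ _) => hk.
have h1 := HK m y t my t01.
have h2 := HK m (2 ^+ k)%R t (ler_weXn2l (ler1n R 2) (leq_maxl _ _)) t01.
move: h1 h2 hk; rewrite -/(limit_path w t) -mulrA; set l := limit_path w t; set z := centred_path mu N (2 ^+ k)%R w t.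
move: (centred_path mu N y w t) (centred_path mu N (2 ^+ m)%R w t) (K * sigma gm ^+ m)%R z l => a b q z l.
rewrite !ler_norml => /andP[? ?] /andP[? ?]; rewrite ltr_norml => /andP[? ?].
by apply/andP; split; lra.
Qed.


Lemma limit_close w e : limit_good w -> (0 < e)%R -> exists y0, forall y t, (y0 <= y)%R ->
  (0 <= t <= 1)%R -> (`|centred_path mu N y w t - limit_path w t| <= e)%R.
Proof.
move=> gw e0; have [K K0 HK] := path_limit gw.
have /andP[s0 s1] := sigma01 gm_bounds.
have cs : (K * sigma gm ^+ m @[m --> \oo] --> (0 : R))%R.
  rewrite -[X in _ --> X](mulr0 K); apply: cvgMr; apply: cvg_expr.
  by rewrite ger0_norm// ltW.
have /cvgrPdist_le /(_ e e0) [m _ h] := cs; exists (2 ^+ m)%R => y t my t01.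
apply: le_trans (HK m y t my t01) _; have := h m (leqnn _).
by rewrite sub0r normrN; apply: le_trans; exact: ler_norm.
Qed.

Lemma limit_path_cadlag w : limit_good w -> cadlag01 (limit_path w).
Proof.
move=> gw; apply: (@uniform_limit_cadlag _ (fun n => path_sk mu N n%:R w)) => e e0.
have [y0 H] := limit_close gw e0.
exists (Num.truncn y0).+1 => t t01.
rewrite (path_skE c (ra _) (rd _) (limit_good_path _ gw) t01); apply: H => //.
exact: ltW (truncnS_gt _).
Qed.

Definition limit_sk (w : W) : skorokhod R :=
  if `[< limit_good w >] then to_skorokhod (limit_path w) else point.

Lemma limit_skE w t : limit_good w -> (0 <= t <= 1)%R -> limit_sk w t = limit_path w t.
Proof.
by move=> gw t01; rewrite /limit_sk asboolT// to_skorokhodE//; exact: limit_path_cadlag.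
Qed.

Lemma limit_sk_close w e : limit_good w -> (0 < e)%R -> exists y0, forall y, (y0 <= y)%R ->
  (skorokhod_dist (path_sk mu N y w) (limit_sk w) <= e)%R.
Proof.
move=> gw e0; have [y0 H] := limit_close gw e0; exists y0 => y yy.
apply: skorokhod_dist_le => t t01.
by rewrite (path_skE c (ra _) (rd _) (limit_good_path _ gw) t01) limit_skE//; exact: H.
Qed.

(** Each coordinate is a pointwise limit of measurable coordinates of truncated paths, all cut to
    the measurable event [limit_good]. *)
Lemma measurable_limit_sk : borel_measurable limit_sk.
Proof.
apply: skorokhod_measurable => t t01.
pose X n w : R := if w \in limit_good then path_sk mu N n%:R w t else 0%R.
have mX n : measurable_fun setT (X n).
  apply: measurable_fun_ifT => //.
    apply: (@measurable_fun_bool _ _ _ _ true); rewrite setTI.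
    rewrite [Y in measurable Y](_ : _ = limit_good); first exact: measurable_limit_good HN.
    by apply/seteqP; split => w /= h; [exact: set_mem|exact/mem_set].
  exact: (measurable_path_sk_at c HN (ra _) (rd _)).
apply: (measurable_fun_cvg mX) => w _; apply/cvgrPdist_le => e e0; rewrite /X.
case: (boolP (w \in limit_good)) => [/set_mem gw|/negP gw]; last first.
  apply: nearW => n; rewrite /limit_sk asboolF; first by rewrite subrr normr0 ltW.
  by move=> h; apply: gw; exact/mem_set.
have [y0 H] := limit_close gw e0.
exists (Num.truncn y0).+1 => // n /= hn.
rewrite (path_skE c (ra _) (rd _) (limit_good_path _ gw) t01) limit_skE// distrC; apply: H => //.
by apply: le_trans (ltW (truncnS_gt _)) _; rewrite ler_nat.
Qed.

(** The truncated paths converge almost surely in the Skorokhod metric; bounded convergence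
    concludes. *)
Lemma mean_limit_sk (h : skorokhod R -> R) (M0 K : R) :
  (forall f, (`|h f| <= M0)%R) -> (forall f g, (`|h f - h g| <= K * skorokhod_dist f g)%R) ->
  (mean P (fun w => h (path_sk mu N n%:R w)) @[n --> \oo] --> mean P (fun w => h (limit_sk w)))%R.
Proof.
move=> hM hK; have ch : continuous h by exact: lipschitz_continuous hK.
apply: (@mean_cvg _ _ _ _ _ _ M0).
- by move=> n; apply: measurable_comp_continuous ch; exact: (measurable_path_sk c HN (ra _) (rd _)).
- by apply: measurable_comp_continuous ch; exact: measurable_limit_sk.
- by move=> n w; exact: hM.
apply: filterS (limit_good_ae gm_bounds HN) => w gw; apply/cvgrPdist_le => e e0.
have K0 : (0 < `|K| + 1)%R by rewrite ltr_pwDr.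
have [y0 H] := limit_sk_close gw (divr_gt0 e0 K0).
exists (Num.truncn y0).+1 => // n /= hn; rewrite distrC.
apply: le_trans (hK _ _) _; apply: (@le_trans _ _ ((`|K| + 1) * skorokhod_dist (path_sk mu N n%:R w) (limit_sk w))%R).
  rewrite ler_wpM2r//; first exact: (@mdist_ge0 R (skorokhod R)).
  by rewrite (le_trans (ler_norm K))// lerDl.
rewrite mulrC -ler_pdivlMr//; apply: H.
by apply: le_trans (ltW (truncnS_gt _)) _; rewrite ler_nat.
Qed.

End limit_process.

(** * The edge count process *)

Section ae_integral.
Context d (W : measurableType d) (R : realType) (P : {measure set W -> \bar R}).
Local Open Scope ereal_scope.
Import HBNNSimple.

Lemma ge0_le_integral_any (f g : W -> \bar R) : (forall w, 0 <= f w) -> (forall w, f w <= g w) ->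
  \int[P]_w f w <= \int[P]_w g w.
Proof.
move=> f0 fg; rewrite !ge0_integralTE//; last by move=> w; exact: le_trans (f0 w) (fg w).
apply: le_ereal_sup => _ [k kf <-]; exists k => // w; exact: le_trans (kf w) (fg w).
Qed.

(* No measurability of [f]: the integral of a nonnegative function is the supremum of the
   integrals of the simple functions below it, and these can be cut off on a null set. *)
Lemma ae_integral_any (f g : W -> \bar R) : measurable_fun setT g ->
  (forall w, 0 <= f w) -> (forall w, 0 <= g w) -> {ae P, forall w, f w = g w} ->
  \int[P]_w f w = \int[P]_w g w.
Proof.
move=> mg f0 g0 [N [mN N0 NS]].
have fgN w : ~ N w -> f w = g w by move=> Nw; apply: contrapT => h; apply: Nw; exact: NS.
have cutE (u : W -> \bar R) : measurable_fun setT u ->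
    \int[P]_w (u w * (\1_(~` N) w)%:E) = \int[P]_w u w.
  move=> mu; apply: ae_eq_integral => //.
    apply: emeasurable_funM => //; apply/measurable_EFinP; apply: measurable_indic.
    exact: measurableC.
  exists N; split => // w h; apply: contrapT => Nw; apply: h => _.
  by rewrite indicE mem_set// mule1.
apply/eqP; rewrite eq_le; apply/andP; split.
  rewrite (ge0_integralTE _ f0); apply: ge_ereal_sup => _ [k kf <-].
  have mk : measurable_fun setT (fun w => (k w)%:E : \bar R) by apply/measurable_EFinP.
  rewrite -integralT_nnsfun -(cutE _ mk); apply: ge0_le_integral_any => w.
    by rewrite mule_ge0// lee_fin.
  rewrite indicE; case: (boolP (w \in ~` N)) => [/set_mem Nw|_]; rewrite ?mule1 ?mule0//.
  by rewrite -(fgN w Nw).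
rewrite -(cutE _ mg); apply: ge0_le_integral_any => w; first by rewrite mule_ge0// lee_fin.
rewrite indicE; case: (boolP (w \in ~` N)) => [/set_mem Nw|_]; rewrite ?mule1 ?mule0//.
by rewrite (fgN w Nw).
Qed.

End ae_integral.

(** * The edge count as a difference of born and dead edges *)

Section edge_count_link.
Context (R : realType) (beta gamma gamma' : R).
Hypotheses (beta0 : 0 < beta) (gamma01 : 0 < gamma < 1) (gamma'01 : 0 < gamma' < 4^-1).
Context d (W : measurableType d) (P : probability W R).
Variables (eta : W -> set (R * R * R * R)) (eta' : W -> set (R * R * R)).
Hypotheses (Heta : poisson_process P (@space_ST R) (@intensity_ST R) eta)
  (Heta' : poisson_process P (@space_SR R) (@intensity_SR R) eta')
  (Hind : independent_pp P (@space_ST R) eta (@space_SR R) eta').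
Variable n : nat.
Local Open Scope ereal_scope.

Local Notation M := (M_ST eta).
Local Notation M' := (M_SR eta').
Local Notation muE := (sigma_finite_restr (intensity_STC R) (@measurable_space_ST R)).
Local Notation edges := (edges beta gamma gamma' eta eta' n).
Local Notation edge_means := (edge_means beta gamma gamma' eta n).
Local Notation edge_error := (edge_error beta gamma gamma' eta eta' n).
Local Notation edge_count := (edge_count beta gamma gamma' eta eta' n).
Local Notation share := (share beta gamma gamma' n).

Let HetaC : poisson_process P (@space_ST R) (intensity_STC R) eta.
Proof. by apply: poisson_process_eq Heta => A mA; exact: intensity_STE. Qed.

Let HetaC' : poisson_process P (@space_SR R) (intensity_SRC R) eta'.
Proof. by apply: poisson_process_eq Heta' => A mA; exact: intensity_SRE. Qed.

Let HPR : poisson_rm P (sigma_finite_restr (intensity_SRC R) (@measurable_space_SR R)) M'.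
Proof.
exact: (poisson_rm_eq _ (pp_poisson_rm HetaC' (@measurable_space_SR R)
  (@measurable_cover_SR R) (@cover_SR_nd R) (@cover_SRT R) (@cover_SR_fin R))).
Qed.

Definition alive (t : R) (a : (R * R) * R) : bool := born t a && ~~ dead t a.

Lemma measurable_alive t : measurable_fun setT (alive t).
Proof.
apply: measurable_and; first exact: measurable_born.
apply: (measurable_comp measurableT (subsetT _) _ (@measurable_dead R t)).
exact: measurable_neg.
Qed.

Lemma edges_alive t w : edges (born t) w = edges (alive t) w + edges (dead t) w.
Proof.
apply: (edgesD beta gamma gamma' eta Heta' n (measurable_alive t) (@measurable_dead R t)) => a.
rewrite /alive; case: (boolP (dead t a)) => [/dead_born ->//|_]; by rewrite andbT addn0.
Qed.

Let weight0 : set (R * R * R * R) := [set p | p.1.1.2 == 0%R].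

Let measurable_weight0 : measurable weight0.
Proof.
apply: measurable_bool_set; apply: (measurable_fun_eqr (g := cst 0%R)) => //.
exact: (measurableT_comp measurable_snd (measurableT_comp measurable_fst measurable_fst)).
Qed.

Let weight0_null : intensity_STC R weight0 = 0.
Proof.
pose F (a : R * R) : \bar R := (a.2 == 0%R)%:R%:E.
have mF : measurable_fun setT F.
  by apply/measurable_EFinP; apply: measurable_natb; apply: (measurable_fun_eqr (g := cst 0%R)).
have -> : intensity_STC R weight0 = \int[intensity_STC R]_p (F p.1.1 * cst 1 (p.1.2, p.2)).
  transitivity (intensity_STC R (weight0 `&` setT)); first by congr (intensity_STC R _); rewrite setIT.
  rewrite -integral_indic//; apply: eq_integral => p _.
  by rewrite indicE mem_setE mule1.
rewrite (@integral_STC R F (cst 1))//.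
rewrite (_ : \int[_]_p F p = 0) ?mul0e//.
rewrite -[LHS]/(\int[prodm (lebC R) (lebC R)]_p (F p)).
transitivity (\int[prodm (lebC R) (lebC R)]_p (cst 1 p.1 * (\1_`[0%R, 0%R]%classic p.2)%:E)).
  apply: eq_integral => p _; rewrite mul1e /F indicE mem_setE in_itv/= -eq_le eq_sym.
  by congr (_%:R%:E).
rewrite (@integral_prod2 _ _ _ _ R (lebC R) (lebC R) (cst 1) (fun u => (\1_`[0%R, 0%R]%classic u)%:E))//.
- rewrite integral_indic; [|by []|exact: measurable_itv].
  have E := lebC_itv (0 : R)%R 0%R; rewrite subrr maxxx in E.
  apply: etrans (congr1 (fun z => _ * z) (etrans (congr1 (lebC R) (setIT _)) E)) _.
  by rewrite mule0.
- by apply/measurable_EFinP; apply: measurable_indic; exact: measurable_itv.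
by move=> *; rewrite lee_fin.
Qed.

(** The window admits weight 0 while [closeb] excludes it. Points of weight 0 have zero intensity,
    so their mean number is 0 and almost surely there are none. *)
Lemma positive_weights : {ae P, forall w, forall p, eta w p -> p.1.1.2 != 0%R}.
Proof.
have HM := M_ST_poisson Heta.
have mZ := prm_measurable HM measurable_weight0.
have : \int[P]_w M w weight0 = 0.
  apply: etrans (prm_mean_set HM measurable_weight0) _; apply/eqP; rewrite eq_le; apply/andP; split; last exact: measure_ge0.
  apply: (@le_trans _ _ (intensity_STC R weight0)); last by rewrite weight0_null.
  rewrite -[X in X <= _]/(intensity_STC R (weight0 `&` @space_ST R)).
  apply: le_measure; [apply/mem_set; apply: measurableI => //; exact: measurable_space_ST|
    exact/mem_set|exact: subIsetl].
move=> I0; have /(ae_eq_integral_abs P measurableT mZ) : \int[P]_w `|M w weight0| = 0.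
  by rewrite -I0; apply: eq_integral => w _; rewrite gee0_abs.
have := pp_count_ae HetaC (@measurable_space_ST R) (@measurable_cover_ST R) (@cover_ST_fin R).
apply: filterS2 => w cw zw p ep; apply/negP => p0.
have := cw _ measurable_weight0; rewrite zw// /count_in /counting.
case: asboolP => // fs [] /eqP; rewrite pnatr_eq0 finmap.cardfs_eq0 => /eqP h.
have : (eta w `&` weight0) p by split.
by rewrite (fset_set_set0 fs h).
Qed.

(** The exceptional event is common to all times, because the identification of sums and counts with
    measures holds for all test functions and sets at once. *)
Lemma edge_count_alive : {ae P, forall w, forall t, (0 <= t <= 1)%R -> edge_count t w = edges (alive t) w}.
Proof.
have h1 := pp_integral_ae HetaC (@measurable_space_ST R) (@measurable_cover_ST R) (@cover_ST_fin R).
have h2 := pp_count_ae HetaC' (@measurable_space_SR R) (@measurable_cover_SR R) (@cover_SR_fin R).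
apply: filterS3 h1 h2 positive_weights => w Iw Cw Zw t /andP[t0 t1].
have mX := measurable_joined beta gamma gamma' n (measurable_alive t).
rewrite edgesE /pairs -Iw; first last.
- by move=> p; exact: measure_ge0.
- have mrm := measurable_xsection_rm HPR mX.
  exact: (measurable_comp measurableT (subsetT _) mrm (measurable_pair1 _)).
rewrite /edge_count esum_mkcondr; apply: eq_esum => p ep.
have mXp : measurable (xsection (joined beta gamma gamma' n (alive t)) p) by exact: measurable_xsection.
have u0 := Zw p ep.
have xE q : xsection (joined beta gamma gamma' n (alive t)) p q =
    (closeb beta gamma gamma' n (p.1.1, q.1) && alive t (p.1.2, p.2, q.2)) :> Prop.
  by rewrite /xsection/= in_setE.
case: ifPn => [/set_mem|/negP] pw.
  rewrite /deg -(Cw _ mXp); congr (count_in _ _ _); apply/seteqP; split => q; rewrite xE.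
    case: p ep u0 pw mXp {xE} => [[[x u] b] l] ep /= u0 [xn /andP[u1 u2]] _; case: q => [[z w'] r] /=.
    move=> [w01 xz /andP[br rt] tb]; apply/andP; split.
      by rewrite /closeb/= xn w01 u2 andbT/= xz andbT lt_neqAle eq_sym u0 u1.
    by rewrite /alive alive_born_dead//= br rt tb.
  case: p ep u0 pw mXp {xE} => [[[x u] b] l] ep /= u0 _ _; case: q => [[z w'] r] /=.
  move=> /andP[]; rewrite /closeb/= => /and4P[_ _ w01 xz].
  by rewrite /alive alive_born_dead//= => /andP[h1 h2].
rewrite (_ : xsection _ p = set0) ?measure0//; apply/seteqP; split => // q; rewrite xE.
move=> /andP[+ _]; rewrite /closeb => /and4P[xn /andP[u1 u2] _ _].
case: pw; apply/mem_set; move: xn u1 u2; case: p ep u0 mXp {xE} => [[[x u] b] l] _ _ _ /= xn u1 u2.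
by split; [exact: xn|rewrite (ltW u1) u2].
Qed.

(** [edge_count] is identified with a measurable variable only almost surely, so the comparison of
    integrals must not ask for its measurability. *)
Lemma mean_edge_count t : (0 <= t <= 1)%R ->
  \int[P]_w edge_count t w = \int[P]_w edges (alive t) w.
Proof.
move=> t01; apply: ae_integral_any.
- exact: (measurable_edges beta gamma gamma' Heta Heta' n (measurable_alive t)).
- move=> w; apply: esum_ge0 => p _; rewrite /deg /count_in /counting.
  by case: asboolP => _; rewrite ?lee_fin// leey.
- by move=> w; exact: edges_ge0.
- by apply: filterS edge_count_alive => w; apply.
Qed.

Definition mean_born t : \bar R := \int[muE]_p ((share p.1.1)%:E * (alpha t (p.1.2, p.2))%:E).
Definition mean_dead t : \bar R := \int[muE]_p ((share p.1.1)%:E * (delta t (p.1.2, p.2))%:E).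

Let mean_familyE t (F : R -> (R * R) * R -> bool) (g : R -> R * R -> R) : measurable_fun setT (F t) ->
  (forall p, section_length (F t) p = (g t p)%:E) ->
  \int[P]_w edges (F t) w = \int[muE]_p ((share p.1.1)%:E * (g t (p.1.2, p.2))%:E).
Proof.
move=> mF Fg; rewrite (@mean_edges R beta gamma gamma' beta0 gamma'01 _ _ _ _ _ Heta Heta' Hind n _ mF).
by apply: eq_integral => p _; rewrite Fg.
Qed.

Let mean_family_fin t (g : R -> R * R -> R) C : path_kernel g C -> (0 <= t <= 1)%R ->
  \int[muE]_p ((share p.1.1)%:E * (g t (p.1.2, p.2))%:E) \is a fin_num.
Proof.
move=> Hg t01.
have mH : measurable_fun setT (fun p : R * R => (g t p)%:E : \bar R) by apply/measurable_EFinP; exact: kg_meas Hg t.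
have H0 (p : R * R) : 0 <= (g t p)%:E by rewrite lee_fin (kg_ge0 Hg).
rewrite ge0_fin_numE; last by apply: integral_ge0 => p _; rewrite mule_ge0// lee_fin share_ge0.
apply: le_lt_trans (mean_share_time beta0 gamma01 gamma'01 n mH H0) _.
apply: mul_lty.
- by rewrite -(mean_share beta0 gamma01 gamma'01 n); apply: integral_ge0 => a _; rewrite lee_fin share_ge0.
- exact: theta_ge0.
- exact: ltry.
- exact: le_lt_trans (theta_kernel Hg t01) (ltry _).
Qed.

Lemma mean_edge_count_fine t : (0 <= t <= 1)%R ->
  fine (\int[P]_w edge_count t w) = (fine (mean_born t) - fine (mean_dead t))%R.
Proof.
move=> t01; rewrite (mean_edge_count t01).
have eb : \int[P]_w edges (born t) w = mean_born t by apply: mean_familyE; [exact: measurable_born|exact: born_length].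
have ed : \int[P]_w edges (dead t) w = mean_dead t by apply: mean_familyE; [exact: measurable_dead|exact: dead_length].
have fb : mean_born t \is a fin_num := mean_family_fin (@alpha_kernel R) t01.
have fd : mean_dead t \is a fin_num := mean_family_fin (@delta_kernel R) t01.
have E : \int[P]_w edges (born t) w = \int[P]_w edges (alive t) w + \int[P]_w edges (dead t) w.
  rewrite -ge0_integralD//.
  - by apply: eq_integral => w _; exact: edges_alive.
  - by move=> w _; exact: edges_ge0.
  - exact: (measurable_edges beta gamma gamma' Heta Heta' n (measurable_alive t)).
  - by move=> w _; exact: edges_ge0.
  - exact: (measurable_edges beta gamma gamma' Heta Heta' n (@measurable_dead R t)).
have a0 : 0 <= \int[P]_w edges (alive t) w by apply: integral_ge0 => w _; exact: edges_ge0.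
move: E; rewrite eb ed -(fineK fb) -(fineK fd).
by case: (\int[P]_w edges (alive t) w) a0 => [x||]//= _ [->]; rewrite addrK.
Qed.

Definition window_good w : Prop :=
  edges_good beta gamma gamma' eta eta' n (@born R) w /\ edges_good beta gamma gamma' eta eta' n (@dead R) w.

Lemma window_good_ae : {ae P, forall w, window_good w}.
Proof.
have hb := edges_good_ae beta0 gamma01 gamma'01 Heta Heta' Hind n (@measurable_born R) (@born_length R) (@alpha_kernel R).
have hd := edges_good_ae beta0 gamma01 gamma'01 Heta Heta' Hind n (@measurable_dead R) (@dead_length R) (@delta_kernel R).
by apply: filterS2 hb hd => w ? ?; split.
Qed.

Lemma edge_count_fine : {ae P, forall w, forall t, (0 <= t <= 1)%R ->
  fine (edge_count t w) = (fine (edges (born t) w) - fine (edges (dead t) w))%R}.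
Proof.
apply: filterS2 edge_count_alive window_good_ae => w E [gb gd] t t01; rewrite (E t t01).
have [_ t1] := andP t01.
have [fb _] := edges_good_le Heta' (@measurable_born R) (@born_mono R) gb t1.
have [fd _] := edges_good_le Heta' (@measurable_dead R) (@dead_mono R) gd t1.
have := edges_alive t w; rewrite -(fineK fb) -(fineK fd).
have := edges_ge0 beta gamma gamma' eta eta' n (alive t) w.
by case: (edges (alive t) w) => [x||]//= _ [->]; rewrite addrK.
Qed.

Let share_window p : (0 < n)%N -> window_dom n p ->
  (n%:R `^ (- gamma) * share p.1.1 = ctilde beta gamma' * pow_block gamma 0 n%:R (window_map n p).1.1)%R.
Proof.
move=> n0; case: p => [[[x u] b] l] [[[/= hx hu] _] _].
move: hx hu; rewrite /half_open/= !in_itv/= => hx /andP[u0 u1].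
have nn0 : (0 < n%:R :> R)%R by rewrite ltr0n.
rewrite /share /window_share/= hx u0 u1 /= mul1r /pow_block /window_map/=.
rewrite mulr_gt0//= ger_pMr// u1 powRM ?(ltW u0)// ?(ltW nn0)// /ctilde; ring.
Qed.

(** The origin of the normalisation: with [v = n u] one has [n^-gamma u^-gamma = v^-gamma], so the
    normalised share of a point becomes [c v^-gamma]. Negative lifetimes lie outside the domain of
    the map, hence the condition on [g]. *)
Lemma window_integral (m : {measure set (R * R * R * R) -> \bar R}) g C t : (0 < n)%N ->
  path_kernel g C -> (forall b l : R, (l < 0)%R -> g t (b, l) = 0%R) ->
  (n%:R `^ (- gamma))%:E * \int[m]_p ((share p.1.1)%:E * (g t (p.1.2, p.2))%:E) =
  (ctilde beta gamma')%:E *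
    \int[rimage (measurable_window_map n) (measurable_window_dom n) m]_p phi gamma 0 n%:R (g t) p.
Proof.
move=> n0 Hg gl.
have c0 : (0 <= ctilde beta gamma')%R.
  by rewrite /ctilde divr_ge0 ?mulr_ge0 ?(ltW beta0)// subr_ge0; case/andP: gamma'01 => ? ?; lra.
have mphi : measurable_fun setT (phi gamma 0 n%:R (g t)) by apply: measurable_phi; exact: kg_meas Hg _.
have phi0 p : 0 <= phi gamma 0 n%:R (g t) p by apply: phi_ge0; exact: kg_ge0 Hg _.
rewrite integral_rimage//.
have mw : measurable_fun (window_dom n) (fun p => phi gamma 0 n%:R (g t) (window_map n p)).
  by apply: measurable_funTS; apply: (measurableT_comp mphi); exact: measurable_window_map.
have ms : measurable_fun setT (fun p : R * R * R * R => (share p.1.1)%:E * (g t (p.1.2, p.2))%:E).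
  apply: emeasurable_funM; apply/measurable_EFinP.
    apply: (measurableT_comp (measurable_share _ _ _ _)).
    exact: (measurableT_comp measurable_fst measurable_fst).
  by apply: (measurableT_comp (kg_meas Hg t)); exact: measurable_pair12.
transitivity (\int[m]_p ((n%:R `^ (- gamma))%:E * ((share p.1.1)%:E * (g t (p.1.2, p.2))%:E))).
  apply/esym/ge0_integralZl; [exact: measurableT|exact: ms| |by rewrite lee_fin powR_ge0].
  by move=> p _; rewrite mule_ge0// lee_fin ?share_ge0// (kg_ge0 Hg).
transitivity (\int[m]_(p in window_dom n) ((ctilde beta gamma')%:E * phi gamma 0 n%:R (g t) (window_map n p))); last first.
  by apply: ge0_integralZl; [exact: measurable_window_dom|exact: mw|move=> p _; exact: phi0|rewrite lee_fin].
rewrite [RHS]integral_mkcond; apply: eq_integral => p _; rewrite patchE; case: ifPn => [/set_mem|/negP] hp.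
  by rewrite muleA -EFinM (share_window n0 hp) -!EFinM mulrA.
case: p hp => [[[x u] b] l] hp /=; rewrite /share /window_share/=.
case: (boolP ((0 <= x <= n%:R) && (0 < u <= 1))%R) => [/andP[hx hu]|_]; last first.
  by rewrite !mul0r mul0e mule0.
case: (ltP l 0%R) => hl; first by rewrite gl// !mule0.
exfalso; apply: hp; apply/mem_set; split; last by rewrite /nonneg/= in_itv/= hl.
by split => //; split => /=; rewrite /half_open/= in_itv.
Qed.

End edge_count_link.

Lemma fineZl (R : realType) (r : R) (a : \bar R) : 0 < r -> fine (r%:E * a) = r * fine a.
Proof.
by move=> r0; case: a => [a||] //=; [rewrite gt0_muley|rewrite gt0_muleNy]; rewrite ?lte_fin//= mulr0.
Qed.

(** Replaces a square root by a bound linear in [q], so that the mean of [q] controls the mean of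
    [|x|] up to the free parameter [e]. *)
Lemma le_invsqr (R : realType) (x q e : R) : 0 < e -> x ^+ 2 <= q -> `|x| <= e + q / e.
Proof.
move=> e0 xq; have [xe|xe] := leP `|x| e.
  by rewrite (le_trans xe)// lerDl divr_ge0 ?(ltW e0)// (le_trans (sqr_ge0 x)).
apply: (@le_trans _ _ (q / e)); last by rewrite lerDr ltW.
rewrite ler_pdivlMr//; apply: le_trans xq; rewrite -real_normK ?num_real// expr2.
by rewrite ler_wpM2l// ltW.
Qed.

Section mean_bounded.
Context d (W : measurableType d) (R : realType) (P : {measure set W -> \bar R}).
Local Open Scope ereal_scope.

Definition mean_bounded (f : W -> \bar R) (x : R) : Prop :=
  [/\ measurable_fun setT f, forall w, 0 <= f w & \int[P]_w f w <= x%:E].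

Lemma mean_boundedD f g x y : mean_bounded f x -> mean_bounded g y ->
  mean_bounded (fun w => f w + g w) (x + y)%R.
Proof.
move=> [mf f0 fx] [mg g0 gy]; split; first exact: emeasurable_funD.
  by move=> w; rewrite adde_ge0.
by rewrite ge0_integralD// EFinD leeD.
Qed.

Lemma mean_boundedZ f x a : (0 <= a)%R -> mean_bounded f x ->
  mean_bounded (fun w => a%:E * f w) (a * x)%R.
Proof.
move=> a0 [mf f0 fx]; split; first exact: measurable_funeM.
  by move=> w; rewrite mule_ge0// lee_fin.
by rewrite ge0_integralZl// EFinM lee_wpmul2l// lee_fin.
Qed.

Lemma mean_bounded_sum m (f : nat -> W -> \bar R) x : (forall j, mean_bounded (f j) x) ->
  mean_bounded (fun w => \sum_(j < m) f j w) (x *+ m)%R.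
Proof.
move=> H; elim: m => [|m IH].
  split; first by rewrite (_ : (fun w => _) = cst 0)//; apply/funext => w; rewrite big_ord0.
    by move=> w; rewrite big_ord0.
  by rewrite integral0_eq// => w _; rewrite big_ord0.
rewrite mulrSr (_ : (fun w => _) = fun w => \sum_(j < m) f j w + f m w).
  exact: mean_boundedD.
by apply/funext => w; rewrite big_ord_recr.
Qed.

End mean_bounded.

(** * Distance from the edge path to the compensated path *)

Section edge_process.
Context (R : realType) (beta gamma gamma' : R).
Hypotheses (beta0 : 0 < beta) (gm_bounds : 2^-1 < gamma < 1) (gamma'01 : 0 < gamma' < 4^-1).
Context d (W : measurableType d) (P : probability W R).
Variables (eta : W -> set (R * R * R * R)) (eta' : W -> set (R * R * R)).
Hypotheses (Heta : poisson_process P (@space_ST R) (@intensity_ST R) eta)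
  (Heta' : poisson_process P (@space_SR R) (@intensity_SR R) eta')
  (Hind : independent_pp P (@space_ST R) eta (@space_SR R) eta').
Variable n : nat.
Hypothesis n0 : (0 < n)%N.
Local Open Scope ereal_scope.

Let gamma01 : (0 < gamma < 1)%R.
Proof. by case/andP: gm_bounds => h ->; rewrite andbT (lt_trans _ h)// invr_gt0. Qed.

Local Notation M := (M_ST eta).
Local Notation M' := (M_SR eta').
Local Notation edges := (edges beta gamma gamma' eta eta' n).
Local Notation edge_means := (edge_means beta gamma gamma' eta n).
Local Notation edge_error := (edge_error beta gamma gamma' eta eta' n).
Local Notation window_good := (window_good beta gamma gamma' eta eta' n).
Local Notation c := (ctilde beta gamma').
Local Notation mun := (rate (measurable_half_open (n%:R : R))).
Local Notation N := (window_rm eta n).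
Local Notation na := ((n%:R : R) `^ (- gamma))%R.

Let HetaC' : poisson_process P (@space_SR R) (intensity_SRC R) eta'.
Proof. by apply: poisson_process_eq Heta' => A mA; exact: intensity_SRE. Qed.

Let na0 : (0 < na)%R. Proof. by rewrite powR_gt0// ltr0n. Qed.

Lemma ctilde_gt0 : (0 < c)%R.
Proof. by rewrite /ctilde divr_gt0 ?mulr_gt0// subr_gt0; case/andP: gamma'01 => ? ?; lra. Qed.

(** For each point the sections decrease to the section at [t] as time decreases to [t]; continuity
    from above, then dominated convergence over the points, give right continuity. Left limits come
    from monotonicity. *)
Let family_cadlag (F : R -> (R * R) * R -> bool) w : (forall t, measurable_fun setT (F t)) ->
  (forall s t a, (s <= t)%R -> F s a -> F t a) ->
  (forall t a, (0 <= t < 1)%R -> (forall k : nat, F (t + (1 - t) * k.+1%:R^-1)%R a) -> F t a) ->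
  edges (F 1%R) w < +oo -> cadlag01 (fun t => fine (edges (F t) w)).
Proof.
move=> mF Fmono Frc.
have HPR : poisson_rm P (sigma_finite_restr (intensity_SRC R) (@measurable_space_SR R)) M'.
  exact: (poisson_rm_eq _ (pp_poisson_rm HetaC' (@measurable_space_SR R)
    (@measurable_cover_SR R) (@cover_SR_nd R) (@cover_SRT R) (@cover_SR_fin R))).
pose f t p := M' w (xsection (joined beta gamma gamma' n (F t)) p).
have mX t := measurable_joined beta gamma gamma' n (mF t).
have mXp t p : measurable (xsection (joined beta gamma gamma' n (F t)) p) by exact: measurable_xsection.
have fE t : edges (F t) w = \int[M w]_p f t p by rewrite edgesE.
have mf t : measurable_fun setT (f t).
  have mrm := measurable_xsection_rm HPR (mX t).
  exact: (measurable_comp measurableT (subsetT _) mrm (measurable_pair1 _)).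
have sub s t p : (s <= t)%R -> xsection (joined beta gamma gamma' n (F s)) p `<=`
    xsection (joined beta gamma gamma' n (F t)) p.
  move=> st q; rewrite /xsection/= !inE/= => /andP[h1 h]; apply/andP; split; [exact: h1|exact: Fmono h].
rewrite fE => foo; rewrite (_ : (fun t => _) = fun t => fine (\int[M w]_p f t p)); last first.
  by apply/funext => t; rewrite fE.
have fmono s t p : (s <= t)%R -> f s p <= f t p.
  by move=> st; apply: le_measure; rewrite ?inE//; exact: sub.
apply: integral_cadlag => // t t01; case/andP: (t01) => t0 t1.
have ffin : {ae M w, forall p, f 1%R p \is a fin_num}.
  have : (M w).-integrable setT (f 1%R).
    apply/integrableP; split => //; apply: le_lt_trans foo; rewrite le_eqVlt; apply/orP; left; apply/eqP.
    by apply: eq_integral => p _; rewrite gee0_abs//; exact: measure_ge0.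
  by move=> /(integrable_ae measurableT); apply: filterS => p /(_ I).
apply: filterS ffin => p fp.
pose u k := (t + (1 - t) * k.+1%:R^-1 : R)%R.
have u1 k : (u k <= 1)%R.
  rewrite /u -lerBrDl ler_piMr ?subr_ge0 ?(ltW t1)// invf_le1 ?ltr0n// ler1n//.
have umono k k' : (k <= k')%N -> (u k' <= u k)%R.
  move=> kk; rewrite lerD2l ler_wpM2l ?subr_ge0 ?(ltW t1)// lef_pV2 ?posrE// ler_nat ltnS//.
have -> : f t p = M' w (\bigcap_k xsection (joined beta gamma gamma' n (F (u k))) p).
  congr (M' w _); apply/seteqP; split => q.
    move=> h k _; apply: sub h; rewrite /u lerDl mulr_ge0 ?subr_ge0 ?(ltW t1)//.
  move=> h; have h0 := h 0%N I; move: h0; rewrite /xsection/= !inE/= => /andP[h1 _].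
  apply/andP; split; first exact: h1.
  apply: Frc t01 _ => k; have := h k I; rewrite /xsection/= inE/= => /andP[_ h']; exact: h'.
apply: (@nonincreasing_cvg_mu _ _ _ (M' w) (fun k => xsection (joined beta gamma gamma' n (F (u k))) p)).
- apply: (@le_lt_trans _ _ (f 1%R p)); first exact: fmono (u1 0%N).
  by rewrite ltey_eq fp.
- by move=> k; exact: mXp.
- by apply: bigcapT_measurable => k; exact: mXp.
- by move=> k k' kk; apply/subsetPset; apply: sub; exact: umono.
Qed.

Let limit_le (x t : R) : (forall k : nat, x <= t + (1 - t) * k.+1%:R^-1)%R -> (x <= t)%R.
Proof.
move=> h; apply/ler_addgt0Pr => e e0.
have d0 : (0 < e / (`|1 - t| + 1))%R by rewrite divr_gt0// ltr_pwDr.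
have [k _ hk] := near_infty_natSinv_lt (PosNum d0); have /= := hk k (leqnn _).
rewrite ltr_pdivlMr ?ltr_pwDr// => hk'; apply: le_trans (h k) _; rewrite lerD2l.
apply: le_trans (ltW hk'); rewrite mulrC ler_wpM2l ?invr_ge0//.
by rewrite (le_trans (ler_norm _))// lerDl.
Qed.

(** The subtracted constant is the mean of the normalised edge count, expressed in the coordinates
    of the rescaled window. *)
Definition edge_path (w : W) (t : R) : R :=
  (na * (fine (edges (born t) w) - fine (edges (dead t) w)) -
   c * (fine (\int[mun]_p phi gamma 0 n%:R (alpha t) p) - fine (\int[mun]_p phi gamma 0 n%:R (delta t) p)))%R.

Hypotheses (Foo : \int[mun]_p phi gamma 0 n%:R (alpha 1%R) p < +oo)
  (Doo : \int[mun]_p phi gamma 0 n%:R (delta 1%R) p < +oo).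

Lemma edge_path_cadlag w : window_good w -> cadlag01 (edge_path w).
Proof.
move=> [[gb _] [gd _]]; apply: cadlag01B; apply: cadlag01Z; apply: cadlag01B.
- apply: family_cadlag; [exact: measurable_born|exact: born_mono| |by rewrite ltey_eq gb].
  move=> t a t01 h; have /and4P[h1 h2 h3 h4] := h 0%N; apply/and4P; split => //.
  by apply: limit_le => k; have /and4P[] := h k.
- apply: family_cadlag; [exact: measurable_dead|exact: dead_mono| |by rewrite ltey_eq gd].
  move=> t a t01 h; have /and4P[h1 h2 h3 h4] := h 0%N; apply/and4P; split => //.
  by apply: limit_le => k; have /and4P[] := h k.
- exact: (cadlag_phi (@alpha_kernel R) Foo).
- exact: (cadlag_phi (@delta_kernel R) Doo).
Qed.

Let neg_alpha t (b l : R) : (l < 0)%R -> alpha t (b, l) = 0%R.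
Proof. by move=> l0; case: alphaP => *; lra. Qed.

Let neg_delta t (b l : R) : (l < 0)%R -> delta t (b, l) = 0%R.
Proof.
by move=> l0; rewrite /delta/=; case: ifP => // _; apply/max_idPl; exact: ltW.
Qed.

Let mun_window g C t (Hg : @path_kernel R g C) : \int[mun]_p phi gamma 0 n%:R (g t) p =
  \int[rimage (measurable_window_map n) (measurable_window_dom n)
     (sigma_finite_restr (intensity_STC R) (@measurable_space_ST R))]_p phi gamma 0 n%:R (g t) p.
Proof. by apply: eq_measure_integral => A mA _; exact: window_rate. Qed.

Lemma mean_born_window t : (na * fine (mean_born beta gamma gamma' n t))%R =
  (c * fine (\int[mun]_p phi gamma 0 n%:R (alpha t) p))%R.
Proof.
rewrite -!fineZl ?ctilde_gt0//; congr fine; apply: etrans (congr1 (fun z => c%:E * z) (esym (mun_window t (@alpha_kernel R)))).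
by apply: (@window_integral R beta gamma gamma' beta0 gamma'01 n _ (@alpha R) _ t n0 (@alpha_kernel R)) => b l; exact: neg_alpha.
Qed.

Lemma mean_dead_window t : (na * fine (mean_dead beta gamma gamma' n t))%R =
  (c * fine (\int[mun]_p phi gamma 0 n%:R (delta t) p))%R.
Proof.
rewrite -!fineZl ?ctilde_gt0//; congr fine; apply: etrans (congr1 (fun z => c%:E * z) (esym (mun_window t (@delta_kernel R)))).
by apply: (@window_integral R beta gamma gamma' beta0 gamma'01 n _ (@delta R) _ t n0 (@delta_kernel R)) => b l; exact: neg_delta.
Qed.

Lemma edge_count_bar_path : {ae P, forall w, forall t, (0 <= t <= 1)%R ->
  edge_count_bar beta gamma gamma' P eta eta' n t w = edge_path w t}.
Proof.
apply: filterS (edge_count_fine beta0 gamma01 gamma'01 Heta Heta' Hind n) => w E t t01.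
rewrite /edge_count_bar E//.
rewrite (mean_edge_count_fine beta0 gamma01 gamma'01 Heta Heta' Hind n t01).
by rewrite /edge_path (mulrBr c) -mean_born_window -mean_dead_window; ring.
Qed.

(** The conditional means given [eta] become, after normalisation, exactly the integrals of the
    compensated path, so only the edge errors remain. *)
Lemma edge_path_error w t :
  (edge_path w t - centred_path c gamma mun N n%:R w t = na * (edge_error (born t) w - edge_error (dead t) w))%R.
Proof.
have eA : (na * fine (edge_means (born t) w) = c * fine (\int[N w]_p phi gamma 0 n%:R (alpha t) p))%R.
  rewrite -!fineZl ?ctilde_gt0//; congr fine.
  rewrite (@edge_meansE R beta gamma gamma' beta0 gamma'01 _ _ eta n _ w (@measurable_born R t)).
  rewrite -(@window_integral R beta gamma gamma' beta0 gamma'01 n _ (@alpha R) _ t n0 (@alpha_kernel R)); last by move=> b l; exact: neg_alpha.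
  by congr (_ * _); apply: eq_integral => p _; rewrite born_length.
have eD : (na * fine (edge_means (dead t) w) = c * fine (\int[N w]_p phi gamma 0 n%:R (delta t) p))%R.
  rewrite -!fineZl ?ctilde_gt0//; congr fine.
  rewrite (@edge_meansE R beta gamma gamma' beta0 gamma'01 _ _ eta n _ w (@measurable_dead R t)).
  rewrite -(@window_integral R beta gamma gamma' beta0 gamma'01 n _ (@delta R) _ t n0 (@delta_kernel R)); last by move=> b l; exact: neg_delta.
  by congr (_ * _); apply: eq_integral => p _; rewrite dead_length.
rewrite !edge_errorE /edge_path /centred_path.
move: eA eD; set a1 := fine (edge_means (born t) w); set a2 := fine (edge_means (dead t) w).
set b1 := fine (\int[N w]_p phi _ _ _ (alpha t) p); set b2 := fine (\int[N w]_p phi _ _ _ (delta t) p).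
move: (fine (edges (born t) w)) (fine (edges (dead t) w)) (fine (\int[mun]_p phi _ _ _ (alpha t) p)).
move: (fine (\int[mun]_p phi _ _ _ (delta t) p)) => z1 z2 z3 z4 eA eD.
rewrite (_ : na * (z2 - a1 - (z3 - a2)) = na * (z2 - z3) - na * a1 + na * a2)%R; last by ring.
by rewrite eA eD; ring.
Qed.

Definition edge_sk (w : W) : skorokhod R :=
  if `[< window_good w >] then to_skorokhod (edge_path w) else point.

Lemma edge_skE w t : window_good w -> (0 <= t <= 1)%R -> edge_sk w t = edge_path w t.
Proof.
by move=> gw t01; rewrite /edge_sk asboolT// to_skorokhodE//; exact: edge_path_cadlag.
Qed.

Let measurable_window_good : measurable ([set w | window_good w] : set W).
Proof.
have mfin (f : W -> \bar R) : measurable_fun setT f -> (forall w, 0 <= f w) ->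
    measurable [set w | f w \is a fin_num].
  move=> mf f0; rewrite [X in measurable X](_ : _ = [set w | f w < +oo]).
    by rewrite -[X in measurable X]setTI; exact: emeasurable_fun_infty_o.
  by apply/seteqP; split => w /=; rewrite ge0_fin_numE.
rewrite [X in measurable X](_ : _ =
  ([set w | edges (born 1%R) w \is a fin_num] `&` [set w | edge_means (born 1%R) w \is a fin_num]) `&`
  ([set w | edges (dead 1%R) w \is a fin_num] `&` [set w | edge_means (dead 1%R) w \is a fin_num]))//.
apply: measurableI; apply: measurableI; apply: mfin.
- exact: (measurable_edges beta gamma gamma' Heta Heta' n (@measurable_born R _)).
- by move=> w; exact: edges_ge0.
- exact: (measurable_edge_means beta gamma gamma' Heta n (@measurable_born R _)).
- by move=> w; exact: edge_means_ge0.
- exact: (measurable_edges beta gamma gamma' Heta Heta' n (@measurable_dead R _)).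
- by move=> w; exact: edges_ge0.
- exact: (measurable_edge_means beta gamma gamma' Heta n (@measurable_dead R _)).
- by move=> w; exact: edge_means_ge0.
Qed.

Lemma measurable_edge_sk : borel_measurable edge_sk.
Proof.
apply: skorokhod_measurable => t t01.
rewrite (_ : (fun w => _) = fun w => if w \in [set w | window_good w] then edge_path w t else 0%R); last first.
  apply/funext => w; case: ifPn => [/set_mem gw|/negP gw]; first exact: edge_skE.
  by rewrite /edge_sk asboolF// => h; apply: gw; exact/mem_set.
apply: measurable_fun_ifT => //.
  apply: (@measurable_fun_bool _ _ _ _ true); rewrite setTI.
  rewrite [X in measurable X](_ : _ = [set w | window_good w]); first exact: measurable_window_good.
  by apply/seteqP; split => w /= h; [exact: set_mem h|exact/mem_set].
apply: measurable_funB => //; apply: measurable_funM => //; apply: measurable_funB;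
  apply: (measurableT_comp (fine_measurable measurableT)).
- exact: (measurable_edges beta gamma gamma' Heta Heta' n (@measurable_born R _)).
- exact: (measurable_edges beta gamma gamma' Heta Heta' n (@measurable_dead R _)).
Qed.

Lemma edge_sk_random_element :
  random_element_of P (edge_count_bar beta gamma gamma' P eta eta' n) edge_sk.
Proof.
split; first exact: measurable_edge_sk.
apply: filterS2 edge_count_bar_path (window_good_ae beta0 gamma01 gamma'01 Heta Heta' Hind n) => w E gw t t01.
by rewrite E// edge_skE.
Qed.

(** The terms with [e] bound the born and dead errors at grid points through [le_invsqr]. Between
    grid points the born edges cost the growth of their conditional mean over one cell,
    [load / 2^K], and the dead edges cost nothing when no cell is crowded. *)
Lemma edge_sk_close K (e : R) w : (0 < e)%R -> window_good w -> path_good gamma N n%:R w ->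
  (forall j, (j < 2 ^ K)%N -> ~ crowded eta n K j w) ->
  load beta gamma gamma' eta n w \is a fin_num ->
  (skorokhod_dist (edge_sk w) (path_sk c gamma mun N n%:R w) <=
  na * (2 * e + (grid_sqr beta gamma gamma' eta eta' n (@born R) K w +
    grid_sqr beta gamma gamma' eta eta' n (@dead R) K w) / e +
    fine (load beta gamma gamma' eta n w) / 2 ^+ K))%R.
Proof.
move=> e0 gw pw nc lfin; have K0 : (0 < 2 ^+ K :> R)%R by rewrite exprn_gt0.
apply: skorokhod_dist_le => t t01; have /andP[t0 t1] := t01.
rewrite edge_skE// (path_skE c Foo Doo pw t01) edge_path_error normrM (gtr0_norm na0).
apply: ler_wpM2l; first exact: ltW.
apply: le_trans (ler_normB _ _) _.
have [gb gd] := gw.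
have grid F i : (i <= 2 ^ K)%N -> (`|edge_error (F (grid_point R K i)) w| <=
    e + grid_sqr beta gamma gamma' eta eta' n F K w / e)%R.
  move=> iK; apply: le_invsqr => //.
  exact: (grid_error_sqr beta gamma gamma' eta eta' n F w iK).
have [i iK ->] := edge_error_grid beta gamma gamma' Heta Heta' t01 nc.
have := grid (@dead R) i iK.
have z01 : (0 <= t * 2 ^+ K <= (2 ^ K)%N%:R)%R.
  by rewrite natrX mulr_ge0 ?(ltW K0)//= ler_piMl// ltW.
have [j1 [j2 [j12 j21 j2K h1 h2]]] := grid_bounds z01.
have s1 : (grid_point R K j1 <= t)%R by rewrite /grid_point ler_pdivrMr.
have s2 : (t <= grid_point R K j2)%R by rewrite /grid_point ler_pdivlMr.
have s3 : (grid_point R K j2 <= 1)%R by rewrite /grid_point ler_pdivrMr// mul1r -natrX ler_nat.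
have := edge_error_sandwich Heta' (@measurable_born R) (@born_mono R) gb s1 s2 s3
  (grid (@born R) j1 (leq_trans j12 j2K)) (grid (@born R) j2 j2K).
have := edge_means_born_inc beta0 gamma'01 Heta' (le_trans s1 s2) s3 gb lfin.
have lf0 : (0 <= fine (load beta gamma gamma' eta n w))%R.
  by apply: fine_ge0; apply: load_ge0.
have hd : ((grid_point R K j2 - grid_point R K j1) * fine (load beta gamma gamma' eta n w) <=
    fine (load beta gamma gamma' eta n w) / 2 ^+ K)%R.
  rewrite mulrC ler_wpM2l// /grid_point -mulrBl -[leRHS]mul1r ler_wpM2r ?invr_ge0 ?(ltW K0)//.
  by rewrite lerBlDr addrC natr1 ler_nat.
move: hd; rewrite (mulrDl (grid_sqr beta gamma gamma' eta eta' n (@born R) K w)).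
move: (fine (load _ _ _ _ _ _) / _)%R ((grid_point R K j2 - _) * _)%R => v1 v2.
move: (fine (edge_means (born (grid_point R K j2)) w) - _)%R (grid_sqr _ _ _ _ _ _ (@born R) _ _ / e)%R => v3 v4.
move: (grid_sqr _ _ _ _ _ _ (@dead R) _ _ / e)%R (`|edge_error (born t) w|)%R => v5 v6.
move: (`|edge_error (dead _) w|)%R => v7 *; lra.
Qed.

Section mean_difference.
Variables (h : skorokhod R -> R) (M0 Kh : R).
Hypotheses (hM : forall f, (`|h f| <= M0)%R) (Kh0 : (0 <= Kh)%R)
  (hK : forall f g, (`|h f - h g| <= Kh * skorokhod_dist f g)%R).
Variables (K : nat) (e : R).
Hypothesis e0 : (0 < e)%R.

Let M00 : (0 <= M0)%R. Proof. exact: le_trans (normr_ge0 _) (hM point). Qed.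

Local Notation gA := (grid_sqr beta gamma gamma' eta eta' n (@born R) K).
Local Notation gD := (grid_sqr beta gamma gamma' eta eta' n (@dead R) K).
Local Notation ld := (load beta gamma gamma' eta n).

(** The last sum replaces the distance bound on crowded outcomes, where two values of [h] differ by
    at most [2 * M0]. *)
Let bound w : \bar R :=
  (Kh * na * (2 * e))%:E + (Kh * na / e)%:E * (gA w)%:E + (Kh * na / e)%:E * (gD w)%:E +
  (Kh * na / 2 ^+ K)%:E * ld w + \sum_(j < (2 ^ K)%N) (2 * M0)%:E * (\1_(crowded eta n K j) w)%:E.

Let kna0 : (0 <= Kh * na)%R. Proof. by rewrite mulr_ge0// ltW. Qed.

Let ms f : (forall g : skorokhod R -> R, continuous g -> measurable_fun setT (g \o f)) ->
  measurable_fun setT (fun w : W => h (f w)).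
Proof. by apply; exact: lipschitz_continuous hK. Qed.

Lemma bound_ae : {ae P, forall w,
  (`|h (edge_sk w) - h (path_sk c gamma mun N n%:R w)|)%:E <= bound w}.
Proof.
have HN : poisson_rm P mun N by exact: window_rm_poisson.
have h1 := path_good_ae HN Foo Doo.
have h2 := window_good_ae beta0 gamma01 gamma'01 Heta Heta' Hind n.
have mld := @measurable_load R beta gamma gamma' beta0 gamma'01 _ _ _ _ Heta n.
have h3 : {ae P, forall w, ld w \is a fin_num}.
  have : P.-integrable setT ld.
    apply/integrableP; split => //.
    apply: (@le_lt_trans _ _ (\int[P]_w ld w)); last first.
      exact: le_lt_trans (mean_load beta0 gamma01 gamma'01 Heta n) (ltry _).
    rewrite le_eqVlt; apply/orP; left; apply/eqP; apply: eq_integral => w _.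
    by rewrite gee0_abs//; exact: load_ge0.
  by move=> /(integrable_ae measurableT); apply: filterS => p /(_ I).
apply: filterS3 h1 h2 h3 => w pw gw lfin.
have pos1 : 0 <= (Kh * na * (2 * e))%:E + (Kh * na / e)%:E * (gA w)%:E + (Kh * na / e)%:E * (gD w)%:E +
  (Kh * na / 2 ^+ K)%:E * ld w.
  have k1 : (0 <= Kh * na / e)%R by rewrite divr_ge0 ?(ltW e0).
  have k2 : (0 <= Kh * na / 2 ^+ K)%R by rewrite divr_ge0 ?exprn_ge0.
  apply: adde_ge0; [apply: adde_ge0; [apply: adde_ge0|]|].
  - by rewrite lee_fin mulr_ge0// mulr_ge0// ltW.
  - by rewrite -EFinM lee_fin mulr_ge0// grid_sqr_ge0.
  - by rewrite -EFinM lee_fin mulr_ge0// grid_sqr_ge0.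
  - by apply: mule_ge0; [rewrite lee_fin|exact: load_ge0].
have [[j [jK cj]]|nc] := pselect (exists j, (j < 2 ^ K)%N /\ crowded eta n K j w).
  apply: (@le_trans _ _ (2 * M0)%:E).
    rewrite lee_fin; apply: le_trans (ler_normB _ _) _.
    by have := hM (edge_sk w); have := hM (path_sk c gamma mun N n%:R w); lra.
  apply: (@le_trans _ _ (\sum_(j < (2 ^ K)%N) (2 * M0)%:E * (\1_(crowded eta n K j) w)%:E)); last first.
    by rewrite /bound leeDr.
  rewrite (bigD1 (Ordinal jK))//= indicE mem_set// mule1 leeDl// sume_ge0// => i _.
  by rewrite mule_ge0// lee_fin ?mulr_ge0.
have nc' j : (j < 2 ^ K)%N -> ~ crowded eta n K j w by move=> jK cj; apply: nc; exists j.
have H := edge_sk_close e0 gw pw nc' lfin.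
apply: (@le_trans _ _ (Kh * skorokhod_dist (edge_sk w) (path_sk c gamma mun N n%:R w))%:E).
  by rewrite lee_fin.
apply: (@le_trans _ _ ((Kh * na * (2 * e))%:E + (Kh * na / e)%:E * (gA w)%:E + (Kh * na / e)%:E * (gD w)%:E +
  (Kh * na / 2 ^+ K)%:E * ld w)); last first.
  rewrite /bound leeDl// sume_ge0// => i _.
  by rewrite mule_ge0// lee_fin ?mulr_ge0.
rewrite -(fineK lfin) -!EFinM -!EFinD lee_fin.
apply: le_trans (ler_wpM2l Kh0 H) _.
rewrite le_eqVlt; apply/orP; left; apply/eqP.
move: (gA w) (gD w) (fine (ld w)) => v1 v2 v3; ring.
Qed.

(** Bounds the mean of [bound], term by term; the last term is the union bound over the [2^K]
    cells. *)
Definition error_bound : R :=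
  Kh * na * (2 * e) +
  (Kh * na / e) * (4 * K.+1%:R ^+ 2 * (edge_const beta gamma gamma' * expo_bound R) * n%:R) +
  (Kh * na / e) * (4 * K.+1%:R ^+ 2 * (edge_const beta gamma gamma' * expo_bound R) * n%:R) +
  (Kh * na / 2 ^+ K) * (2 * beta / (1 - gamma) / (1 - gamma') * n%:R * expo_bound R) +
  (2 * M0 * (n%:R / 2 ^+ K) ^+ 2) *+ (2 ^ K).

Lemma mean_bound : mean_bounded P bound error_bound.
Proof.
have kd : (0 <= Kh * na / e)%R by rewrite divr_ge0 ?(ltW e0).
have K0 : (0 < 2 ^+ K :> R)%R by rewrite exprn_gt0.
apply: mean_boundedD.
  apply: mean_boundedD; last first.
    apply: mean_boundedZ; first by rewrite divr_ge0 ?(ltW K0).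
    split; first exact: (@measurable_load R beta gamma gamma' beta0 gamma'01 _ _ _ _ Heta n).
      by move=> w; exact: load_ge0.
    exact: (mean_load beta0 gamma01 gamma'01 Heta n).
  apply: mean_boundedD.
    apply: mean_boundedD.
      split => //; first by move=> w; rewrite lee_fin mulr_ge0// mulr_ge0// ltW.
      apply: (@le_trans _ _ ((Kh * na * (2 * e))%:E * P setT)); first by rewrite -integral_cst.
      by rewrite probability_setT mule1.
    apply: mean_boundedZ => //; split.
    - apply/measurable_EFinP.
      exact: (measurable_grid_sqr beta gamma gamma' Heta Heta' n (@measurable_born R) K).
    - by move=> w; rewrite lee_fin grid_sqr_ge0.
    exact: (mean_grid_sqr beta0 gamma01 gamma'01 Heta Heta' Hind n (@measurable_born R)
      (@born_mono R) (@born_life R) (@born_length R) (@alpha_kernel R) K).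
  apply: mean_boundedZ => //; split.
  - apply/measurable_EFinP.
    exact: (measurable_grid_sqr beta gamma gamma' Heta Heta' n (@measurable_dead R) K).
  - by move=> w; rewrite lee_fin grid_sqr_ge0.
  exact: (mean_grid_sqr beta0 gamma01 gamma'01 Heta Heta' Hind n (@measurable_dead R)
    (@dead_mono R) (@dead_life R) (@dead_length R) (@delta_kernel R) K).
apply: (@mean_bounded_sum _ _ _ P (2 ^ K)%N (fun j w => (2 * M0)%:E * (\1_(crowded eta n K j) w)%:E)) => j; apply: mean_boundedZ; first by rewrite mulr_ge0.
have mc := measurable_crowded Heta n K j.
split.
- by apply/measurable_EFinP; exact: measurable_indic.
- by move=> w; rewrite lee_fin.
rewrite integral_indic//; apply: (@le_trans _ _ (P (crowded eta n K j))); first by rewrite setIT.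
exact: (crowded_small Heta n K j).
Qed.

Lemma mean_difference :
  (`|mean P (fun w => h (edge_sk w)) - mean P (fun w => h (path_sk c gamma mun N n%:R w))| <= error_bound)%R.
Proof.
have HN : poisson_rm P mun N by exact: window_rm_poisson.
have ch : continuous h by exact: lipschitz_continuous hK.
have m1 : measurable_fun setT (fun w => h (edge_sk w)) := measurable_comp_continuous measurable_edge_sk ch.
have m2 : measurable_fun setT (fun w => h (path_sk c gamma mun N n%:R w)) :=
  measurable_comp_continuous (measurable_path_sk c HN Foo Doo) ch.
have i1 := bounded_integrable P m1 (fun w => hM _).
have i2 := bounded_integrable P m2 (fun w => hM _).
rewrite /mean -RintegralB//.
have m12 : measurable_fun setT (fun w => h (edge_sk w) - h (path_sk c gamma mun N n%:R w))%R.
  exact: measurable_funB.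
have b12 w : (`|h (edge_sk w) - h (path_sk c gamma mun N n%:R w)| <= 2 * M0)%R.
  apply: le_trans (ler_normB _ _) _.
  by have := hM (edge_sk w); have := hM (path_sk c gamma mun N n%:R w); lra.
apply: le_trans (le_normr_Rintegral measurableT (bounded_integrable P m12 b12)) _.
have [mb b0 bb] := mean_bound.
rewrite /Rintegral -lee_fin fineK; last first.
  rewrite ge0_fin_numE; last by apply: integral_ge0.
  apply: (@le_lt_trans _ _ (\int[P]_w (2 * M0)%:E)).
    apply: ge0_le_integral => //.
    - by apply/measurable_EFinP; exact: measurableT_comp.
    - by move=> w _; rewrite lee_fin.
  apply: (@le_lt_trans _ _ ((2 * M0)%:E * P setT)); first by rewrite -integral_cst.
  by rewrite probability_setT mule1 ltry.
apply: le_trans bb; apply: ae_ge0_le_integral => //.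
- by apply/measurable_EFinP; exact: measurableT_comp.
by apply: filterS bound_ae => w H _.
Qed.

End mean_difference.

End edge_process.

(** * Choice of the mesh and of the tolerance *)

Section error_bound_cvg.
Context (R : realType) (beta gamma gamma' : R).
Hypotheses (beta0 : 0 < beta) (gm_bounds : 2^-1 < gamma < 1) (gamma'01 : 0 < gamma' < 4^-1).
Variables (M0 Kh : R).
Hypotheses (M00 : 0 <= M0) (Kh0 : 0 <= Kh).

Let gamma01 : 0 < gamma < 1.
Proof. by case/andP: gm_bounds => h ->; rewrite andbT (lt_trans _ h)// invr_gt0. Qed.

(** The exponent [K] is logarithmic in [n], while [2^K >= n^3]. *)
Definition mesh (n : nat) : nat := (3 * (trunc_log 2 n).+1)%N.

Lemma mesh_ge n : (0 < n)%N -> (n ^ 3 <= 2 ^ mesh n)%N.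
Proof.
move=> n0; by rewrite /mesh mulnC expnM leq_exp2r//; apply/ltnW/trunc_log_ltn.
Qed.

Let rho : R := 2 `^ (1 - 2 * gamma).

Let rho01 : 0 < rho < 1.
Proof.
have /andP[h1 h2] := gm_bounds.
rewrite powR_gt0//= /rho (_ : 1 - 2 * gamma = - (2 * gamma - 1)); last by ring.
rewrite powRN invf_lt1 ?powR_gt0//; apply: (@le_lt_trans _ _ (1 `^ (2 * gamma - 1))); first by rewrite powR1.
by apply: gt0_ltr_powR; rewrite ?nnegrE ?ltr1n//; lra.
Qed.

(** With [m] the binary logarithm of [n], [(mesh n + 1)^2] is at most [16 (m+1)^2] and
    [n^(1 - 2 gamma)] is at most [rho^m]: a polynomial against a geometric sequence. *)
Lemma mesh_cvg (A e : R) : 0 < e -> exists n1, forall n, (n1 <= n)%N ->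
  A * ((mesh n).+1%:R ^+ 2 * n%:R `^ (1 - 2 * gamma)) <= e.
Proof.
move=> e0; have [C [C0 HC]] := poly_geometric rho01.
have A0 : 0 < `|A| + 1 by rewrite ltr_pwDr.
pose D := (`|A| + 1) * 16 * C.
have D0 : 0 <= D by rewrite !mulr_ge0// ltW.
pose m1 := Num.truncn (D / e); exists (2 ^ m1.+1)%N => n n1.
have npos : (0 < n)%N by rewrite (leq_trans _ n1)// expn_gt0.
set m := trunc_log 2 n.
have mm : (m1 < m)%N by rewrite /m trunc_log_max.
have m0 : 0 < m.+1%:R :> R by rewrite ltr0n.
have K16 : (mesh n).+1%:R ^+ 2 <= 16 * m.+1%:R ^+ 2 :> R.
  have hm : ((mesh n).+1 <= 4 * m.+1)%N.
    by rewrite /mesh -/m -[4%N]/(3 + 1)%N mulnDl mul1n -addn1 leq_add2l.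
  apply: (@le_trans _ _ ((4 * m.+1%:R) ^+ 2)).
    by rewrite lerXn2r ?nnegrE// ?mulr_ge0// -natrM ler_nat.
  by rewrite le_eqVlt; apply/orP; left; apply/eqP; ring.
have np : n%:R `^ (1 - 2 * gamma) <= rho ^+ m.
  have /andP[h1 _] := gm_bounds.
  have -> : rho ^+ m = (2 ^+ m) `^ (1 - 2 * gamma).
    have e1 : rho `^ m%:R = rho ^+ m by rewrite powR_mulrn// powR_ge0.
    have e2 : 2 `^ m%:R = 2 ^+ m :> R by rewrite powR_mulrn.
    by rewrite -e1 -e2 /rho -!powRrM mulrC.
  have -> : 1 - 2 * gamma = - (2 * gamma - 1) by ring.
  have p0 : 0 < 2 ^+ m :> R by rewrite exprn_gt0.
  have pn : 2 ^+ m <= n%:R :> R by rewrite -natrX ler_nat trunc_logP.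
  rewrite !powRN lef_pV2 ?posrE ?powR_gt0 ?ltr0n//.
  by apply: ge0_ler_powR; rewrite ?nnegrE ?(ltW p0)//; lra.
apply: (@le_trans _ _ ((`|A| + 1) * (16 * m.+1%:R ^+ 2 * rho ^+ m))).
  apply: (@le_trans _ _ ((`|A| + 1) * ((mesh n).+1%:R ^+ 2 * n%:R `^ (1 - 2 * gamma)))).
    apply: ler_wpM2r; first by apply: mulr_ge0; rewrite ?powR_ge0// exprn_ge0.
    by rewrite (le_trans (ler_norm _))// lerDl.
  apply: ler_wpM2l; first exact: ltW.
  by apply: ler_pM.
(* The fourth power in [poly_geometric] exceeds the square needed here; one of the spare powers
   supplies the decay [1/(m+1)]. *)
apply: (@le_trans _ _ (D / m.+1%:R)).
  rewrite ler_pdivlMr// /D -!mulrA ler_wpM2l ?(ltW A0)// ler_wpM2l//.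
  rewrite (_ : _ * _ = m.+1%:R ^+ 3 * rho ^+ m); last by ring.
  apply: le_trans (HC m); apply: ler_wpM2r; first by rewrite exprn_ge0//; case/andP: rho01 => /ltW.
  by apply: ler_weXn2l; rewrite ?ler1n.
rewrite ler_pdivrMr// mulrC -ler_pdivrMr//; apply: le_trans (ltW (truncnS_gt _)) _.
by rewrite ler_nat -/m1 (leq_trans mm).
Qed.

Let inv_cvg (A e : R) : 0 < e -> exists n1, forall n, (n1 <= n)%N -> A / n%:R <= e.
Proof.
move=> e0; exists (Num.truncn (`|A| / e)).+1 => n n1.
have n0 : 0 < n%:R :> R by rewrite ltr0n (leq_trans _ n1).
rewrite ler_pdivrMr// mulrC -ler_pdivrMr//; apply: le_trans (_ : _ <= `|A| / e) _.
  by rewrite ler_wpM2r ?invr_ge0 ?(ltW e0)// ler_norm.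
by apply: le_trans (ltW (truncnS_gt _)) _; rewrite ler_nat.
Qed.

(** Five terms, each at most [e / 5]. [Kh + 1] stands in for [Kh] where a division is made. *)
Lemma error_bound_cvg (e : R) : 0 < e -> exists n1, forall n, (n1 <= n)%N -> (0 < n)%N ->
  exists2 d, 0 < d & error_bound beta gamma gamma' n M0 Kh (mesh n) d <= e.
Proof.
move=> e0; pose k := Kh + 1; have k0 : 0 < k by rewrite ltr_pwDr.
pose e' := e / (5 * (2 * k)); have e'0 : 0 < e' by rewrite divr_gt0// mulr_gt0// mulr_gt0.
pose A := edge_const beta gamma gamma' * expo_bound R.
have A0 : 0 <= A by rewrite mulr_ge0 ?expo_bound_ge0//; exact: edge_const_ge0.
pose B := 2 * beta / (1 - gamma) / (1 - gamma') * expo_bound R.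
have B0 : 0 <= B.
  case/andP: gamma01 => _ h1; case/andP: gamma'01 => h2 h3.
  rewrite mulr_ge0 ?expo_bound_ge0// !mulr_ge0 ?invr_ge0 ?(ltW beta0)//; lra.
have e5 : 0 < e / 5 by rewrite divr_gt0.
have [n1 H1] := mesh_cvg (Kh / e' * (4 * A)) e5.
have [n2 H2] := inv_cvg (Kh * B) e5.
have [n3 H3] := inv_cvg (2 * M0) e5.
exists (maxn n1 (maxn n2 n3)) => n; rewrite !geq_max => /and3P[h1 h2 h3] n0.
pose na : R := n%:R `^ (- gamma).
have nn0 : 0 < n%:R :> R by rewrite ltr0n.
have nn1 : 1 <= n%:R :> R by rewrite ler1n.
have na0 : 0 < na by rewrite powR_gt0.
have na1 : na <= 1.
  rewrite /na powRN invf_le1 ?powR_gt0//; apply: (@le_trans _ _ (1 `^ gamma)); first by rewrite powR1.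
  by apply: ge0_ler_powR; rewrite ?nnegrE//; case/andP: gamma01 => /ltW.
(* This tolerance is [e'] after multiplication by [n^-gamma]; its inverse brings a second factor
   [n^-gamma] into the variance terms, which become of order [n^(1 - 2 gamma)] up to logarithms. *)
exists (e' / na); first by rewrite divr_gt0.
set K := mesh n; have K0 : 0 < 2 ^+ K :> R by rewrite exprn_gt0.
have Kn : n%:R ^+ 3 <= 2 ^+ K :> R by rewrite -!natrX ler_nat mesh_ge.
rewrite /error_bound -/A -/na.
have t1 : Kh * na * (2 * (e' / na)) <= e / 5.
  rewrite (_ : Kh * na * (2 * (e' / na)) = Kh * 2 * e'); last by field; rewrite gt_eqF.
  apply: (@le_trans _ _ (k * 2 * e')); first by rewrite !ler_wpM2r ?(ltW e'0)// lerDl.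
  by rewrite le_eqVlt; apply/orP; left; apply/eqP; rewrite /e'; field; rewrite gt_eqF.
have na2 : na * na * n%:R = n%:R `^ (1 - 2 * gamma).
  rewrite -powRD ?(gt_eqF nn0) ?implybT// -[X in _ * X]powRr1 ?(ltW nn0)// -powRD ?(gt_eqF nn0) ?implybT//.
  by congr (_ `^ _); ring.
have t2 : Kh * na / (e' / na) * (4 * K.+1%:R ^+ 2 * A * n%:R) <= e / 5.
  apply: le_trans (H1 n h1); rewrite -/K -na2 le_eqVlt; apply/orP; left; apply/eqP.
  by field; rewrite !gt_eqF.
have t3 : Kh * na / 2 ^+ K * (2 * beta / (1 - gamma) / (1 - gamma') * n%:R * expo_bound R) <= e / 5.
  apply: le_trans (H2 n h2).
  rewrite (_ : _ * (_ * n%:R * expo_bound R) = Kh * B * (na * (n%:R / 2 ^+ K))); last by rewrite /B; ring.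
  apply: ler_wpM2l; first exact: mulr_ge0.
  rewrite -[leRHS]mul1r; apply: ler_pM => //; first exact: ltW.
  rewrite ler_pdivrMr// ler_pdivlMl//; apply: le_trans Kn; rewrite -expr2.
  by rewrite ler_weXn2l.
have t4 : (2 * M0 * (n%:R / 2 ^+ K) ^+ 2) *+ (2 ^ K) <= e / 5.
  apply: le_trans (H3 n h3); rewrite -mulr_natr natrX -mulrA ler_wpM2l ?mulr_ge0//.
  rewrite (_ : (n%:R / 2 ^+ K) ^+ 2 * 2 ^+ K = n%:R ^+ 2 / 2 ^+ K); last by field; rewrite gt_eqF.
  by rewrite ler_pdivrMr// ler_pdivlMl// -exprS.
lra.
Qed.

End error_bound_cvg.

(** * The limit *)

Section limit_points.
Context (R : realType) (beta gamma gamma' : R).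
Hypotheses (beta0 : 0 < beta) (gm_bounds : 2^-1 < gamma < 1) (gamma'01 : 0 < gamma' < 4^-1).
Context d (W : measurableType d) (P : probability W R) (nu : {measure set R -> \bar R}).
Variable eta : W -> set (R * R * R).
Local Notation c := (ctilde beta gamma').
Hypothesis nuE : forall a : R, 0 < a ->
  nu `[a, +oo[%classic = (c `^ gamma^-1 * a `^ (- gamma^-1))%:E.
Hypothesis Heta : poisson_process P (@space_infty R) (intensity_infty nu) eta.
Local Notation N := (jump_rm c gamma eta).
Local Notation mu := (rate (@measurable_positives R)).

Let c0 : 0 < c. Proof. exact: ctilde_gt0. Qed.

Let g0 : 0 < gamma.
Proof. by case/andP: gm_bounds => h _; rewrite (lt_trans _ h)// invr_gt0. Qed.

Let HN := jump_rm_poisson c0 g0 nuE Heta.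

(** With [v = (j/c)^(-1/gamma)] one has [c v^-gamma = j], and [v <= 1/eps] is the condition
    [j >= c eps^gamma]. *)
Lemma weight_jump_map eps t j b l : 0 < eps -> 0 < j ->
  weight c gamma eps^-1 t (jump_map c gamma (j, b, l)) =
  j * (t - b) * (c * eps `^ gamma <= j)%R%:R * (b <= t < b + l)%R%:R.
Proof.
move=> e0 j0; rewrite /weight /jump_map /pow_block/=.
have x0 : 0 < j / c by rewrite divr_gt0.
set y := (j / c) `^ gamma^-1; have y0 : 0 < y by rewrite powR_gt0.
have yx : y `^ gamma = j / c by rewrite -powRrM mulVf ?gt_eqF// powRr1// ltW.
have -> : (j / c) `^ (- gamma^-1) = y^-1 by rewrite powRN.
have yg : y^-1 `^ (- gamma) = j / c.
  have y1 : y `^ (-1) = y^-1 by exact: powR_inv1 (ltW y0).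
  by rewrite -y1 -powRrM mulrNN mul1r.
rewrite invr_gt0 y0 yg/= lef_pV2 ?posrE//.
have -> : (c * eps `^ gamma <= j) = (eps <= y).
  rewrite mulrC -ler_pdivlMr// -yx; case: (leP eps y) => h.
    by apply: ge0_ler_powR => //; rewrite ?nnegrE ltW.
  by apply/negbTE; rewrite -ltNge; apply: gt0_ltr_powR => //; rewrite ?nnegrE ltW.
case: (eps <= y); last by rewrite !mulr0 !mul0r.
by rewrite mulr1 mulrA; congr (_ * _ * _); rewrite mulrC divfK// gt_eqF.
Qed.

Let HetaC : poisson_process P (@space_infty R) (jump_intensity nu) eta.
Proof. by apply: poisson_process_eq Heta => A mA; exact: jump_intensityE. Qed.

Let mE : measurable (@space_infty R).
Proof. rewrite -jump_domE; exact: measurable_jump_dom. Qed.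

Local Open Scope ereal_scope.

Let mweight y t : measurable_fun setT (fun p => (weight c gamma y t p)%:E : \bar R).
Proof. by apply/measurable_EFinP; exact: measurable_weight. Qed.

Let weight0 y t p : 0 <= (weight c gamma y t p)%:E.
Proof. by rewrite lee_fin; exact: weight_ge0. Qed.

Lemma limit_sum_integral : {ae P, forall w, forall eps t, (0 < eps)%R ->
  limit_sum beta gamma gamma' eta eps t w = \int[N w]_p (weight c gamma eps^-1 t p)%:E}.
Proof.
have := pp_integral_ae HetaC mE (measurable_cover_jump c gamma) (cover_jump_fin c0 g0 nuE).
apply: filterS => w h eps t e0.
pose f q : \bar R := (weight c gamma eps^-1 t (jump_map c gamma q))%:E.
have mf : measurable_fun setT f.
  exact: (measurableT_comp (mweight eps^-1 t) (measurable_jump_map c gamma)).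
have f0 q : 0 <= f q by exact: weight0.
transitivity (\int[M_jump c gamma eta w]_(q in @jump_dom R) f q); last first.
  apply/esym; exact: (integral_rimage (measurable_jump_map c gamma) (@measurable_jump_dom R)
    (M_jump c gamma eta w) (mweight _ t) (weight0 _ t)).
rewrite integral_mkcond -[RHS]h; first last.
- by move=> q; apply: erestrict_ge0.
- by apply/(measurable_restrictT _ (@measurable_jump_dom R)); exact: measurable_funTS.
apply: eq_esum => -[[j b] l] wq; have [j0 l0] := pp_sub Heta wq.
rewrite patchE mem_set; last by rewrite jump_domE.
by rewrite /f weight_jump_map.
Qed.

Lemma limit_sum_ge0 eps t w : 0 <= limit_sum beta gamma gamma' eta eps t w.
Proof.
apply: esum_ge0 => -[[j b] l] wq; have [j0 l0] := pp_sub Heta wq; rewrite lee_fin.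
case: (boolP (b <= t < _)%R) => [/andP[h _]|_]; last by rewrite mulr0.
by rewrite mulr1 mulr_ge0// mulr_ge0 ?(ltW j0)// subr_ge0.
Qed.

Lemma limit_bar_path : {ae P, forall w, limit_good gamma N w /\
  forall eps t, (0 < eps)%R -> (0 <= t <= 1)%R ->
  path_sk c gamma mu N eps^-1 w t = limit_bar beta gamma gamma' P eta eps t w}.
Proof.
have hs := limit_sum_integral.
apply: filterS2 hs (limit_good_ae gm_bounds HN) => w hw gw; split => // eps t e0 t01.
have gp := limit_good_path eps^-1 gw.
have Foo := rate_alpha gm_bounds eps^-1; have Doo := rate_delta gm_bounds eps^-1.
rewrite (path_skE c Foo Doo gp t01); have [_ _ ->] := centred_path_weight c0 Foo Doo gp t01.
rewrite /limit_bar hw//; congr (_ - fine _)%R.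
rewrite -(campbell HN (mweight eps^-1 t) (weight0 eps^-1 t)); apply/esym.
(* [limit_sum] is identified with a measurable variable only almost surely. *)
apply: ae_integral_any.
- exact: (prm_mintegral HN (mweight eps^-1 t) (weight0 eps^-1 t)).
- by move=> v; exact: limit_sum_ge0.
- by move=> v; apply: integral_ge0 => p _; exact: weight0.
by apply: filterS limit_sum_integral => v; apply.
Qed.

Local Close Scope ereal_scope.

(** The witness is the path truncated at [v <= 1/eps]; the uniform bound for all large truncations
    covers the continuous parameter [eps]. *)
Lemma limit_bar_cvg : {ae P, forall w, exists F : R -> skorokhod R,
  (forall eps t : R, 0 < eps -> 0 <= t <= 1 -> F eps t = limit_bar beta gamma gamma' P eta eps t w) /\
  F eps @[eps --> 0^'+] --> limit_sk c gamma N w}.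
Proof.
apply: filterS limit_bar_path => w [gw E].
exists (fun eps => path_sk c gamma mu N eps^-1 w); split; first exact: E.
move=> U /(@metricType_numDomainType.nbhs_mdistP R (skorokhod R))[r /= r0 hr].
have [y0 H] := limit_sk_close c0 gm_bounds gw (divr_gt0 r0 (ltr0Sn R 1)).
have yM : 0 < `|y0| + 1 by rewrite ltr_pwDr.
rewrite /nbhs/=; near=> eps; apply: hr.
have e0 : 0 < eps by near: eps; exact: nbhs_right_gt.
rewrite /= -[X in X < _]/(skorokhod_dist _ _) skorokhod_dist_sym.
apply: le_lt_trans (H _ _) _; last by rewrite ltr_pdivrMr// ltr_pMr// ltr1n.
apply: (@le_trans _ _ (`|y0| + 1)); first by rewrite (le_trans (ler_norm _))// lerDl.
rewrite -[leLHS]invrK lef_pV2 ?posrE ?invr_gt0//.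
by near: eps; apply: nbhs_right_le; rewrite invr_gt0.
Unshelve. all: end_near. Qed.

End limit_points.

(** * Weak convergence of the edge process *)

Section edge_process.
Context (R : realType) (beta gamma gamma' : R).
Hypotheses (beta0 : 0 < beta) (gm_bounds : 2^-1 < gamma < 1) (gamma'01 : 0 < gamma' < 4^-1).
Context d (W : measurableType d) (P : probability W R).
Variables (eta : W -> set (R * R * R * R)) (eta' : W -> set (R * R * R)).
Hypothesis Heta : poisson_process P (@space_ST R) (@intensity_ST R) eta.
Hypothesis Heta' : poisson_process P (@space_SR R) (@intensity_SR R) eta'.
Hypothesis Hind : independent_pp P (@space_ST R) eta (@space_SR R) eta'.

(** The rescaling of the window needs [n > 0], so [n = 0] receives the zero path. *)
Definition edge_process (n : nat) : W -> skorokhod R :=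
  if n is 0 then fun _ => point else edge_sk beta gamma gamma' eta eta' n.

Lemma edge_process_random_element n :
  random_element_of P (edge_count_bar beta gamma gamma' P eta eta' n) (edge_process n).
Proof.
case: n => [|n]; last first.
  exact: (edge_sk_random_element beta0 gm_bounds gamma'01 Heta Heta' Hind (ltn0Sn n)
    (window_alpha gm_bounds _) (window_delta gm_bounds _)).
split; first by apply: skorokhod_measurable => t _; exact: measurable_cst.
(* At [n = 0] the normalisation is a power of 0, equal to 0 by convention, and the centred count
   vanishes. *)
apply: aeW => w t _; rewrite /edge_count_bar powR0 ?mul0r//.
by case/andP: gm_bounds => h _; rewrite oppr_eq0 gt_eqF// (lt_trans _ h)// invr_gt0.
Qed.

Context d1 (W1 : measurableType d1) (P1 : probability W1 R).
Variable N : W1 -> {measure set (R * R * R) -> \bar R}.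
Hypothesis HN : poisson_rm P1 (rate (@measurable_positives R)) N.
Hypothesis HI : independent_rm P1 N.
Local Notation c := (ctilde beta gamma').

(** For large [n] two errors of [e / 2]: on the first space from the edge path to the compensated
    path, on the second from the truncated path to the limit. Between them [window_path_law] is an
    equality. *)
Lemma edge_process_weak_cvg : weak_cvg P edge_process P1 (limit_sk c gamma N).
Proof.
have c0 : 0 < c by exact: ctilde_gt0.
apply: weak_cvg_lipschitz.
- by move=> n; have [] := edge_process_random_element n.
- exact: (measurable_limit_sk c0 gm_bounds HN).
move=> h M K hM hK.
have M0 : 0 <= M by apply: le_trans (hM point).
have hK' f g : `|h f - h g| <= `|K| * skorokhod_dist f g.
  apply: le_trans (hK f g) _; apply: ler_wpM2r; last exact: ler_norm.
  exact: (@mdist_ge0 R (skorokhod R)).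
have cv := mean_limit_sk c0 gm_bounds HN hM hK.
apply/cvgrPdist_le => e e0; have e2 : 0 < e / 2 by rewrite divr_gt0.
have [n1 H1] := error_bound_cvg beta0 gm_bounds gamma'01 M0 (normr_ge0 K) e2.
have /cvgrPdist_le /(_ _ e2) [n2 _ H2] := cv.
exists (maxn 1 (maxn n1 n2)) => // n /=; rewrite !geq_max => /and3P[n0 h1 h2].
have [e' e'0 le_e] := H1 n h1 n0.
have D := mean_difference beta0 gm_bounds gamma'01 Heta Heta' Hind n0
  (window_alpha gm_bounds n) (window_delta gm_bounds n) hM (normr_ge0 K) hK' (mesh n) e'0.
have L := window_path_law c0 gm_bounds HN HI (window_rm_poisson Heta n0)
  (window_rm_independent Heta n) hM hK.
have D2 := H2 n h2; move: D; rewrite [X in `|_ - X|]L => D.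
have -> : mean P (h \o edge_process n) = mean P (fun w => h (edge_sk beta gamma gamma' eta eta' n w)).
  by case: n n0 {h1 h2 le_e D D2 L} => // n _.
apply: le_trans (ler_distD (mean P1 (fun w => h (path_sk c gamma (rate (@measurable_positives R)) N n%:R w))) _ _) _.
rewrite [leRHS](splitr e); apply: lerD; first exact: D2.
by rewrite distrC; exact: le_trans D le_e.
Qed.

End edge_process.
Theorem theorem2p6 (R : realType) (beta gamma gamma' : R)
    (d : measure_display) (Omega : measurableType d) (P : probability Omega R)
    (eta : Omega -> set (R * R * R * R)) (eta' : Omega -> set (R * R * R))
    (d1 : measure_display) (Omega1 : measurableType d1)
    (P1 : probability Omega1 R) (nu : {measure set R -> \bar R})
    (eta_infty : Omega1 -> set (R * R * R)) :
  0 < beta -> 2^-1 < gamma < 1 -> 0 < gamma' < 4^-1 ->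
  poisson_process P (@space_ST R) (@intensity_ST R) eta ->
  poisson_process P (@space_SR R) (@intensity_SR R) eta' ->
  independent_pp P (@space_ST R) eta (@space_SR R) eta' ->
  nu `]-oo, 0]%classic = 0%E ->
  (forall a : R, 0 < a ->
    nu `[a, +oo[%classic =
      (ctilde beta gamma' `^ gamma^-1 * a `^ (- gamma^-1))%:E) ->
  poisson_process P1 (@space_infty R) (intensity_infty nu) eta_infty ->
  exists Sbar : Omega1 -> skorokhod R,
    [/\ borel_measurable Sbar,
        {ae P1, forall w, exists F : R -> skorokhod R,
          (forall eps t : R, 0 < eps -> 0 <= t <= 1 ->
            F eps t = limit_bar beta gamma gamma' P1 eta_infty eps t w) /\
          F eps @[eps --> 0^'+] --> Sbar w} &
        exists Y : nat -> Omega -> skorokhod R,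
          (forall n, random_element_of P
            (edge_count_bar beta gamma gamma' P eta eta' n) (Y n)) /\
          weak_cvg P Y P1 Sbar].

Proof.
move=> beta0 gm_bounds gamma'01 Heta Heta' Hind _ nuE Hinfty.
have c0 := ctilde_gt0 beta0 gamma'01.
have g0 : 0 < gamma.
  by case/andP: gm_bounds => h _; rewrite (lt_trans _ h)// invr_gt0.
have HN := jump_rm_poisson c0 g0 nuE Hinfty.
have HI := jump_rm_independent c0 g0 nuE Hinfty.
exists (limit_sk (ctilde beta gamma') gamma (jump_rm (ctilde beta gamma') gamma eta_infty)); split.
- exact: (measurable_limit_sk c0 gm_bounds HN).
- exact: (limit_bar_cvg beta0 gm_bounds gamma'01 nuE Hinfty).
exists (edge_process beta gamma gamma' eta eta'); split.
  exact: (edge_process_random_element beta0 gm_bounds gamma'01 Heta Heta' Hind).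
exact: (edge_process_weak_cvg beta0 gm_bounds gamma'01 Heta Heta' Hind HN HI).
Qed.
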